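(* Assume the standing assumptions below and $p\ge2$. Let $\mathcal U=\mathcal U(\xi,t)$ be a weak solution of $$\mathcal U_t=\big(|(\mathcal U^m)_\xi|^{p-2}(\mathcal U^m)_\xi\big)_\xi+c^*\mathcal U_\xi+h(\mathcal U),\qquad(\xi,t)\in\mathbb{R}^2,$$ which is nonincreasing in $\xi$ and satisfies $U_{c^*}(\xi+C)\le\mathcal U(\xi,t)\le U_{c^*}(\xi-C)$ for all $(\xi,t)\in\mathbb{R}^2$, for some $C>0$. Then there exists $\xi^*\in[-C,C]$ such that $\mathcal U(\xi,t)=U_{c^*}(\xi-\xi^* )$ for all $(\xi,t)$.
   Context: Standing assumptions: $m>0$, $p>1$ with $m(p-1)>1$. $h\in C^1([0,\infty))$ satisfies $h(0)=0$, and for some $a\in[0,1)$: $h\le0$ on $[0,a]$, $h>0$ on $(a,1)$, $h<0$ on $(1,\infty)$, $h'(1)<0$; if $a>0$ also $\int_0^1h(u)u^{m-1}du>0$. Weak solutions are understood in the distributional sense. A finite wavefront with speed $c$ is a travelling wave $U(x-ct)$ of $u_t=(|(u^m)_x|^{p-2}(u^m)_x)_x+h(u)$ with $U$ continuous, nonincreasing, $U(-\infty)=1$, $U=0$ on some $[\xi_0,\infty)$ and $U>0$ on $(-\infty,\xi_0)$. $c^*>0$ is the unique speed for which a finite wavefront exists and $U_{c^*}$ is that wavefront normalized so that its support is $(-\infty,0]$.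
   Formalization: Weak solutions are required to be continuous; without this the equality for all (ξ,t) fails, e.g. for 𝒰 equal to U_{c*}(ξ) when t≠0 and to U_{c*}(ξ−C/2) at t=0. *)

(* Defs.v *)
From mathcomp Require Import all_boot all_order all_algebra.
From mathcomp Require Import all_classical all_reals all_analysis.
Import Order.TTheory GRing.Theory Num.Theory.
Import numFieldNormedType.Exports.
Local Open Scope classical_set_scope.
Local Open Scope ring_scope.

Set Implicit Arguments.
Unset Strict Implicit.
Unset Printing Implicit Defensive.

Section Defs.
Variable R : realType.

Definition leb2 := ((@lebesgue_measure R) \x (@lebesgue_measure R))%E.

Definition unc (f : R -> R -> R) : R * R -> R := fun z => f z.1 z.2.

Definition loc_int2 (f : R -> R -> R) : Prop :=
  forall a b c d : R, leb2.-integrable (`[a, b] `*` `[c, d]) (EFin \o unc f).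

Definition pd_x (f : R -> R -> R) : R -> R -> R :=
  fun x t => derive1 (fun s => f s t) x.
Definition pd_t (f : R -> R -> R) : R -> R -> R :=
  fun x t => derive1 (fun s => f x s) t.

Fixpoint pder (w : seq bool) (f : R -> R -> R) : R -> R -> R :=
  match w with
  | [::] => f
  | b :: w' => (if b then pd_x else pd_t) (pder w' f)
  end.

Definition smooth2 (f : R -> R -> R) : Prop :=
  forall w : seq bool,
    continuous (unc (pder w f)) /\
    (forall x t : R, derivable (fun s => pder w f s t) x 1 /\
                     derivable (fun s => pder w f x s) t 1).

Definition test_fun (phi : R -> R -> R) : Prop :=
  smooth2 phi /\
  exists K : R, forall x t : R, (K < `|x| \/ K < `|t|) -> phi x t = 0.

(** Weak (distributional) solution on R^2 of
      u_t = ( |(u^m)_xi|^(p-2) (u^m)_xi )_xi + c u_xi + h(u).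
    u is continuous; (u^m)_xi is the distributional xi-derivative g of u^m,
    a locally integrable function with |g|^(p-1) locally integrable. *)
Definition weak_sol (m p c : R) (h : R -> R) (u : R -> R -> R) : Prop :=
  continuous (unc u) /\ loc_int2 u /\
  exists g : R -> R -> R,
    loc_int2 g /\ loc_int2 (fun x t => `|g x t| `^ (p - 1)) /\
    (forall phi, test_fun phi ->
       (\int[leb2]_z ((u z.1 z.2 `^ m) * pd_x phi z.1 z.2)%:E
        = - \int[leb2]_z (g z.1 z.2 * phi z.1 z.2)%:E)%E) /\
    (forall phi, test_fun phi ->
       (\int[leb2]_z (u z.1 z.2 * pd_t phi z.1 z.2
                      - (`|g z.1 z.2| `^ (p - 2)) * g z.1 z.2 * pd_x phi z.1 z.2
                      - c * u z.1 z.2 * pd_x phi z.1 z.2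
                      + h (u z.1 z.2) * phi z.1 z.2)%:E = 0)%E).

Definition C1_halfline (h h' : R -> R) : Prop :=
  {within `[0, +oo[, continuous h'} /\
  forall x : R, 0 <= x ->
    (h (x + d) - h x) / d @[d --> within (fun d : R => 0 <= x + d) 0^'] --> h' x.

Definition standing (m p : R) (h : R -> R) : Prop :=
  [/\ 0 < m /\ 1 < p, 1 < m * (p - 1),
      (exists h' : R -> R, C1_halfline h h' /\ h' 1 < 0),
      h 0 = 0 &
      (exists a : R, [/\ 0 <= a /\ a < 1,
        (forall u, 0 <= u <= a -> h u <= 0),
        (forall u, a < u < 1 -> 0 < h u),
        (forall u, 1 < u -> h u < 0) &
        (0 < a -> (0 < \int[@lebesgue_measure R]_(u in `[0%R, 1%R]) (h u * u `^ (m - 1))%R%:E)%E)])].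

Definition finite_wavefront (m p : R) (h : R -> R) (c : R) (U : R -> R) (xi0 : R) : Prop :=
  [/\ continuous U /\ {homo U : x y / x <= y >-> y <= x},
      (U x @[x --> -oo] --> (1:R)),
      (forall x, xi0 <= x -> U x = 0),
      (forall x, x < xi0 -> 0 < U x) &
      weak_sol m p 0 h (fun x t => U (x - c * t))].

End Defs.

(* Main.v *)
Require Import Defs.
From mathcomp Require Import all_boot all_order all_algebra.
From mathcomp Require Import all_classical all_reals all_analysis.
From mathcomp Require Import measurable_realfun lebesgue_integral_under.
From mathcomp Require Import ring lra.
Import Order.TTheory GRing.Theory Num.Theory.
Import numFieldNormedType.Exports.
Local Open Scope classical_set_scope.
Local Open Scope ring_scope.

Set Implicit Arguments.
Unset Strict Implicit.
Unset Printing Implicit Defensive.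

(** Writing [V = U(z)] with [z <= 0] and [U] the wave profile, the translates of the wave are the functions [z = min(x - a, 0)]. The weak form is used only through the flux [s = |(V^m)_x|]. It gives [z_x = sig], where [sig = s / P(z)^(1/n)], [n = p - 1] and [P] is the flux of the wave, and it gives one inequality for the time increments of the integrals of [Psi(x, z)], obtained by testing the increments of [V] against weights [rho(z) f(x - th z)].

Three weights are used. The first makes a Lyapunov functional whose dissipation [P(z) |sig^n - 1| min(|sig - 1|, 1)] has finite space-time integral. The second makes a nonincreasing functional measuring how far [V] exceeds [U(x - b)] to the right of a point, the third one doing the same on left half-lines, or on the whole line with exponential growth.

Hence [z_x] is close to [1] at most early times, [V] is then close to a translate, and the Lyapunov functional decides which one: if its value at the translate by [b] lies below its limit at [t = -oo], then [V <= U(x - b')] for every [b' > b], at early times by the comparison functionals and later by Gronwall. So at the translate by the least [a] with [V <= U(x - a)] the Lyapunov functional is at least its limit at [-oo]. As it is strictly increasing in [z] and nonincreasing in time, [V = U(x - a)]. *)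

(** * Integrals over intervals and absolutely continuous functions *)

Section IntervalIntegral.
Variable R : realType.
Implicit Types (f g F G : R -> R) (a b c x y : R).
Notation mu := (@lebesgue_measure R).

(** The solution has no time derivative and its flux is only locally integrable, so functionals of
    [z] cannot be differentiated in time. Their increments are estimated instead, by a tangent-line
    inequality for the potential [Psi] with respect to [U]; the passage to the limit is one-sided,
    by Fatou's lemma. The logarithmic derivative [h(U)/(n P)] of the weight [rho] is dictated by the
    reaction term: it cancels the part linear in [sig - 1], and for [p >= 2] the rest lies between
    [0] and [(1 - sig)(1 - sig^n)]. The diffusion dominates it once [f] is a high power, because
    then [|f| <= q f'] with [q] small. Since [x - z] stays bounded, a weight [f(x - z)] need not
    vanish far to the left; [f(x - (1 + e) z)] or [f(x - (1 - e) z)] does, at the cost of [e] times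
    the variation of [V^m], and [e] finally tends to [0]. The flux [P(z)] degenerates at the edge of
    the support, so the dissipation controls [sig] only where [P(z)] is bounded below; the small
    levels of [V] are left to the comparison functionals. *)

Definition iv a b f := mu.-integrable `[a, b] (EFin \o f).
Definition I a b f : R := \int[mu]_(x in `[a, b]) f x.

Lemma iv_sub a b a' b' f : a <= a' -> b' <= b -> iv a b f -> iv a' b' f.
Proof.
move=> aa bb; apply: integrableS => //.
by apply: subset_itv; rewrite bnd_simp.
Qed.

Lemma iv_cont a b f : {within `[a, b], continuous f} -> iv a b f.
Proof.
move=> cf; apply: continuous_compact_integrable => //; exact: segment_compact.
Qed.

Lemma iv_contT a b f : continuous f -> iv a b f.
Proof. by move=> cf; apply: iv_cont; exact: continuous_subspaceT. Qed.

Lemma iv_ext a b f g : (forall x, a <= x <= b -> f x = g x) -> iv a b f -> iv a b g.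
Proof.
move=> fg; apply: eq_integrable => //.
by move=> x; rewrite inE/= in_itv/= => /fg ->.
Qed.

Lemma I_ext a b f g : (forall x, a <= x <= b -> f x = g x) -> I a b f = I a b g.
Proof.
by move=> fg; apply: eq_Rintegral => x; rewrite inE/= in_itv/= => /fg.
Qed.

Lemma ivD a b f g : iv a b f -> iv a b g -> iv a b (fun x => f x + g x).
Proof. by move=> If Ig; rewrite /iv (_ : EFin \o _ = (EFin \o f) \+ (EFin \o g))%E//; exact: integrableD. Qed.

Lemma ivB a b f g : iv a b f -> iv a b g -> iv a b (fun x => f x - g x).
Proof. by move=> If Ig; rewrite /iv (_ : EFin \o _ = (EFin \o f) \- (EFin \o g))%E//; exact: integrableB. Qed.

Lemma ivN a b f : iv a b f -> iv a b (fun x => - f x).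
Proof. by move=> If; rewrite /iv (_ : EFin \o _ = -%E \o (EFin \o f))%E//; exact: integrableN. Qed.

Lemma ivZ a b k f : iv a b f -> iv a b (fun x => k * f x).
Proof. by move=> If; rewrite /iv (_ : EFin \o _ = fun x => (k%:E * (EFin \o f) x)%E)//; exact: integrableZl. Qed.

Lemma iv_norm a b f : iv a b f -> iv a b (fun x => `|f x|).
Proof. by move=> If; apply: integrable_norm. Qed.

Lemma iv_cst a b k : iv a b (fun=> k).
Proof. by apply: iv_contT => x; exact: cvg_cst. Qed.

Lemma iv_mes a b f : iv a b f -> measurable_fun `[a, b] f.
Proof. by move=> /measurable_int /measurable_EFinP. Qed.

Lemma iv_le a b f g : measurable_fun `[a, b] f ->
  (forall x, a <= x <= b -> `|f x| <= g x) -> iv a b g -> iv a b f.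
Proof.
move=> mf fg; apply: le_integrable => //; first exact/measurable_EFinP.
move=> x; rewrite /= in_itv/= => xab; rewrite lee_fin.
by rewrite (le_trans (fg _ xab))// ler_norm.
Qed.

Lemma iv_mulb a b f g M : measurable_fun `[a, b] g ->
  (forall x, a <= x <= b -> `|g x| <= M) -> iv a b f -> iv a b (fun x => g x * f x).
Proof.
move=> mg gM If; apply: (@iv_le _ _ _ (fun x => M * `|f x|)).
- by apply: measurable_funM => //; exact: iv_mes If.
- by move=> x xab; rewrite normrM ler_wpM2r// gM.
- by apply: ivZ; exact: iv_norm.
Qed.

Lemma within_bounded a b f : {within `[a, b], continuous f} ->
  exists2 M, 0 <= M & forall x, a <= x <= b -> `|f x| <= M.
Proof.
move=> cf; have [ab|ba] := leP a b; last first.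
  by exists 0 => // x /andP[ax xb]; have := lt_le_trans ba (le_trans ax xb); rewrite ltxx.
have [] := @EVT_max _ (fun x => `|f x|) _ _ ab.
  by move=> x; apply: continuous_comp; [exact: cf|exact: norm_continuous].
by move=> c cab fc; exists `|f c| => // x xab; apply: fc; rewrite in_itv.
Qed.

Lemma iv_mulc a b f g : {within `[a, b], continuous g} -> iv a b f ->
  iv a b (fun x => g x * f x).
Proof.
move=> cg If; have [M _ gM] := within_bounded cg.
apply: iv_mulb gM If; apply: subspace_continuous_measurable_fun => //.
Qed.

Lemma I_le a b f g : iv a b f -> iv a b g ->
  (forall x, a <= x <= b -> f x <= g x) -> I a b f <= I a b g.
Proof.
by move=> If Ig fg; apply: le_Rintegral.
Qed.

Lemma I_ge0 a b f : (forall x, a <= x <= b -> 0 <= f x) -> 0 <= I a b f.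
Proof. by move=> f0; apply: Rintegral_ge0 => x; rewrite /= in_itv/=; exact: f0. Qed.

Lemma ID a b f g : iv a b f -> iv a b g ->
  I a b (fun x => f x + g x) = I a b f + I a b g.
Proof. by move=> If Ig; apply: RintegralD. Qed.

Lemma IB a b f g : iv a b f -> iv a b g ->
  I a b (fun x => f x - g x) = I a b f - I a b g.
Proof. by move=> If Ig; apply: RintegralB. Qed.

Lemma IZ a b k f : iv a b f -> I a b (fun x => k * f x) = k * I a b f.
Proof. by move=> If; apply: RintegralZl. Qed.

Lemma I_N a b f : iv a b f -> I a b (fun x => - f x) = - I a b f.
Proof.
move=> If; rewrite -mulN1r -IZ//; apply: I_ext => x _; by rewrite mulN1r.
Qed.

Lemma I_norm a b f : iv a b f -> `|I a b f| <= I a b (fun x => `|f x|).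
Proof. by move=> If; apply: le_normr_Rintegral. Qed.

Lemma I_cst a b k : a <= b -> I a b (fun=> k) = k * (b - a).
Proof.
move=> ab; rewrite /I Rintegral_cst//= lebesgue_measure_itv/= lte_fin.
by move: ab; rewrite le_eqVlt => /orP[/eqP ->|ab]; rewrite ?ltxx ?ab/= ?subrr.
Qed.

Lemma Iaa a f : I a a f = 0.
Proof. by rewrite /I set_itv1 Rintegral_set1. Qed.

Lemma I_split a c b f : a <= c -> c <= b -> iv a b f -> I a b f = I a c f + I c b f.
Proof.
move=> ac cb If; have If' : mu.-integrable [set` Interval (BLeft a) (BRight b)] (EFin \o f) by [].
have := @Rintegral_itvB R f (BLeft a) (BRight b) c If'.
rewrite !bnd_simp => /(_ ac cb) /(canRL (subrK _)); rewrite /I => ->.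
rewrite addrC; congr (_ + _); rewrite Rintegral_itv_obnd_cbnd//.
by apply: integrableS If => //; apply: subset_itv; rewrite bnd_simp.
Qed.

Lemma I_le_abs a b f M : a <= b -> iv a b f -> (forall x, a <= x <= b -> `|f x| <= M) ->
  `|I a b f| <= M * (b - a).
Proof.
move=> ab If fM; apply: (le_trans (I_norm If)); rewrite -I_cst//.
by apply: I_le => //; [exact: iv_norm|exact: iv_cst].
Qed.

Lemma I_sub_le a b a' b' f : a <= a' -> a' <= b' -> b' <= b -> iv a b f ->
  (forall x, a <= x <= b -> 0 <= f x) -> I a' b' f <= I a b f.
Proof.
move=> aa ab bb If f0.
rewrite (I_split aa (le_trans ab bb) If) (I_split ab bb); last exact: iv_sub If.
have p1 : 0 <= I a a' f.
  apply: I_ge0 => x /andP[ax xa]; apply: f0.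
  by rewrite ax (le_trans xa)// (le_trans ab).
have p2 : 0 <= I b' b f.
  apply: I_ge0 => x /andP[bx xb]; apply: f0.
  by rewrite xb (le_trans aa)// (le_trans ab).
by rewrite addrCA lerDl addr_ge0.
Qed.

(** Real induction on the supremum of the points up to which the estimate with a fixed [e] holds.
    Measuring increments by a monotone [phi] instead of by length lets [phi] be the integral of a
    function that is merely integrable. *)
Lemma const_of_small_increments (E phi : R -> R) a b : a <= b ->
  (forall x y, a <= x -> x <= y -> y <= b -> phi x <= phi y) ->
  (forall e x, 0 < e -> a <= x <= b -> exists2 d, 0 < d & forall y, a <= y <= b ->
     `|y - x| < d -> `|E y - E x| <= e * `|phi y - phi x|) ->
  E a = E b.
Proof.
move=> ab phim HE.
suff H : forall e, 0 < e -> `|E b - E a| <= e * (phi b - phi a).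
  apply/esym/eqP; rewrite -subr_eq0 -normr_le0; apply/ler_addgt0Pl => e e0.
  have p0 : 0 <= phi b - phi a by rewrite subr_ge0 phim.
  have q0 : 0 < phi b - phi a + 1 by rewrite ltr_wpDl.
  rewrite addr0; apply: (le_trans (H (e / (phi b - phi a + 1)) _)).
    by rewrite divr_gt0.
  by rewrite mulrAC ler_pdivrMr// ler_wpM2l ?(ltW e0)// lerDl.
move=> e e0.
pose S := [set x | a <= x <= b /\ `|E x - E a| <= e * (phi x - phi a)].
have Sa : S a by split; [rewrite lexx ab|rewrite !subrr normr0 mulr0].
have Sb : ubound S b by move=> x [/andP[]].
have hS : has_sup S by split; [exists a|exists b].
set s := sup S.
have as_ : a <= s by apply: ub_le_sup => //; exists b.
have sb : s <= b by apply: sup_le_ub => //; exists a.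
have [d d0 Hd] := HE e s e0 (introT andP (conj as_ sb)).
have Ss : S s.
  have [y Sy sy] := sup_adherent d0 hS.
  have ys : y <= s by apply: ub_le_sup => //; exists b.
  case: Sy => yab Ey; split; first by rewrite as_ sb.
  have /andP[ay yb] := yab.
  rewrite -(subrKA (E y)); apply: (le_trans (ler_normD _ _)).
  have : `|E s - E y| <= e * (phi s - phi y).
    rewrite distrC (le_trans (Hd y yab _))//; last first.
      by rewrite distrC ger0_norm ?subr_ge0 ?phim// ?as_ // distrC.
    by rewrite distrC ger0_norm ?subr_ge0//; move: sy; rewrite -/s; lra.
  by move: Ey; lra.
have [bs|sb'] := leP b s.
  by case: Ss => _; have -> : s = b by apply/eqP; rewrite eq_le sb bs.
pose y := Num.min b (s + d / 2).
have sy : s < y by rewrite lt_min sb' ltrDl divr_gt0.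
have yb : y <= b by rewrite ge_min lexx.
have : S y.
  split; first by rewrite yb (le_trans as_ (ltW sy)).
  case: Ss => _ Es.
  rewrite -(subrKA (E s)); apply: (le_trans (ler_normD _ _)).
  have : `|E y - E s| <= e * (phi y - phi s).
    rewrite (le_trans (Hd y _ _))//.
    - by rewrite yb (le_trans as_ (ltW sy)).
    - rewrite ger0_norm ?subr_ge0 ?(ltW sy)//.
      have : y <= s + d / 2 by rewrite ge_min lexx orbT.
      by move: d0; lra.
    - by rewrite ger0_norm// subr_ge0 phim// ltW.
  by move: Es; lra.
move=> /(ub_le_sup _) -/(_ (ex_intro _ b Sb)).
by rewrite -/s leNgt sy.
Qed.

(** Absolute continuity with a prescribed density, stated through increments so that no pointwise
    derivative of [F] has to be discussed. *)
Definition ac a b F f :=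
  iv a b f /\ forall x y, a <= x -> x <= y -> y <= b -> F y - F x = I x y f.

Lemma ac_sub a b a' b' F f : a <= a' -> b' <= b -> ac a b F f -> ac a' b' F f.
Proof.
move=> aa bb [If FE]; split; first exact: iv_sub If.
by move=> x y ax xy yb; apply: FE => //; [exact: le_trans ax|exact: le_trans bb].
Qed.

Lemma ac_I a b F f : a <= b -> ac a b F f -> I a b f = F b - F a.
Proof. by move=> ab [_ ->]. Qed.

Lemma ac_ext a b F F' f f' : (forall x, a <= x <= b -> F x = F' x) ->
  (forall x, a <= x <= b -> f x = f' x) -> ac a b F f -> ac a b F' f'.
Proof.
move=> EF Ef [If H]; split; first exact: iv_ext If.
move=> x y ax xy yb; rewrite -!EF ?H ?ax ?yb ?(le_trans ax) ?(le_trans xy)//.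
by apply: I_ext => s /andP[xs sy]; rewrite Ef// (le_trans ax)// (le_trans sy).
Qed.

Lemma ac_indef a b f : iv a b f -> ac a b (fun x => I a x f) f.
Proof.
move=> If; split => // x y ax xy yb.
by rewrite (I_split ax xy) ?[_ + I x y f]addrC ?addrK//; exact: iv_sub If.
Qed.

Lemma within_ptP a b F : {within `[a, b], continuous F} <->
  (forall x e, a <= x <= b -> 0 < e -> exists2 d, 0 < d & forall y, a <= y <= b ->
     `|y - x| < d -> `|F y - F x| < e).
Proof.
split=> [/subspace_continuousP cF x e xab e0|H].
  have := cF x; rewrite /= in_itv/= => /(_ xab).
  move=> /cvgrPdist_lt /(_ _ e0); rewrite near_withinE => -[d /= d0 Hd].
  exists d => // y yab yx; rewrite distrC; apply: Hd; first by rewrite /= distrC.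
  by rewrite /= in_itv.
apply/subspace_continuousP => x; rewrite /= in_itv/= => xab.
apply/cvgrPdist_lt => e e0; rewrite near_withinE.
have [d d0 Hd] := H x e xab e0.
exists d => //= y /= yx; rewrite in_itv/= => yab; rewrite distrC; apply: Hd => //.
by rewrite distrC.
Qed.

Lemma ac_within a b F f : ac a b F f -> {within `[a, b], continuous F}.
Proof.
move=> [If FE]; have [ab|ba] := leP a b; last first.
  by apply/within_ptP => x e /andP[ax xb]; have := lt_le_trans ba (le_trans ax xb); rewrite ltxx.
have := parameterized_integral_continuous ab If => /within_ptP H.
apply/within_ptP => x e xab e0; have [d d0 Hd] := H x e xab e0.
exists d => // y yab yx; move: (Hd y yab yx); rewrite /parameterized_integral -/(I a y f) -/(I a x f).
have /andP[ax xb] := xab; have /andP[ay yb] := yab.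
by rewrite -!FE// opprB addrA subrK.
Qed.

(** The common source of the product, composition and inverse rules: it is enough to compare
    increments on short intervals that have the given point [x] as an endpoint, with an error small
    relative to the integral of a fixed weight [w]. *)
Lemma ac_of_increments a b F f w : iv a b f -> iv a b w -> (forall x, a <= x <= b -> 0 <= w x) ->
  (forall e x, 0 < e -> a <= x <= b -> exists2 d, 0 < d & forall u v, a <= u -> u <= v -> v <= b ->
     x = u \/ x = v -> v - u < d -> `|F v - F u - I u v f| <= e * I u v w) ->
  ac a b F f.
Proof.
move=> If Iw w0 H; split => // x y ax xy yb.
pose E t := F t - I a t f; pose phi t := I a t w.
have key u v : a <= u -> u <= v -> v <= b ->
    E v - E u = F v - F u - I u v f /\ phi v - phi u = I u v w.
  move=> au uv vb; rewrite /E /phi.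
  rewrite (I_split au uv); last exact: iv_sub If.
  rewrite (I_split (f := w) au uv); last exact: iv_sub Iw.
  by split; ring.
have w0' u v : a <= u -> v <= b -> 0 <= I u v w.
  move=> au vb; apply: I_ge0 => t /andP[ut tv].
  by apply: w0; rewrite (le_trans au)//= (le_trans tv).
suff : E x = E y.
  by have [+ _] := key x y ax xy yb => /[swap] ->; rewrite subrr => /esym/eqP; rewrite subr_eq0 => /eqP.
apply: (@const_of_small_increments E phi) => //.
  move=> u v xu uv vy; rewrite -subr_ge0.
  by have [||| _ ->] := key u v => //; [exact: le_trans xu|exact: le_trans yb|
    apply: w0'; [exact: le_trans xu|exact: le_trans yb]].
move=> e t e0 /andP[xt ty].
have [|d d0 Hd] := H e t e0; first by rewrite (le_trans ax)//= (le_trans ty).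
exists d => // s /andP[xs sy] st.
have [ts|/ltW ts] := leP t s.
  have [||| -> ->] := key t s => //; [exact: le_trans xt|exact: le_trans yb|].
  rewrite [X in _ * X]ger0_norm; last by apply: w0'; [exact: le_trans xt|exact: le_trans yb].
  apply: Hd => //; [exact: le_trans xt|exact: le_trans yb|by left|].
  by move: st; rewrite ger0_norm ?subr_ge0.
rewrite distrC [X in _ * X]distrC.
have [||| -> ->] := key s t => //; [exact: le_trans xs|exact: le_trans yb|].
rewrite [X in _ * X]ger0_norm; last by apply: w0'; [exact: le_trans xs|exact: le_trans yb].
apply: Hd => //; [exact: le_trans xs|exact: le_trans yb|by right|].
by move: st; rewrite distrC ger0_norm ?subr_ge0.
Qed.

Lemma acD a b F G f g : ac a b F f -> ac a b G g ->
  ac a b (fun x => F x + G x) (fun x => f x + g x).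
Proof.
move=> [If FE] [Ig GE]; split; first exact: ivD.
move=> x y ax xy yb; rewrite ID; [|exact: iv_sub If|exact: iv_sub Ig].
by rewrite -FE// -GE//; ring.
Qed.

Lemma acZ a b k F f : ac a b F f -> ac a b (fun x => k * F x) (fun x => k * f x).
Proof.
move=> [If FE]; split; first exact: ivZ.
by move=> x y ax xy yb; rewrite IZ ?(iv_sub _ _ If)// -FE//; ring.
Qed.

Lemma acB a b F G f g : ac a b F f -> ac a b G g ->
  ac a b (fun x => F x - G x) (fun x => f x - g x).
Proof.
move=> HF HG; apply: (ac_ext _ _ (acD HF (acZ (-1) HG))) => x _; ring.
Qed.

Lemma ac_cst a b k : ac a b (fun=> k) (fun=> 0).
Proof.
by split; [exact: iv_cst|move=> x y _ xy _; rewrite I_cst// mul0r subrr].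
Qed.

Lemma ac_id a b : ac a b id (fun=> 1).
Proof. by split; [exact: iv_cst|move=> x y _ xy _; rewrite I_cst// mul1r]. Qed.

Lemma acM a b F G f g : ac a b F f -> ac a b G g ->
  ac a b (fun x => F x * G x) (fun x => F x * g x + G x * f x).
Proof.
move=> HF HG; have [If FE] := HF; have [Ig GE] := HG.
have cF := ac_within HF; have cG := ac_within HG.
have IFg := iv_mulc cF Ig; have IGf := iv_mulc cG If.
apply: (@ac_of_increments _ _ _ _ (fun x => `|f x| + `|g x|)).
- exact: ivD.
- by apply: ivD; exact: iv_norm.
- by move=> x _; rewrite addr_ge0.
move=> e x e0 xab.
have e20 : 0 < e / 2 by rewrite divr_gt0.
have [d1 d10 H1] := (within_ptP _ _ _).1 cF x _ xab e20.
have [d2 d20 H2] := (within_ptP _ _ _).1 cG x _ xab e20.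
exists (Num.min d1 d2); first by rewrite lt_min d10.
move=> u v au uv vb xuv; rewrite lt_min => /andP[uv1 uv2].
have near s : u <= s -> s <= v -> `|F s - F x| < e / 2 /\ `|G s - G x| < e / 2.
  move=> us sv; have sab : a <= s <= b by rewrite (le_trans au)//= (le_trans sv).
  have sx : `|s - x| <= v - u.
    rewrite ler_norml; apply/andP; split; case: xuv => ->; lra.
  split; [apply: H1|apply: H2] => //; exact: le_lt_trans sx _.
have Ifs := iv_sub au vb If; have Igs := iv_sub au vb Ig.
have IFgs := iv_sub au vb IFg; have IGfs := iv_sub au vb IGf.
have -> : F v * G v - F u * G u = I u v (fun s => F v * g s + G u * f s).
  rewrite ID; [|exact: ivZ|exact: ivZ].
  by rewrite !IZ// -FE// -GE//; ring.
have IFG : iv u v (fun s => F v * g s + G u * f s) by apply: ivD; exact: ivZ.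
have IFG' : iv u v (fun s => F s * g s + G s * f s) by exact: ivD.
rewrite -IB// -IZ; last by apply: ivD; exact: iv_norm.
apply: (le_trans (I_norm _)); first exact: ivB.
apply: I_le; [by apply: iv_norm; exact: ivB|by apply: ivZ; apply: ivD; exact: iv_norm|].
move=> s /andP[us sv].
have -> : F v * g s + G u * f s - (F s * g s + G s * f s) =
  (F v - F s) * g s + (G u - G s) * f s by ring.
have [Fs Gs] := near s us sv; have [Fv _] := near v uv (lexx _).
have [_ Gu] := near u (lexx _) uv.
have Fvs : `|F v - F s| <= e.
  by rewrite -(subrKA (F x)) (le_trans (ler_normD _ _))// [X in _ + X]distrC; move: Fv Fs; lra.
have Gus : `|G u - G s| <= e.
  by rewrite -(subrKA (G x)) (le_trans (ler_normD _ _))// [X in _ + X]distrC; move: Gu Gs; lra.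
rewrite mulrDr addrC (le_trans (ler_normD _ _))// !normrM lerD// ler_wpM2r//.
Qed.

Lemma is_derive_increment (phi : R -> R) y d : is_derive y 1 phi d ->
  forall e, 0 < e -> exists2 r, 0 < r & forall y', `|y' - y| < r ->
    `|phi y' - phi y - d * (y' - y)| <= e * `|y' - y|.
Proof.
move=> [dphi <-] e e0.
have /cvgrPdist_le /(_ e e0) := dphi; rewrite near_withinE => -[r /= r0 Hr].
exists r => // y' yy'; have [->|yn] := eqVneq y' y; first by rewrite !subrr mulr0 subr0 normr0 mulr0.
have yn' : y' - y != 0 by rewrite subr_eq0.
have := Hr (y' - y); rewrite /= sub0r normrN => /(_ yy' yn').
rewrite /= [_%:A]mulr1 subrK -/(derive phi y 1) => H.
have -> : phi y' - phi y - 'D_1 phi y * (y' - y) =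
   - (('D_1 phi y - (y' - y)^-1 * (phi y' - phi y)) * (y' - y)).
  by field.
by rewrite normrN normrM ler_wpM2r.
Qed.

Lemma is_derive_of_increment (phi : R -> R) y d :
  (forall e, 0 < e -> exists2 r, 0 < r & forall y', `|y' - y| < r ->
    `|phi y' - phi y - d * (y' - y)| <= e * `|y' - y|) -> is_derive y 1 phi d.
Proof.
move=> H.
suff C : h^-1 *: ((phi \o shift y) (h *: 1) - phi y) @[h --> 0^'] --> d.
  by split; [apply/cvg_ex; exists d|apply/cvg_lim => //; exact: Rhausdorff].
apply/cvgrPdist_le => e e0; rewrite near_withinE.
have [r r0 Hr] := H e e0; exists r => //= h /=; rewrite sub0r normrN => hr h0.
have := Hr (h + y); rewrite addrK => /(_ hr) {}Hr.
rewrite [_%:A]mulr1 -(ler_pM2r (_ : 0 < `|h|)) ?normr_gt0// -normrM mulrBl.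
rewrite distrC (_ : h^-1 *: _ * h = phi (h + y) - phi y)//.
by rewrite /GRing.scale/=; field.
Qed.

Lemma dD f g x a b : is_derive x 1 f a -> is_derive x 1 g b ->
  is_derive x 1 (fun y => f y + g y) (a + b).
Proof. by move=> Hf Hg; exact: is_deriveD. Qed.

Lemma dM f g x a b : is_derive x 1 f a -> is_derive x 1 g b ->
  is_derive x 1 (fun y => f y * g y) (f x * b + g x * a).
Proof. by move=> Hf Hg; exact: is_deriveM. Qed.

Lemma dZ k f x a : is_derive x 1 f a -> is_derive x 1 (fun y => k * f y) (k * a).
Proof. by move=> Hf; exact: is_deriveZ. Qed.

Lemma dN f x a : is_derive x 1 f a -> is_derive x 1 (fun y => - f y) (- a).
Proof. by move=> Hf; exact: is_deriveN. Qed.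

Lemma dB f g x a b : is_derive x 1 f a -> is_derive x 1 g b ->
  is_derive x 1 (fun y => f y - g y) (a - b).
Proof. by move=> Hf Hg; exact: is_deriveB. Qed.

Lemma dC f g x a b : is_derive (g x) 1 f a -> is_derive x 1 g b ->
  is_derive x 1 (fun y => f (g y)) (a * b).
Proof.
by move=> Hf Hg; exact: (@is_derive1_comp _ f g x a b Hf Hg).
Qed.

Lemma dX n f x a : is_derive x 1 f a ->
  is_derive x 1 (fun y => f y ^+ n) (n%:R * f x ^+ n.-1 * a).
Proof.
move=> Hf; have H := @is_deriveX _ _ f n x 1 _ Hf.
by have -> : (fun y => f y ^+ n) = f ^+ n by apply/funext => y; rewrite exprfctE.
Qed.

Lemma dV f x a : f x != 0 -> is_derive x 1 f a ->
  is_derive x 1 (fun y => (f y)^-1) (- a / f x ^+ 2).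
Proof.
move=> fx Hf; have H := @is_deriveV _ f x _ _ fx Hf; apply: (is_derive_eq H).
by rewrite /GRing.scale/= mulNr mulrC mulNr.
Qed.

Lemma is_derive_cont f (x a : R) : is_derive x 1 f a -> {for x, continuous f}.
Proof.
by move=> [df _]; apply: differentiable_continuous; exact/derivable1_diffP.
Qed.

Lemma ac_comp a b F f (phi dphi : R -> R) : ac a b F f ->
  (forall x, a <= x <= b -> is_derive (F x) 1 phi (dphi (F x))) ->
  {within `[a, b], continuous (dphi \o F)} ->
  ac a b (phi \o F) (fun x => dphi (F x) * f x).
Proof.
move=> HF Hphi cphi; have [If FE] := HF; have cF := ac_within HF.
have Ipf := iv_mulc cphi If.
apply: (@ac_of_increments _ _ _ _ (fun x => `|f x|)) => //; first exact: iv_norm.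
move=> e x e0 xab.
have e20 : 0 < e / 2 by rewrite divr_gt0.
have [d1 d10 H1] := (within_ptP _ _ _).1 cphi x _ xab e20.
have [r r0 Hr] := is_derive_increment (Hphi x xab) e20.
have [d2 d20 H2] := (within_ptP _ _ _).1 cF x _ xab r0.
exists (Num.min d1 d2); first by rewrite lt_min d10.
move=> u v au uv vb xuv; rewrite lt_min => /andP[uv1 uv2].
have near s : u <= s -> s <= v -> `|dphi (F s) - dphi (F x)| < e / 2 /\
    `|F s - F x| < r.
  move=> us sv; have sab : a <= s <= b by rewrite (le_trans au)//= (le_trans sv).
  have sx : `|s - x| <= v - u.
    rewrite ler_norml; apply/andP; split; case: xuv => ->; lra.
  split; [apply: H1|apply: H2] => //; exact: le_lt_trans sx _.
have Ifs := iv_sub au vb If; have Ipfs := iv_sub au vb Ipf.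
have step1 : `|phi (F v) - phi (F u) - dphi (F x) * (F v - F u)| <= e / 2 * I u v (fun s => `|f s|).
  have Fuv : `|F v - F u| <= I u v (fun s => `|f s|) by rewrite FE// I_norm.
  apply: le_trans (ler_wpM2l (ltW e20) Fuv).
  case: xuv => xE; rewrite -xE.
    by apply: Hr; have [] := near v uv (lexx _).
  rewrite -normrN [`|_ - F u|]distrC.
  have -> : - (phi (F x) - phi (F u) - dphi (F x) * (F x - F u)) =
     phi (F u) - phi (F x) - dphi (F x) * (F u - F x) by ring.
  by apply: Hr; have [] := near u (lexx _) uv.
have step2 : `|dphi (F x) * (F v - F u) - I u v (fun s => dphi (F s) * f s)|
     <= e / 2 * I u v (fun s => `|f s|).
  rewrite FE// -IZ// -IB//; last exact: ivZ.
  rewrite -IZ; last exact: iv_norm.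
  apply: (le_trans (I_norm _)); first by apply: ivB => //; exact: ivZ.
  apply: I_le; [by apply: iv_norm; apply: ivB => //; exact: ivZ|by apply: ivZ; exact: iv_norm|].
  move=> s /andP[us sv]; rewrite -mulrBl normrM ler_wpM2r// distrC ltW//.
  by have [] := near s us sv.
rewrite -(subrKA (dphi (F x) * (F v - F u))) (le_trans (ler_normD _ _))//=.
by move: step1 step2 => /=; lra.
Qed.

(** Inverse function rule along [z]. Continuity of [z] and [Wd <> 0] first bound the increments of
    [z] by the integral of [|s|]; the first-order expansion of [W] then identifies the density. *)
Lemma ac_inv a b (z W Wd s : R -> R) :
  {within `[a, b], continuous z} -> ac a b (W \o z) s ->
  (forall x, a <= x <= b -> is_derive (z x) 1 W (Wd (z x))) ->
  {within `[a, b], continuous (Wd \o z)} -> (forall x, a <= x <= b -> Wd (z x) != 0) ->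
  ac a b z (fun x => s x / Wd (z x)).
Proof.
move=> cz HW HWd cWd Wd0; have [Is WE] := HW.
have cV : {within `[a, b], continuous (fun x => (Wd (z x))^-1)}.
  apply/subspace_continuousP => x xab.
  have := (subspace_continuousP _ _).1 cWd x xab.
  by apply: cvgV; apply: Wd0; move: xab; rewrite /= in_itv.
have Iq : iv a b (fun x => s x / Wd (z x)).
  by apply: iv_ext (iv_mulc cV Is) => x _; rewrite mulrC.
have [M M0 HM] := within_bounded cV.
apply: (@ac_of_increments _ _ _ _ (fun x => `|s x|)) => //; first exact: iv_norm.
move=> e x e0 xab.
have M1 : 0 < M + 1 by rewrite ltr_wpDl.
(* The three bounds serve, in this order, the variation of [1/Wd] in [step2], the linearisation
   error in [step1], and the absorption of half of [|D|] in [D2]. *)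
pose e1 := Num.min (e / 2) (Num.min (e / (4 * (M + 1) ^+ 2)) ((2 * (M + 1))^-1)).
have e10 : 0 < e1 by rewrite !lt_min !divr_gt0 ?mulr_gt0 ?exprn_gt0//= invr_gt0 mulr_gt0.
have [d1 d10 H1] := (within_ptP _ _ _).1 cV x _ xab e10.
have [r r0 Hr] := is_derive_increment (HWd x xab) e10.
have [d2 d20 H2] := (within_ptP _ _ _).1 cz x _ xab r0.
exists (Num.min d1 d2); first by rewrite lt_min d10.
move=> u v au uv vb xuv; rewrite lt_min => /andP[uv1 uv2].
have near t : u <= t -> t <= v -> `|(Wd (z t))^-1 - (Wd (z x))^-1| < e1 /\
    `|z t - z x| < r.
  move=> us sv; have sab : a <= t <= b by rewrite (le_trans au)//= (le_trans sv).
  have sx : `|t - x| <= v - u.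
    rewrite ler_norml; apply/andP; split; case: xuv => ->; lra.
  split; [apply: H1|apply: H2] => //; exact: le_lt_trans sx _.
have Iss := iv_sub au vb Is; have Iqs := iv_sub au vb Iq.
set J := I u v (fun s0 => `|s s0|).
have J0 : 0 <= J by apply: I_ge0.
set k := Wd (z x).
have k0 : k != 0 by apply: Wd0.
have kM : `|k^-1| <= M by apply: HM.
have st0 : `|W (z v) - W (z u) - k * (z v - z u)| <= e1 * `|z v - z u|.
  case: xuv => xE; rewrite -xE.
    by apply: Hr; have [] := near v uv (lexx _).
  rewrite -normrN [`|_ - z u|]distrC.
  have -> : - (W (z x) - W (z u) - k * (z x - z u)) =
     W (z u) - W (z x) - k * (z u - z x) by ring.
  by apply: Hr; have [] := near u (lexx _) uv.
have WJ : `|W (z v) - W (z u)| <= J.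
  by have := WE u v au uv vb => /= ->; exact: I_norm.
have dzE : z v - z u = k^-1 * (W (z v) - W (z u)) - k^-1 * (W (z v) - W (z u) - k * (z v - z u)).
  by field.
set D := z v - z u in st0 dzE *.
set Dw := W (z v) - W (z u) in st0 WJ dzE *.
have e1M : e1 * M <= 2^-1.
  have : e1 <= (2 * (M + 1))^-1 by rewrite !ge_min lexx !orbT.
  move=> /(ler_wpM2r M0) /le_trans; apply.
  by rewrite ler_pdivrMl ?mulr_gt0//; lra.
have D2 : `|D| <= 2 * (M + 1) * J.
  have : `|D| <= M * J + 2^-1 * `|D|.
    rewrite {1}dzE (le_trans (ler_normB _ _))// !normrM lerD//.
      by rewrite ler_pM.
    apply: (@le_trans _ _ (M * (e1 * `|D|))); first by rewrite ler_pM.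
    by rewrite mulrA ler_wpM2r// mulrC.
  by have := J0; move: e1M; lra.
have step1 : `|D - k^-1 * Dw| <= e / 2 * J.
  rewrite {1}dzE addrC addKr normrN normrM.
  apply: (@le_trans _ _ ((M + 1) * (e1 * (2 * (M + 1) * J)))).
    apply: ler_pM => //; first by rewrite (le_trans kM)// lerDl.
    by rewrite (le_trans st0)// ler_wpM2l// ltW.
  have e1b : e1 <= e / (4 * (M + 1) ^+ 2) by rewrite !ge_min lexx !orbT.
  have : e1 * (2 * (M + 1) ^+ 2) <= e / 2.
    apply: (le_trans (ler_wpM2r _ e1b)); first by rewrite mulr_ge0// exprn_ge0// ltW.
    rewrite le_eqVlt; apply/orP; left; apply/eqP; field.
    by rewrite gt_eqF.
  move=> /(ler_wpM2r J0); apply: le_trans; rewrite le_eqVlt; apply/orP; left; apply/eqP; ring.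
have step2 : `|k^-1 * Dw - I u v (fun s0 => s s0 / Wd (z s0))| <= e / 2 * J.
  have -> : Dw = I u v s by have := WE u v au uv vb.
  rewrite -IZ// -IB//; last exact: ivZ.
  rewrite -IZ; last exact: iv_norm.
  apply: (le_trans (I_norm _)); first by apply: ivB => //; exact: ivZ.
  apply: I_le; [by apply: iv_norm; apply: ivB => //; exact: ivZ|by apply: ivZ; exact: iv_norm|].
  move=> t /andP[us sv]; rewrite mulrC -mulrBr normrM mulrC ler_wpM2r// distrC ltW//.
  have [+ _] := near t us sv => /lt_le_trans; apply; by rewrite ge_min lexx.
rewrite -(subrKA (k^-1 * Dw)) (le_trans (ler_normD _ _))//=.
by move: step1 step2 => /=; lra.
Qed.

Lemma ac_smooth a b (F f : R -> R) : continuous f -> (forall x, is_derive x 1 F (f x)) -> ac a b F f.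
Proof.
move=> cf HF; apply: (ac_ext _ _ (ac_comp (phi := F) (dphi := f) (ac_id a b) _ _)) => //.
- by move=> x _; rewrite mulr1.
- exact: continuous_subspaceT.
Qed.

End IntervalIntegral.

(** * Integrals over rectangles *)

Section Plane.
Variable R : realType.
Implicit Types (f g u : R -> R -> R) (a b c d x t : R).
Notation mu := (@lebesgue_measure R).

Lemma cont2P u : continuous (unc u) <-> (forall x t (e : R), 0 < e -> exists2 d : R, 0 < d &
  forall x' t' : R, `|x' - x| < d -> `|t' - t| < d -> `|u x' t' - u x t| < e).
Proof.
split=> [cu x t e e0|H [x t]].
  have /cvgrPdist_lt /(_ e e0) := cu (x, t).
  move=> [[A B] /= [[d1 /= d10 H1] [d2 /= d20 H2]] HAB].
  exists (Num.min d1 d2); first by rewrite lt_min d10.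
  move=> x' t'; rewrite !lt_min => /andP[xx1 _] /andP[_ tt2].
  rewrite distrC; apply: (HAB (x', t')); split => /=.
    by apply: H1; rewrite /= distrC.
  by apply: H2; rewrite /= distrC.
apply/cvgrPdist_lt => e e0.
have [d d0 Hd] := H x t e e0.
exists (ball x d, ball t d) => /=; first by split; exact: nbhsx_ballx.
move=> [x' t'] [/= xx tt]; rewrite distrC; apply: Hd; rewrite distrC; by [exact: xx|exact: tt].
Qed.

Lemma contP (f : R -> R) : continuous f <-> (forall (x e : R), 0 < e -> exists2 d : R, 0 < d &
  forall y : R, `|y - x| < d -> `|f y - f x| < e).
Proof.
split=> [cf x e e0|H x].
  have /cvgrPdist_lt /(_ e e0) [d /= d0 Hd] := cf x; exists d => // y yx.
  by rewrite distrC; apply: Hd; rewrite /= distrC.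
apply/cvgrPdist_lt => e e0; have [d d0 Hd] := H x e e0; exists d => //= y /= yx.
by rewrite distrC; apply: Hd; rewrite distrC.
Qed.

Lemma cont2_sec1 u t : continuous (unc u) -> continuous (fun x => u x t).
Proof.
move=> /cont2P cu; apply/contP => x e e0; have [d d0 H] := cu x t e e0.
by exists d => // y yx; apply: H => //; rewrite subrr normr0.
Qed.

Lemma cont2_sec2 u x : continuous (unc u) -> continuous (u x).
Proof.
move=> /cont2P cu; apply/contP => t e e0; have [d d0 H] := cu x t e e0.
by exists d => // y yx; apply: H => //; rewrite subrr normr0.
Qed.

Lemma cont2_swap u : continuous (unc u) -> continuous (unc (fun t x => u x t)).
Proof.
move=> /cont2P cu; apply/cont2P => x t e e0; have [d d0 H] := cu t x e e0.
by exists d => // x' t' xx tt; apply: H.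
Qed.

(** Measurability for the product sigma-algebra: the preimage of an open ray is the union of the
    squares with rational centres and radii [1/(n+1)] that it contains, a countable union. *)
Lemma cont2_mes u : continuous (unc u) -> measurable_fun setT (unc u).
Proof.
move=> cu; apply: (measurability _ (@RGenOInfty.measurableE R)).
move=> /= _ [_ [a ->]] <-; rewrite setTI.
set O := _ @^-1` _.
pose box (q : rat * rat * nat) : set (R * R) :=
  ball (ratr q.1.1 : R) (q.2.+1%:R^-1) `*` ball (ratr q.1.2 : R) (q.2.+1%:R^-1).
have -> : O = \bigcup_(q in [set q | box q `<=` O]) box q.
  apply/seteqP; split => [[x t] Oxt|z [q qO]]; last exact: qO.
  have oxt : a < u x t by move: Oxt; rewrite /O/= in_itv/= andbT.
  have [d d0 Hd] := (cont2P u).1 cu x t _ (ltac:(rewrite subr_gt0; exact: oxt) : 0 < u x t - a).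
  have [n nd] : exists n : nat, 2 * n.+1%:R^-1 < d.
    have [n n1] := @ltr_add_invr R 0 (d / 2) (ltac:(by rewrite divr_gt0)).
    by exists n; move: n1; rewrite add0r ltr_pdivlMr// mulrC.
  have n0 : (0 : R) < n.+1%:R^-1 by rewrite invr_gt0.
  set i : R := n.+1%:R^-1 in nd n0.
  have [q1] : exists q : rat, (ratr q : R) \in `]x - i, x + i[.
    by apply: rat_in_itvoo; lra.
  rewrite in_itv/= => /andP[q11 q12].
  have [q2] : exists q : rat, (ratr q : R) \in `]t - i, t + i[.
    by apply: rat_in_itvoo; lra.
  rewrite in_itv/= => /andP[q21 q22].
  exists (q1, q2, n); last first.
    by split => /=; rewrite /ball/= -/i ltr_norml; apply/andP; split; lra.
  move=> [x' t'] [] /=; rewrite /ball/= -/i !ltr_norml => /andP[h1 h2] /andP[h3 h4].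
  rewrite /O/= in_itv/= andbT /unc/=.
  have := Hd x' t'; rewrite !ltr_norml => H.
  have : `|u x' t' - u x t| < u x t - a by rewrite ltr_norml; apply: H; apply/andP; split; lra.
  by rewrite ltr_norml => /andP[]; lra.
rewrite bigcup_mkcond; apply: countable_bigcupT_measurable; first exact: countableP.
move=> q; case: ifPn => // _.
by apply: measurableX; exact: measurable_ball.
Qed.

Definition int2 a b c d f := (@leb2 R).-integrable (`[a, b] `*` `[c, d]) (EFin \o unc f).

Lemma measurable_rect a b c d : measurable (`[a, b] `*` `[c, d] : set (R * R)).
Proof. by apply: measurableX; exact: measurable_itv. Qed.

Lemma int2_sub a b c d a' b' c' d' f : a <= a' -> b' <= b -> c <= c' -> d' <= d ->
  int2 a b c d f -> int2 a' b' c' d' f.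
Proof.
move=> aa bb cc dd; apply: integrableS; [exact: measurable_rect|exact: measurable_rect|].
by move=> [x t] /= []; rewrite !in_itv/= => /andP[h1 h2] /andP[h3 h4]; split;
  apply/andP; split; lra.
Qed.

Section Fubini.
Variables (a b c d : R) (f : R -> R -> R).
Hypothesis If : int2 a b c d f.

Let f' : R * R -> \bar R := (EFin \o unc f) \_ (`[a, b] `*` `[c, d]).

Let If' : (@leb2 R).-integrable setT f'.
Proof. apply: (iffLR (integrable_mkcond _ _)) If; exact: measurable_rect. Qed.

Let f'E1 x : a <= x <= b -> (fun t => f' (x, t)) = (EFin \o f x) \_ `[c, d].
Proof.
move=> xab; apply/funext => t; rewrite /f' !patchE.
have -> : ((x, t) \in `[a, b] `*` `[c, d]) = (t \in `[c, d]%classic).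
  by apply/idP/idP; rewrite !inE/= !in_itv/= xab => //; case.
by [].
Qed.

Let f'E2 t : c <= t <= d -> (fun x => f' (x, t)) = (EFin \o (f ^~ t)) \_ `[a, b].
Proof.
move=> xab; apply/funext => x; rewrite /f' !patchE.
have -> : ((x, t) \in `[a, b] `*` `[c, d]) = (x \in `[a, b]%classic).
  by apply/idP/idP; rewrite !inE/= !in_itv/= xab => //; case.
by [].
Qed.

Lemma fub_ae1 : \forall x \ae mu, a <= x <= b -> iv c d (f x).
Proof.
have := ae_integrable1 If'; apply: filterS => x /= + xab.
rewrite f'E1// => H; by apply/integrable_mkcond.
Qed.

Lemma fub_ae2 : \forall t \ae mu, c <= t <= d -> iv a b (f ^~ t).
Proof.
have := ae_integrable2 If'; apply: filterS => x /= + xab.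
rewrite f'E2// => H; by apply/integrable_mkcond.
Qed.

Let F := fubini_F mu f'.
Let G := fubini_G mu f'.

Let FE x : a <= x <= b -> F x = (\int[mu]_(t in `[c, d]) (f x t)%:E)%E.
Proof. by move=> xab; rewrite /F/fubini_F f'E1// -integral_mkcond. Qed.

Let GE t : c <= t <= d -> G t = (\int[mu]_(x in `[a, b]) (f x t)%:E)%E.
Proof. by move=> xab; rewrite /G/fubini_G f'E2// -integral_mkcond. Qed.

Let F0 x : ~ (a <= x <= b) -> F x = 0%E.
Proof.
move=> xab; rewrite /F/fubini_F; apply: integral0_eq => t _.
by rewrite /f' patchE; case: ifPn => //; rewrite inE/= in_itv/= => -[].
Qed.

Let G0 t : ~ (c <= t <= d) -> G t = 0%E.
Proof.
move=> xab; rewrite /G/fubini_G; apply: integral0_eq => x _.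
by rewrite /f' patchE; case: ifPn => //; rewrite inE/= !in_itv/= => -[].
Qed.

(** Partial integrals are extended-real functions, finite only almost everywhere; this transfers
    their integrability and their integral to the real-valued [I]. *)
Let gen (F1 : R -> \bar R) h a1 b1 : mu.-integrable setT F1 ->
  (forall x, a1 <= x <= b1 -> fine (F1 x) = h x) ->
  (forall x, ~ (a1 <= x <= b1) -> F1 x = 0%E) ->
  iv a1 b1 h /\ (\int[mu]_x F1 x)%E = (I a1 b1 h)%:E.
Proof.
move=> IF1 Fh F10.
have IF1' : mu.-integrable `[a1, b1] F1 by apply: integrableS IF1.
have Ih : iv a1 b1 h.
  apply: (@le_integrable _ _ _ mu `[a1, b1] _ _ F1) => //.
    apply/measurable_EFinP; apply: (eq_measurable_fun (fine \o F1)).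
      by move=> x; rewrite inE/= in_itv/= => /Fh.
    apply: measurableT_comp => //; exact: measurable_int IF1'.
  move=> x; rewrite /= in_itv/= => /Fh <-.
  by case: (F1 x) => [r| |]//=; rewrite ?leey.
split=> //.
have -> : (\int[mu]_x F1 x = \int[mu]_(x in `[a1, b1]) F1 x)%E.
  rewrite [RHS]integral_mkcond; apply: eq_integral => x _; rewrite patchE.
  by case: ifPn => //; rewrite notin_setE/= in_itv/= => /F10.
rewrite /I fineK//; last exact: integrable_fin_num.
apply: ae_eq_integral => //; [exact: measurable_int IF1'|exact: measurable_int Ih|].
have : \forall x \ae mu, `[a1, b1]%classic x -> F1 x \is a fin_num by exact: integrable_ae IF1'.
apply: filterS; first exact: (ae_filter_ringOfSetsType mu).
move=> x /= H xab.
rewrite -Fh; last by move: xab; rewrite in_itv.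
by rewrite fineK// H.
Qed.

Let integrable_fubini_G' : mu.-integrable setT (fubini_G mu f').
Proof.
apply/integrableP; split; first exact: (measurable_fubini_G If').
have mf' : measurable_fun setT f' by exact: measurable_int If'.
have := (integrable21ltyP mu mu mf').1 If'; apply: le_lt_trans.
apply: ge0_le_integral => //.
- by apply: measurableT_comp => //; exact: (measurable_fubini_G If').
- apply: (@measurable_fun_fubini_tonelli_G _ _ _ _ _ mu (abse \o f')).
    exact: measurableT_comp.
  by move=> z; exact: abse_ge0.
- move=> t _; apply: le_abse_integral => //.
  exact: measurable_fun_pair1 mf'.
Qed.

Lemma fub_iv1 : iv a b (fun x => I c d (f x)).
Proof.
have IF := integrable_fubini_F If'.
by apply: (proj1 (gen IF _ F0)) => x xab; exact: (congr1 fine (FE xab)).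
Qed.

Lemma fub_iv2 : iv c d (fun t => I a b (f ^~ t)).
Proof.
have IF := integrable_fubini_G'.
by apply: (proj1 (gen IF _ G0)) => x xab; exact: (congr1 fine (GE xab)).
Qed.

Lemma fub_int1 : (\int[@leb2 R]_(z in `[a, b] `*` `[c, d]) (unc f z)%:E)%E =
  (I a b (fun x => I c d (f x)))%:E.
Proof.
have IF := integrable_fubini_F If'.
rewrite integral_mkcond -/f' /leb2 -integral12_prod_meas1//.
by apply: (proj2 (gen IF _ F0)) => x xab; exact: (congr1 fine (FE xab)).
Qed.

Lemma fub_int2 : (\int[@leb2 R]_(z in `[a, b] `*` `[c, d]) (unc f z)%:E)%E =
  (I c d (fun t => I a b (f ^~ t)))%:E.
Proof.
have IF := integrable_fubini_G'.
rewrite integral_mkcond -/f' /leb2 -integral21_prod_meas1//.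
by apply: (proj2 (gen IF _ G0)) => x xab; exact: (congr1 fine (GE xab)).
Qed.

Lemma fub : I a b (fun x => I c d (f x)) = I c d (fun t => I a b (f ^~ t)).
Proof. by apply: EFin_inj; rewrite -fub_int1 fub_int2. Qed.

End Fubini.

End Plane.

(** * Smooth steps and tensor test functions *)

Section SmoothStep.
Variable R : realType.
Implicit Types (f g : R -> R) (x : R).

(** A class generated by the functions [x^-k exp(-1/x)] on [x > 0] that is closed under
    differentiation, see [smooth1_derive]. It stands in for infinite differentiability: a test
    function is smooth as soon as it is built inside the class. *)
Inductive smooth1 : (R -> R) -> Prop :=
| smooth1_flat k : smooth1 (fun x => if 0 < x then x ^- k * expR (- x^-1) else 0)
| smooth1_cst c : smooth1 (fun=> c)
| smooth1_add f g : smooth1 f -> smooth1 g -> smooth1 (fun x => f x + g x)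
| smooth1_mul f g : smooth1 f -> smooth1 g -> smooth1 (fun x => f x * g x)
| smooth1_aff f a b : smooth1 f -> smooth1 (fun x => f (a * x + b))
| smooth1_prim F f : smooth1 f -> (forall x : R, is_derive x 1 F (f x)) -> smooth1 F.

Definition flat k (x : R) : R := if 0 < x then x ^- k * expR (- x^-1) else 0.

(** With [N = k + 2], raise [exp(1/(N x)) >= 1/(N x)] to the power [N]. Two powers more than [k]
    leave the factor [x^2], which gives the derivative [0] at the origin. *)
Lemma flat_le k (x : R) : 0 < x -> flat k x <= (k.+2)%:R ^+ k.+2 * x ^+ 2.
Proof.
move=> x0; rewrite /flat x0.
have kx : 0 < (k.+2%:R * x)^-1 by rewrite invr_gt0 mulr_gt0.
have H : (k.+2%:R * x) ^- k.+2 <= expR (x^-1).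
  have -> : expR x^-1 = expR ((k.+2%:R * x)^-1) ^+ k.+2.
    rewrite -expRM_natl; congr expR; field.
    by rewrite gt_eqF//= natr1 natr1 pnatr_eq0.
  rewrite -exprVn lerXn2r ?nnegrE ?expR_ge0 ?(ltW kx)//.
  by rewrite (le_trans _ (expR_ge1Dx _))// lerDr.
rewrite expRN.
have : (expR x^-1)^-1 <= (k.+2%:R * x) ^+ k.+2.
  by rewrite -[leRHS]invrK lef_pV2// posrE ?expR_gt0// invr_gt0 exprn_gt0// mulr_gt0.
move=> /(ler_wpM2l (ltW (_ : 0 < x ^- k))) -/(_ _)/le_trans; apply.
  by rewrite invr_gt0 exprn_gt0.
rewrite exprMn mulrCA ler_wpM2l ?exprn_ge0//.
by rewrite -addn2 exprD mulKf// expf_neq0// gt_eqF.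
Qed.

Lemma flat_ge0 k (x : R) : 0 <= flat k x.
Proof.
by rewrite /flat; case: ifPn => // x0; rewrite mulr_ge0 ?expR_ge0// invr_ge0 exprn_ge0// ltW.
Qed.

Lemma is_derive_near f g x a : (exists2 r : R, 0 < r & forall y, `|y - x| < r -> f y = g y) ->
  is_derive x 1 g a -> is_derive x 1 f a.
Proof.
move=> [r r0 fg] /is_derive_increment H; apply: is_derive_of_increment => e e0.
have [d d0 Hd] := H e e0; exists (Num.min r d); first by rewrite lt_min r0.
move=> y; rewrite lt_min => /andP[yr yd]; rewrite !fg ?subrr ?normr0//; exact: Hd.
Qed.

Lemma flat_npos k (x : R) : x <= 0 -> flat k x = 0.
Proof. by move=> x0; rewrite /flat ltNge x0. Qed.

Lemma is_derive_flat k (x : R) : is_derive x 1 (flat k) (flat k.+2 x - k%:R * flat k.+1 x).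
Proof.
have [x0|x0|->] := ltgtP x 0.
- rewrite (flat_npos k.+2 (ltW x0)) (flat_npos k.+1 (ltW x0)) mulr0 subrr.
  apply: is_derive_of_increment => e e0; exists (- x); first by rewrite oppr_gt0.
  move=> y; rewrite ltr_norml => /andP[y1 y2].
  by rewrite !flat_npos ?subrr ?mul0r ?subrr ?normr0 ?mulr_ge0//; lra.
- have xn : x != 0 by rewrite gt_eqF.
  have xkn : x ^+ k != 0 by rewrite expf_neq0.
  have d1 : is_derive x 1 (fun y : R => (y ^+ k)^-1) (- (k%:R * x ^+ k.-1 * 1) / (x ^+ k) ^+ 2).
    exact: (dV _ (dX k (is_derive_id x 1))).
  have d2 : is_derive x 1 (fun y : R => expR (- y^-1)) (expR (- x^-1) * - (- 1 / (x ^+ 2))).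
    exact: (dC (is_derive_expR _) (dN (dV xn (is_derive_id x 1)))).
  have dm := dM d1 d2.
  apply: (@is_derive_near _ (fun y => (y ^+ k)^-1 * expR (- y^-1))).
    by exists x => // y; rewrite ltr_norml => /andP[y1 _]; rewrite /flat ifT//; lra.
  apply: (is_derive_eq dm).
  rewrite /flat x0.
  case: k xkn {d1 d2 dm} => [|k] xkn.
    by rewrite !expr0 !mul0r; field.
  by rewrite /= !exprS; field; rewrite xn/= expf_neq0.
- rewrite !(flat_npos _ (lexx 0)) mulr0 subrr.
  apply: is_derive_of_increment => e e0.
  have K0 : 0 < (k.+2)%:R ^+ k.+2 :> R by rewrite exprn_gt0.
  exists (e / (k.+2)%:R ^+ k.+2); first by rewrite divr_gt0.
  move=> y; rewrite (flat_npos _ (lexx 0)) !subr0 mul0r subr0 => ye.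
  have [y0|y0] := leP y 0; first by rewrite flat_npos// normr0 mulr_ge0// ltW.
  rewrite ger0_norm ?flat_ge0// (le_trans (flat_le k y0))//.
  move: ye; rewrite ger0_norm ?(ltW y0)// ltr_pdivlMr// => ye.
  by rewrite expr2 mulrA ler_wpM2r ?(ltW y0)// mulrC ltW.
Qed.

Lemma smooth1_derive f : smooth1 f -> exists2 f', smooth1 f' & forall x, is_derive x 1 f (f' x).
Proof.
elim=> {f} [k|c|f g _ [f' sf Hf] _ [g' sg Hg]|f g mf [f' sf Hf] mg [g' sg Hg]|f a b _ [f' sf Hf]|F f sf _ HF].
- exists (fun x => flat k.+2 x + (- k%:R) * flat k.+1 x).
    by apply: smooth1_add; [exact: smooth1_flat|apply: smooth1_mul; [exact: smooth1_cst|exact: smooth1_flat]].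
  by move=> x; rewrite mulNr; exact: is_derive_flat.
- by exists (fun=> 0); [exact: smooth1_cst|move=> x; exact: is_derive_cst].
- by exists (fun x => f' x + g' x); [exact: smooth1_add|move=> x; exact: is_deriveD].
- exists (fun x => f x * g' x + g x * f' x).
    by apply: smooth1_add; exact: smooth1_mul.
  by move=> x; have := is_deriveM (Hf x) (Hg x).
- exists (fun x => a * f' (a * x + b)).
    by apply: smooth1_mul; [exact: smooth1_cst|exact: smooth1_aff].
  move=> x.
  have da : is_derive x 1 (fun x : R => a * x + b) a.
    have H := is_deriveD (is_deriveZ a (is_derive_id x 1)) (is_derive_cst b x 1).
    by apply: (is_derive_eq H); rewrite addr0 [_ *: _]mulr1.
  by rewrite mulrC; exact: dC.
- by exists f.
Qed.

Lemma smooth1_cont f : smooth1 f -> continuous f.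
Proof.
move=> /smooth1_derive[f' _ Hf] x; apply: differentiable_continuous.
by apply/derivable1_diffP; case: (Hf x).
Qed.

Lemma smooth1_derive1 f : smooth1 f -> smooth1 (derive1 f) /\ forall x, is_derive x 1 f (derive1 f x).
Proof.
move=> /smooth1_derive[f' sf' Hf].
have -> : derive1 f = f' by apply/funext => x; rewrite derive1E; case: (Hf x).
by [].
Qed.

Lemma smooth_step_ex : exists S : R -> R, [/\ smooth1 S, forall x, x <= 0 -> S x = 0,
  forall x, 1 <= x -> S x = 1, forall x, 0 <= S x <= 1 & forall x, 0 <= derive1 S x].
Proof.
pose bump x := flat 0 x * flat 0 (- x + 1).
have sb : smooth1 bump.
  apply: smooth1_mul; first exact: smooth1_flat.
  have := smooth1_aff (-1) 1 (smooth1_flat 0).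
  by congr smooth1; apply/funext => x; rewrite mulN1r.
have b0 x : 0 <= bump x by rewrite mulr_ge0 ?flat_ge0.
have bl x : x <= 0 -> bump x = 0 by move=> x0; rewrite /bump flat_npos ?mul0r.
have br x : 1 <= x -> bump x = 0 by move=> x0; rewrite /bump (@flat_npos _ (-x+1)) ?mulr0//; lra.
have bp : 0 < bump (1/2).
  rewrite /bump /flat !ifT; [|lra|lra].
  by rewrite expr0 invr1 !mul1r mulr_gt0 ?expR_gt0.
have cb := smooth1_cont sb.
have Ib a b : iv a b bump by exact: iv_contT.
pose c := I (-1) 1 bump.
have c0 : 0 < c.
  have [d d0 Hd] := (contP bump).1 cb (1/2) (bump (1/2) / 2) (divr_gt0 bp (ltr0n _ 2)).
  pose e := Num.min (d / 2) (1/2).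
  have e0 : 0 < e by rewrite lt_min divr_gt0//=; lra.
  have [e1 e2] : e <= d / 2 /\ e <= 1/2 by split; rewrite ge_min lexx ?orbT.
  apply: (@lt_le_trans _ _ (I (1/2) (1/2 + e) (fun=> bump (1/2) / 2))).
    rewrite I_cst; last by lra.
    by rewrite mulr_gt0 ?divr_gt0//; lra.
  apply: (@le_trans _ _ (I (1/2) (1/2 + e) bump)).
    apply: I_le => //; first exact: iv_cst.
    move=> x /andP[x1 x2]; have H := Hd x.
    have : `|bump x - bump (1/2)| < bump (1/2) / 2 by apply: H; rewrite ger0_norm; lra.
    by rewrite ltr_norml => /andP[]; lra.
  by apply: I_sub_le => //; lra.
pose P x := I (-1) x bump.
have dP (x : R) : -1 < x -> is_derive x 1 P (bump x).
  move=> x1; have [H1 H2] := @continuous_FTC1_closed _ bump (-1) x (x + 1) (ltac:(lra)) (Ib _ _) x1 (cb x).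
  by rewrite -H2 derive1E; exact: DeriveDef.
have P0 x : -1 <= x -> x <= 0 -> P x = 0.
  move=> x1 x0; rewrite /P (I_ext (g := fun=> 0)) ?I_cst ?mul0r//.
  by move=> y /andP[_ yx]; apply: bl; exact: le_trans x0.
pose S x := if x <= 0 then 0 else c^-1 * P x.
have Sp x : -1 <= x -> S x = c^-1 * P x.
  by move=> x1; rewrite /S; case: ifPn => // x0; rewrite P0 ?mulr0.
have dS (x : R) : is_derive x 1 S (c^-1 * bump x).
  have [x0|x0] := leP x (-1/2).
    rewrite bl ?mulr0; last by lra.
    apply: is_derive_of_increment => e e0; exists (1/4) => // y.
    rewrite ltr_norml => /andP[y1 y2]; rewrite /S !ifT; [|lra|lra].
    by rewrite subrr mul0r subrr normr0 mulr_ge0// ltW.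
  have dd : is_derive x 1 (fun x => c^-1 * P x) (c^-1 * bump x).
    by apply: is_deriveZ; apply: dP; lra.
  apply: is_derive_of_increment => e e0.
  have [r r0 Hr] := is_derive_increment dd e0.
  exists (Num.min r (1/4)); first by rewrite lt_min r0/=; lra.
  move=> y; rewrite lt_min => /andP[yr]; rewrite ltr_norml => /andP[y1 y2].
  by rewrite !Sp; [exact: Hr|lra|lra].
have sS : smooth1 S.
  by apply: (smooth1_prim (f := fun x => c^-1 * bump x)) => //; apply: smooth1_mul => //; exact: smooth1_cst.
have Pc x : 1 <= x -> P x = c.
  move=> x1; rewrite /P (I_split (c := 1) _ x1 (Ib _ _)) -/c; last by lra.
  rewrite [X in _ + X](I_ext (g := fun=> 0)) ?I_cst ?mul0r ?addr0//.
  by move=> y /andP[y1 _]; exact: br.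
exists S; split => //.
- by move=> x x0; rewrite /S x0.
- by move=> x x1; rewrite Sp ?Pc ?mulVf ?gt_eqF//; lra.
- move=> x; rewrite /S; case: ifPn; first by rewrite lexx ler01.
  rewrite -ltNge => x0; apply/andP; split.
    by rewrite mulr_ge0 ?invr_ge0 ?(ltW c0)//; apply: I_ge0.
  rewrite ler_pdivrMl// mulr1.
  have [x1|x1] := leP x 1; first by rewrite /P; apply: I_sub_le => //; lra.
  by rewrite Pc// ltW.
- by move=> x; rewrite derive1E; case: (dS x) => _ ->; rewrite mulr_ge0// invr_ge0 ltW.
Qed.

End SmoothStep.

(** * Calculus on rectangles, almost-everywhere tools and mollification *)

Section PlaneMore.
Variable R : realType.
Implicit Types (f g u : R -> R -> R) (a b c d x t : R).
Notation mu := (@lebesgue_measure R).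

Lemma cont2D f g : continuous (unc f) -> continuous (unc g) ->
  continuous (unc (fun x t => f x t + g x t)).
Proof. by move=> cf cg z; apply: (continuousD (cf z) (cg z)). Qed.

Lemma cont2B f g : continuous (unc f) -> continuous (unc g) ->
  continuous (unc (fun x t => f x t - g x t)).
Proof. by move=> cf cg z; apply: (continuousB (cf z) (cg z)). Qed.

Lemma cont2M f g : continuous (unc f) -> continuous (unc g) ->
  continuous (unc (fun x t => f x t * g x t)).
Proof. by move=> cf cg z; apply: (continuousM (cf z) (cg z)). Qed.

Lemma cont2_comp (phi : R -> R) f : continuous phi -> continuous (unc f) ->
  continuous (unc (fun x t => phi (f x t))).
Proof. by move=> cp cf z; apply: (continuous_comp (cf z) (cp _)). Qed.

Lemma cont2_1 (phi : R -> R) : continuous phi -> continuous (unc (fun x t : R => phi x)).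
Proof. by move=> cp z; apply: (continuous_comp (@cvg_fst _ _ _ _ _) (cp _)). Qed.

Lemma cont2_2 (phi : R -> R) : continuous phi -> continuous (unc (fun x t : R => phi t)).
Proof. by move=> cp z; apply: (continuous_comp (@cvg_snd _ _ _ _ _) (cp _)). Qed.

Lemma cont2_bounded f a b c d : continuous (unc f) ->
  exists2 M, 0 <= M & forall x t, a <= x <= b -> c <= t <= d -> `|f x t| <= M.
Proof.
move=> cf.
have K : compact (`[a, b] `*` `[c, d] : set (R * R)).
  by apply: compact_setX; exact: segment_compact.
have : compact ((fun z => `|unc f z|) @` (`[a, b] `*` `[c, d])).
  apply: continuous_compact => //; apply: continuous_subspaceT => z.
  by apply: continuous_comp; [exact: cf|exact: norm_continuous].
move=> /compact_bounded [M [_ HM]].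
have M1 : M < `|M| + 1 by rewrite (le_lt_trans (ler_norm _))// ltrDl.
exists (`|M| + 1) => [|x t xab tcd]; first by rewrite addr_ge0.
rewrite -[leLHS]normr_id; apply: (HM _ M1); by exists (x, t).
Qed.

Lemma int2_mes a b c d f : int2 a b c d f ->
  measurable_fun (`[a, b] `*` `[c, d]) (unc f).
Proof. by move=> /measurable_int /measurable_EFinP. Qed.

Lemma int2_le a b c d f g : measurable_fun (`[a, b] `*` `[c, d]) (unc f) ->
  (forall x t, a <= x <= b -> c <= t <= d -> `|f x t| <= g x t) -> int2 a b c d g -> int2 a b c d f.
Proof.
move=> mf fg; apply: le_integrable => //; first exact: measurable_rect.
  exact/measurable_EFinP.
move=> [x t] [] /=; rewrite !in_itv/= => xab tcd; rewrite lee_fin.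
by rewrite /unc/= (le_trans (fg _ _ xab tcd))// ler_norm.
Qed.

Lemma int2D a b c d f g : int2 a b c d f -> int2 a b c d g -> int2 a b c d (fun x t => f x t + g x t).
Proof.
move=> If Ig; rewrite /int2 (_ : EFin \o _ = (EFin \o unc f) \+ (EFin \o unc g))%E//.
by apply: integrableD => //; exact: measurable_rect.
Qed.

Lemma int2Z a b c d k f : int2 a b c d f -> int2 a b c d (fun x t => k * f x t).
Proof.
move=> If; rewrite /int2 (_ : EFin \o _ = fun z => (k%:E * (EFin \o unc f) z)%E)//.
by apply: integrableZl => //; exact: measurable_rect.
Qed.

Lemma int2_ext a b c d f g : (forall x t, a <= x <= b -> c <= t <= d -> f x t = g x t) ->
  int2 a b c d f -> int2 a b c d g.
Proof.
move=> fg; apply: eq_integrable; first exact: measurable_rect.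
by move=> [x t]; rewrite inE/= !in_itv/= => -[xab tcd]; rewrite /unc/= fg.
Qed.

Lemma int2B a b c d f g : int2 a b c d f -> int2 a b c d g -> int2 a b c d (fun x t => f x t - g x t).
Proof.
move=> If Ig; apply: int2_ext (int2D If (int2Z (-1) Ig)) => x t _ _; ring.
Qed.

Lemma int2_norm a b c d f : int2 a b c d f -> int2 a b c d (fun x t => `|f x t|).
Proof. by move=> If; apply: integrable_norm. Qed.

Lemma leb2_rect a b c d : (@leb2 R (`[a, b] `*` `[c, d]) < +oo)%E.
Proof.
rewrite /leb2 product_measure1E; [|exact: measurable_itv|exact: measurable_itv].
have H (x y : R) : (mu `[x, y]%classic < +oo)%E.
  by rewrite lebesgue_measure_itv/=; case: ifPn => _; rewrite -?EFinB ltry.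
apply: lte_mul_pinfty => //; last exact: H.
by rewrite ge0_fin_numE//; exact: H.
Qed.

Lemma int2_cst a b c d k : int2 a b c d (fun _ _ => k).
Proof.
apply: measurable_bounded_integrable; [exact: measurable_rect|exact: leb2_rect|exact: measurable_cst|].
by exists `|k|; split => // M kM z _ /=; exact: ltW.
Qed.

Lemma int2_cont a b c d f : continuous (unc f) -> int2 a b c d f.
Proof.
move=> cf; have [M _ HM] := cont2_bounded a b c d cf.
apply: (@int2_le _ _ _ _ _ (fun _ _ => M)) => //; last exact: int2_cst.
by apply: measurable_funTS; exact: cont2_mes.
Qed.

Lemma int2_mulb a b c d f k M : measurable_fun (`[a, b] `*` `[c, d]) (unc k) ->
  (forall x t, a <= x <= b -> c <= t <= d -> `|k x t| <= M) -> int2 a b c d f ->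
  int2 a b c d (fun x t => k x t * f x t).
Proof.
move=> mk kM If; apply: (@int2_le _ _ _ _ _ (fun x t => M * `|f x t|)).
- by apply: measurable_funM => //; exact: int2_mes If.
- by move=> x t xab tcd; rewrite normrM ler_wpM2r// kM.
- by apply: int2Z; exact: int2_norm.
Qed.

Lemma int2_mulc a b c d f k : continuous (unc k) -> int2 a b c d f ->
  int2 a b c d (fun x t => k x t * f x t).
Proof.
move=> ck If; have [M _ HM] := cont2_bounded a b c d ck.
by apply: int2_mulb HM If; apply: measurable_funTS; exact: cont2_mes.
Qed.

Lemma integral_rect a b c d f : (forall x t, ~ (a <= x <= b /\ c <= t <= d) -> f x t = 0) ->
  (\int[@leb2 R]_z (f z.1 z.2)%:E = \int[@leb2 R]_(z in `[a, b] `*` `[c, d]) (unc f z)%:E)%E.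
Proof.
move=> f0; rewrite [RHS]integral_mkcond; apply: eq_integral => -[x t] _.
rewrite patchE; case: ifPn => //; rewrite notin_setE/= !in_itv/= => H.
by rewrite f0.
Qed.

Lemma I_param_cont f a b : continuous (unc f) -> continuous (fun t => I a b (f ^~ t)).
Proof.
move=> cf t; have [M M0 HM] := cont2_bounded a b (t - 1) (t + 1) cf.
have := @continuity_under_integral R _ _ mu (fun t x => f x t) `[a, b] (measurable_itv _) (t - 1) (t + 1).
move=> /(_ _ _ (fun=> M)) H; apply: H => //.
- by move=> s _; apply: iv_contT; exact: cont2_sec1.
- by apply: aeW => x _ s _; exact: cont2_sec2.
- exact: iv_cst.
- move=> s; rewrite /= in_itv/= => /andP[s1 s2]; apply: aeW => x; rewrite /= in_itv/= => xab.
  by apply: HM => //; lra.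
- by rewrite inE/= in_itv/=; lra.
Qed.

Lemma ae_countable (T : countType) (P : T -> R -> Prop) :
  (forall i, \forall x \ae mu, P i x) -> \forall x \ae mu, forall i, P i x.
Proof.
move=> H.
have : \forall x \ae mu, forall n, (if unpickle n is Some i then P i x else True).
  apply: ae_foralln => n; case: (unpickle n) => [i|]; [exact: H|exact: aeW].
apply: filterS; first exact: (ae_filter_ringOfSetsType mu).
by move=> x Hx i; have := Hx (pickle i); rewrite pickleK.
Qed.

Lemma aeI (P Q : R -> Prop) : (\forall x \ae mu, P x) -> (\forall x \ae mu, Q x) ->
  \forall x \ae mu, P x /\ Q x.
Proof. by move=> HP HQ; exact: (@filterI _ _ (ae_filter_ringOfSetsType mu)). Qed.

Lemma aeS (P Q : R -> Prop) : (forall x, P x -> Q x) -> (\forall x \ae mu, P x) ->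
  \forall x \ae mu, Q x.
Proof. by move=> PQ; apply: (@filterS _ _ (ae_filter_ringOfSetsType mu)). Qed.

Lemma ae_ex (P : R -> Prop) a b : a < b -> (\forall x \ae mu, a < x < b -> P x) ->
  exists2 x, a < x < b & P x.
Proof.
move=> ab [N [mN N0 HN]]; apply: contrapT => H.
have : (`]a, b[ `<=` N).
  move=> x; rewrite /= in_itv/= => xab; apply: HN => /= /(_ xab) Px.
  by apply: H; exists x.
move=> /(le_measure mu); rewrite !inE => /(_ (measurable_itv _) mN).
move=> H1; have : (mu `]a, b[%classic <= 0)%E by rewrite -[leRHS]N0; exact: H1.
by rewrite lebesgue_measure_itv/= lte_fin ab -EFinB lee_fin subr_le0 leNgt ab.
Qed.

Lemma I_ae_eq a b (F G : R -> R) : iv a b F -> iv a b G ->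
  (\forall x \ae mu, a <= x <= b -> F x = G x) -> I a b F = I a b G.
Proof.
move=> IF IG H; congr fine; apply: ae_eq_integral => //.
- exact: measurable_int IF.
- exact: measurable_int IG.
apply: aeS H => x H; rewrite /= in_itv/= => xab; by rewrite H.
Qed.

Lemma I_ae_le a b (F G : R -> R) : iv a b F -> iv a b G ->
  (\forall x \ae mu, a <= x <= b -> F x <= G x) -> I a b F <= I a b G.
Proof.
move=> IF IG H; rewrite -subr_ge0 -IB//.
have IGF := ivB IG IF.
rewrite (@I_ae_eq _ _ _ (fun x => `|G x - F x|))//; [|exact: iv_norm|].
  by apply: I_ge0 => x _.
by apply: aeS H => x H xab; rewrite ger0_norm// subr_ge0 H.
Qed.

Lemma ftc_ae a b (F : R -> R) : iv a b F ->
  \forall x \ae mu, a < x < b -> is_derive x 1 (fun y => I a y F) (F x).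
Proof.
move=> IF; pose F' := F \_ `[a, b].
have IF' : mu.-integrable setT (EFin \o F').
  rewrite -restrict_EFin; apply: (iffLR (integrable_mkcond _ _)) IF; exact: measurable_itv.
have li : locally_integrable setT F' by apply: open_integrable_locally => //; exact: openT.
have IFy y : mu.-integrable [set` Interval (BLeft a) (BRight y)] (EFin \o F') by apply: integrableS IF'.
have := FTC1 IFy li.
apply: aeS => x H /andP[ax xb].
have [] := H; first by rewrite lte_fin.
move=> H1 H2.
have FxE : F' x = F x by rewrite /F' patchE mem_set//= in_itv/= !ltW.
apply: (@is_derive_near _ _ (fun y => I a y F')).
  exists (b - x); first by rewrite subr_gt0.
  move=> y; rewrite ltr_norml => /andP[_ yb]; apply: I_ext => s /andP[as_ sy].
  by rewrite /F' patchE mem_set//= in_itv/= as_/=; lra.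
by rewrite -FxE -H2 derive1E; exact: DeriveDef.
Qed.

Section TensorTests.
Variable S : R -> R.
Hypotheses (sS : smooth1 S) (S0 : forall x, x <= 0 -> S x = 0) (S1 : forall x, 1 <= x -> S x = 1).
Hypotheses (S01 : forall x, 0 <= S x <= 1).
Implicit Types (th ph : R -> R).

(** Every iterated partial derivative of a tensor product is again a tensor product of functions of
    the class, by induction on the word of derivatives. *)
Lemma test_tensor th ph (K : R) : smooth1 th -> smooth1 ph ->
  (forall x, K < `|x| -> th x = 0) -> (forall x, K < `|x| -> ph x = 0) ->
  test_fun (fun x t => th x * ph t).
Proof.
move=> sth sph hth hph; split; last first.
  by exists K => x t [/hth ->|/hph ->]; rewrite ?mul0r ?mulr0.
have : forall w, exists th' ph', [/\ smooth1 th', smooth1 ph' &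
    pder w (fun x t => th x * ph t) = (fun x t => th' x * ph' t)].
  elim=> [|b w [th' [ph' [s1 s2 E]]]]; first by exists th, ph.
  have [s1' d1] := smooth1_derive1 s1; have [s2' d2] := smooth1_derive1 s2.
  case: b => /=; rewrite E.
    exists (derive1 th'), ph'; split => //; apply/funext => x; apply/funext => t.
    rewrite /pd_x derive1E.
    have H : is_derive x 1 (fun s => th' s * ph' t) (th' x * 0 + ph' t * derive1 th' x).
      exact: (dM (d1 x) (is_derive_cst _ _ _)).
    by case: H => _ ->; rewrite mulr0 add0r mulrC.
  exists th', (derive1 ph'); split => //; apply/funext => x; apply/funext => t.
  rewrite /pd_t derive1E.
  have H : is_derive t 1 (fun s => th' x * ph' s) (th' x * derive1 ph' t).
    exact: (dZ _ (d2 t)).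
  by case: H => _ ->.
move=> H w; have [th' [ph' [s1 s2 ->]]] := H w.
have [_ d1] := smooth1_derive1 s1; have [_ d2] := smooth1_derive1 s2.
split; first by apply: cont2M; [apply: cont2_1|apply: cont2_2]; exact: smooth1_cont.
move=> x t; split.
  by have [] := dM (d1 x) (is_derive_cst (ph' t) x 1).
by have [] := dZ (th' x) (d2 t).
Qed.

Lemma pd_x_tensor th ph : smooth1 th -> pd_x (fun x t => th x * ph t) = (fun x t => derive1 th x * ph t).
Proof.
move=> s1; have [_ d1] := smooth1_derive1 s1.
apply/funext => x; apply/funext => t; rewrite /pd_x derive1E.
have H : is_derive x 1 (fun s => th s * ph t) (th x * 0 + ph t * derive1 th x).
  exact: (dM (d1 x) (is_derive_cst _ _ _)).
by case: H => _ ->; rewrite mulr0 add0r mulrC.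
Qed.

Lemma pd_t_tensor th ph : smooth1 ph -> pd_t (fun x t => th x * ph t) = (fun x t => th x * derive1 ph t).
Proof.
move=> s1; have [_ d2] := smooth1_derive1 s1.
apply/funext => x; apply/funext => t; rewrite /pd_t derive1E.
have H : is_derive t 1 (fun s => th x * ph s) (th x * derive1 ph t) by exact: (dZ _ (d2 t)).
by case: H => _ ->.
Qed.

(** For [k > 0] a step rising from [0] at [a] to [1] at [a + 1/k]; its derivative [dstp] is an
    approximate identity supported to the right of [a]. *)
Definition stp k a x := S (k * (x - a)).
Definition dstp k a x := k * derive1 S (k * (x - a)).

Lemma smooth1_shift (f : R -> R) k a : smooth1 f -> smooth1 (fun x => f (k * (x - a))).
Proof.
move=> /(smooth1_aff k (- (k * a))) H.
have -> // : (fun x => f (k * (x - a))) = (fun x => f (k * x + - (k * a))).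
by apply/funext => x; rewrite mulrBr.
Qed.

Lemma smooth_stp k a : smooth1 (stp k a). Proof. exact: smooth1_shift. Qed.

Lemma dS0 x : x <= 0 \/ 1 <= x -> derive1 S x = 0.
Proof.
have [sS' dS] := smooth1_derive1 sS.
have lt0 (y : R) : y < 0 \/ 1 < y -> derive1 S y = 0.
  move=> Hy; rewrite derive1E.
  have : is_derive y 1 S 0.
    have C : is_derive y 1 (fun=> S y) (0 : R) by exact: is_derive_cst.
    apply: is_derive_near C.
    case: Hy => Hy.
      exists (- y); first by rewrite oppr_gt0.
      by move=> z; rewrite ltr_norml => /andP[z1 z2]; rewrite !S0//; lra.
    exists (y - 1); first by rewrite subr_gt0.
    by move=> z; rewrite ltr_norml => /andP[z1 z2]; rewrite !S1//; lra.
  by case.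
have cS := (contP _).1 (smooth1_cont sS') x.
move=> Hx; apply/eqP; rewrite -normr_le0; apply/ler_addgt0Pl => e e0; rewrite addr0.
have [d d0 Hd] := cS e e0.
case: Hx => Hx.
  have := Hd (x - d / 2); rewrite (_ : x - d / 2 - x = - (d / 2)); last by lra.
  rewrite normrN gtr0_norm ?divr_gt0// => /(_ (ltac:(lra))).
  by rewrite lt0 ?sub0r ?normrN; [exact: ltW|left; lra].
have := Hd (x + d / 2); rewrite (_ : x + d / 2 - x = d / 2); last by lra.
rewrite gtr0_norm ?divr_gt0// => /(_ (ltac:(lra))).
by rewrite lt0 ?sub0r ?normrN; [exact: ltW|right; lra].
Qed.

Lemma is_derive_stp k a x : is_derive x 1 (stp k a) (dstp k a x).
Proof.
have [_ dS] := smooth1_derive1 sS.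
have H : is_derive x 1 (fun x => k * (x - a)) (k * (1 - 0)).
  exact: (dZ _ (dB (is_derive_id _ _) (is_derive_cst _ _ _))).
have := dC (dS _) H; rewrite subr0 mulr1 mulrC; exact.
Qed.

Lemma derive1_stp k a : derive1 (stp k a) = dstp k a.
Proof. by apply/funext => x; rewrite derive1E; case: (is_derive_stp k a x). Qed.

Lemma dstp_out k a x : 0 < k -> x <= a \/ a + k^-1 <= x -> dstp k a x = 0.
Proof.
move=> k0 H; rewrite /dstp dS0 ?mulr0//; case: H => H; [left|right].
  by rewrite pmulr_rle0// subr_le0.
by rewrite -ler_pdivrMl// mulr1; lra.
Qed.

Lemma dstp_mass k a : 0 < k -> I a (a + k^-1) (dstp k a) = 1.
Proof.
move=> k0; have ak : a <= a + k^-1 by rewrite lerDl invr_ge0 ltW.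
have [_ d] := smooth1_derive1 (smooth_stp k a).
have := @ac_smooth R a (a + k^-1) (stp k a) (dstp k a) _ _.
rewrite -derive1_stp => H; rewrite (ac_I ak (H _ _))//.
  rewrite /stp subrr mulr0 [a + _]addrC addrK mulfV ?gt_eqF// (S0 (lexx 0)).
  by rewrite (S1 (lexx 1)) subr0.
by apply: smooth1_cont; have [] := smooth1_derive1 (smooth_stp k a).
Qed.

(** Where the primitive of [B] has derivative [B x0], its first-order remainder [E] is [o(y - x0)].
    Integration by parts moves the derivative onto [dstp], whose derivative is of order [k^2] on an
    interval of length [1/k], so the error is at most [e M/(M + 1)]. *)
Lemma mollify (B : R -> R) a b x0 : iv a b B -> a < x0 -> x0 < b ->
  is_derive x0 1 (fun y => I a y B) (B x0) ->
  forall e, 0 < e -> exists2 N, 0 < N & forall k, N <= k ->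
    x0 + k^-1 <= b /\ `|I x0 (x0 + k^-1) (fun y => B y * dstp k x0 y) - B x0| <= e.
Proof.
move=> IB' ax xb derB e e0.
have [sS' dS] := smooth1_derive1 sS; have [sS'' dS'] := smooth1_derive1 sS'.
have [M M0 HM] : exists2 M, 0 <= M & forall x, 0 <= x <= 1 -> `|derive1 (derive1 S) x| <= M.
  by apply: within_bounded; apply: continuous_subspaceT; exact: smooth1_cont.
have e1 : 0 < e / (M + 1) by rewrite divr_gt0// ltr_wpDl.
have [r r0 Hr] := is_derive_increment derB e1.
exists (r^-1 + 1 + (b - x0)^-1).
  by rewrite !addr_gt0// invr_gt0// subr_gt0.
move=> k Nk.
have bx : 0 < b - x0 by rewrite subr_gt0.
have k0 : 0 < k by apply: lt_le_trans Nk; rewrite !addr_gt0// invr_gt0.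
have ki0 : 0 < k^-1 by rewrite invr_gt0.
have kr : k^-1 < r.
  rewrite -[ltRHS]invrK ltf_pV2 ?posrE ?invr_gt0//; apply: lt_le_trans Nk.
  by rewrite -addrA ltrDl addr_gt0// invr_gt0.
have kb : k^-1 <= b - x0.
  rewrite -[leRHS]invrK lef_pV2 ?posrE ?invr_gt0//; apply: le_trans Nk.
  by rewrite lerDr addr_ge0// ltW// invr_gt0.
have xkb : x0 + k^-1 <= b by lra.
split => //.
have xk : x0 <= x0 + k^-1 by lra.
have IBs : iv x0 (x0 + k^-1) B by apply: iv_sub IB' => //; exact: ltW.
pose E y := I a y B - I a x0 B - B x0 * (y - x0).
have acE : ac x0 (x0 + k^-1) E (fun y => B y - B x0).
  have h1 : ac x0 (x0 + k^-1) (fun y => I a y B) B.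
    by apply: ac_sub (ac_indef IB') => //; exact: ltW.
  have h2 := acB (acB h1 (ac_cst _ _ (I a x0 B))) (acZ (B x0) (acB (ac_id _ _) (ac_cst _ _ x0))).
  by apply: ac_ext h2 => y _; rewrite ?subr0 ?mulr1.
pose D' y := k ^+ 2 * derive1 (derive1 S) (k * (y - x0)).
have dD (y : R) : is_derive y 1 (dstp k x0) (D' y).
  have H : is_derive y 1 (fun x => k * (x - x0)) (k * (1 - 0)).
    exact: (dZ _ (dB (is_derive_id _ _) (is_derive_cst _ _ _))).
  have := dZ k (dC (dS' _) H); rewrite subr0 mulr1.
  by rewrite /D' expr2 -mulrA [_ * k]mulrC.
have cD' : continuous D'.
  by apply: smooth1_cont; apply: smooth1_mul; [exact: smooth1_cst|exact: smooth1_shift].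
have acD' := @ac_smooth R x0 (x0 + k^-1) _ _ cD' dD.
have [IED EE] := acM acE acD'.
have := EE x0 (x0 + k^-1) (lexx _) xk (lexx _).
rewrite !dstp_out//; [|by left|by right]; rewrite !mulr0 subrr => Z0.
have IE' : iv x0 (x0 + k^-1) (fun y => E y * D' y).
  by apply: iv_mulc; [exact: ac_within acE|case: acD'].
have IBD : iv x0 (x0 + k^-1) (fun y => dstp k x0 y * (B y - B x0)).
  apply: iv_mulc; [exact: ac_within acD'|by case: acE].
rewrite ID// in Z0.
have IDs : iv x0 (x0 + k^-1) (dstp k x0) by apply: iv_cont; exact: ac_within acD'.
have IBD' : iv x0 (x0 + k^-1) (fun y => B y * dstp k x0 y).
  apply: iv_ext (iv_mulc (ac_within acD') IBs) => y _; exact: mulrC.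
have -> : I x0 (x0 + k^-1) (fun y => B y * dstp k x0 y) - B x0 =
  I x0 (x0 + k^-1) (fun y => dstp k x0 y * (B y - B x0)).
  rewrite -[X in _ - X]mulr1 -(dstp_mass x0 k0) -IZ// -IB//; last exact: ivZ.
  by apply: I_ext => y _; ring.
have -> : I x0 (x0 + k^-1) (fun y => dstp k x0 y * (B y - B x0)) =
   - I x0 (x0 + k^-1) (fun y => E y * D' y) by apply/eqP; rewrite -addr_eq0 addrC -Z0.
rewrite normrN.
apply: (le_trans (I_le_abs (M := e / (M + 1) * k^-1 * (k ^+ 2 * M)) xk IE' _)).
  move=> y /andP[y1 y2]; rewrite normrM; apply: ler_pM => //.
    have yx : `|y - x0| <= k^-1 by rewrite ger0_norm; lra.
    apply: (le_trans (Hr y (le_lt_trans yx kr))).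
    by rewrite ler_wpM2l// ltW.
  rewrite normrM normrX (gtr0_norm k0) ler_wpM2l ?exprn_ge0 ?(ltW k0)//.
  apply: HM; apply/andP; split; first by rewrite mulr_ge0 ?(ltW k0)//; lra.
  by rewrite -ler_pdivlMl// mulr1; lra.
have -> : x0 + k^-1 - x0 = k^-1 by ring.
have -> : e / (M + 1) * k^-1 * (k ^+ 2 * M) * k^-1 = e * (M / (M + 1)).
  by field; rewrite !gt_eqF// ltr_wpDl.
by rewrite ler_piMr ?(ltW e0)// ler_pdivrMr ?ltr_wpDl// mul1r lerDl.
Qed.

End TensorTests.

End PlaneMore.

(** * Consequences of the weak formulation *)

Section WeakForm.
Variable R : realType.
Implicit Types (f g u w : R -> R -> R) (a b c d x t : R) (q v : R -> R).
Notation mu := (@lebesgue_measure R).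

Lemma cont1D (F G : R -> R) : continuous F -> continuous G -> continuous (fun x => F x + G x).
Proof. by move=> cF cG x; apply: cvgD; [exact: cF|exact: cG]. Qed.

Lemma cont1B (F G : R -> R) : continuous F -> continuous G -> continuous (fun x => F x - G x).
Proof. by move=> cF cG x; apply: cvgB; [exact: cF|exact: cG]. Qed.

Lemma cont1M (F G : R -> R) : continuous F -> continuous G -> continuous (fun x => F x * G x).
Proof. by move=> cF cG x; apply: cvgM; [exact: cF|exact: cG]. Qed.

Lemma cont1c (k : R) : continuous ((fun=> k) : R -> R).
Proof. by move=> x; exact: cvg_cst. Qed.

Lemma cont1_comp (F G : R -> R) : continuous F -> continuous G -> continuous (fun x => F (G x)).
Proof. by move=> cF cG x; apply: (@continuous_comp _ _ _ G F); [exact: cG|exact: cF]. Qed.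

Definition J2 a b c d f := I c d (fun t => I a b (f ^~ t)).

Lemma J2E a b c d f : int2 a b c d f ->
  (\int[@leb2 R]_(z in `[a, b] `*` `[c, d]) (unc f z)%:E)%E = (J2 a b c d f)%:E.
Proof. by move=> If; rewrite fub_int2. Qed.

Lemma J2_ext a b c d f g : (forall x t, a <= x <= b -> c <= t <= d -> f x t = g x t) ->
  J2 a b c d f = J2 a b c d g.
Proof. by move=> fg; apply: I_ext => t tcd; apply: I_ext => x xab; exact: fg. Qed.

Lemma J2D a b c d f g : int2 a b c d f -> int2 a b c d g ->
  J2 a b c d (fun x t => f x t + g x t) = J2 a b c d f + J2 a b c d g.
Proof.
move=> If Ig; rewrite /J2 -ID; [|exact: fub_iv2|exact: fub_iv2].
apply: I_ae_eq; [exact: fub_iv2 (int2D If Ig)|by apply: ivD; exact: fub_iv2|].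
have := aeI (fub_ae2 If) (fub_ae2 Ig); apply: aeS => t [H1 H2] tt.
by rewrite ID; [|exact: H1|exact: H2].
Qed.

Lemma J2Z a b c d k f : int2 a b c d f ->
  J2 a b c d (fun x t => k * f x t) = k * J2 a b c d f.
Proof.
move=> If; rewrite /J2 -IZ; last exact: fub_iv2.
apply: I_ae_eq; [exact: fub_iv2 (int2Z k If)|by apply: ivZ; exact: fub_iv2|].
have := fub_ae2 If; apply: aeS => t H tt; by rewrite IZ; [|exact: H].
Qed.

Lemma J2_le a b c d f g : int2 a b c d f -> int2 a b c d g ->
  (forall x t, a <= x <= b -> c <= t <= d -> f x t <= g x t) -> J2 a b c d f <= J2 a b c d g.
Proof.
move=> If Ig fg; apply: I_ae_le; [exact: fub_iv2|exact: fub_iv2|].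
have := aeI (fub_ae2 If) (fub_ae2 Ig); apply: aeS => t [H1 H2] tcd.
by apply: I_le; [exact: H1|exact: H2|move=> x xab; exact: fg].
Qed.

Lemma J2_swap a b c d f : int2 a b c d f -> J2 a b c d f = I a b (fun x => I c d (f x)).
Proof. by move=> If; rewrite fub. Qed.

Lemma ftc_cont q a x : continuous q -> a < x -> is_derive x 1 (fun y => I a y q) (q x).
Proof.
move=> cq ax.
have [H1 H2] := @continuous_FTC1_closed _ q a x (x + 1) (ltac:(lra)) (iv_contT _ _ cq) ax (cq x).
by rewrite -H2 derive1E; exact: DeriveDef.
Qed.

Lemma I_support al be a b : al <= a -> a <= b -> b <= be -> forall h : R -> R, iv al be h ->
  (forall x, al <= x <= be -> x <= a \/ b <= x -> h x = 0) -> I al be h = I a b h.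
Proof.
move=> ala ab bbe h Ih h0.
rewrite (I_split ala (le_trans ab bbe) Ih) (I_split ab bbe); last exact: iv_sub Ih.
rewrite (I_ext (a := al) (g := fun=> 0)); last first.
  by move=> x /andP[x1 x2]; apply: h0; [apply/andP; split; lra|left].
rewrite [X in _ + (_ + X)](I_ext (g := fun=> 0)); last first.
  by move=> x /andP[x1 x2]; apply: h0; [apply/andP; split; lra|right].
by rewrite !I_cst// !mul0r add0r addr0.
Qed.

Lemma iv_small al be v x e : iv al be v -> al < x -> x < be -> 0 < e ->
  exists2 r, 0 < r & forall y, 0 <= y -> y < r -> x + y <= be /\ I x (x + y) (fun s => `|v s|) < e.
Proof.
move=> Iv ax xb e0.
have := (within_ptP _ _ _).1 (ac_within (ac_indef (iv_norm Iv))) x e.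
move=> /(_ _ e0)[|d d0 Hd]; first by rewrite !ltW.
exists (Num.min d (be - x)); first by rewrite lt_min d0 subr_gt0.
move=> y y0; rewrite lt_min => /andP[yd yb]; have xy : x + y <= be by lra.
split => //; have := Hd (x + y) (ltac:(by apply/andP; split; lra)).
rewrite addrAC subrr add0r ger0_norm// => /(_ yd).
rewrite (@I_split _ _ x); [|lra|lra|]; last by apply: iv_sub (iv_norm Iv).
by rewrite addrAC subrr add0r ger0_norm//; apply: I_ge0.
Qed.

Lemma half_steps (a b b0 d1 d2 d3 x y : R) : 0 < d3 -> d3 <= d1 -> d3 <= d2 -> d3 <= b - a -> d3 <= b0 - b ->
  b < x -> x < b + d3 / 2 -> a < y -> y < a + d3 / 2 ->
  y < x /\ x < b0 /\ `|y - a| < d1 /\ `|x - b| < d2 /\ a < b.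
Proof. by move=> *; rewrite !gtr0_norm ?subr_gt0//; repeat split; lra. Qed.

Lemma abs2_small (e x y z : R) : `|z - x| < e / 2 -> `|z - y| < e / 2 -> `|x - y| <= e.
Proof. by rewrite !ltr_norml ler_norml => /andP[? ?] /andP[? ?]; apply/andP; split; lra. Qed.

(** Almost-everywhere arguments give the increment formula only for countably many pairs of
    endpoints; continuity of both sides extends it to all pairs. *)
Lemma rational_increments q v a0 b0 : {within `[a0, b0], continuous q} -> iv a0 b0 v ->
  (forall r1 r2 : rat, a0 < ratr r1 -> (ratr r1 : R) < ratr r2 -> ratr r2 < b0 ->
     q (ratr r2) - q (ratr r1) = I (ratr r1) (ratr r2) v) ->
  forall a b, a0 < a -> a <= b -> b < b0 -> q b - q a = I a b v.
Proof.
move=> cq Iv H a b a0a ab bb0.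
pose E x := q x - I a0 x v.
have cE : {within `[a0, b0], continuous E}.
  have cI := ac_within (ac_indef Iv).
  apply/subspace_continuousP => x xab; apply: cvgB.
    exact: (subspace_continuousP _ _).1 cq x xab.
  exact: (subspace_continuousP _ _).1 cI x xab.
have EE (r1 r2 : rat) : a0 < ratr r1 -> (ratr r1 : R) < ratr r2 -> ratr r2 < b0 -> E (ratr r1) = E (ratr r2).
  move=> h1 h2 h3; have := H r1 r2 h1 h2 h3.
  rewrite /E (I_split (ltW h1) (ltW h2)); last by apply: iv_sub Iv => //; exact: ltW.
  by move=> <-; ring.
suff : E a = E b.
  rewrite /E (@I_split _ _ a b); [|exact: ltW|exact: ab|by apply: iv_sub Iv => //; exact: ltW].
  lra.
move: ab; rewrite le_eqVlt => /orP[/eqP->//|ab].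
apply/eqP; rewrite -subr_eq0 -normr_le0; apply/ler_addgt0Pl => e e0; rewrite addr0.
have e20 : 0 < e / 2 by rewrite divr_gt0.
have [d1 d10 H1] := (within_ptP _ _ _).1 cE a _ (introT andP (conj (ltW a0a) (ltW (lt_trans ab bb0)))) e20.
have [d2 d20 H2] := (within_ptP _ _ _).1 cE b _ (introT andP (conj (ltW (lt_trans a0a ab)) (ltW bb0))) e20.
pose d3 := Num.min d1 (Num.min d2 (Num.min (b - a) (b0 - b))).
have d30 : 0 < d3 by rewrite !lt_min d10 d20 !subr_gt0 ab bb0.
have [hd1 [hd2 [hd3 hd4]]] : d3 <= d1 /\ d3 <= d2 /\ d3 <= b - a /\ d3 <= b0 - b.
  by rewrite !ge_min !lexx !orbT.
have aa3 : a < a + d3 / 2 by rewrite ltrDl divr_gt0.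
have bb3 : b < b + d3 / 2 by rewrite ltrDl divr_gt0.
have [r1] := rat_in_itvoo aa3; have [r2] := rat_in_itvoo bb3.
rewrite !in_itv/= => /andP[h1 h2] /andP[h3 h4].
move: (ratr r2 : R) (ratr r1 : R) (EE r1 r2) h1 h2 h3 h4 => x y Exy h1 h2 h3 h4.
have [g1 [g2 [g3 [g4 g5]]]] := half_steps d30 hd1 hd2 hd3 hd4 h1 h2 h3 h4.
have E0 := Exy (lt_trans a0a h3) g1 g2.
have H1y := H1 y (introT andP (conj (ltW (lt_trans a0a h3)) (ltW (lt_trans g1 g2)))) g3.
have H2x := H2 x (introT andP (conj (ltW (lt_trans (lt_trans a0a h3) g1)) (ltW g2))) g4.
move: H1y H2x; rewrite E0; exact: abs2_small.
Qed.

Lemma near01 (s : R) : 0 <= s <= 1 -> `|s - 0 - 1| <= 1 /\ `|1 - s| <= 1.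
Proof. by move=> /andP[s0 s1]; rewrite !ler_norml; split; apply/andP; split; lra. Qed.

Lemma abs4_small (e x1 x2 x3 x4 x5 qa qb v1 : R) : 0 < e -> `|x1 - qa| <= e / 4 -> `|x2 - qb| <= e / 4 ->
  `|x3 - v1| <= e / 4 -> `|x4| <= e / 4 -> x1 - x2 + (x3 + (x5 + x4)) = 0 -> `|qb - qa - (v1 + x5)| <= e.
Proof. by rewrite !ler_norml => ? /andP[? ?] /andP[? ?] /andP[? ?] /andP[? ?] ?; apply/andP; split; lra. Qed.

Lemma rect_out al a b be c t t' d x s : al <= a -> b <= be -> c <= t -> t' <= d ->
  ~ (al <= x <= be /\ c <= s <= d) -> (x <= a \/ b <= x) \/ (s <= t \/ t' <= s).
Proof.
move=> h1 h2 h3 h4 H.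
have [xa|xa] := leP x a; first by left; left.
have [bx|bx] := leP b x; first by left; right.
have [st|st] := leP s t; first by right; left.
have [ts|ts] := leP t' s; first by right; right.
by case: H; split; apply/andP; split; apply: ltW;
  [exact: le_lt_trans h1 _|exact: lt_le_trans h2|exact: le_lt_trans h3 _|exact: lt_le_trans h4].
Qed.

Lemma I_norm_eq0 a b v : iv a b v -> I a b (fun x => `|v x|) = 0 ->
  \forall x \ae mu, a <= x <= b -> v x = 0.
Proof.
move=> Iv H.
have mv : measurable_fun `[a, b] (EFin \o v) by exact: measurable_int Iv.
have : (\int[mu]_(x in `[a, b]) `|(EFin \o v) x| = 0)%E.
  have := fineK (@integrable_fin_num _ _ _ mu _ (measurable_itv _) _ (iv_norm Iv)).
  by move: H; rewrite /I /Rintegral => -> <-.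
move=> /((ae_eq_integral_abs mu (measurable_itv _) mv).1); apply: aeS => x Hx xab.
by have := Hx (ltac:(by rewrite /= in_itv)) => -[].
Qed.

Lemma I_0 a b : I a b (fun=> 0 : R) = 0.
Proof. by rewrite /I Rintegral_cst// mul0r. Qed.

Lemma abs_sum_out (x y s : R) : `|x| + `|y| < `|s| -> s <= x \/ y <= s.
Proof.
move=> H; have [xs|xs] := leP s x; [by left|right].
have := ler_norm y; have := ler_norm (- x); rewrite normrN.
have [s0|s0] := lerP 0 s; move: H; first by rewrite [`|s|]ger0_norm//; have := normr_ge0 x; lra.
rewrite [`|s|]ltr0_norm//; have := normr_ge0 y; lra.
Qed.

Lemma abs2_sum (e x1 x2 x3 x4 x5 : R) : `|x1 - x2| <= e / 2 -> x3 + x1 = 0 ->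
  x4 - x3 = x5 -> `|x5| <= e / 2 -> `|x2 + x4| <= e.
Proof. by rewrite !ler_norml => /andP[? ?] ? ? /andP[? ?]; apply/andP; split; lra. Qed.

Section Steps.
Variable S : R -> R.
Hypotheses (sS : smooth1 S) (S0 : forall x, x <= 0 -> S x = 0) (S1 : forall x, 1 <= x -> S x = 1).
Hypotheses (S01 : forall x, 0 <= S x <= 1).
Notation stp := (stp S).
Notation dstp := (dstp S).

Let cst_stp k a : continuous (stp k a). Proof. exact: smooth1_cont (smooth_stp sS _ _). Qed.
Let smooth_dstp k a : smooth1 (dstp k a).
Proof. by rewrite -derive1_stp//; have [] := smooth1_derive1 (smooth_stp sS k a). Qed.
Let c_dstp k a : continuous (dstp k a). Proof. exact: smooth1_cont. Qed.

Lemma stp_left k a x : 0 < k -> x <= a -> stp k a x = 0.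
Proof. by move=> k0 xa; rewrite -[LHS]/(S (k * (x - a))) S0// pmulr_rle0// subr_le0. Qed.

Lemma stp_right k a x : 0 < k -> a + k^-1 <= x -> stp k a x = 1.
Proof. by move=> k0 xa; rewrite -[LHS]/(S (k * (x - a))) S1// -ler_pdivrMl// mulr1; lra. Qed.

(** The tests [stp k a - stp k b] tend to the indicator of [[a, b]], and their derivatives to point
    masses at [a] and [b]. Integer [k] suffices, which keeps the family of tests countable. *)
Lemma step_increment q v al be a b : continuous q -> iv al be v -> al < a -> a < b -> b < be ->
  (forall k : nat, b + (k.+1%:R)^-1 <= be ->
     I al be (fun x => q x * (dstp k.+1%:R a x - dstp k.+1%:R b x) +
                       v x * (stp k.+1%:R a x - stp k.+1%:R b x)) = 0) ->
  q b - q a = I a b v.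
Proof.
move=> cq Iv ala ab bbe H.
apply/eqP; rewrite -subr_eq0 -normr_le0; apply/ler_addgt0Pl => e e0; rewrite addr0.
have e4 : 0 < e / 4 by rewrite divr_gt0.
have Iq : iv al be q by exact: iv_contT.
have [Na Na0 HNa] := mollify sS S0 S1 Iq ala (lt_trans ab bbe) (ftc_cont cq ala) e4.
have [Nb Nb0 HNb] := mollify sS S0 S1 Iq (lt_trans ala ab) bbe (ftc_cont cq (lt_trans ala ab)) e4.
have [ra ra0 Hra] := iv_small Iv ala (lt_trans ab bbe) e4.
have [rb rb0 Hrb] := iv_small Iv (lt_trans ala ab) bbe e4.
pose M := Na + Nb + ra^-1 + rb^-1 + (b - a)^-1.
have iab : 0 < (b - a)^-1 by rewrite invr_gt0 subr_gt0.
have ira : 0 < ra^-1 by rewrite invr_gt0. have irb : 0 < rb^-1 by rewrite invr_gt0.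
have [K [K0 kM HK]] : exists K : R, [/\ 0 < K, M < K & b + K^-1 <= be ->
    I al be (fun x => q x * (dstp K a x - dstp K b x) + v x * (stp K a x - stp K b x)) = 0].
  by exists (Num.truncn M).+1%:R; split; [exact: ltr0n|exact: truncnS_gt|exact: H].
have Ki0 : 0 < K^-1 by rewrite invr_gt0.
have small y : 0 < y -> y^-1 < K -> K^-1 < y.
  by move=> y0 yK; rewrite -[ltRHS]invrK ltf_pV2 ?posrE ?invr_gt0.
have Kra : K^-1 < ra by apply: small => //; rewrite /M in kM; lra.
have Krb : K^-1 < rb by apply: small => //; rewrite /M in kM; lra.
have Kab : K^-1 < b - a by apply: small; [rewrite subr_gt0|rewrite /M in kM; lra].
have [l2 [l3 [l4 [l5 l6]]]] : a <= a + K^-1 /\ b <= b + K^-1 /\ a <= b + K^-1 /\ al <= b /\ a + K^-1 <= b + K^-1.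
  by repeat split; lra.
have l7 : a + K^-1 <= b by rewrite addrC -lerBrDr ltW.
have [aK Ha] := HNa K (ltac:(rewrite /M in kM; lra)).
have [bK Hb] := HNb K (ltac:(rewrite /M in kM; lra)).
have [_ Va] := Hra _ (ltW Ki0) Kra; have [_ Vb] := Hrb _ (ltW Ki0) Krb.
have := HK bK.
have Iqa c : iv al be (fun x => q x * dstp K c x).
  by apply: iv_contT => x; apply: continuousM; [exact: cq|exact: c_dstp].
have Ivs c : iv al be (fun x => stp K c x * v x).
  by apply: iv_mulc => //; apply: continuous_subspaceT; exact: cst_stp.
have IvT : iv al be (fun x => v x * (stp K a x - stp K b x)).
  by apply: iv_ext (ivB (Ivs a) (Ivs b)) => x _; ring.
have -> : I al be (fun x => q x * (dstp K a x - dstp K b x) + v x * (stp K a x - stp K b x)) =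
  I al be (fun x => q x * dstp K a x) - I al be (fun x => q x * dstp K b x) +
  I al be (fun x => v x * (stp K a x - stp K b x)).
  rewrite -IB// -ID//; last exact: ivB.
  by apply: I_ext => x _; ring.
have s1 := I_support (ltW ala) l2 aK (Iqa a) (fun x _ xo => (ltac:(by rewrite dstp_out ?mulr0) : q x * dstp K a x = 0)).
have s2 := I_support l5 l3 bK (Iqa b) (fun x _ xo => (ltac:(by rewrite dstp_out ?mulr0) : q x * dstp K b x = 0)).
have s3 : I al be (fun x => v x * (stp K a x - stp K b x)) =
    I a (b + K^-1) (fun x => v x * (stp K a x - stp K b x)).
  apply: (I_support (ltW ala) l4 bK IvT).
  move=> x _ [xa|xb].
    by rewrite (stp_left K0 xa) (stp_left K0 (le_trans xa (ltW ab))) subrr mulr0.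
  by rewrite (stp_right K0 xb) (stp_right K0 (le_trans l6 xb)) subrr mulr0.
rewrite s1 s2 s3.
have Iab : iv a (b + K^-1) v by apply: iv_sub Iv => //; exact: ltW.
have IabT : iv a (b + K^-1) (fun x => v x * (stp K a x - stp K b x)) by apply: iv_sub IvT => //; exact: ltW.
have split3 (h : R -> R) : iv a (b + K^-1) h -> I a (b + K^-1) h =
    I a (a + K^-1) h + (I (a + K^-1) b h + I b (b + K^-1) h).
  move=> Ih; rewrite (I_split l2 l6 Ih); congr (_ + _).
  by rewrite (I_split l7 l3)//; exact: iv_sub Ih.
rewrite split3//.
have -> : I (a + K^-1) b (fun x => v x * (stp K a x - stp K b x)) = I (a + K^-1) b v.
  apply: I_ext => x /andP[x1 x2]; rewrite (stp_right K0 x1) (stp_left K0 x2); ring.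
have -> : I a b v = I a (a + K^-1) v + I (a + K^-1) b v.
  by rewrite -I_split//; apply: iv_sub Iab.
have bnd c1 c2 (k1 : R -> R) : a <= c1 -> c1 <= c2 -> c2 <= b + K^-1 -> continuous k1 ->
    (forall x, c1 <= x <= c2 -> `|k1 x| <= 1) ->
    `|I c1 c2 (fun x => v x * k1 x)| <= I c1 c2 (fun x => `|v x|).
  move=> h1 h2 h3 ck kb.
  have Iv' : iv c1 c2 v by apply: iv_sub Iab.
  have Ivk : iv c1 c2 (fun x => v x * k1 x).
    by apply: iv_ext (iv_mulc (continuous_subspaceT ck) Iv') => x _; rewrite mulrC.
  apply: (le_trans (I_norm Ivk)); apply: I_le; [exact: iv_norm|exact: iv_norm|].
  by move=> x xc; rewrite normrM ler_piMr// kb.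
have B1 : `|I a (a + K^-1) (fun x => v x * (stp K a x - stp K b x - 1))| <= e / 4.
  apply: (le_trans (bnd _ _ _ (lexx _) l2 l6 _ _)); [| |exact: ltW].
    by apply: cont1B; [apply: cont1B; exact: cst_stp|exact: cont1c].
  move=> x /andP[x1 x2]; rewrite (stp_left K0 (le_trans x2 l7)).
  exact: (near01 (S01 _)).1.
have B2 : `|I b (b + K^-1) (fun x => v x * (stp K a x - stp K b x))| <= e / 4.
  apply: (le_trans (bnd _ _ _ (ltW ab) l3 (lexx _) _ _)); [| |exact: ltW].
    by apply: cont1B; exact: cst_stp.
  move=> x /andP[x1 x2]; rewrite (stp_right K0 (le_trans l7 x1)).
  exact: (near01 (S01 _)).2.
have E1 : I a (a + K^-1) (fun x => v x * (stp K a x - stp K b x - 1)) =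
   I a (a + K^-1) (fun x => v x * (stp K a x - stp K b x)) - I a (a + K^-1) v.
  rewrite -IB; [|exact: iv_sub IabT|exact: iv_sub Iab].
  by apply: I_ext => x _; ring.
rewrite E1 in B1.
exact: abs4_small.
Qed.

Lemma step_out k a b x : 0 < k -> a <= b -> x <= a \/ b + k^-1 <= x ->
  stp k a x - stp k b x = 0.
Proof.
move=> k0 ab [xa|xb].
  by rewrite (stp_left k0 xa) (stp_left k0 (le_trans xa ab)) subrr.
by rewrite (stp_right k0 xb) (stp_right k0 (le_trans _ xb)) ?subrr// lerD2r.
Qed.

Lemma bump_out k a K0 x : 0 < k -> `|a| + k^-1 <= K0 -> K0 < `|x| -> dstp k a x = 0.
Proof.
move=> k0 aK Kx; apply: dstp_out => //.
have ki : 0 < k^-1 by rewrite invr_gt0.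
have [x0|x0] := leP 0 x; move: Kx.
  by rewrite ger0_norm// => Kx; right; have := ler_norm a; lra.
by rewrite ltr0_norm// => Kx; left; have := ler_norm (- a); rewrite normrN; lra.
Qed.

Lemma steps_out k a b K0 x : 0 < k -> a <= b -> `|a| + `|b| + k^-1 <= K0 -> K0 < `|x| ->
  stp k a x - stp k b x = 0.
Proof.
move=> k0 ab aK Kx; apply: step_out => //.
have ki : 0 < k^-1 by rewrite invr_gt0.
have [x0|x0] := leP 0 x; move: Kx.
  by rewrite ger0_norm// => Kx; right; have := ler_norm b; have := normr_ge0 a; lra.
by rewrite ltr0_norm// => Kx; left; have := ler_norm (- a); have := normr_ge0 b; rewrite normrN; lra.
Qed.

Lemma smooth_steps k a b : smooth1 (fun x => stp k a x - stp k b x).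
Proof.
have := smooth1_add (smooth_stp sS k a) (smooth1_mul (smooth1_cst (-1)) (smooth_stp sS k b)).
by congr smooth1; apply/funext => x; ring.
Qed.

Lemma derive1_steps k a b : derive1 (fun x => stp k a x - stp k b x) = (fun x => dstp k a x - dstp k b x).
Proof.
apply/funext => x; rewrite derive1E.
by have [_ ->] := dB (is_derive_stp sS k a x) (is_derive_stp sS k b x).
Qed.

Lemma ae_zero_of_bumps (G : R -> R) c d : iv c d G ->
  (forall t k, 0 < k -> c < t -> t + k^-1 <= d -> I t (t + k^-1) (fun s => G s * dstp k t s) = 0) ->
  \forall t \ae mu, c < t < d -> G t = 0.
Proof.
move=> IG H; have := ftc_ae IG; apply: aeS => t dG /andP[ct td].
apply/eqP; rewrite -normr_le0; apply/ler_addgt0Pl => e e0; rewrite addr0.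
have [N N0 HN] := mollify sS S0 S1 IG ct td (dG (introT andP (conj ct td))) e0.
have [td' +] := HN N (lexx _).
by rewrite H// sub0r normrN.
Qed.

(** Tensor tests split the planar identity: for a fixed test in [x], varying the bump in [t] gives
    the one-dimensional identity at almost every [t]. Rational endpoints and integer steepness leave
    a single exceptional null set. *)
Lemma weak_x_deriv w g : continuous (unc w) -> loc_int2 g ->
  (forall phi, test_fun phi -> (\int[@leb2 R]_z ((w z.1 z.2) * pd_x phi z.1 z.2)%:E
        = - \int[@leb2 R]_z (g z.1 z.2 * phi z.1 z.2)%:E)%E) ->
  forall al be c d, \forall t \ae mu, c < t < d -> iv al be (g ^~ t) /\
    forall a b, al < a -> a <= b -> b < be -> w b t - w a t = I a b (g ^~ t).
Proof.
move=> cw Ig Hw al be c d.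
have Igr : int2 al be c d g by exact: Ig.
have key (i : rat * rat * nat) : \forall t \ae mu, c < t < d ->
   al < ratr i.1.1 -> (ratr i.1.1 : R) < ratr i.1.2 -> ratr i.1.2 + (i.2.+1%:R)^-1 <= be ->
   I al be (fun x => w x t * (dstp i.2.+1%:R (ratr i.1.1) x - dstp i.2.+1%:R (ratr i.1.2) x) +
     g x t * (stp i.2.+1%:R (ratr i.1.1) x - stp i.2.+1%:R (ratr i.1.2) x)) = 0.
  case: i => -[r1 r2] k /=.
  have k0 : (0 : R) < k.+1%:R by [].
  move: (ratr r1 : R) (ratr r2 : R) (k.+1%:R : R) k0 => {r1 r2}a b {}k k0.
  have [ala|ala] := ltP al a; last by apply: aeW.
  have [ab|ab] := ltP a b; last by apply: aeW.
  have [bbe|bbe] := leP (b + k^-1) be; last by apply: aeW.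
  have ki : 0 < k^-1 by rewrite invr_gt0.
  pose th x := stp k a x - stp k b x; pose dth x := dstp k a x - dstp k b x.
  have cdth : continuous dth by apply: cont1B; exact: c_dstp.
  have cth : continuous th by apply: cont1B; exact: cst_stp.
  have thout x : x <= a \/ b + k^-1 <= x -> th x = 0 by exact: step_out (ltW ab).
  have dthout x : x <= a \/ b + k^-1 <= x -> dth x = 0.
    move=> [xa|xb]; rewrite /dth !dstp_out ?subrr//; [by left; exact: le_trans (ltW ab)|by left|by right|].
    by right; apply: le_trans xb; rewrite lerD2r ltW.
  have IF1 : int2 al be c d (fun x t => w x t * dth x).
    by apply: int2_cont; apply: cont2M => //; exact: cont2_1.
  have IF2 : int2 al be c d (fun x t => g x t * th x).
    apply: int2_ext (int2_mulc (cont2_1 cth) Igr) => x t _ _; exact: mulrC.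
  have IF := int2D IF1 IF2.
  suff Q t k' : 0 < k' -> c < t -> t + k'^-1 <= d ->
      I t (t + k'^-1) (fun s => I al be (fun x => w x s * dth x + g x s * th x) * dstp k' t s) = 0.
    by have := ae_zero_of_bumps (fub_iv2 IF) Q; apply: aeS => t Ht tcd _ _ _; exact: Ht.
  move=> k'0 ct td.
  have k'i : 0 < k'^-1 by rewrite invr_gt0.
  pose ph := dstp k' t.
  pose K := Num.max (`|a| + `|b| + k^-1) (`|t| + k'^-1).
  have tst : test_fun (fun x s => th x * ph s).
    apply: (@test_tensor R th ph K); [exact: smooth_steps|exact: smooth_dstp| |].
      by move=> x; apply: steps_out => //; [exact: ltW|rewrite le_max lexx].
    by move=> x; apply: bump_out => //; rewrite le_max lexx orbT.
  have := Hw _ tst; rewrite (pd_x_tensor _ (smooth_steps _ _ _)) derive1_steps.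
  have out x s : ~ (al <= x <= be /\ c <= s <= d) -> (x <= a \/ b + k^-1 <= x) \/ (s <= t \/ t + k'^-1 <= s).
    exact: rect_out (ltW ala) bbe (ltW ct) td.
  have -> : (\int[@leb2 R]_z (w z.1 z.2 * (dth z.1 * ph z.2))%:E =
     \int[@leb2 R]_(z in `[al, be] `*` `[c, d]) (unc (fun x s => w x s * (dth x * ph s)) z)%:E)%E.
    apply: (integral_rect (f := fun x s => w x s * (dth x * ph s))) => x s /out[/dthout ->|H]; first by rewrite mul0r mulr0.
    by rewrite /ph dstp_out ?mulr0.
  have -> : (\int[@leb2 R]_z (g z.1 z.2 * (th z.1 * ph z.2))%:E =
     \int[@leb2 R]_(z in `[al, be] `*` `[c, d]) (unc (fun x s => g x s * (th x * ph s)) z)%:E)%E.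
    apply: (integral_rect (f := fun x s => g x s * (th x * ph s))) => x s /out[/thout ->|H]; first by rewrite mul0r mulr0.
    by rewrite /ph dstp_out ?mulr0.
  have cph : continuous ph by exact: c_dstp.
  have I1 : int2 al be c d (fun x s => w x s * (dth x * ph s)).
    by apply: int2_ext (int2_mulc (cont2_2 cph) IF1) => x s _ _; ring.
  have I2 : int2 al be c d (fun x s => g x s * (th x * ph s)).
    by apply: int2_ext (int2_mulc (cont2_2 cph) IF2) => x s _ _; ring.
  rewrite (J2E I1) (J2E I2) => -[] E.
  have : J2 al be c d (fun x s => (w x s * dth x + g x s * th x) * ph s) = 0.
    transitivity (J2 al be c d (fun x s => w x s * (dth x * ph s) + g x s * (th x * ph s))).
      by apply: J2_ext => x s _ _; ring.
    by rewrite (J2D I1 I2) E addNr.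
  have Iph : int2 al be c d (fun x s => (w x s * dth x + g x s * th x) * ph s).
    by apply: int2_ext (int2_mulc (cont2_2 cph) IF) => x s _ _; ring.
  have IG : iv c d (fun s => I al be (fun x => w x s * dth x + g x s * th x) * ph s).
    by apply: iv_ext (iv_mulc (continuous_subspaceT cph) (fub_iv2 IF)) => s _; rewrite mulrC.
  rewrite /J2 (@I_ae_eq _ _ _ _ (fun s => I al be (fun x => w x s * dth x + g x s * th x) * ph s)) //; last first.
  - have := fub_ae2 IF; apply: aeS => s Hs /Hs Is; rewrite [RHS]mulrC -IZ//.
    by apply: I_ext => x _; rewrite mulrC.
  - exact: fub_iv2 Iph.
  have lt1 : t <= t + k'^-1 by rewrite lerDl ltW.
  rewrite (I_support (ltW ct) lt1 td IG) => [//|s _ sout].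
  by rewrite /ph dstp_out ?mulr0.
have := aeI (fub_ae2 Igr) (ae_countable key); apply: aeS => t [H1 H2] tcd.
have /andP[ct td] := tcd.
have Igt : iv al be (g ^~ t) by apply: H1; rewrite !ltW.
split => //.
have cwt : continuous (w ^~ t) by exact: cont2_sec1.
apply: (@rational_increments (w ^~ t) (g ^~ t)) => //; first exact: continuous_subspaceT.
move=> r1 r2 h1 h2 h3.
apply: (@step_increment (w ^~ t) (g ^~ t) al be) => // k kb.
exact: (H2 (r1, r2, k)).
Qed.

(** The test in [x] rises just to the right of a point [x0] and is cut off inside [[R0, be]], where
    [u], the reaction and the flux vanish, so the cut-off contributes nothing. As the rise gets
    steep it isolates the flux at [x0], for almost every [x0]. *)
Lemma weak_t_deriv u hu A cc : continuous (unc u) -> continuous (unc hu) -> loc_int2 A ->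
  (forall phi, test_fun phi -> (\int[@leb2 R]_z (u z.1 z.2 * pd_t phi z.1 z.2
     - A z.1 z.2 * pd_x phi z.1 z.2 - cc * u z.1 z.2 * pd_x phi z.1 z.2
     + hu z.1 z.2 * phi z.1 z.2)%:E = 0)%E) ->
  forall al R0 be c d, al < R0 -> R0 < be ->
  (forall x t, R0 <= x -> x <= be -> c <= t <= d -> u x t = 0 /\ hu x t = 0) ->
  J2 R0 be c d (fun x t => `|A x t|) = 0 ->
  \forall x \ae mu, al < x < R0 -> iv c d (A x) /\
    forall t1 t2, c < t1 -> t1 <= t2 -> t2 < d ->
    I x R0 (u ^~ t2) - I x R0 (u ^~ t1) =
    I t1 t2 (fun t => - A x t - cc * u x t + I x R0 (hu ^~ t)).
Proof.
move=> cu chu IA Hw al R0 be c d alR Rbe uvan HA.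
have IAr : int2 al be c d A by exact: IA.
(* With this steepness the cut-off [stp ka R0] reaches [1] exactly at [be]. *)
pose ka := (be - R0)^-1.
have bR : 0 < be - R0 by rewrite subr_gt0.
have ka0 : 0 < ka by rewrite invr_gt0.
have kai : R0 + ka^-1 = be by rewrite invrK; ring.
pose Bx x t := - A x t - cc * u x t.
have IBx : int2 al be c d Bx.
  apply: int2_ext (int2B (int2Z (-1) IAr) (int2Z cc (int2_cont al be c d cu))) => x t _ _.
  by rewrite mulN1r.
have key (i : rat * rat * nat) : \forall x \ae mu, al < x < R0 ->
   c < ratr i.1.1 -> (ratr i.1.1 : R) < ratr i.1.2 -> ratr i.1.2 + (i.2.+1%:R)^-1 <= d ->
   I c d (fun t => I x R0 (u ^~ t) * (dstp i.2.+1%:R (ratr i.1.1) t - dstp i.2.+1%:R (ratr i.1.2) t) +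
     (Bx x t + I x R0 (hu ^~ t)) * (stp i.2.+1%:R (ratr i.1.1) t - stp i.2.+1%:R (ratr i.1.2) t)) = 0.
  case: i => -[r1 r2] k /=.
  have k0 : (0 : R) < k.+1%:R by [].
  move: (ratr r1 : R) (ratr r2 : R) (k.+1%:R : R) k0 => {r1 r2}a b {}k k0.
  have [ca|ca] := ltP c a; last by apply: aeW.
  have [ab|ab] := ltP a b; last by apply: aeW.
  have [bd|bd] := leP (b + k^-1) d; last by apply: aeW.
  pose ph t := stp k a t - stp k b t; pose dph t := dstp k a t - dstp k b t.
  have cdph : continuous dph by apply: cont1B; exact: c_dstp.
  have cph : continuous ph by apply: cont1B; exact: cst_stp.
  have phout x : x <= a \/ b + k^-1 <= x -> ph x = 0 by exact: step_out (ltW ab).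
  have dphout x : x <= a \/ b + k^-1 <= x -> dph x = 0.
    move=> [xa|xb]; rewrite /dph !dstp_out ?subrr//; [by left; exact: le_trans (ltW ab)|by left|by right|].
    by right; apply: le_trans xb; rewrite lerD2r ltW.
  pose aF x t := u x t * dph t + hu x t * ph t.
  pose bF x t := Bx x t * ph t.
  have caF : continuous (unc aF) by apply: cont2D; apply: cont2M => //; exact: cont2_2.
  have IaF : int2 al be c d aF by exact: int2_cont.
  have IbF : int2 al be c d bF.
    by apply: int2_ext (int2_mulc (cont2_2 cph) IBx) => x t _ _; exact: mulrC.
  pose a' x := I c d (aF x); pose b' x := I c d (bF x).
  have Ib' : iv al be b' by exact: fub_iv1 IbF.
  have Ia' : iv al be a' by exact: fub_iv1 IaF.
  have ca' : continuous a' by apply: I_param_cont; exact: cont2_swap.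
  have cI (x : R) : continuous (fun t => I x R0 (u ^~ t)) by exact: I_param_cont.
  have cIh (x : R) : continuous (fun t => I x R0 (hu ^~ t)) by exact: I_param_cont.
  have a'0 x : R0 <= x -> x <= be -> a' x = 0.
    move=> x1 x2; rewrite /a' (I_ext (g := fun=> 0)) ?I_cst ?mul0r//; last first.
      by move=> t tcd; have [h1 h2] := uvan x t x1 x2 tcd; rewrite /aF h1 h2 !mul0r addr0.
    by rewrite ltW// (lt_trans ca)// (lt_le_trans ab)// (le_trans _ bd)// lerDl invr_ge0 ltW.
  have b'0 : \forall x \ae mu, R0 <= x <= be -> b' x = 0.
    have IAR : int2 R0 be c d A by exact: IA.
    have IbR : int2 R0 be c d bF by apply: int2_sub IbF => //; exact: ltW.
    have z0 : \forall x \ae mu, R0 <= x <= be -> I c d (fun t => `|A x t|) = 0.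
      have h0 : I R0 be (fun x => `|I c d (fun t => `|A x t|)|) = 0.
        rewrite -[RHS]HA J2_swap; last exact: int2_norm.
        by apply: I_ext => x _; rewrite ger0_norm//; apply: I_ge0.
      exact: (I_norm_eq0 (fub_iv1 (int2_norm IAR)) h0).
    have := aeI (aeI z0 (fub_ae1 (int2_norm IAR))) (fub_ae1 IbR); apply: aeS => x [[Hx Hx1] Hx2] xR.
    have /andP[x1 x2] := xR.
    have [M M0 HM] := within_bounded (continuous_subspaceT (A := `[c, d]%classic) cph).
    apply/eqP; rewrite -normr_le0; apply: (le_trans (I_norm (Hx2 xR))).
    have -> : 0 = I c d (fun t => M * `|A x t|) by rewrite IZ ?Hx ?mulr0//; exact: Hx1.
    apply: I_le; [exact: iv_norm (Hx2 xR)|exact: ivZ (Hx1 xR)|].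
    move=> t tcd; have [h1 _] := uvan x t x1 x2 tcd.
    by rewrite /bF /Bx h1 mulr0 subr0 normrM normrN mulrC ler_wpM2r// HM.
  (* Localisation in space at a Lebesgue point [x0] of [b']: the rising part of the test produces
     [b' x0], its plateau the integral of [a'] up to [R0]. *)
  have main x0 : al < x0 -> x0 < R0 -> is_derive x0 1 (fun y => I al y b') (b' x0) ->
     b' x0 + I x0 R0 a' = 0.
    move=> alx xR db; apply/eqP; rewrite -normr_le0; apply/ler_addgt0Pl => e e0; rewrite addr0.
    have e2 : 0 < e / 2 by rewrite divr_gt0.
    have [N N0 HN] := mollify sS S0 S1 Ib' alx (lt_trans xR Rbe) db e2.
    have [r rr0 Hr] := iv_small Ia' alx (lt_trans xR Rbe) e2.
    pose K := N + r^-1 + (R0 - x0)^-1 + 1.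
    have ir : 0 < r^-1 by rewrite invr_gt0.
    have ix : 0 < (R0 - x0)^-1 by rewrite invr_gt0 subr_gt0.
    have K0 : 0 < K by rewrite !addr_gt0.
    have KN : N <= K by rewrite /K -!addrA lerDl !addr_ge0// ltW.
    have Kr : K^-1 < r.
      rewrite -[ltRHS]invrK ltf_pV2 ?posrE// /K.
      by rewrite [N + _]addrC -!addrA ltrDl !addr_gt0.
    have KR : x0 + K^-1 <= R0.
      rewrite addrC -lerBrDr -[leRHS]invrK lef_pV2 ?posrE// /K.
      by rewrite addrAC lerDr !addr_ge0 ?ltW.
    have Ki : 0 < K^-1 by rewrite invr_gt0.
    have [_ H1] := HN K KN.
    have [_ H2] := Hr _ (ltW Ki) Kr.
    pose th x := stp K x0 x * (1 - stp ka R0 x).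
    pose dth x := stp K x0 x * - dstp ka R0 x + (1 - stp ka R0 x) * dstp K x0 x.
    have sth : smooth1 th.
      apply: smooth1_mul; first exact: smooth_stp.
      have := smooth1_add (smooth1_cst 1) (smooth1_mul (smooth1_cst (-1)) (smooth_stp sS ka R0)).
      by congr smooth1; apply/funext => x; ring.
    have dthE : derive1 th = dth.
      apply/funext => x; rewrite derive1E.
      have [_ ->] := dM (is_derive_stp sS K x0 x) (dB (is_derive_cst (1:R) (x:R) (1:R)) (is_derive_stp sS ka R0 x)).
      by rewrite sub0r.
    have cth : continuous th by exact: smooth1_cont.
    have cdth : continuous dth.
      by rewrite -dthE; apply: smooth1_cont; have [] := smooth1_derive1 sth.
    have thout x : x <= x0 \/ be <= x -> th x = 0.
      move=> [xx|xb]; rewrite /th; first by rewrite stp_left// mul0r.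
      by rewrite (@stp_right ka)// ?kai// subrr mulr0.
    have dthout x : x <= x0 \/ be <= x -> dth x = 0.
      move=> [xx|xb]; rewrite /dth.
        by rewrite stp_left// mul0r add0r (@dstp_out _ _ sS S0 S1 K)// ?mulr0//; left.
      rewrite (@dstp_out _ _ sS S0 S1 ka)//; last by right; rewrite kai.
      by rewrite (@stp_right ka)// ?kai// subrr oppr0 mulr0 mul0r addr0.
    pose KK := Num.max (`|x0| + `|be|) (`|a| + `|b| + k^-1).
    have tst : test_fun (fun x s => th x * ph s).
      apply: (@test_tensor R th ph KK) => //; [exact: smooth_steps| |].
        by move=> x; rewrite gt_max => /andP[Hx _]; apply: thout; exact: abs_sum_out.
      by move=> x; apply: steps_out => //; [exact: ltW|rewrite le_max lexx orbT].
    have := Hw _ tst; rewrite (pd_x_tensor _ sth) (pd_t_tensor _ (smooth_steps _ _ _)) derive1_steps dthE.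
    pose FF x s := aF x s * th x + bF x s * dth x.
    have -> : (\int[@leb2 R]_z (u z.1 z.2 * (th z.1 * (dstp k a z.2 - dstp k b z.2)) - A z.1 z.2 * (dth z.1 * ph z.2) -
         cc * u z.1 z.2 * (dth z.1 * ph z.2) + hu z.1 z.2 * (th z.1 * ph z.2))%:E =
         \int[@leb2 R]_z (FF z.1 z.2)%:E)%E.
      by apply: eq_integral => z _; congr EFin; rewrite /FF /aF /bF /Bx /dph; ring.
    rewrite (integral_rect (a := al) (b := be) (c := c) (d := d)); last first.
      move=> x s /(rect_out (ltW alx) (lexx be) (ltW ca) bd)[xo|so].
        by rewrite /FF thout// dthout// !mulr0 addr0.
      by rewrite /FF /aF /bF phout// dphout// !mulr0 addr0 !mul0r addr0.
    have IF1 : int2 al be c d (fun x s => aF x s * th x).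
      by apply: int2_ext (int2_mulc (cont2_1 cth) IaF) => x s _ _; exact: mulrC.
    have IF2 : int2 al be c d (fun x s => bF x s * dth x).
      by apply: int2_ext (int2_mulc (cont2_1 cdth) IbF) => x s _ _; exact: mulrC.
    have IFF : int2 al be c d FF by exact: int2D.
    rewrite (J2E IFF) J2_swap// => -[].
    have Ith : iv al be (fun x => a' x * th x).
      by apply: iv_ext (iv_mulc (continuous_subspaceT cth) Ia') => x _; exact: mulrC.
    have Idth : iv al be (fun x => b' x * dth x).
      by apply: iv_ext (iv_mulc (continuous_subspaceT cdth) Ib') => x _; exact: mulrC.
    rewrite (@I_ae_eq _ _ _ _ (fun x => a' x * th x + b' x * dth x)); [|exact: fub_iv1 IFF|exact: ivD|]; last first.
      have := aeI (fub_ae1 IaF) (fub_ae1 IbF); apply: aeS => x [g1 g2] xab.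
      rewrite /a' /b' [_ * th x]mulrC [_ * dth x]mulrC -IZ; last exact: g1.
      rewrite -IZ; last exact: g2.
      rewrite -ID; [|by apply: ivZ; exact: g1|by apply: ivZ; exact: g2].
      by apply: I_ext => s _; rewrite /FF; ring.
    rewrite ID// => E0.
    have xK : x0 <= x0 + K^-1 by rewrite lerDl ltW.
    have E1 : I al be (fun x => b' x * dth x) = I x0 (x0 + K^-1) (fun x => b' x * dstp K x0 x).
      rewrite (I_split (ltW alx) (ltW (lt_trans xR Rbe)) Idth).
      rewrite (I_split (ltW xR) (ltW Rbe)); last by apply: iv_sub Idth => //; exact: ltW.
      rewrite (I_split xK KR); last by apply: iv_sub Idth => //; exact: ltW.
      rewrite (I_ext (a := al) (g := fun=> 0)); last first.
        by move=> x /andP[_ xx]; rewrite dthout ?mulr0//; left.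
      rewrite (@I_ae_eq _ R0 be _ (fun=> 0)); [| |exact: iv_cst|]; last first.
        + by apply: aeS b'0 => x Hx xx; rewrite Hx// mul0r.
        + apply: iv_sub Idth => //; exact: ltW (lt_trans alx xR).
      rewrite (I_ext (a := x0 + K^-1) (b := R0) (g := fun=> 0)); last first.
        move=> x /andP[xx1 xx2]; rewrite /dth (@dstp_out _ _ sS S0 S1 ka)//; last by left.
        by rewrite (@dstp_out _ _ sS S0 S1 K) ?oppr0 ?mulr0 ?addr0 ?mulr0//; right.
      rewrite !I_0 add0r !addr0; apply: I_ext => x /andP[xx1 xx2].
      rewrite /dth (@dstp_out _ _ sS S0 S1 ka)//; last by left; exact: le_trans KR.
      by have xR0 : x <= R0 := le_trans xx2 KR; rewrite (@stp_left ka)// oppr0 mulr0 add0r addr0 mul1r.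
    have E2 : I al be (fun x => a' x * th x) = I x0 R0 (fun x => a' x * stp K x0 x).
      rewrite (I_split (ltW alx) (ltW (lt_trans xR Rbe)) Ith).
      rewrite (I_split (ltW xR) (ltW Rbe)); last by apply: iv_sub Ith => //; exact: ltW.
      rewrite (I_ext (a := al) (g := fun=> 0)); last first.
        by move=> x /andP[_ xx]; rewrite thout ?mulr0//; left.
      rewrite (I_ext (a := R0) (b := be) (g := fun=> 0)); last first.
        by move=> x /andP[xx1 xx2]; rewrite a'0// mul0r.
      rewrite !I_0 add0r !addr0; apply: I_ext => x /andP[xx1 xx2].
      by rewrite /th (@stp_left ka)// subr0 mulr1.
    rewrite E1 E2 in E0.
    have Ist : iv x0 R0 (fun x => a' x * stp K x0 x).
      by apply: iv_contT; apply: cont1M => //; exact: cst_stp.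
    have Iax : iv x0 R0 a' by exact: iv_contT.
    have E3 : I x0 R0 a' - I x0 R0 (fun x => a' x * stp K x0 x) =
       I x0 (x0 + K^-1) (fun x => a' x * (1 - stp K x0 x)).
      rewrite -IB// (I_split xK KR); last exact: ivB.
      rewrite [X in _ + X](I_ext (g := fun=> 0)); last first.
        by move=> x /andP[xx1 xx2]; rewrite stp_right// mulr1 subrr.
      by rewrite I_cst// mul0r addr0; apply: I_ext => x _; ring.
    have E4 : `|I x0 (x0 + K^-1) (fun x => a' x * (1 - stp K x0 x))| <= e / 2.
      have ii : iv x0 (x0 + K^-1) (fun x => a' x * (1 - stp K x0 x)).
        by apply: iv_contT; apply: cont1M => //; apply: cont1B; [exact: cont1c|exact: cst_stp].
      apply: (le_trans (I_norm ii)); apply: (le_trans _ (ltW H2)).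
      apply: I_le; [exact: iv_norm|by apply: iv_norm; exact: iv_contT|].
      by move=> x _; rewrite normrM ler_piMr//; exact: (near01 (S01 _)).2.
    exact: abs2_sum H1 E0 E3 E4.
  have := aeI (ftc_ae Ib') (fub_ae1 IBx); apply: aeS => x0 [dbx HB] xx _ _ _; have /andP[x1 x2] := xx.
  have Bi : iv c d (Bx x0) by apply: HB; rewrite !ltW// (lt_trans x2).
  have := main x0 x1 x2 (dbx (introT andP (conj x1 (lt_trans x2 Rbe)))).
  have -> : I x0 R0 a' = J2 x0 R0 c d aF by rewrite J2_swap//; exact: int2_cont.
  have -> : J2 x0 R0 c d aF = I c d (fun t => I x0 R0 (u ^~ t) * dph t + I x0 R0 (hu ^~ t) * ph t).
    apply: I_ext => t _; rewrite [_ * dph t]mulrC [_ * ph t]mulrC -!IZ; last 2 first.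
    - by apply: iv_contT; exact: cont2_sec1.
    - by apply: iv_contT; exact: cont2_sec1.
    rewrite -ID; [|by apply: ivZ; apply: iv_contT; exact: cont2_sec1|by apply: ivZ; apply: iv_contT; exact: cont2_sec1].
    by apply: I_ext => x _; rewrite /aF; ring.
  rewrite /b' -ID; last 2 first.
  - by apply: iv_ext (iv_mulc (continuous_subspaceT cph) Bi) => t _; exact: mulrC.
  - by apply: iv_contT; apply: cont1D; apply: cont1M.
  by move=> E0; rewrite -[RHS]E0; apply: I_ext => t _; rewrite /bF /dph /ph; ring.
have := aeI (aeI (fub_ae1 IAr) (fub_ae1 IBx)) (ae_countable key); apply: aeS => x [[HA1 HB1] Hk] xx.
have /andP[x1 x2] := xx.
have xab : al <= x <= be by rewrite !ltW// (lt_trans x2).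
split; first exact: HA1.
have cI : continuous (fun t => I x R0 (u ^~ t)) by exact: I_param_cont.
have cIh : continuous (fun t => I x R0 (hu ^~ t)) by exact: I_param_cont.
have Iv : iv c d (fun t => Bx x t + I x R0 (hu ^~ t)).
  by apply: ivD; [exact: HB1|exact: iv_contT].
apply: rational_increments => //; first exact: continuous_subspaceT.
move=> r1 r2 h1 h2 h3.
apply: (@step_increment (fun t => I x R0 (u ^~ t)) (fun t => Bx x t + I x R0 (hu ^~ t)) c d) => // k kb.
exact: (Hk (r1, r2, k)).
Qed.

End Steps.

End WeakForm.

(** * Powers and the reaction term *)

Section Powers.
Variable R : realType.
Implicit Types (x y r e a b : R).

(** Cutting the base at [0] makes positive powers continuous and monotone on the whole line. *)
Definition pw r x : R := (Num.max x 0) `^ r.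

Lemma pwE r x : 0 <= x -> pw r x = x `^ r.
Proof. by move=> x0; rewrite /pw max_l. Qed.

Lemma pw_npos r x : r != 0 -> x <= 0 -> pw r x = 0.
Proof. by move=> r0 x0; rewrite /pw max_r// powR0. Qed.

Lemma pw_ge0 r x : 0 <= pw r x.
Proof. exact: powR_ge0. Qed.

Lemma pw_gt0 r x : 0 < x -> 0 < pw r x.
Proof. by move=> x0; rewrite pwE ?ltW// powR_gt0. Qed.

Lemma pw_le r x y : 0 <= r -> x <= y -> pw r x <= pw r y.
Proof.
move=> r0 xy; have m0 (z : R) : 0 <= Num.max z 0 by rewrite le_max lexx orbT.
apply: ge0_ler_powR; rewrite ?nnegrE//.
by rewrite ge_max m0 andbT le_max xy.
Qed.

Lemma pw_lt r x y : 0 < r -> 0 <= x -> x < y -> pw r x < pw r y.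
Proof.
move=> r0 x0 xy; have y0 := le_lt_trans x0 xy; rewrite !pwE//; last exact: ltW.
by apply: gt0_ltr_powR; rewrite ?nnegrE// ltW.
Qed.

Lemma pw_inv r x : 0 < r -> 0 <= x -> pw r^-1 (pw r x) = x.
Proof. by move=> r0 x0; rewrite !pwE ?powR_ge0// -powRrM mulfV ?gt_eqF// powRr1. Qed.

Lemma pw_invV r x : 0 < r -> 0 <= x -> pw r (pw r^-1 x) = x.
Proof. by move=> r0 x0; rewrite !pwE ?powR_ge0// -powRrM mulVf ?gt_eqF// powRr1. Qed.

Lemma is_derive_pw r x : 0 < x -> is_derive x 1 (pw r) (r * x `^ (r - 1)).
Proof.
move=> x0; apply: (@is_derive_near _ (pw r) (fun y => y `^ r)); last exact: is_derive1_powR.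
by exists x => // y; rewrite ltr_distl => /andP[y0 _]; rewrite pwE//; lra.
Qed.

Lemma pw_cont r : 0 < r -> continuous (pw r).
Proof.
move=> r0 x; have [x0|x0] := leP x 0; last by apply: is_derive_cont; exact: is_derive_pw.
move: x x0; suff H : forall x, x <= 0 -> forall e, 0 < e -> exists2 d, 0 < d & forall y,
    `|y - x| < d -> `|pw r y - pw r x| < e.
  move=> x x0; apply/cvgrPdist_lt => e e0; have [d d0 Hd] := H x x0 e e0.
  by exists d => //= y; rewrite /ball/= distrC => yx; rewrite distrC Hd.
move=> x x0 e e0; exists (e `^ r^-1); first by rewrite powR_gt0.
move=> y; rewrite ltr_distl => /andP[_ yx]; rewrite (@pw_npos _ x) ?gt_eqF// subr0 ger0_norm ?pw_ge0//.
have [y0|y0] := leP y 0; first by rewrite pw_npos// gt_eqF.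
rewrite -[ltRHS](pw_invV r0 (ltW e0)); apply: pw_lt => //; first exact: ltW.
rewrite pwE ?ltW//; lra.
Qed.

End Powers.

(** * The reaction term on the half-line *)

Section HalfLine.
Variable R : realType.
Implicit Types (x y e u v : R).

Lemma max0_dist x y : `|Num.max y 0 - Num.max x 0| <= `|y - x|.
Proof.
have := ler_norm (y - x); have := ler_norm (x - y); rewrite distrC => h1 h2.
by have [y0|y0] := leP y 0; have [x0|x0] := leP x 0; rewrite ler_norml; apply/andP; split; lra.
Qed.

Lemma halfline_cont (h h' : R -> R) : C1_halfline h h' -> continuous (fun x => h (Num.max x 0)).
Proof.
move=> [_ Hd].
have cm (x : R) : {for x, continuous (fun y : R => Num.max y 0)}.
  by apply: (@continuous_max R R id (fun=> 0)); [exact: cvg_id|exact: cvg_cst].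
suff H u : 0 <= u -> forall e, 0 < e -> exists2 d, 0 < d & forall y, 0 <= y ->
    `|y - u| < d -> `|h y - h u| < e.
  apply/contP => x e e0.
  have m0 (y : R) : 0 <= Num.max y 0 by rewrite le_max lexx orbT.
  have [d d0 Hd'] := H _ (m0 x) e e0; exists d => // y yx.
  apply: Hd' => //; apply: le_lt_trans yx.
  exact: max0_dist.
move=> u0 e e0; have /cvgrPdist_lt /(_ 1 ltr01) := Hd u u0.
rewrite near_withinE /= near_withinE => -[d /= d0 Hd'].
pose K : R := `|h' u| + 1.
have K0 : 0 < K by rewrite ltr_wpDl.
exists (Num.min d (e / K)); first by rewrite lt_min d0 divr_gt0.
move=> y y0; rewrite lt_min => /andP[yd ye].
have [->|yn] := eqVneq y u; first by rewrite subrr normr0.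
have yun : y - u != 0 by rewrite subr_eq0.
have := Hd' (y - u); rewrite /ball/= sub0r normrN => /(_ yd yun).
rewrite addrC subrK => /(_ y0) H.
have -> : h y - h u = (h y - h u) / (y - u) * (y - u) by rewrite divfK.
rewrite normrM; move: ye; rewrite ltr_pdivlMr// mulrC => ye; apply: le_lt_trans ye.
rewrite ler_wpM2r//; set q := _ / _ in H *.
have := ler_distD (h' u) q 0; rewrite !subr0 => /le_trans -> //.
rewrite /K addrC lerD2l distrC; exact: ltW.
Qed.

Lemma halfline_derive (h h' : R -> R) x : C1_halfline h h' -> 0 < x -> is_derive x 1 h (h' x).
Proof.
move=> [_ Hd] x0; apply: is_derive_of_increment => e e0.
have /cvgrPdist_lt /(_ e e0) := Hd x (ltW x0).
rewrite near_withinE /= near_withinE => -[d /= d0 Hd'].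
exists (Num.min d x); first by rewrite lt_min d0.
move=> y; rewrite lt_min => /andP[yd yx].
have [->|yn] := eqVneq y x; first by rewrite !subrr mulr0 subr0 normr0 mulr0.
have yxn : y - x != 0 by rewrite subr_eq0.
have := Hd' (y - x); rewrite /ball/= sub0r normrN => /(_ yd yxn).
have y0 : 0 <= y by move: yx; rewrite ltr_distl => /andP[]; lra.
rewrite addrC subrK => /(_ y0) H.
have -> : h y - h x - h' x * (y - x) = - (h' x - (h y - h x) / (y - x)) * (y - x).
  by rewrite opprB mulrBl divfK.
by rewrite normrM normrN ler_wpM2r// ltW.
Qed.

Lemma halfline_derive0 (h h' : R -> R) : C1_halfline h h' -> h 0 = 0 ->
  forall e, 0 < e -> exists2 d, 0 < d & forall u, 0 < u -> u < d -> `|h u / u - h' 0| < e.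
Proof.
move=> [_ Hd] h0 e e0; have /cvgrPdist_lt /(_ e e0) := Hd 0 (lexx _).
rewrite near_withinE /= near_withinE => -[d /= d0 Hd'].
exists d => // u u0 ud; have := Hd' u; rewrite /ball/= sub0r normrN gtr0_norm// => /(_ ud).
by rewrite add0r h0 subr0 [`|h' 0 - _|]distrC; apply; [by rewrite gt_eqF|exact: ltW].
Qed.

Lemma halfline_mvt (h h' : R -> R) u v : C1_halfline h h' -> 0 <= u -> u < v ->
  exists2 x, u < x < v & h v - h u = h' x * (v - u).
Proof.
move=> Hh u0 uv.
have ch := halfline_cont Hh.
have [x xuv E] : exists2 x, x \in `]u, v[%R & h v - h u = h' x * (v - u).
  apply: (@MVT R h h' u v uv).
    move=> x; rewrite in_itv/= => /andP[ux xv]; apply: halfline_derive => //; exact: le_lt_trans ux.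
  apply/within_ptP => x e /andP[ux xv] e0; have /contP/(_ x e e0)[d d0 Hd] := ch.
  exists d => // y /andP[uy yv] yx; have := Hd y yx.
  by rewrite !max_l ?(le_trans u0).
by exists x => //; move: xuv; rewrite in_itv.
Qed.

Lemma halfline_lipschitz (h h' : R -> R) : C1_halfline h h' ->
  exists2 L : R, 0 < L & forall u v, 0 <= u -> u <= v -> v <= 1 -> `|h v - h u| <= L * (v - u).
Proof.
move=> Hh; have [ch' _] := Hh.
have cw : {within `[0, 1], continuous h'}.
  apply: continuous_subspaceW ch' => x /=; rewrite !in_itv/= => /andP[-> _//].
have [M M0 HM] := within_bounded cw.
exists (M + 1); first by rewrite ltr_wpDl.
move=> u v u0; rewrite le_eqVlt => /orP[/eqP ->|uv] v1; first by rewrite !subrr normr0 mulr0.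
have [x /andP[ux xv] ->] := halfline_mvt Hh u0 uv.
have vu : 0 <= v - u by rewrite subr_ge0 ltW.
rewrite normrM (ger0_norm vu) ler_wpM2r//.
have x01 : 0 <= x <= 1 by rewrite !ltW// ?(lt_le_trans xv)// (le_lt_trans u0).
by have := HM x x01; lra.
Qed.

(** Mean value theorem and continuity of [h'] at [1]. This monotonicity controls the comparison
    functional far to the left, where [U] is close to [1]. *)
Lemma halfline_decreasing (h h' : R -> R) : C1_halfline h h' -> h' 1 < 0 ->
  exists2 d : R, 0 < d < 1 & forall u v, 1 - d <= u -> u <= v -> v <= 1 -> h v <= h u.
Proof.
move=> Hh h1; have [ch' _] := Hh.
have cw : {within `[0, 1], continuous h'}.
  apply: continuous_subspaceW ch' => x /=; rewrite !in_itv/= => /andP[-> _//].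
have e0 : 0 < - h' 1 by rewrite oppr_gt0.
have [d d0 Hd] := (within_ptP _ _ _).1 cw (1:R) _ (introT andP (conj ler01 (lexx (1:R)))) e0.
have dpos : 0 < Num.min (d / 2) (1 / 2) < 1.
  by rewrite lt_min gt_min; apply/andP; split; [apply/andP; split; lra|apply/orP; right; lra].
exists (Num.min (d / 2) (1 / 2)) => //.
move=> u v; set k := Num.min _ _ in dpos *.
have kd : k <= d / 2 by rewrite ge_min lexx.
move: dpos => /andP[k0 k1].
move=> du; rewrite le_eqVlt => /orP[/eqP ->//|uv] v1.
have u0 : 0 <= u by lra.
have [x /andP[ux xv] E] := halfline_mvt Hh u0 uv.
have x01 : 0 <= x <= 1 by apply/andP; split; lra.
have xd : `|x - 1| < d by rewrite ltr_norml; apply/andP; split; lra.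
have := Hd x x01 xd; rewrite ltr_norml => /andP[_ Hx].
rewrite -subr_le0 E pmulr_lle0 ?subr_gt0//; lra.
Qed.

End HalfLine.

(** * Fluxes *)

Section Flux.
Variable R : realType.
Implicit Types (a b c d x t al be : R).
Notation mu := (@lebesgue_measure R).

Lemma ae_neq (x0 : R) : \forall x \ae mu, x != x0.
Proof.
exists [set x0]; split => //; first exact: lebesgue_measure_set1.
by move=> x /= H; apply: contrapT => /eqP.
Qed.

Lemma ae_le_lt c d (P : R -> Prop) : (\forall t \ae mu, c < t < d -> P t) ->
  \forall t \ae mu, c <= t <= d -> P t.
Proof.
move=> H; have := aeI H (aeI (ae_neq c) (ae_neq d)); apply: aeS => t [Ht [tc td]] /andP[ct dt].
by apply: Ht; rewrite !lt_neqAle ct dt eq_sym tc td.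
Qed.

Lemma ae_ge0_of_I al be (v : R -> R) : iv al be v ->
  (forall a b, al < a -> a <= b -> b < be -> 0 <= I a b v) -> \forall x \ae mu, al < x < be -> 0 <= v x.
Proof.
move=> Iv Hv; have := ftc_ae Iv; apply: aeS => x Hx xab; have /andP[ax xb] := xab.
have Hd := Hx xab; rewrite leNgt; apply/negP => v0.
have e0 : 0 < - v x / 2 by lra.
have [r r0 Hr] := is_derive_increment Hd e0.
pose y := Num.min (x + r / 2) ((x + be) / 2).
have xy : x < y by rewrite /y lt_min; apply/andP; split; lra.
have yr : y <= x + r / 2 by rewrite /y ge_min lexx.
have yb : y < be by rewrite /y gt_min; apply/orP; right; lra.
have : `|y - x| < r by rewrite ger0_norm; lra.
move=> /Hr; rewrite [`|y - x|]ger0_norm; last lra.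
have E : I al y v = I al x v + I x y v.
  by apply: I_split; [exact: ltW|exact: ltW|apply: iv_sub Iv => //; exact: ltW].
rewrite E.
have := Hv x y ax (ltW xy) yb.
have : 0 < (- v x) * (y - x) by rewrite mulr_gt0//; lra.
move=> h1 h2; rewrite ler_norml => /andP[_]; nra.
Qed.

Lemma ae_eq0_of_I al be (v : R -> R) : iv al be v ->
  (forall a b, al < a -> a <= b -> b < be -> I a b v = 0) -> \forall x \ae mu, al <= x <= be -> v x = 0.
Proof.
move=> Iv Hv; apply: ae_le_lt.
have h1 : \forall x \ae mu, al < x < be -> 0 <= v x by apply: ae_ge0_of_I => // a b h1 h2 h3; rewrite Hv.
have h2 : \forall x \ae mu, al < x < be -> 0 <= - v x.
  apply: ae_ge0_of_I; first exact: ivN.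
  by move=> a b g1 g2 g3; rewrite I_N ?Hv ?oppr0//; apply: iv_sub Iv; exact: ltW.
have := aeI h1 h2; apply: aeS => x [g1 g2] xab; apply: le_anti.
by rewrite g1// andbT -oppr_ge0 g2.
Qed.

(* Both sides amount to the vanishing of the double integral of [|f|]. *)
Lemma ae_slices_swap a b c d (f : R -> R -> R) : int2 a b c d f ->
  (\forall t \ae mu, c <= t <= d -> \forall x \ae mu, a <= x <= b -> f x t = 0) ->
  \forall x \ae mu, a <= x <= b -> \forall t \ae mu, c <= t <= d -> f x t = 0.
Proof.
move=> If H; have In := int2_norm If.
have h0 : J2 a b c d (fun x t => `|f x t|) = 0.
  rewrite /J2 -(I_0 c d); apply: I_ae_eq; [exact: fub_iv2 In|exact: iv_cst|].
  have := aeI H (fub_ae2 If); apply: aeS => t [Ht It] tcd; rewrite -(I_0 a b).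
  apply: I_ae_eq; [exact: iv_norm (It tcd)|exact: iv_cst|].
  by have := Ht tcd; apply: aeS => x Hx xab; rewrite Hx// normr0.
have h1 : I a b (fun x => `|I c d (fun t => `|f x t|)|) = 0.
  rewrite -[RHS]h0 J2_swap//; apply: I_ext => x _; rewrite ger0_norm//; exact: I_ge0.
have h2 := I_norm_eq0 (fub_iv1 In) h1.
have := aeI h2 (fub_ae1 If); apply: aeS => x [Hx Ix] xab.
exact: (I_norm_eq0 (Ix xab) (Hx xab)).
Qed.

(* [s] stands for [|(V^m)_x|]; the last clause is the equation integrated from [x] to a point [R0] beyond the support. *)
Definition flux (n m cc : R) (h : R -> R) (V s : R -> R -> R) : Prop :=
  [/\ forall x t, 0 <= s x t, loc_int2 s, loc_int2 (fun x t => pw n (s x t)),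
   forall al be c d, \forall t \ae mu, c < t < d -> iv al be (s ^~ t) /\
     forall a b, al < a -> a <= b -> b < be -> pw m (V a t) - pw m (V b t) = I a b (s ^~ t) &
   forall c d R0, (forall x t, R0 <= x -> c <= t <= d -> V x t = 0) -> forall al, al < R0 ->
     \forall x \ae mu, al < x < R0 -> iv c d (fun t => pw n (s x t)) /\
     forall t1 t2, c < t1 -> t1 <= t2 -> t2 < d ->
     I x R0 (V ^~ t2) - I x R0 (V ^~ t1) =
     I t1 t2 (fun t => pw n (s x t) - cc * V x t + I x R0 (fun y => h (V y t)))].

(** Monotonicity of [V] in [x] gives [g <= 0], so the flux [|g|^(p-2) g] equals [-s^n] with
    [s = |g|] and [n = p - 1]. The sign is known for almost every [t] and then almost every [x],
    whereas the time equation holds for almost every [x]; [ae_slices_swap] reconciles the two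
    orders. *)
Lemma weak_flux m p cc (h : R -> R) V : 0 < m -> 2 <= p ->
  continuous (fun x => h (Num.max x 0)) -> h 0 = 0 -> (forall x t, 0 <= V x t) ->
  (forall t, {homo (fun x => V x t) : x y / x <= y >-> y <= x}) ->
  weak_sol m p cc h V -> continuous (unc V) /\ exists s, flux (p - 1) m cc h V s.
Proof.
move=> m0 p2 ch h0 V0 Vm [cV [_ [g [Ig [Is [H1 H2]]]]]]; split => //.
have n0 : 0 < p - 1 by lra.
have [S [sS S0 S1 S01 _]] := smooth_step_ex R.
pose w x t := pw m (V x t).
have wE x t : w x t = V x t `^ m by rewrite /w pwE.
have cw : continuous (unc w) by apply: (cont2_comp (phi := pw m)) => //; exact: pw_cont.
pose s x t := `|g x t|.
have s0 x t : 0 <= s x t by exact: normr_ge0.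
have Ls : loc_int2 s by move=> a b c d; apply: int2_norm; exact: Ig.
have Lsn : loc_int2 (fun x t => pw (p - 1) (s x t)).
  by move=> a b c d; apply: int2_ext (Is a b c d) => x t _ _; rewrite pwE.
have F1 al be c d : \forall t \ae mu, c < t < d -> iv al be (g ^~ t) /\
    forall a b, al < a -> a <= b -> b < be -> w b t - w a t = I a b (g ^~ t).
  apply: (weak_x_deriv sS S0 S1 S01 cw Ig) => phi /H1 <-.
  by apply: eq_integral => z _; rewrite wE.
have gneg al be c d : \forall t \ae mu, c < t < d -> iv al be (g ^~ t) /\
    \forall x \ae mu, al < x < be -> g x t <= 0.
  have := F1 al be c d; apply: aeS => t Ht tcd; have [Igt E] := Ht tcd; split => //.
  have : \forall x \ae mu, al < x < be -> 0 <= - g x t.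
    apply: ae_ge0_of_I; first exact: ivN.
    move=> a b h1 h2 h3; rewrite I_N; last by apply: iv_sub Igt; exact: ltW.
    by rewrite -E// opprB subr_ge0; apply: pw_le; [exact: ltW|exact: Vm].
  by apply: aeS => x Hx /Hx; rewrite oppr_ge0.
pose A x t := `|g x t| `^ (p - 2) * g x t.
have An x t : `|A x t| = pw (p - 1) (s x t).
  rewrite /A normrM ger0_norm ?powR_ge0// pwE// /s mulrC.
  have -> : p - 2 = (p - 1) - 1 by ring.
  by rewrite mulr_powRB1.
have LA : loc_int2 A.
  move=> a b c d; apply: (@int2_le _ a b c d A (fun x t => pw (p - 1) (s x t))) => //.
  - apply: measurable_funM; last exact: int2_mes (Ig a b c d).
    apply: (measurableT_comp (measurable_powR (p - 2))).
    exact: int2_mes (Ls a b c d).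
  - by move=> x t _ _; rewrite An.
  - exact: Lsn.
exists s; split => // [al be c d|c d R0 VR al alR].
  have := F1 al be c d; have := gneg al be c d => G1 G2; have := aeI G1 G2.
  apply: aeS => t [g1 g2] tcd; have [Igt gn] := g1 tcd; have [_ E] := g2 tcd.
  split; first exact: iv_norm Igt.
  move=> a b ha ab hb; have Iab : iv a b (g ^~ t) by apply: iv_sub Igt; exact: ltW.
  rewrite -opprB E// -I_N//; apply: I_ae_eq; [exact: ivN|exact: iv_norm|].
  apply: aeS gn => x Hx /andP[ax xb]; rewrite /s ler0_norm//; apply: Hx.
  by rewrite (lt_le_trans ha)// (le_lt_trans xb).
pose be := R0 + 1.
have Rbe : R0 < be by rewrite ltrDl.
have chV : continuous (unc (fun x t => h (V x t))).
  have -> : (fun x t => h (V x t)) = (fun x t => h (Num.max (V x t) 0)).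
    by apply/funext => x; apply/funext => t; rewrite max_l.
  exact: (cont2_comp ch cV).
have hwz x t : R0 <= x -> c <= t <= d -> V x t = 0 /\ h (V x t) = 0.
  by move=> Rx tcd; rewrite VR.
have HA : J2 R0 be c d (fun x t => `|A x t|) = 0.
  rewrite /J2 -(I_0 c d); apply: I_ae_eq; [exact: (fub_iv2 (int2_norm (LA R0 be c d)))|exact: iv_cst|].
  have := aeI (ae_le_lt (F1 R0 be c d)) (fub_ae2 (int2_norm (LA R0 be c d))).
  apply: aeS => t [Ht IAt] tcd; have [Igt E] := Ht tcd; rewrite -(I_0 R0 be).
  apply: I_ae_eq; [exact: IAt|exact: iv_cst|].
  have : \forall x \ae mu, R0 <= x <= be -> g x t = 0.
    apply: ae_eq0_of_I Igt _ => a b ha ab hb; rewrite -E// /w !VR ?subrr// ltW//.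
    exact: lt_le_trans ab.
  by apply: aeS => x Hx xab; rewrite /A Hx// mulr0 normr0.
have F2 := @weak_t_deriv _ S sS S0 S1 S01 V (fun x t => h (V x t)) A cc cV chV LA H2 al R0 be c d alR Rbe
   (fun x t Rx _ tcd => hwz x t Rx tcd) HA.
pose B x t := - A x t - pw (p - 1) (s x t).
have IB2 : int2 al R0 c d B.
  apply: int2B; last exact: Lsn.
  by apply: int2_ext (int2Z (-1) (LA al R0 c d)) => x t _ _; rewrite mulN1r.
have B0 : \forall x \ae mu, al <= x <= R0 -> \forall t \ae mu, c <= t <= d -> B x t = 0.
  apply: (ae_slices_swap IB2); apply: ae_le_lt; have := gneg al R0 c d; apply: aeS => t Ht tcd.
  have [_ gn] := Ht tcd; apply: ae_le_lt; apply: aeS gn => x Hx /Hx gx.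
  have := An x t; rewrite ler0_norm.
    by move=> AE; rewrite /B AE subrr.
  by rewrite /A mulr_ge0_le0// powR_ge0.
have := aeI F2 (aeI B0 (fub_ae1 (Lsn al R0 c d))); apply: aeS => x [Hx [Bx Sx]] xx.
have xx' : al <= x <= R0 by have /andP[? ?] := xx; rewrite !ltW.
have [IAx E] := Hx xx; have Is' := Sx xx'; split => // t1 t2 ct1 t12 t2d.
have sub f : iv c d f -> iv t1 t2 f by apply: iv_sub; exact: ltW.
rewrite E//; apply: I_ae_eq.
- apply: ivD; last first.
    by apply: iv_contT; apply: (I_param_cont (f := fun x t => h (V x t))).
  apply: ivB; last by apply: iv_contT; apply: cont1M; [exact: cont1c|exact: cont2_sec2].
  by apply: ivN; exact: sub.
- apply: ivD; last first.
    by apply: iv_contT; apply: (I_param_cont (f := fun x t => h (V x t))).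
  apply: ivB; last by apply: iv_contT; apply: cont1M; [exact: cont1c|exact: cont2_sec2].
  exact: sub.
- have := Bx xx'; apply: aeS => t Ht /andP[h1 h2].
  have := Ht (introT andP (conj (le_trans (ltW ct1) h1) (le_trans h2 (ltW t2d)))).
  by rewrite /B => /subr0_eq ->.
Qed.

End Flux.

(** * The wave profile *)

Section Primitive.
Variable R : realType.
Implicit Types (f q : R -> R) (a b x y e : R).
Notation mu := (@lebesgue_measure R).

(* [I a b] is [0] when [b < a], so this is the signed integral from [0] to [y]. *)
Definition prim f y : R := I 0 y f - I y 0 f.

Lemma I_rev a b f : b <= a -> I a b f = 0.
Proof.
rewrite le_eqVlt => /orP[/eqP ->|ba]; first exact: Iaa.
by rewrite /I set_itv_ge ?Rintegral_set0// -leNgt bnd_simp.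
Qed.

Lemma prim_ge0E f y : 0 <= y -> prim f y = I 0 y f.
Proof. by move=> y0; rewrite /prim (I_rev f y0) subr0. Qed.

Lemma prim_le0E f y : y <= 0 -> prim f y = - I y 0 f.
Proof. by move=> y0; rewrite /prim (I_rev f y0) sub0r. Qed.

Lemma prim0 f : prim f 0 = 0.
Proof. by rewrite /prim Iaa subr0. Qed.

Lemma is_derive_prim f y : continuous f -> is_derive y 1 (prim f) (f y).
Proof.
move=> cf; pose b := - `|y| - 1.
have [by1 b0] : b < y /\ b < 0 by rewrite /b; have := ler_norm (- y); have := normr_ge0 y; rewrite normrN; lra.
have H : is_derive y 1 (fun x => I b x f - I b 0 f) (f y).
  by have := dB (ftc_cont cf by1) (is_derive_cst (I b 0 f) y 1); rewrite subr0.
apply: is_derive_near H; exists (y - b); first by rewrite subr_gt0.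
move=> x; rewrite ltr_distl => /andP[xb _]; have {}xb : b < x by lra.
have If u v : iv u v f by exact: iv_contT.
have [x0|/ltW x0] := leP 0 x.
  by rewrite prim_ge0E// (I_split (ltW b0) x0)// addrAC subrr add0r.
by rewrite prim_le0E// (I_split (ltW xb) x0)// opprD addrA subrr add0r.
Qed.

Lemma prim_cont f : continuous f -> continuous (prim f).
Proof. by move=> cf x; exact: is_derive_cont (is_derive_prim x cf). Qed.

Lemma I_prim f a b : continuous f -> a <= b -> I a b f = prim f b - prim f a.
Proof.
move=> cf ab; have [_ ->//] := ac_smooth a b cf (fun x => is_derive_prim x cf).
Qed.

Lemma daff f (a b t d : R) : is_derive (a + b * t) 1 f d -> is_derive t 1 (fun s => f (a + b * s)) (b * d).
Proof.
move=> D; have A : is_derive t 1 (fun s => a + b * s) b.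
  by have := dD (is_derive_cst a t 1) (dZ b (is_derive_id t (1:R))); rewrite add0r mulr1.
by have := @dC _ f (fun s => a + b * s) t d b D A; rewrite mulrC.
Qed.

Lemma dshift f (x k d : R) : is_derive (x + k) 1 f d -> is_derive x 1 (fun y => f (y + k)) d.
Proof.
move=> D; have A : is_derive x 1 (fun y => y + k) 1.
  by have := dD (is_derive_id x (1:R)) (is_derive_cst k x 1); rewrite addr0.
by have := @dC _ f (fun y => y + k) x d 1 D A; rewrite mulr1.
Qed.

Lemma le_of_derive a b f f' : a < b -> (forall x, a < x < b -> is_derive x 1 f (f' x)) ->
  {within `[a, b], continuous f} -> (forall x, a < x < b -> 0 <= f' x) -> f a <= f b.
Proof.
move=> ab df cf f0; have [x + E] := MVT ab (fun x => fun h => df x (ltac:(by move: h; rewrite in_itv))) cf.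
rewrite in_itv/= => xab; rewrite -subr_ge0 E mulr_ge0 ?f0// subr_ge0; exact: ltW.
Qed.

Lemma I_gt0 a b f x0 : a < x0 < b -> continuous f -> (forall x, a <= x <= b -> 0 <= f x) ->
  0 < f x0 -> 0 < I a b f.
Proof.
move=> /andP[ax xb] cf f0 fx0.
have e0 : 0 < f x0 / 2 by rewrite divr_gt0.
have [d d0 Hd] := (contP _).1 cf x0 _ e0.
pose r := Num.min (d / 2) ((b - x0) / 2).
have r0 : 0 < r by rewrite lt_min; apply/andP; split; lra.
have rd : r <= d / 2 by rewrite ge_min lexx.
have rb : r <= (b - x0) / 2 by rewrite ge_min lexx orbT.
apply: (@lt_le_trans _ _ (I x0 (x0 + r) f)); last first.
  by apply: I_sub_le => //; [exact: ltW|lra|lra|exact: iv_contT].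
apply: (@lt_le_trans _ _ (I x0 (x0 + r) (fun=> f x0 / 2))).
  by rewrite I_cst ?mulr_gt0//; lra.
apply: I_le; [exact: iv_cst|exact: iv_contT|].
move=> x /andP[h1 h2]; have : `|x - x0| < d by rewrite ger0_norm; lra.
by move=> /Hd; rewrite ltr_norml => /andP[]; lra.
Qed.

Lemma ae_slices_swap' a b c d (f : R -> R -> R) : int2 a b c d f ->
  (\forall x \ae mu, a <= x <= b -> \forall t \ae mu, c <= t <= d -> f x t = 0) ->
  \forall t \ae mu, c <= t <= d -> \forall x \ae mu, a <= x <= b -> f x t = 0.
Proof.
move=> If H; have In := int2_norm If.
have h0 : J2 a b c d (fun x t => `|f x t|) = 0.
  rewrite J2_swap// -(I_0 a b); apply: I_ae_eq; [exact: fub_iv1 In|exact: iv_cst|].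
  have := aeI H (fub_ae1 If); apply: aeS => t [Ht It] tcd; rewrite -(I_0 c d).
  apply: I_ae_eq; [exact: iv_norm (It tcd)|exact: iv_cst|].
  by have := Ht tcd; apply: aeS => x Hx xab; rewrite Hx// normr0.
have h1 : I c d (fun t => `|I a b (fun x => `|f x t|)|) = 0.
  rewrite -[RHS]h0; apply: I_ext => x _; rewrite ger0_norm//; exact: I_ge0.
have h2 := I_norm_eq0 (fub_iv2 In) h1.
have := aeI h2 (fub_ae2 If); apply: aeS => x [Hx Ix] xab.
exact: (I_norm_eq0 (Ix xab) (Hx xab)).
Qed.

End Primitive.

(** * The first-order equation of the travelling wave *)

Section WaveProfile.
Variable R : realType.
Variables (n m c : R) (h U : R -> R).
Implicit Types (x y t e v : R).
Notation mu := (@lebesgue_measure R).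
Hypotheses (n0 : 0 < n) (m0 : 0 < m).
Hypotheses (cU : continuous U) (Um : forall x y, x <= y -> U y <= U x).
Hypotheses (U0 : forall x, 0 <= x -> U x = 0) (Up : forall x, x < 0 -> 0 < U x).
Hypotheses (ch : continuous (fun x => h (Num.max x 0))) (h00 : h 0 = 0).

Let U_ge0 x : 0 <= U x.
Proof. by have [x0|x0] := leP 0 x; [rewrite U0|exact: ltW (Up x0)]. Qed.

(* The flux [|(U^m)'|^n] of the wave, read off from the equation integrated from [y] to the end of the support. *)
Definition pres (y : R) : R := c * U y + prim (h \o U) y.

Lemma comp_cont_halfline : continuous (h \o U).
Proof.
have -> : h \o U = (fun x => h (Num.max x 0)) \o U.
  by apply/funext => x /=; rewrite max_l.
by apply: cont1_comp.
Qed.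

Let chU := comp_cont_halfline.

Lemma prim_zero (f : R -> R) x : (forall y, 0 <= y -> f y = 0) -> 0 <= x -> prim f x = 0.
Proof.
move=> f0 x0; rewrite prim_ge0E// (I_ext (g := fun=> 0)) ?I_0// => y /andP[y0 _]; exact: f0.
Qed.

Let phU0 x : 0 <= x -> prim (h \o U) x = 0.
Proof. by apply: prim_zero => y y0 /=; rewrite U0. Qed.

Lemma pres_cont : continuous pres.
Proof. by apply: cont1D; [apply: cont1M => //; exact: cont1c|exact: prim_cont]. Qed.

Lemma pres_npos y : 0 <= y -> pres y = 0.
Proof. by move=> y0; rewrite /pres U0// phU0// mulr0 addr0. Qed.

Let shift_deriv (f : R -> R) (t x : R) : continuous f ->
  is_derive x 1 (fun y => prim f (y - c * t)) (f (x - c * t)).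
Proof.
by move=> cf; exact: (dshift (is_derive_prim (x - c * t) cf)).
Qed.

Let shift_derivt (f : R -> R) (t x : R) : continuous f ->
  is_derive t 1 (fun s => - prim f (x - c * s)) (c * f (x - c * t)).
Proof.
move=> cf; have D := is_derive_prim (x - c * t) cf.
have {}D : is_derive (x + - c * t) 1 (prim f) (f (x - c * t)) by rewrite mulNr.
have := dN (daff D); rewrite mulNr opprK => {}D; apply: is_derive_near D.
by exists 1 => // s _; rewrite mulNr.
Qed.

Let c_shift (f : R -> R) t : continuous f -> continuous (fun x => f (x - c * t)).
Proof. by move=> cf; apply: cont1_comp => //; apply: cont1B; [move=> x; exact: cvg_id|exact: cont1c]. Qed.

Let c_shiftt (f : R -> R) x : continuous f -> continuous (fun t => f (x - c * t)).
Proof.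
move=> cf; apply: cont1_comp => //; apply: cont1B; first exact: cont1c.
by apply: cont1M; [exact: cont1c|move=> ?; exact: cvg_id].
Qed.

Let I_shift (f : R -> R) x R0 t : continuous f -> (forall y, 0 <= y -> f y = 0) -> x <= R0 -> 0 <= R0 - c * t ->
  I x R0 (fun y => f (y - c * t)) = - prim f (x - c * t).
Proof.
move=> cf f0 xR R0t.
have [_ <-//] := ac_smooth x R0 (@c_shift f t cf) (fun y => @shift_deriv f t y cf).
by rewrite (prim_zero f0 R0t) sub0r.
Qed.

(** The equation in the fixed frame identifies the flux with [pres (x - c t)] almost everywhere. One
    good time [t0] suffices: continuity then gives the sign of [pres] everywhere, and [U^m], locally
    a primitive of a continuous function, is differentiable everywhere. *)
Lemma wave_pressure s : flux n m 0 h (fun x t => U (x - c * t)) s ->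
  (forall y, 0 <= pres y) /\ forall y, is_derive y 1 (fun y => pw m (U y)) (- pw n^-1 (pres y)).
Proof.
move=> [s0 Ls Lsn F1 F2].
(* For [t] in [[0, 1]] the support of the wave ends at or before [R0 - 1], so [R0] lies beyond it
   during the whole time interval. *)
pose R0 := `|c| + 1.
have R0t t : 0 <= t <= 1 -> 1 <= R0 - c * t.
  move=> /andP[t0 t1]; have : c * t <= `|c|.
    apply: (le_trans (ler_norm _)); rewrite normrM [`|t|]ger0_norm// ler_piMr//.
  by rewrite /R0; lra.
have key (N : nat) : \forall t \ae mu, 0 < t < 1 ->
    (iv (- N%:R) R0 (s ^~ t) /\ forall a b, - N%:R < a -> a <= b -> b < R0 ->
     pw m (U (a - c * t)) - pw m (U (b - c * t)) = I a b (s ^~ t)) /\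
    \forall x \ae mu, - N%:R < x < R0 -> pw n (s x t) = pres (x - c * t).
  have NR : - N%:R < R0 by rewrite /R0; have := normr_ge0 c; have : 0 <= N%:R :> R by []; lra.
  have G : \forall x \ae mu, - N%:R <= x <= R0 -> \forall t \ae mu, 0 <= t <= 1 ->
      pw n (s x t) - pres (x - c * t) = 0.
    apply: ae_le_lt.
    have hz x t : R0 <= x -> 0 <= t <= 1 -> U (x - c * t) = 0.
      by move=> xR /R0t t01; rewrite U0//; lra.
    have := F2 0 1 R0 hz _ NR; apply: aeS => x Hx xx; have [Isx E] := Hx xx.
    have /andP[_ xR] := xx.
    have cpx : continuous (fun t => pres (x - c * t)) by apply: c_shiftt; exact: pres_cont.
    apply: ae_eq0_of_I; first by apply: ivB => //; exact: iv_contT.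
    move=> t1 t2 h1 h2 h3; rewrite IB; last 2 first.
    - by apply: iv_sub Isx; exact: ltW.
    - exact: iv_contT.
    have := E t1 t2 h1 h2 h3.
    have t01 t : t1 <= t <= t2 -> 0 <= R0 - c * t.
      move=> /andP[g1 g2]; apply: le_trans ler01 (R0t t _); rewrite (le_trans (ltW h1))//=.
      by rewrite (le_trans g2)// ltW.
    rewrite !I_shift// ?t01 ?h2 ?lexx// ?ltW//.
    have -> : I t1 t2 (fun t => pw n (s x t) - 0 * U (x - c * t) + I x R0 (fun y => h (U (y - c * t)))) =
       I t1 t2 (fun t => pw n (s x t) - prim (h \o U) (x - c * t)).
      apply: I_ext => t tt; rewrite mul0r subr0.
      by rewrite (@I_shift (h \o U) x R0 t chU _ (ltW xR) (t01 t tt))// => y y0 /=; rewrite U0.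
    have cp : continuous (fun t => prim (h \o U) (x - c * t)) by apply: c_shiftt; exact: prim_cont.
    rewrite IB; [|by apply: iv_sub Isx; exact: ltW|exact: iv_contT].
    have cUx : continuous (fun t => U (x - c * t)) by exact: c_shiftt.
    have := ac_smooth t1 t2 (cont1M (@cont1c R c) cUx) (fun t => @shift_derivt U t x cU).
    move=> [_ /(_ t1 t2 (lexx _) h2 (lexx _)) ->] E'.
    have -> : I t1 t2 (fun t => pres (x - c * t)) =
       I t1 t2 (fun t => c * U (x - c * t)) + I t1 t2 (fun t => prim (h \o U) (x - c * t)).
      by rewrite -ID//; [apply: iv_contT; apply: cont1M => //; exact: cont1c|exact: iv_contT].
    by rewrite E'; ring.
  have cP2 : continuous (unc (fun x t => pres (x - c * t))).
    apply: (cont2_comp (f := fun x t => x - c * t) pres_cont); apply: cont2B.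
      by apply: (cont2_1 (phi := id)) => x; exact: cvg_id.
    by apply: (cont2_2 (phi := fun t => c * t)); apply: cont1M; [exact: cont1c|move=> x; exact: cvg_id].
  have IB2 : int2 (- N%:R) R0 0 1 (fun x t => pw n (s x t) - pres (x - c * t)).
    by apply: int2B; [exact: Lsn|exact: int2_cont].
  have := aeI (F1 (- N%:R) R0 0 1) (ae_slices_swap' IB2 G).
  apply: aeS => t [H1 H2] t01; split; first exact: H1.
  have t01' : 0 <= t <= 1 by move: t01 => /andP[]; rewrite !le_eqVlt => -> ->; rewrite !orbT.
  have := H2 t01'; apply: aeS => x Hx /andP[x1 x2]; apply: subr0_eq; apply: Hx.
  by rewrite !ltW.
have [t0 t01 Ht] := ae_ex ltr01 (aeS (fun t H (_ : 0 < t < 1) => H) (ae_countable key)).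
have t01' : 0 <= t0 <= 1 by move: t01 => /andP[]; rewrite !le_eqVlt => -> ->; rewrite !orbT.
have R1 := R0t _ t01'.
pose q x := pres (x - c * t0).
have cq : continuous q by apply: c_shift; exact: pres_cont.
have big x : exists N : nat, - N%:R < x.
  exists (Num.bound `|x|); have := archi_boundP (normr_ge0 x).
  have := ler_norm (- x); rewrite normrN; lra.
have q0 x : x < R0 -> 0 <= q x.
  move=> xR; rewrite leNgt; apply/negP => qx.
  have e0 : 0 < - q x by rewrite oppr_gt0.
  have [d d0 Hd] := (contP _).1 cq x _ e0.
  have [N Nx] := big x.
  have [] := Ht N t01; move=> _ HN.
  pose b := Num.min (x + d) R0.
  have xb : x < b by rewrite lt_min xR ltrDl d0.
  have : \forall y \ae mu, x < y < b -> 0 <= q y.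
    apply: aeS HN => y Hy /andP[h1 h2]; rewrite /q -Hy ?pw_ge0//.
    by rewrite (lt_trans Nx h1)/=; move: h2; rewrite lt_min => /andP[].
  move=> /(ae_ex xb)[y /andP[h1 h2]].
  move: h2; rewrite lt_min => /andP[h2 _].
  have : `|y - x| < d by rewrite ger0_norm; lra.
  by move=> /Hd; rewrite ltr_norml => /andP[]; lra.
have P0 y : 0 <= pres y.
  have [y0|y0] := leP 0 y; first by rewrite pres_npos.
  have := q0 (y + c * t0); rewrite /q addrK; apply; lra.
split=> // y; have [y0|y0] := ltP 0 y.
  rewrite pres_npos ?ltW// pw_npos ?invr_eq0 ?gt_eqF// oppr0.
  apply: is_derive_near (is_derive_cst 0 y 1); exists y => // z.
  by rewrite ltr_distl => /andP[z0 _]; rewrite U0 ?pw_npos ?gt_eqF//; lra.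
pose x0 := y + c * t0.
have xR : x0 < R0 by rewrite /x0; lra.
have [N Nx] := big x0.
have [[_ E] HN] := Ht N t01.
pose x1 := (- N%:R + x0) / 2.
have x1N : - N%:R < x1 by rewrite /x1; lra.
have x10 : x1 < x0 by rewrite /x1; lra.
have cpq : continuous (fun x => pw n^-1 (q x)).
  by apply: cont1_comp => //; apply: pw_cont; rewrite invr_gt0.
have EE x : x1 <= x -> x < R0 -> pw m (U (x - c * t0)) = pw m (U (x1 - c * t0)) - I x1 x (fun x => pw n^-1 (q x)).
  move=> h1 h2; have Iv : iv x1 x (s ^~ t0).
    by have [[Iv _] _] := Ht N t01; apply: iv_sub Iv; exact: ltW.
  have <- : I x1 x (s ^~ t0) = I x1 x (fun x => pw n^-1 (q x)).
    apply: I_ae_eq => //; first exact: iv_contT.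
    apply: aeS HN => z Hz /andP[z1 z2]; rewrite /q -(Hz _) ?pw_inv//.
    by rewrite (lt_le_trans x1N z1) (le_lt_trans z2 h2).
  by rewrite -(E x1 x x1N h1 h2); ring.
have D : is_derive x0 1 (fun x => pw m (U (x1 - c * t0)) - I x1 x (fun x => pw n^-1 (q x))) (- pw n^-1 (q x0)).
  by have := dB (is_derive_cst (pw m (U (x1 - c * t0))) x0 1) (ftc_cont cpq x10); rewrite sub0r.
have D2 := dshift D; rewrite /q /x0 addrK in D2.
apply: is_derive_near D2; exists (Num.min (x0 - x1) (R0 - x0)).
  by rewrite lt_min !subr_gt0 x10.
move=> z; rewrite lt_min !ltr_distl => /andP[/andP[h1 h2] /andP[h3 h4]].
rewrite -EE ?addrK//; rewrite /x0 in h1 h2 h3 h4; lra.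
Qed.

End WaveProfile.

(** * Speed, sign and monotonicity of the wave; its logarithmic weight *)

Section WaveQualitative.
Variable R : realType.
Variables (n m c L a h0' : R) (h U : R -> R).
Implicit Types (x y z t e v : R).
Hypotheses (n1 : 1 <= n) (m0 : 0 < m) (L0 : 0 < L).
Hypotheses (cU : continuous U) (Um : forall x y, x <= y -> U y <= U x).
Hypotheses (U0 : forall x, 0 <= x -> U x = 0) (Up : forall x, x < 0 -> 0 < U x).
Hypothesis (Ulim : forall e, 0 < e -> exists A : R, forall y, y <= A -> `|U y - 1| < e).
Hypotheses (ch : continuous (fun x => h (Num.max x 0))) (h00 : h 0 = 0).
Hypothesis (hL : forall u v, 0 <= u -> u <= v -> v <= 1 -> `|h v - h u| <= L * (v - u)).
Hypotheses (a0 : 0 <= a) (a1 : a < 1) (hneg : forall u, 0 <= u <= a -> h u <= 0)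
  (hpos : forall u, a < u < 1 -> 0 < h u) (h1 : h 1 = 0).
Hypothesis (h0d : forall e, 0 < e -> exists2 d, 0 < d & forall u, 0 < u -> u < d -> `|h u / u - h0'| < e).
Let phi v := h (Num.max v 0) * (Num.max v 0) `^ (m - 1).
Hypothesis (phi_gt0 : 0 < I 0 1 phi).
Notation P := (pres c h U).
Hypotheses (P_ge0 : forall y, 0 <= P y)
  (dW : forall y, is_derive y 1 (fun y => pw m (U y)) (- pw n^-1 (P y))).

Let n0 : 0 < n. Proof. exact: lt_le_trans n1. Qed.
Let g0 : 0 < n^-1. Proof. by rewrite invr_gt0. Qed.

Let U_ge0 x : 0 <= U x.
Proof. by have [x0|x0] := leP 0 x; [rewrite U0|exact: ltW (Up x0)]. Qed.

Let U_le1 x : U x <= 1.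
Proof.
apply/ler_addgt0Pl => e e0; have [A HA] := Ulim e0.
have := HA _ (_ : Num.min A x <= A); rewrite ge_min lexx => /(_ isT).
have := Um (_ : Num.min A x <= x); rewrite ge_min lexx orbT => /(_ isT).
by rewrite ltr_norml => ? /andP[]; lra.
Qed.

Lemma is_derive_pw1 r x : 1 < r -> is_derive x 1 (pw r) (r * pw (r - 1) x).
Proof.
move=> r1; have [x0|x0|->] := ltgtP x 0.
- have r0 : r - 1 != 0 by rewrite gt_eqF// subr_gt0.
  rewrite (pw_npos r0 (ltW x0)) mulr0.
  apply: is_derive_near (is_derive_cst 0 x 1); exists (- x); first by rewrite oppr_gt0.
  move=> y; rewrite ltr_distl => /andP[_ yx]; rewrite pw_npos//; last by lra.
  by rewrite gt_eqF//; lra.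
- by rewrite pwE ?ltW//; exact: is_derive_pw.
have r0 : 0 < r - 1 by rewrite subr_gt0.
have rn : r != 0 by rewrite gt_eqF//; lra.
rewrite (pw_npos _ (lexx 0)) ?gt_eqF// mulr0.
apply: is_derive_of_increment => e e0; exists (pw (r - 1)^-1 e); first exact: pw_gt0.
move=> y; rewrite subr0 (pw_npos rn (lexx 0)) subr0 mul0r subr0 => ye.
have [y0|y0] := leP y 0; first by rewrite pw_npos// normr0 mulr_ge0// ltW.
rewrite ger0_norm ?pw_ge0// (gtr0_norm y0) (pwE _ (ltW y0)).
rewrite -mulr_powRB1 ?(ltW y0)//; last by lra.
rewrite mulrC ler_wpM2r ?(ltW y0)// -(@pwE _ (r - 1)) ?(ltW y0)//.
rewrite -[leRHS](pw_invV r0 (ltW e0)); apply: pw_le; first exact: ltW.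
by move: ye; rewrite (gtr0_norm y0) => /ltW.
Qed.

(** This is [-U'] on the support, from differentiating [U = (U^m)^(1/m)]; it may be unbounded near
    the edge [0]. *)
Definition slope y := m^-1 * (pw m (U y)) `^ (m^-1 - 1) * pw n^-1 (P y).

Lemma slope_ge0 y : 0 <= slope y.
Proof. by rewrite /slope !mulr_ge0 ?powR_ge0// ?pw_ge0// invr_ge0 ltW. Qed.

Lemma is_derive_profile y : y < 0 -> is_derive y 1 U (- slope y).
Proof.
move=> y0; have W0 : 0 < pw m (U y) by rewrite pw_gt0// Up.
have D := @dC _ (pw m^-1) (fun y => pw m (U y)) y _ _ (is_derive_pw _ W0) (dW y).
rewrite mulrN in D; apply: is_derive_near D; exists 1 => // z _.
by rewrite pw_inv.
Qed.

Let chU : continuous (h \o U) := comp_cont_halfline cU U0 Up ch.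
Let cP : continuous P := pres_cont cU U0 Up ch.

Lemma is_derive_pres y : y < 0 -> is_derive y 1 P (- (c * slope y) + h (U y)).
Proof.
move=> y0; have := dD (dZ c (is_derive_profile y0)) (is_derive_prim y chU).
by rewrite mulrN.
Qed.

Let hU_le u : 0 <= u <= 1 -> `|h u| <= L * u.
Proof. by move=> /andP[u0 u1]; have := hL (lexx 0) u0 u1; rewrite h00 !subr0. Qed.

Let phi_bound v : v <= 1 -> `|phi v| <= L * pw m v.
Proof.
move=> v1; rewrite /phi; have [v0|v0] := leP v 0.
  by rewrite h00 mul0r normr0 mulr_ge0 ?pw_ge0// ltW.
rewrite (pwE _ (ltW v0)) normrM [`|_ `^ _|]ger0_norm ?powR_ge0//.
rewrite -[leRHS](_ : (L * v) * v `^ (m - 1) = _); last by rewrite -mulrA mulr_powRB1// (ltW v0).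
by rewrite ler_wpM2r ?powR_ge0// hU_le// (ltW v0).
Qed.

Let phi_cont : continuous phi.
Proof.
have neg x : x <= 0 -> phi x = 0 by move=> x0; rewrite /phi max_r// h00 mul0r.
move=> x; have [x0|x0] := ltP 0 x.
  have c1 : {for x, continuous (fun v => h (Num.max v 0))} by exact: ch.
  have c2 : {for x, continuous (pw (m - 1))} by exact: is_derive_cont (is_derive_pw _ x0).
  exact: (@continuousM _ _ _ _ _ c1 c2).
apply/cvgrPdist_lt => e e0.
have e1 : 0 < e / L by rewrite divr_gt0.
have d0 := pw_gt0 m^-1 e1.
exists (Num.min 1 (pw m^-1 (e / L))); first by rewrite /= lt_min ltr01.
move=> y /=; rewrite (neg x x0) sub0r normrN lt_min distrC => /andP[y1 ye].
apply: (le_lt_trans (phi_bound _)).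
  by move: y1; rewrite ltr_norml => /andP[_]; lra.
rewrite mulrC -ltr_pdivlMr//.
have [y0|y0] := leP y 0; first by rewrite pw_npos// gt_eqF.
rewrite -[ltRHS](pw_invV m0 (ltW e1)); apply: pw_lt => //; first exact: ltW.
by move: ye; rewrite ltr_norml => /andP[_]; lra.
Qed.

(** Energy argument with [E = P^k + k m Phi(U)], [Phi] being the primitive of [h(v) v^(m-1)]. The
    exponent [k = 1 + 1/n] makes the two reaction contributions cancel and leaves
    [E' = - k c P^(1/n) |U'|]. If [c <= 0], then [E] is nondecreasing up to [E(0) = 0], so [E <= 0]
    on the support; but far to the left [E >= k m Phi(U) > 0], since [Phi(1) > 0]. *)
Lemma wave_speed_gt0 : 0 < c.
Proof.
rewrite ltNge; apply/negP => c0.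
pose k := n^-1 + 1.
have k1 : 1 < k by rewrite ltrDr.
pose E y := pw k (P y) + k * m * prim phi (U y).
have cE : continuous E.
  apply: cont1D; first by apply: cont1_comp => //; apply: pw_cont; lra.
  apply: cont1M; first exact: cont1c.
  by apply: cont1_comp => //; exact: prim_cont.
have dE y : y < 0 -> is_derive y 1 E (- (k * c * pw n^-1 (P y) * slope y)).
  move=> y0.
  have D1 := @dC _ (pw k) P y _ _ (is_derive_pw1 (P y) k1) (is_derive_pres y0).
  have D2 := @dC _ (prim phi) U y _ _ (is_derive_prim (U y) phi_cont) (is_derive_profile y0).
  apply: (is_derive_eq (dD D1 (dZ (k * m) D2))).
  have -> : k - 1 = n^-1 by rewrite /k addrK.
  have Uy := Up y0.
  have pos : phi (U y) * slope y = m^-1 * h (U y) * pw n^-1 (P y).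
    rewrite /phi /slope max_l ?ltW// (pwE m (ltW Uy)) -powRrM.
    have -> : m * (m^-1 - 1) = - (m - 1) by field; rewrite gt_eqF.
    rewrite powRN; have : U y `^ (m - 1) != 0 by rewrite gt_eqF// powR_gt0.
    by move=> ?; field; rewrite gt_eqF.
  have -> : phi (U y) * - slope y = - (m^-1 * h (U y) * pw n^-1 (P y)) by rewrite mulrN pos.
  by field; rewrite gt_eqF.
have E0 y : y < 0 -> E y <= 0.
  move=> y0; have -> : 0 = E 0.
    rewrite /E (pres_npos c U0 h00 (lexx 0)) (U0 (lexx 0)) prim0 mulr0 addr0 pw_npos//.
    by rewrite gt_eqF//; lra.
  apply: (@le_of_derive _ y 0 E (fun y => - (k * c * pw n^-1 (P y) * slope y))) => //.
  - by move=> x /andP[_ x0]; exact: dE.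
  - exact: continuous_subspaceT.
  - move=> x _; rewrite oppr_ge0 -mulrA; apply: mulr_le0_ge0; last by rewrite mulr_ge0 ?pw_ge0// slope_ge0.
    by rewrite pmulr_rle0//; lra.
have p1 : 0 < prim phi 1 by rewrite prim_ge0E.
have [d d0 Hd] := (contP _).1 (prim_cont phi_cont) 1 _ p1.
have [A HA] := Ulim d0.
pose y := Num.min A (- 1).
have yA : y <= A by rewrite ge_min lexx.
have y0 : y < 0 by rewrite gt_min; apply/orP; right; lra.
have := Hd _ (HA _ yA); rewrite ltr_norml => /andP[H _].
have : 0 < k * m * prim phi (U y) by rewrite !mulr_gt0//; lra.
have := E0 y y0; rewrite /E; have := pw_ge0 k (P y); lra.
Qed.

Let c0 := wave_speed_gt0.

Let hU1 u : 0 <= u <= 1 -> h u <= L * (1 - u).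
Proof.
move=> /andP[u0 u1]; have := hL u0 u1 (lexx 1); rewrite h1 sub0r normrN.
by move=> /(le_trans (ler_norm _)).
Qed.

Let ihU x y : iv x y (h \o U). Proof. exact: iv_contT. Qed.

(** If [U] reached [1], let [y1] be the last such point: [U] is constant before it, so [P] vanishes
    there. From [y1] to [z = y1 + r] the relation [P' = c U' + h(U)] integrates to at most
    [(- c + L r)(1 - U z)], which is negative for [r = c/(2L)], against [P >= 0]. *)
Lemma profile_lt1 y : U y < 1.
Proof.
rewrite ltNge; apply/negP => Uy.
pose S := [set z | 1 <= U z].
have S0 : S !=set0 by exists y.
have Sneg z : S z -> z < 0.
  by rewrite /S/= => Sz; rewrite ltNge; apply/negP => z0; move: Sz; rewrite U0// ler10.
have Sb : has_ubound S by exists 0 => z /Sneg /ltW.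
pose y1 := sup S.
have gtS z : y1 < z -> U z < 1.
  move=> yz; rewrite ltNge; apply/negP => Sz; have := ub_le_sup Sb (Sz : S z).
  by rewrite leNgt yz.
have ltS z : z < y1 -> U z = 1.
  move=> zy; have e0 : 0 < y1 - z by rewrite subr_gt0.
  have [w Sw zw] := sup_adherent e0 (conj S0 Sb).
  have {}zw : z <= w by rewrite subKr in zw; exact: ltW.
  by apply: le_anti; rewrite U_le1//= (le_trans Sw)// Um.
have Uy1 : U y1 = 1.
  apply: le_anti; rewrite U_le1/= leNgt; apply/negP => U1.
  have e0 : 0 < 1 - U y1 by rewrite subr_gt0.
  have [d d0 Hd] := (contP _).1 cU y1 _ e0.
  have := Hd (y1 - d / 2); rewrite ltS; last by lra.
  rewrite [`|1 - _|]ger0_norm ?(ltW e0)// ltxx => H.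
  by suff : false by []; apply: H; rewrite ltr_norml; apply/andP; split; lra.
have P1 : P (y1 - 1) = 0.
  have D : is_derive (y1 - 1) 1 (fun y => pw m (U y)) 0.
    apply: is_derive_near (is_derive_cst (pw m 1) (y1 - 1) 1).
    exists 1 => // z; rewrite ltr_distl => /andP[_ z1]; rewrite ltS//; lra.
  have [_ E1] := dW (y1 - 1); have [_ E2] := D.
  have /eqP : pw n^-1 (P (y1 - 1)) = 0 by apply: oppr_inj; rewrite oppr0 -E1.
  by rewrite pwE// powR_eq0 => /andP[/eqP].
have Py1 : P y1 = 0.
  have y11 : y1 - 1 < y1 by lra.
  rewrite -P1 /pres (ltS _ y11) Uy1.
  congr (_ + _); apply/eqP; rewrite -subr_eq0 -I_prim//; last by lra.
  rewrite (I_ext (g := fun=> 0)) ?I_0// => z /andP[_ z1] /=.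
  suff -> : U z = 1 by [].
  by move: z1; rewrite le_eqVlt => /orP[/eqP ->//|]; exact: ltS.
pose r := c / (2 * L).
have r0 : 0 < r by rewrite divr_gt0// mulr_gt0.
pose z := y1 + r.
have zy : y1 < z by rewrite ltrDl.
have Uz := gtS z zy.
have : P z - P y1 <= - c * (1 - U z) + L * (1 - U z) * r.
  have -> : P z - P y1 = - c * (1 - U z) + I y1 z (h \o U).
    by rewrite I_prim//; [rewrite /pres Uy1; ring|exact: ltW].
  rewrite lerD2l -[X in _ * X](_ : z - y1 = r); last by rewrite /z addrAC subrr add0r.
  rewrite -I_cst ?(ltW zy)//; apply: I_le => //; first exact: iv_cst.
  move=> s /andP[s1 s2] /=; apply: (le_trans (hU1 _)); first by rewrite U_ge0 U_le1.
  by rewrite ler_wpM2l ?(ltW L0)// lerD2l lerN2 Um.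
rewrite Py1 subr0 leNgt => /negP; apply; apply: lt_le_trans (P_ge0 z).
have -> : L * (1 - U z) * r = (c / 2) * (1 - U z) by rewrite /r; field; rewrite gt_eqF.
rewrite -mulrDl pmulr_llt0 ?subr_gt0//; have := c0; lra.
Qed.

Lemma pres_ge_low y : y <= 0 -> U y <= a -> c * U y <= P y.
Proof.
move=> y0 Ua; rewrite /pres lerDl prim_le0E// oppr_ge0.
rewrite -[leRHS](I_0 y 0); apply: I_le => //; first exact: iv_cst.
by move=> s /andP[s1 s2] /=; apply: hneg; rewrite U_ge0 (le_trans (Um s1)).
Qed.

(** At a zero of [P] the slope vanishes, so [P' = h(U)]; as [P >= 0] on both sides, [h(U) = 0],
    hence [U <= a] because [U < 1]. But [P >= c U > 0] there. *)
Lemma pres_gt0 y : y < 0 -> 0 < P y.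
Proof.
move=> y0; rewrite lt_neqAle P_ge0 andbT eq_sym; apply/negP => /eqP Py.
have sl : slope y = 0 by rewrite /slope Py (pw_npos _ (lexx 0)) ?mulr0// gt_eqF.
have := is_derive_pres y0; rewrite sl mulr0 oppr0 add0r => D.
have hz : h (U y) = 0.
  apply/eqP; rewrite -normr_eq0; apply/negPn/negP => hn.
  have e0 : 0 < `|h (U y)| / 2 by rewrite divr_gt0// normr_gt0 -normr_eq0.
  have [r r0 Hr] := is_derive_increment D e0.
  have hh : 0 < `|h (U y)| by rewrite normr_gt0 -normr_eq0.
  have r2 : 0 < r / 2 by rewrite divr_gt0.
  have [hp|hp] := leP 0 (h (U y)).
    have := Hr (y - r / 2); rewrite Py subr0 addrAC subrr add0r normrN (ger0_norm (ltW r2)).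
    have -> : r / 2 < r by lra.
    move=> /(_ isT) /(le_trans (ler_norm _)); rewrite (ger0_norm hp) in hh *.
    have := P_ge0 (y - r / 2); have := mulr_gt0 hh r2; lra.
  have := Hr (y + r / 2); rewrite Py subr0 addrAC subrr add0r (ger0_norm (ltW r2)).
  have -> : r / 2 < r by lra.
  move=> /(_ isT) /(le_trans (ler_norm _)); rewrite (ltr0_norm hp) in hh *.
  have := P_ge0 (y + r / 2); have := mulr_gt0 hh r2; lra.
have Ua : U y <= a.
  rewrite leNgt; apply/negP => aU; have := @hpos (U y); rewrite aU profile_lt1 hz ltxx => /(_ isT)//.
have := pres_ge_low (ltW y0) Ua; rewrite Py leNgt mulr_gt0 ?Up//.
Qed.

Lemma profile_decr x y : x < y -> y <= 0 -> U y < U x.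
Proof.
move=> xy y0; rewrite lt_neqAle Um ?(ltW xy)// andbT; apply/negP => /eqP E.
have D : is_derive ((x + y) / 2) 1 (fun y => pw m (U y)) 0.
  apply: is_derive_near (is_derive_cst (pw m (U x)) ((x + y) / 2) 1).
  exists ((y - x) / 2); first by rewrite divr_gt0 ?subr_gt0.
  move=> z; rewrite ltr_distl => /andP[z1 z2]; congr pw; apply: le_anti.
  by rewrite Um ?(le_trans _ (Um _))// -?E ?Um//; lra.
have [_ E1] := dW ((x + y) / 2); have [_ E2] := D.
have /eqP : pw n^-1 (P ((x + y) / 2)) = 0 by apply: oppr_inj; rewrite oppr0 -E1.
by rewrite gt_eqF// pw_gt0// pres_gt0//; lra.
Qed.

(** It makes [P/U] tend to [c] at the edge of the support, which determines the value of [kap]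
    there. *)
Lemma pres_near0 y : y <= 0 -> `|P y - c * U y| <= L * - y * U y.
Proof.
move=> y0; rewrite /pres addrAC subrr add0r prim_le0E// normrN.
have := @I_le_abs _ y 0 (h \o U) (L * U y) y0 (ihU _ _).
rewrite sub0r => H; apply: (le_trans (H _)); last by rewrite mulrAC.
move=> s /andP[s1 s2] /=; apply: (le_trans (hU_le _)); first by rewrite U_ge0 U_le1.
by rewrite ler_wpM2l ?(ltW L0)// Um.
Qed.

Let hU_above y : a < U y -> 0 <= h (U y).
Proof. by move=> aU; apply/ltW/hpos; rewrite aU profile_lt1. Qed.

Let ya_ex : exists2 ya, ya < 0 & forall y, y <= ya -> a < U y.
Proof.
have e0 : 0 < 1 - a by rewrite subr_gt0.
have [A HA] := Ulim e0; exists (Num.min A (- 1)).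
  by rewrite gt_min; apply/orP; right; lra.
move=> y; rewrite le_min => /andP[yA _]; have := HA y yA.
by rewrite ltr_norml => /andP[]; lra.
Qed.

(** To the left of [ya] the profile exceeds [a], where [h >= 0], so the far part of the integral of
    [h(U)] enters [P] with a minus sign; the part between [ya] and [0] is bounded by its length. *)
Lemma pres_bounded : exists PM, forall y, P y <= PM.
Proof.
have [ya ya0 Hya] := ya_ex; exists (c + L * - ya) => y.
have LA : 0 <= L * - ya by rewrite mulr_ge0 ?oppr_ge0 ?ltW.
have cU1 : c * U y <= c by rewrite ler_piMr ?U_le1// ltW.
have [y0|y0] := leP 0 y; first by rewrite (pres_npos c U0 h00 y0); have := c0; lra.
rewrite /pres lerD// (prim_le0E _ (ltW y0)) lerNl.
have bd x : x <= 0 -> ya <= x -> - (L * - ya) <= I x 0 (h \o U).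
  move=> x0 yx; have := @I_le_abs _ x 0 (h \o U) L x0 (ihU _ _).
  rewrite sub0r => H; have := H _; rewrite ler_norml => /(_ _)/andP[|+ _].
    move=> s _ /=; apply: (le_trans (hU_le _)); first by rewrite U_ge0 U_le1.
    by rewrite ler_piMr ?U_le1// ltW.
  by apply: le_trans; rewrite lerN2 ler_wpM2l ?(ltW L0)// lerN2.
have [yy|yy] := leP ya y; first by apply: bd => //; exact: ltW.
rewrite (I_split (ltW yy) (ltW ya0))//.
apply: (le_trans (bd ya (ltW ya0) (lexx _))); rewrite lerDr.
by apply: I_ge0 => s /andP[_ s2] /=; apply/hU_above/Hya.
Qed.

(* [h(U) / (n P)], extended by its limit at the end of the support. *)
Definition kap y := if y < 0 then n^-1 * (h (U y) / U y) / (P y / U y) else n^-1 * h0' / c.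

Lemma kap_pres y : y <= 0 -> kap y * P y = n^-1 * h (U y).
Proof.
rewrite le_eqVlt => /orP[/eqP ->|y0].
  by rewrite (pres_npos c U0 h00 (lexx 0)) (U0 (lexx 0)) h00 !mulr0.
rewrite /kap y0; have Uy := Up y0; have Py := pres_gt0 y0.
by field; rewrite !gt_eqF.
Qed.

Lemma glue_cont (f : R -> R) (k : R) : (forall y, y < 0 -> {for y, continuous f}) ->
  (forall e, 0 < e -> exists2 d, 0 < d & forall y, - d < y -> y < 0 -> `|f y - k| < e) ->
  continuous (fun y => if y < 0 then f y else k).
Proof.
move=> cf fk y; apply/cvgrPdist_lt => e e0; have [y0|y0|->] := ltgtP y 0.
- have /cvgrPdist_lt /(_ e e0) [d /= d0 Hd] := cf y y0.
  exists (Num.min d (- y)); first by rewrite /= lt_min d0 oppr_gt0.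
  move=> z /=; rewrite lt_min => /andP[zd zy].
  have -> : z < 0 by move: zy; rewrite ltr_distl => /andP[]; lra.
  exact: Hd.
- exists y => //= z /=; rewrite ltr_distl => /andP[_ zy].
  have -> : (z < 0) = false by apply/negbTE; rewrite -leNgt; lra.
  by rewrite subrr normr0.
- have [d d0 Hd] := fk e e0; exists d => //= z /=; rewrite sub0r normrN => zd.
  have [z0|z0] := ltP z 0; last by rewrite subrr normr0.
  by rewrite distrC; apply: Hd => //; move: zd; rewrite ltr_norml => /andP[].
Qed.

(** A quotient of [h(U)/U] and [P/U], which have the limits [h'(0)] and [c > 0] at the edge of the
    support. *)
Lemma kap_cont : continuous kap.
Proof.
pose r1 y := if y < 0 then h (U y) / U y else h0'.
pose r2 y := if y < 0 then P y / U y else c.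
have UV y : y < 0 -> {for y, continuous (fun z => (U z)^-1)}.
  by move=> y0; apply: continuousV; [rewrite gt_eqF// Up|exact: cU].
have c1 : continuous r1.
  apply: glue_cont => [y y0|e e0].
    by apply: (@continuousM _ _ (h \o U) (fun z => (U z)^-1)); [exact: chU|exact: UV].
  have [d d0 Hd] := h0d e0; have [r r0 Hr] := (contP _).1 cU 0 _ d0.
  exists r => // y y1 y2; apply: Hd; first exact: Up.
  have := Hr y; rewrite subr0 (U0 (lexx 0)) subr0 (ltr0_norm y2) ltrNl => /(_ y1).
  by rewrite gtr0_norm// Up.
have c2 : continuous r2.
  apply: glue_cont => [y y0|e e0].
    by apply: (@continuousM _ _ P (fun z => (U z)^-1)); [exact: cP|exact: UV].
  exists (e / L); first by rewrite divr_gt0.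
  move=> y y1 y2; have Uy := Up y2.
  have -> : P y / U y - c = (P y - c * U y) / U y by rewrite mulrBl mulfK// gt_eqF.
  rewrite normrM normfV (gtr0_norm Uy) ltr_pdivrMr//.
  apply: (le_lt_trans (pres_near0 (ltW y2))); rewrite ltr_pM2r//.
  by rewrite mulrC -ltr_pdivlMr// ltrNl.
have r2n y : r2 y != 0.
  rewrite /r2; case: ifP => y0; last by rewrite gt_eqF.
  by rewrite gt_eqF// divr_gt0 ?Up// pres_gt0.
have -> : kap = (fun y => n^-1 * r1 y * (r2 y)^-1).
  by apply/funext => y; rewrite /kap /r1 /r2; case: ifP.
have c3 : continuous (fun y => (r2 y)^-1).
  by move=> y; apply: continuousV; [exact: r2n|exact: c2].
by apply: cont1M => //; apply: cont1M => //; exact: cont1c.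
Qed.

(** [h(U)] is negative only where [U <= a]; there [P >= c U], while [|h(U)| <= L U]. *)
Lemma hneg_le_pres y : y <= 0 -> - h (U y) <= L / c * P y.
Proof.
move=> y0; have [Ua|Ua] := leP (U y) a; last first.
  have := hU_above Ua; have : 0 <= L / c * P y by rewrite mulr_ge0// divr_ge0 ?ltW.
  lra.
have := pres_ge_low y0 Ua; have := hU_le (_ : 0 <= U y <= 1); rewrite U_ge0 U_le1 => /(_ isT).
rewrite -normrN => /(le_trans (ler_norm _)) H1 H2; apply: (le_trans H1).
have -> : L * U y = L / c * (c * U y) by field; rewrite gt_eqF.
by rewrite ler_wpM2l// divr_ge0 ?ltW.
Qed.

Lemma kap_ge y : y <= 0 -> - (n^-1 * L / c) <= kap y.
Proof.
have neg z : z < 0 -> - (n^-1 * L / c) <= kap z.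
  move=> z0; have Pz := pres_gt0 z0; rewrite -(ler_pM2r Pz) (kap_pres (ltW z0)).
  have := ler_wpM2l (ltW g0) (hneg_le_pres (ltW z0)); rewrite mulrN => H.
  by rewrite mulNr lerNl; apply: (le_trans H); rewrite !mulrA.
rewrite le_eqVlt => /orP[/eqP ->|]; last exact: neg.
apply/ler_addgt0Pl => e e0; have [d d0 Hd] := (contP _).1 kap_cont 0 _ e0.
have := Hd (- (d / 2)); rewrite subr0 normrN (ger0_norm (ltW (_ : 0 < d / 2))); last by lra.
have -> : d / 2 < d by lra.
move=> /(_ isT); rewrite ltr_norml => /andP[_]; have := neg (- (d / 2)); lra.
Qed.

(** [kap >= 0] to the left of [ya], and [kap] is bounded below between [ya] and [0], so its integral
    from [y] to [0] is bounded below uniformly in [y]. *)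
Lemma rho_bounded : exists rM, forall y, y <= 0 -> expR (prim kap y) <= rM.
Proof.
have [ya ya0 Hya] := ya_ex; pose K := n^-1 * L / c.
have K0 : 0 <= K by rewrite /K divr_ge0 ?mulr_ge0 ?ltW.
exists (expR (K * - ya)) => y y0; rewrite ler_expR prim_le0E// lerNl.
have ick x z : iv x z kap by apply: iv_contT; exact: kap_cont.
have bd x : x <= 0 -> ya <= x -> - (K * - ya) <= I x 0 kap.
  move=> x0 yx; apply: (@le_trans _ _ (I x 0 (fun=> - K))).
    by rewrite I_cst// sub0r mulNr lerN2 ler_wpM2l// lerN2.
  by apply: I_le => //; [exact: iv_cst|move=> s /andP[_ s0]; exact: kap_ge].
have [yy|yy] := leP ya y; first exact: bd.
rewrite (I_split (ltW yy) (ltW ya0))//.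
apply: (le_trans (bd ya (ltW ya0) (lexx _))); rewrite lerDr.
apply: I_ge0 => s /andP[_ s2]; have s0 := le_lt_trans s2 ya0.
rewrite -(pmulr_lge0 _ (pres_gt0 s0)) kap_pres ?(ltW s0)//.
by rewrite mulr_ge0 ?(ltW g0)//; apply/hU_above/Hya.
Qed.

End WaveQualitative.

(** * The pressure coordinate *)

Section AbsContLimit.
Variable R : realType.
Implicit Types (f F : R -> R) (a b c x y e : R).
Notation mu := (@lebesgue_measure R).

Lemma iv_glue a c b f : a <= c -> c <= b -> iv a c f -> iv c b f -> iv a b f.
Proof.
move=> ac cb I1 I2.
pose f1 : R -> \bar R := (EFin \o f) \_ `[a, c]; pose f2 : R -> \bar R := (EFin \o f) \_ `]c, b].
have J1 : mu.-integrable `[a, b] f1.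
  apply: (@integrableS _ _ _ mu setT) => //.
  by apply: (iffLR (integrable_mkcond _ _)) I1; exact: measurable_itv.
have J2 : mu.-integrable `[a, b] f2.
  apply: (@integrableS _ _ _ mu setT) => //.
  apply: (iffLR (integrable_mkcond _ _)); first exact: measurable_itv.
  by apply: integrableS I2 => //; apply: subset_itv; rewrite bnd_simp.
have : mu.-integrable `[a, b] (f1 \+ f2)%E by exact: integrableD.
apply: eq_integrable => //.
move=> x; rewrite inE/= in_itv/= => /andP[ax xb]; rewrite /f1 /f2 !patchE.
rewrite !mem_setE !in_itv/= ax xb/= andbT.
by have [xc|xc] := leP x c; rewrite ?adde0 ?add0e.
Qed.

Lemma ac_glue a c b F f : a <= c -> c <= b -> ac a c F f -> ac c b F f -> ac a b F f.
Proof.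
move=> ac cb H1 H2; have [I1 E1] := H1; have [I2 E2] := H2.
have If := iv_glue ac cb I1 I2; split => // x y ax xy yb.
have [yc|yc] := leP y c; first exact: E1.
have [xc|xc] := leP c x; first exact: E2.
have -> : F y - F x = (F c - F x) + (F y - F c) by ring.
rewrite E1 ?E2 ?(ltW xc) ?(ltW yc)// -I_split ?(ltW xc) ?(ltW yc)//.
exact: iv_sub If.
Qed.

(** Monotone convergence along [[a, b - (b - a)/(k + 1)]]. It serves densities that may blow up at
    the endpoint, such as the slope of the wave. *)
Lemma iv_of_bounded a b f M : a < b -> measurable_fun `[a, b] f ->
  (forall x, a <= x <= b -> 0 <= f x) ->
  (forall x, a <= x -> x < b -> iv a x f /\ I a x f <= M) -> iv a b f.
Proof.
move=> ab mf f0 H.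
pose d k : R := (b - a) / k.+1%:R.
pose F k : set (measurableTypeR R) := `[a, b - d k]%classic.
have d0 k : 0 < d k by rewrite divr_gt0 ?subr_gt0.
have da k : a <= b - d k.
  have ba : 0 <= b - a by rewrite subr_ge0 ltW.
  by rewrite lerBrDl -lerBrDr ler_pdivrMr// ler_peMr// ler1n.
have sub k : F k `<=` `[a, b]%classic.
  by apply: subset_itv; rewrite bnd_simp// gerBl ltW.
have nd : nondecreasing_seq F.
  move=> i j ij; rewrite subsetEset; apply: subset_itvl; rewrite bnd_simp lerD2l lerN2 /d.
  by rewrite ler_pM2l ?subr_gt0// lef_pV2 ?posrE// ler_nat.
have mfE : measurable_fun `[a, b] (EFin \o f) by exact/measurable_EFinP.
have mabs i : measurable_fun (F i) (fun x => `|(EFin \o f) x|)%E.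
  by apply: (measurableT_comp (@abse_measurable R _)); exact: measurable_funS (measurable_itv _) (sub i) mfE.
have cv := @ge0_nondecreasing_set_cvg_integral _ (measurableTypeR R) R F (fun x => `|(EFin \o f) x|)%E mu nd
  (fun i => measurable_itv _) mabs (fun _ _ _ => abse_ge0 _).
have UF : \bigcup_i F i = `[a, b[%classic.
  apply/seteqP; split => [x [k _]|x]; rewrite /F/= !in_itv/=.
    by move=> /andP[-> xk]/=; apply: (le_lt_trans xk); rewrite gtrBl.
  move=> /andP[ax xb]; have bx0 : 0 < (b - x) / (b - a) by rewrite divr_gt0 ?subr_gt0.
  have [k] := ltr_add_invr bx0.
  rewrite add0r => Hk.
  exists k => //=; rewrite in_itv/= ax/= lerBrDr -lerBrDl /d.
  by move: Hk; rewrite ltr_pdivlMr ?subr_gt0// mulrC => /ltW.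
have le : (\int[mu]_(x in \bigcup_i F i) `|(EFin \o f) x| <= M%:E)%E.
  move/cvg_lim: cv => <- //; apply: lime_le.
    apply: ereal_nondecreasing_is_cvgn.
    exact: (@ge0_nondecreasing_set_nondecreasing_integral _ (measurableTypeR R) R F _ mu nd
      (fun i => measurable_itv _) mabs (fun _ _ _ => abse_ge0 _)).
  apply: nearW => k; have bk : b - d k < b by rewrite gtrBl.
  have [Ik IM] := H _ (da k) bk.
  have := fineK (@integrable_fin_num _ _ _ mu _ (measurable_itv _) _ (iv_norm Ik)).
  rewrite /F => <-; rewrite lee_fin -[X in X <= M]/(I a (b - d k) (fun x => `|f x|)).
  apply: le_trans IM; rewrite (I_ext (g := f))// => x /andP[h1 h2].
  by rewrite ger0_norm// f0// h1 (le_trans h2) ?ltW.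
apply/integrableP; split => //.
rewrite UF in le.
rewrite -integral_itv_bndo_bndc; first by apply: le_lt_trans le _; rewrite ltry.
apply: (measurableT_comp (@abse_measurable R _)).
by apply: measurable_funS mfE => //; apply: subset_itv; rewrite bnd_simp.
Qed.

(* Monotone convergence recovers the endpoint. *)
Lemma ac_limit a b F f : a < b -> {within `[a, b], continuous F} -> measurable_fun `[a, b] f ->
  (forall x, a <= x <= b -> 0 <= f x) -> (forall x, a <= x -> x < b -> ac a x F f) -> ac a b F f.
Proof.
move=> ab cF mf f0 H; have [M M0 HM] := within_bounded cF.
have If : iv a b f.
  apply: (@iv_of_bounded a b f (2 * M)) => // x ax xb; have Hx := H x ax xb.
  split; first by case: Hx.
  rewrite (ac_I ax Hx).
  have := HM x; rewrite ax ltW// => /(_ isT); have := HM a; rewrite lexx ltW// => /(_ isT).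
  by rewrite !ler_norml => /andP[? ?] /andP[? ?]; lra.
have E1 x : a <= x -> x < b -> F x = F a + I a x f.
  by move=> ax xb; rewrite (ac_I ax (H x ax xb)); ring.
have Eb : F b = F a + I a b f.
  have cI := ac_within (ac_indef If).
  apply/eqP; rewrite -subr_eq0 -normr_le0; apply/ler_addgt0Pl => e e0; rewrite addr0.
  have e2 : 0 < e / 2 by rewrite divr_gt0.
  have bab : a <= b <= b by rewrite lexx ltW.
  have [d1 d10 H1] := (within_ptP _ _ _).1 cF b _ bab e2.
  have [d2 d20 H2] := (within_ptP _ _ _).1 cI b _ bab e2.
  pose y := Num.max a (b - Num.min d1 d2 / 2).
  have m0 : 0 < Num.min d1 d2 by rewrite lt_min d10.
  have ay : a <= y by rewrite le_max lexx.
  have yb : y < b by rewrite gt_max ab/=; lra.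
  have ym : b - Num.min d1 d2 / 2 <= y by rewrite le_max lexx orbT.
  have yab : a <= y <= b by rewrite ay ltW.
  have yd : `|y - b| < Num.min d1 d2 by rewrite ltr0_norm; lra.
  move: yd; rewrite lt_min => /andP[yd1 yd2].
  have := H1 y yab yd1; have := H2 y yab yd2; rewrite (E1 y ay yb).
  by rewrite !ltr_norml ler_norml => /andP[? ?] /andP[? ?]; apply/andP; split; lra.
split => // x y ax xy yb.
have Ix : iv x y f by exact: iv_sub If.
have EE z : a <= z -> z <= b -> F z = F a + I a z f.
  by move=> az; rewrite le_eqVlt => /orP[/eqP ->|]; [exact: Eb|exact: E1].
rewrite (EE x ax (le_trans xy yb)) (EE y (le_trans ax xy) yb).
by rewrite (I_split ax xy); [ring|exact: iv_sub If].
Qed.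

End AbsContLimit.

(** * Passing to the limit in time difference quotients *)

Section FatouFlux.
Variable R : realType.
Implicit Types (q : R -> R) (Q Th k b : R -> R -> R) (x y t e : R).
Notation mu := (@lebesgue_measure R).

Lemma cont_I_upper b (A : R) : continuous (unc b) ->
  continuous (unc (fun x z => I A (Num.max z A) (b x))).
Proof.
move=> cb; apply/cont2P => x z e e0.
pose B := `|A| + `|z| + 2.
have AB : A < B by rewrite /B; have := ler_norm A; have := normr_ge0 z; lra.
have zB : z + 1 < B by rewrite /B; have := ler_norm z; have := normr_ge0 A; lra.
have [M M0 HM] := cont2_bounded (x - 1) (x + 1) A B cb.
have M1 : 0 < M + 1 by rewrite ltr_wpDl.
pose z1 := Num.max z A.
have Az1 : A <= z1 by rewrite le_max lexx orbT.
have cI : continuous (fun x => I A z1 (b x)) by apply: (I_param_cont (cont2_swap cb)).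
have e2 : 0 < e / 2 by rewrite divr_gt0.
have [d d0 Hd] := (contP _).1 cI x _ e2.
pose r := Num.min (Num.min d 1) (e / 2 / (M + 1)).
exists r; first by rewrite !lt_min d0 ltr01 divr_gt0.
move=> x' z'; rewrite !lt_min => /andP[/andP[xd x1] _] /andP[/andP[_ zz1] ze].
pose z2 := Num.max z' A.
have Az2 : A <= z2 by rewrite le_max lexx orbT.
have z12 : `|z2 - z1| < e / 2 / (M + 1).
  apply: le_lt_trans ze; rewrite /z1 /z2.
  have := ler_norm (z' - z); have := ler_norm (z - z'); rewrite distrC => h1 h2.
  by have [y0|y0] := leP z' A; have [x0|x0] := leP z A; rewrite ler_norml; apply/andP; split; lra.
have zb : z' < z + 1 by move: zz1; rewrite ltr_norml => /andP[_]; lra.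
have z1B : z1 <= B by rewrite ge_max; apply/andP; split; lra.
have z2B : z2 <= B by rewrite ge_max; apply/andP; split; lra.
have xr : x - 1 <= x' <= x + 1 by move: x1; rewrite ltr_norml => /andP[? ?]; apply/andP; split; lra.
have ib u v : iv u v (b x') by apply: iv_contT; exact: cont2_sec2.
have diff u v : A <= u -> u <= v -> v <= B -> `|I A v (b x') - I A u (b x')| <= M * (v - u).
  move=> Au uv vB; rewrite (I_split Au uv)// addrAC subrr add0r.
  apply: I_le_abs => // y /andP[uy yv]; apply: HM => //.
  by rewrite (le_trans Au uy) (le_trans yv vB).
have D1 : `|I A z2 (b x') - I A z1 (b x')| <= M * `|z2 - z1|.
  have [zz|/ltW zz] := leP z1 z2; first by rewrite (ger0_norm (_ : 0 <= z2 - z1)) ?subr_ge0// diff.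
  by rewrite distrC [`|z2 - z1|]distrC (ger0_norm (_ : 0 <= z1 - z2)) ?subr_ge0// diff.
have D2 : M * `|z2 - z1| < e / 2.
  apply: (@le_lt_trans _ _ ((M + 1) * `|z2 - z1|)); first by rewrite ler_wpM2r// lerDl.
  by rewrite mulrC -ltr_pdivlMr.
have D3 := Hd x' xd.
have -> : I A z2 (b x') - I A z1 (b x) = (I A z2 (b x') - I A z1 (b x')) + (I A z1 (b x') - I A z1 (b x)) by ring.
apply: (le_lt_trans (ler_normD _ _)); lra.
Qed.

(** The integral telescopes to increments of the primitive of [q] near [T2] and near [T1]. *)
Lemma mean_slope (q : R -> R) (T1 T2 e : R) : continuous q -> T1 <= T2 -> 0 < e ->
  exists2 d, 0 < d & forall tau, 0 < tau -> tau < d ->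
    I T1 T2 (fun t => (q t - q (t - tau)) / tau) <= q T2 - q T1 + e.
Proof.
move=> cq T12 e0; have e2 : 0 < e / 2 by rewrite divr_gt0.
have [d1 d10 H1] := is_derive_increment (is_derive_prim T1 cq) e2.
have [d2 d20 H2] := is_derive_increment (is_derive_prim T2 cq) e2.
exists (Num.min d1 d2); first by rewrite lt_min d10.
move=> tau t0; rewrite lt_min => /andP[td1 td2].
have cs : continuous (fun t => q (t - tau)).
  by apply: cont1_comp => //; apply: cont1B; [move=> ?; exact: cvg_id|exact: cont1c].
have Es : I T1 T2 (fun t => q (t - tau)) = prim q (T2 - tau) - prim q (T1 - tau).
  by have [_ ->//] := ac_smooth T1 T2 cs (fun x => dshift (is_derive_prim (x - tau) cq)).
have -> : I T1 T2 (fun t => (q t - q (t - tau)) / tau) =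
    ((prim q T2 - prim q T1) - (prim q (T2 - tau) - prim q (T1 - tau))) / tau.
  rewrite mulrC -Es -I_prim// -IB; [|exact: iv_contT|exact: iv_contT].
  rewrite -IZ; first by apply: I_ext => t _; rewrite mulrC.
  by apply: iv_contT; exact: cont1B.
rewrite ler_pdivrMr//.
have := H1 (T1 - tau); have := H2 (T2 - tau).
rewrite !(_ : forall u, u - tau - u = - tau); try by move=> u; ring.
rewrite normrN (gtr0_norm t0) => /(_ td2) + /(_ td1); rewrite !ler_norml => /andP[a1 a2] /andP[b1 b2].
move: a1 a2 b1 b2; set p1 := prim _ _; set p2 := prim _ _; set p3 := prim _ _; set p4 := prim _ _.
rewrite !mulrN; move=> a1 a2 b1 b2; rewrite mulrDl mulrBl; lra.
Qed.

Lemma measurable_to_rect (a b c d : R) (f : R -> R -> R) :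
  measurable_fun (`[a, b] `*` `[c, d]) (unc f) ->
  measurable_fun setT ((EFin \o unc f) \_ (`[a, b] `*` `[c, d] : set (R * R))).
Proof.
move=> mf; apply: (measurable_restrictT _ (measurable_rect a b c d)).1.
exact/measurable_EFinP.
Qed.

Lemma tonelli_leb2 (f : R * R -> \bar R) : measurable_fun setT f -> (forall z, (0 <= f z)%E) ->
  (\int[@leb2 R]_z f z = \int[mu]_x \int[mu]_t f (x, t))%E /\ measurable_fun setT (fun x => \int[mu]_t f (x, t))%E.
Proof.
move=> mf f0; split; first exact: (@fubini_tonelli1 _ _ _ _ R mu mu f mf f0).
exact: (@measurable_fun_fubini_tonelli_F _ _ _ _ R mu f mf f0).
Qed.

(* Fatou's lemma turns the difference quotients in time into the flux; only a bound from below on the flux and an upper bound on [k] are available. *)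
Lemma fatou_flux (l r T0 T1 T2 T3 c1 L0 : R) Q Th k q :
  T0 < T1 -> T1 <= T2 -> T2 < T3 -> continuous (unc Q) -> continuous q ->
  (\forall x \ae mu, l < x < r -> iv T0 T3 (Th x) /\
     forall t1 t2, T0 < t1 -> t1 <= t2 -> t2 < T3 -> Q x t2 - Q x t1 = I t1 t2 (Th x)) ->
  (forall x t1 t2, l <= x <= r -> T0 < t1 -> t1 <= t2 -> t2 < T3 -> - L0 * (t2 - t1) <= Q x t2 - Q x t1) ->
  measurable_fun (`[l, r] `*` `[T1, T2]) (unc Th) ->
  (forall x t, l <= x <= r -> T1 <= t <= T2 -> - L0 <= Th x t) ->
  int2 l r T1 T2 k -> (forall x t, l <= x <= r -> T1 <= t <= T2 -> k x t <= c1) ->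
  (\forall t \ae mu, T1 < t < T2 -> forall tau, 0 < tau -> tau < T1 - T0 ->
     I l r (fun x => (Q x t - Q x (t - tau)) * (c1 - k x t)) <= q t - q (t - tau)) ->
  int2 l r T1 T2 (fun x t => (Th x t + L0) * (c1 - k x t)) /\
  J2 l r T1 T2 (fun x t => (Th x t + L0) * (c1 - k x t)) <=
    q T2 - q T1 + L0 * J2 l r T1 T2 (fun x t => c1 - k x t).
Proof.
move=> T01 T12 T23 cQ cq HQ HL mTh ThL Ik kc Hq.
pose D : set (R * R) := `[l, r] `*` `[T1, T2].
have mD : measurable D by exact: measurable_rect.
pose tau j : R := (T1 - T0) / 2 / j.+1%:R.
have T010 : 0 < T1 - T0 by rewrite subr_gt0.
have T0h : 0 < (T1 - T0) / 2 by rewrite divr_gt0.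
have tau0 j : 0 < tau j by rewrite divr_gt0.
have tau1 j : tau j < T1 - T0.
  apply: (@le_lt_trans _ _ ((T1 - T0) / 2)); last by lra.
  by rewrite ler_pdivrMr// ler_peMr ?ler1n// ltW.
pose K x t := c1 - k x t.
have IK : int2 l r T1 T2 K by apply: int2B => //; exact: int2_cst.
have K0 x t : l <= x <= r -> T1 <= t <= T2 -> 0 <= K x t.
  by move=> h1 h2; rewrite subr_ge0 kc.
pose N j x t := (Q x t - Q x (t - tau j)) / tau j + L0.
have cN j : continuous (unc (N j)).
  apply: cont2D; last by apply: (cont2_1 (phi := fun=> L0)); exact: cont1c.
  apply: cont2M; last by apply: (cont2_1 (phi := fun=> (tau j)^-1)); exact: cont1c.
  apply: cont2B => //; apply/cont2P => x t e e0.
  have [d d0 Hd] := (cont2P _).1 cQ x (t - tau j) e e0.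
  exists d => // x' t' xx tt; apply: Hd => //.
  by rewrite (_ : t' - tau j - (t - tau j) = t' - t)//; ring.
pose f j x t := N j x t * K x t.
have If j : int2 l r T1 T2 (f j) by exact: int2_mulc.
have N0 j x t : l <= x <= r -> T1 <= t <= T2 -> 0 <= N j x t.
  move=> h1 /andP[h2 h3]; have t0 := tau0 j; have t1 := tau1 j.
  rewrite /N -lerBlDr sub0r ler_pdivlMr//.
  have := @HL x (t - tau j) t h1; rewrite subKr; apply; lra.
have f0 j x t : l <= x <= r -> T1 <= t <= T2 -> 0 <= f j x t.
  by move=> h1 h2; rewrite mulr_ge0 ?N0 ?K0.
pose Bd := q T2 - q T1 + L0 * J2 l r T1 T2 K.
have Jf j : J2 l r T1 T2 (f j) <= I T1 T2 (fun t => (q t - q (t - tau j)) / tau j) + L0 * J2 l r T1 T2 K.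
  have IKt : iv T1 T2 (fun t => L0 * I l r (K ^~ t)) by apply: ivZ; exact: fub_iv2.
  have Iq : iv T1 T2 (fun t => (q t - q (t - tau j)) / tau j).
    apply: iv_contT; apply: cont1M; last exact: cont1c.
    apply: cont1B => //; apply: cont1_comp => //.
    by apply: cont1B; [move=> ?; exact: cvg_id|exact: cont1c].
  rewrite /J2 -IZ; last exact: fub_iv2.
  rewrite -ID//; apply: I_ae_le; [exact: (fub_iv2 (If j))|exact: ivD|].
  have := aeI (ae_le_lt Hq) (aeI (fub_ae2 IK) (fub_ae2 (If j))).
  apply: aeS => t [h1 [h2 h3]] tt.
  have := h1 tt _ (tau0 j) (tau1 j); set X := I l r _ => HX.
  have -> : I l r (f j ^~ t) = X / tau j + L0 * I l r (K ^~ t).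
    have IX : iv l r (fun x => (Q x t - Q x (t - tau j)) * K x t).
      apply: iv_ext (ivB (ivZ (tau j) (h3 tt)) (ivZ (tau j * L0) (h2 tt))) => x _.
      by rewrite /f /N; field; rewrite gt_eqF.
    have -> : X / tau j = I l r (fun x => (tau j)^-1 * ((Q x t - Q x (t - tau j)) * K x t)).
      by rewrite IZ// mulrC.
    have -> : L0 * I l r (K ^~ t) = I l r (fun x => L0 * K x t) by rewrite IZ//; exact: h2.
    rewrite -ID; [|exact: ivZ|by apply: ivZ; exact: h2].
    by apply: I_ext => x _; rewrite /f /N /K; field; rewrite gt_eqF.
  by rewrite lerD2r ler_pM2r ?invr_gt0.
have Jlim e : 0 < e -> \forall j \near \oo, J2 l r T1 T2 (f j) <= Bd + e.
  move=> e0; have [d d0 Hd] := mean_slope cq T12 e0.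
  have [j0] := ltr_add_invr (divr_gt0 d0 T0h); rewrite add0r ltr_pdivlMr// mulrC => Hj0.
  exists j0 => // j /= jj; apply: (le_trans (Jf j)).
  have : tau j < d.
    apply: le_lt_trans Hj0; rewrite /tau ler_pM2l// lef_pV2 ?posrE//.
    by rewrite ler_nat.
  by move=> /(Hd _ (tau0 j)); rewrite /Bd; lra.
pose G x t := (Th x t + L0) * K x t.
have mG : measurable_fun D (unc G).
  apply: measurable_funM; last exact: int2_mes IK.
  by apply: measurable_funD => //; exact: measurable_cst.
have G0 x t : l <= x <= r -> T1 <= t <= T2 -> 0 <= G x t.
  by move=> h1 h2; rewrite mulr_ge0 ?K0// -lerBlDr sub0r ThL.
have Dxt (z : R * R) : D z -> l <= z.1 <= r /\ T1 <= z.2 <= T2.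
  by case: z => x t [] /=; rewrite !in_itv.
pose F j : R * R -> \bar R := EFin \o unc (f j).
have mF j : measurable_fun D (F j) by exact: measurable_int (If j).
have F0 j (z : R * R) : D z -> (0 <= F j z)%E by move=> /Dxt[h1 h2]; rewrite lee_fin f0.
pose LF (z : R * R) := limn_einf (F ^~ z).
have mLF : measurable_fun D LF.
  have Hc (z : R * R) : D z -> (fun n => einfs (F ^~ z) n) @ \oo --> LF z.
    by move=> _; rewrite /LF limn_einf_lim; exact: is_cvg_einfs.
  have He n : measurable_fun D (fun z => einfs (F ^~ z) n) by exact: measurable_fun_einfs.
  exact: (emeasurable_fun_cvg _ _ He Hc).
have LF0 (z : R * R) : D z -> (0 <= LF z)%E.
  move=> Dz; rewrite /LF limn_einf_lim; apply: lime_ge; first exact: is_cvg_einfs.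
  apply: nearW => n; apply: le_ereal_inf_tmp => _ [j _ <-]; exact: F0.
have step1 : (\int[@leb2 R]_(z in D) LF z <= Bd%:E)%E.
  apply: (le_trans (fatou (@leb2 R) mD mF F0)).
  apply/lee_addgt0Pr => e e0; rewrite -EFinD limn_einf_lim.
  apply: lime_le; first exact: is_cvg_einfs.
  have [j0 _ Hj0] := Jlim e e0; exists j0 => // j jj.
  apply: (@le_trans _ _ (\int[@leb2 R]_(z in D) F j z)%E); first by apply: ereal_inf_lbound; exists j => /=.
  by rewrite (J2E (If j)) lee_fin; exact: Hj0.
pose G' := (EFin \o unc G) \_ D; pose L' := LF \_ D.
have mG' : measurable_fun setT G' by exact: measurable_to_rect.
have mL' : measurable_fun setT L' by exact: (measurable_restrictT _ mD).1.
have G'0 (z : R * R) : (0 <= G' z)%E.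
  rewrite /G' patchE; case: ifPn => // ; rewrite inE => /Dxt[h1 h2]; by rewrite lee_fin G0.
have L'0 (z : R * R) : (0 <= L' z)%E.
  by rewrite /L' patchE; case: ifPn => // ; rewrite inE => Dz; exact: LF0.
(* The quotients converge at almost every [t] for almost every [x], so the two integrals are
   compared by iterated integration. *)
have step2 : (\int[@leb2 R]_(z in D) (EFin \o unc G) z <= \int[@leb2 R]_(z in D) LF z)%E.
  rewrite [leLHS]integral_mkcond [leRHS]integral_mkcond -/G' -/L'.
  have [-> mG1] := tonelli_leb2 mG' G'0; have [-> mL1] := tonelli_leb2 mL' L'0.
  apply: ae_ge0_le_integral => //.
  - by move=> x _; apply: integral_ge0.
  - by move=> x _; apply: integral_ge0.
  have := aeI HQ (aeI (ae_neq l) (ae_neq r)); apply: aeS => x [Hx [xl xr]] _.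
  apply: ae_ge0_le_integral => //.
  - exact: (measurableT_comp mG' (measurable_pair1 x)).
  - exact: (measurableT_comp mL' (measurable_pair1 x)).
  have [xx|nx] := boolP (l <= x <= r); last first.
    apply: aeW => t _; rewrite /G' /L' !patchE.
    have -> : ((x, t) \in D) = false by apply/negP; rewrite inE => /Dxt[/= h _]; rewrite h in nx.
    by [].
  have xo : l < x < r by move: xx => /andP[h1 h2]; rewrite !lt_neqAle h1 h2 eq_sym xl xr.
  have [ITh E] := Hx xo.
  have := ftc_ae ITh; apply: aeS => t Ht _.
  rewrite /G' /L' !patchE; case: ifPn => //; rewrite inE => Dz.
  have [h1 h2] := Dxt _ Dz.
  have t03 : T0 < t < T3.
    by move: h2 => /= /andP[h3 h4]; rewrite (lt_le_trans T01 h3) (le_lt_trans h4 T23).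
  have dI := Ht t03; have /andP[t0 t3] := t03.
  have cvN : (N j x t) @[j --> \oo] --> Th x t + L0.
    apply/cvgrPdist_lt => e e0.
    have e2 : 0 < e / 2 by rewrite divr_gt0.
    have [d d0 Hd] := is_derive_increment dI e2.
    have [j0] := ltr_add_invr (divr_gt0 d0 T0h); rewrite add0r ltr_pdivlMr// mulrC => Hj0.
    exists j0 => // j /= jj.
    have td : tau j < d.
      apply: le_lt_trans Hj0; rewrite /tau ler_pM2l// lef_pV2 ?posrE//.
      by rewrite ler_nat.
    have tj := tau0 j; have tj1 := tau1 j.
    have tjT : T0 < t - tau j by move: h2 => /= /andP[]; lra.
    have := Hd (t - tau j); rewrite (_ : t - tau j - t = - tau j); last by ring.
    rewrite normrN (gtr0_norm tj) => /(_ td).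
    have EI : I T0 t (Th x) - I T0 (t - tau j) (Th x) = Q x t - Q x (t - tau j).
      have h3 : t - tau j <= t by rewrite gerBl ltW.
      rewrite (E _ _ tjT h3 t3) (@I_split _ T0 (t - tau j) t) ?(ltW tjT)//; first by ring.
      by apply: iv_sub ITh => //; exact: ltW.
    have -> : I T0 (t - tau j) (Th x) - I T0 t (Th x) - Th x t * - tau j =
       (Th x t + L0 - N j x t) * tau j.
      by rewrite /N -EI; field; rewrite gt_eqF.
    rewrite normrM (gtr0_norm tj) ler_pM2r// => H; apply: (le_lt_trans H); lra.
  have cvf : (f j x t) @[j --> \oo] --> G x t by apply: cvgM => //; exact: cvg_cst.
  have cvF : (F j (x, t)) @[j --> \oo] --> (G x t)%:E by apply/cvg_EFin; [exact: nearW|exact: cvf].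
  by rewrite /LF (is_cvg_limn_einfE (cvgP _ cvF)) (cvg_lim _ cvF).
have bound := le_trans step2 step1.
have IG : int2 l r T1 T2 G.
  apply/integrableP; split; first exact/measurable_EFinP.
  apply: (@le_lt_trans _ _ (Bd%:E)); last exact: ltry.
  apply: le_trans bound; rewrite le_eqVlt; apply/orP; left; apply/eqP; apply: eq_integral.
  by move=> z; rewrite inE => /Dxt[h1 h2] /=; rewrite ger0_norm// G0.
split=> //; by rewrite -lee_fin -(J2E IG).
Qed.

End FatouFlux.

(** * The data of a wave and of an entire solution *)

Section Setting.
Variable R : realType.
Implicit Types (x y t e : R).
Notation mu := (@lebesgue_measure R).

(** What the rest of the proof uses about the wave. [L] is a Lipschitz constant of [h] on [[0, 1]],
    [kap] is [h(U)/(n P)], and the last field, the behaviour of [h(U)] far to the left, comes from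
    [h'(1) < 0]. *)
Record profile (n m c L PM rM : R) (h U kap : R -> R) : Prop := Profile {
  pr_n : 1 <= n; pr_m : 0 < m; pr_c : 0 < c; pr_L : 0 < L;
  pr_cU : continuous U;
  pr_Um : forall x y, x <= y -> U y <= U x;
  pr_U0 : forall x, 0 <= x -> U x = 0;
  pr_Up : forall x, x < 0 -> 0 < U x;
  pr_U1 : forall x, U x < 1;
  pr_lim : forall e, 0 < e -> exists A : R, forall y, y <= A -> `|U y - 1| < e;
  pr_dec : forall x y, x < y -> y <= 0 -> U y < U x;
  pr_ch : continuous (fun x => h (Num.max x 0)); pr_h0 : h 0 = 0;
  pr_hL : forall u v, 0 <= u -> u <= v -> v <= 1 -> `|h v - h u| <= L * (v - u);
  pr_P0 : forall y, y < 0 -> 0 < pres c h U y;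
  pr_PM : forall y, pres c h U y <= PM;
  pr_dW : forall y, is_derive y 1 (fun y => pw m (U y)) (- pw n^-1 (pres c h U y));
  pr_ck : continuous kap;
  pr_kP : forall y, y <= 0 -> kap y * pres c h U y = n^-1 * h (U y);
  pr_kge : forall y, y <= 0 -> - (n^-1 * L / c) <= kap y;
  pr_hn : forall y, y <= 0 -> - h (U y) <= L / c * pres c h U y;
  pr_rM : forall y, y <= 0 -> expR (prim kap y) <= rM;
  pr_hdec : exists A : R, forall x y, x <= y -> y <= A -> 0 <= h (U x) /\ h (U x) <= h (U y) }.

(* [z] is the coordinate in which [V = U(z)], and [s] is [|(V^m)_x|]. *)
Record entire (n m c C : R) (h U : R -> R) (V s z : R -> R -> R) : Prop := Entire {
  en_C : 0 < C; en_cV : continuous (unc V); en_flux : flux n m c h V s;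
  en_cz : continuous (unc z); en_z0 : forall x t, z x t <= 0;
  en_Uz : forall x t, U (z x t) = V x t;
  en_zm : forall x y t, x <= y -> z x t <= z y t;
  en_lo : forall x t, Num.min (x - C) 0 <= z x t;
  en_hi : forall x t, x <= - C -> z x t <= x + C }.

End Setting.

Lemma cont1N (R : realType) (F : R -> R) : continuous F -> continuous (fun x => - F x).
Proof. by move=> cf x; exact: (@cvgN _ _ _ _ _ F _ (cf x)). Qed.

(** * The slope of the pressure coordinate *)

Section Slope.
Variable R : realType.
Implicit Types (x y t e a b l r c d : R).
Notation mu := (@lebesgue_measure R).
Variables (n m c L PM rM C : R) (h U kap : R -> R) (V s z : R -> R -> R).
Hypotheses (W : profile n m c L PM rM h U kap) (E : entire n m c C h U V s z).
Notation P := (pres c h U).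

(* This is [z_x], see [ac_z]. *)
Definition sig x t := s x t * P (z x t) `^ (- n^-1).

Let n1 := pr_n W. Let m0 := pr_m W.
Let n0 : 0 < n. Proof. exact: lt_le_trans n1. Qed.
Let g0 : 0 < n^-1. Proof. by rewrite invr_gt0. Qed.
Let cU := pr_cU W.
Let cz := en_cz E.
Let z0 := en_z0 E.

Lemma flux_s_ge0 x t : 0 <= s x t. Proof. by case: (en_flux E). Qed.

Lemma sig_ge0 x t : 0 <= sig x t.
Proof. by rewrite mulr_ge0 ?flux_s_ge0 ?powR_ge0. Qed.

Lemma pres_zero y : 0 <= y -> P y = 0.
Proof. exact: (pres_npos _ (pr_U0 W) (pr_h0 W)). Qed.

Lemma pres_ge0 y : 0 <= P y.
Proof. by have [y0|y0] := leP 0 y; [rewrite pres_zero|exact/ltW/(pr_P0 W)]. Qed.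

Lemma presc : continuous P.
Proof. exact: pres_cont cU (pr_U0 W) (pr_Up W) (pr_ch W). Qed.

Lemma hU_cont : continuous (h \o U).
Proof. exact: comp_cont_halfline cU (pr_U0 W) (pr_Up W) (pr_ch W). Qed.

Lemma V_ge0 x t : 0 <= V x t.
Proof.
rewrite -(en_Uz E); have := z0 x t; rewrite le_eqVlt => /orP[/eqP ->|/(pr_Up W)/ltW//].
by rewrite (pr_U0 W).
Qed.

Lemma V_right x t : C <= x -> V x t = 0.
Proof.
move=> Cx; rewrite -(en_Uz E) (pr_U0 W)//; have := en_lo E x t.
by rewrite min_r ?subr_ge0.
Qed.

Lemma z_right x t : C <= x -> z x t = 0.
Proof.
move=> Cx; apply: le_anti; rewrite z0/=; have := en_lo E x t.
by rewrite min_r ?subr_ge0.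
Qed.

Lemma cz1 t : continuous (z ^~ t). Proof. exact: cont2_sec1. Qed.

Lemma Pz_cont : continuous (unc (fun x t => P (z x t))).
Proof. exact: (cont2_comp presc cz). Qed.

(** At [z = 0] one has [P(z) = 0], and zero to a nonzero power is zero: [sig] takes the default
    value [0], which is the right slope beyond the support. *)
Lemma sig_zero x t : z x t = 0 -> sig x t = 0.
Proof. by move=> zx; rewrite /sig zx pres_zero// powR0 ?mulr0// oppr_eq0 gt_eqF. Qed.

Lemma sig_div x t : z x t < 0 -> sig x t = s x t / pw n^-1 (P (z x t)).
Proof. by move=> zx; rewrite /sig powRN pwE// pres_ge0. Qed.

Lemma sig_pow x t : z x t < 0 -> pw n (s x t) = P (z x t) * pw n (sig x t).
Proof.
move=> zx; have Pz := pr_P0 W zx; rewrite !pwE ?sig_ge0 ?flux_s_ge0// /sig.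
rewrite powRM ?flux_s_ge0 ?powR_ge0// -powRrM mulNr mulVf ?gt_eqF//.
by rewrite powR_inv1 ?ltW// mulrCA mulfV ?mulr1// gt_eqF.
Qed.

Lemma V_pos x t : 0 < V x t -> z x t < 0.
Proof.
by move=> Vx; rewrite lt_neqAle z0 andbT; apply/eqP => zx; move: Vx; rewrite -(en_Uz E) zx (pr_U0 W) ?ltxx.
Qed.

Lemma V_zero x t : V x t = 0 -> z x t = 0.
Proof.
move=> Vx; apply: le_anti; rewrite z0/= leNgt; apply/negP => /(pr_Up W).
by rewrite (en_Uz E) Vx ltxx.
Qed.

Lemma V_mono x y t : x <= y -> V y t <= V x t.
Proof. by move=> xy; rewrite -!(en_Uz E); apply: (pr_Um W); exact: (en_zm E). Qed.

Let mneg_powR_meas : measurable_fun setT (fun x : R => x `^ (- n^-1)) := measurable_powR _.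

Lemma sig_measurable a b (c0 d : R) : measurable_fun (`[a, b] `*` `[c0, d]) (unc sig).
Proof.
have [_ Is _ _ _] := en_flux E.
apply: measurable_funM; first exact: int2_mes (Is a b c0 d).
by apply: (measurableT_comp mneg_powR_meas); apply: measurable_funTS; exact: cont2_mes Pz_cont.
Qed.

Lemma sig_meas1 a b t : iv a b (s ^~ t) -> measurable_fun `[a, b] (sig ^~ t).
Proof.
move=> Is; apply: measurable_funM; first exact: iv_mes Is.
apply: (measurableT_comp mneg_powR_meas); apply: measurable_funTS.
by apply: continuous_measurable_fun; exact: cont2_sec1 Pz_cont.
Qed.

(* Where [V > 0] invert [U]; the endpoint of the support is reached by monotone convergence. *)
Lemma ac_z_slice al be t a b : iv al be (s ^~ t) ->
  (forall a b, al < a -> a <= b -> b < be -> pw m (V a t) - pw m (V b t) = I a b (s ^~ t)) ->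
  al < a -> a <= b -> b < be -> ac a b (z ^~ t) (sig ^~ t).
Proof.
move=> Is HF ala ab bbe.
have cw : continuous (fun x => pw m (V x t)).
  by apply: cont1_comp; [exact: pw_cont|exact: cont2_sec1 (en_cV E)].
have pos y : a <= y -> y <= b -> 0 < V y t -> ac a y (z ^~ t) (sig ^~ t).
  move=> ay yb Vy.
  have Hneg x : a <= x <= y -> z x t < 0.
    by move=> /andP[ax xy]; apply: V_pos; apply: lt_le_trans Vy _; exact: V_mono.
  have Is' : iv a y (s ^~ t) by apply: iv_sub Is; [exact: ltW|exact: ltW (le_lt_trans yb bbe)].
  have Hw : ac a y ((fun y => pw m (U y)) \o (z ^~ t)) (fun x => - s x t).
    split; first exact: ivN.
    move=> u v au uv vy /=; rewrite !(en_Uz E).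
    have iuv : iv u v (s ^~ t) by apply: iv_sub Is'.
    rewrite I_N// -HF ?opprB//; first exact: lt_le_trans au.
    by apply: le_lt_trans bbe; exact: le_trans yb.
  have := @ac_inv R a y (z ^~ t) (fun y => pw m (U y)) (fun y => - pw n^-1 (P y)) (fun x => - s x t).
  move=> /(_ (continuous_subspaceT (@cz1 t)) Hw) H.
  have := H (fun x _ => pr_dW W _) _ _ => {}H.
  apply: ac_ext (H _ _) => //.
  - by move=> x xx; rewrite sig_div ?Hneg// invrN mulrNN.
  - apply: continuous_subspaceT; apply: cont1N.
    by apply: cont1_comp; [exact: pw_cont|apply: cont1_comp; [exact: presc|exact: cz1]].
  - by move=> x xx; rewrite oppr_eq0 gt_eqF// pw_gt0// (pr_P0 W)// Hneg.
have flat y y' : y <= y' -> V y t = 0 -> ac y y' (z ^~ t) (sig ^~ t).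
  move=> yy Vy.
  have zz x : y <= x <= y' -> z x t = 0.
    move=> /andP[yx _]; apply: V_zero; apply: le_anti; rewrite V_ge0 andbT -Vy.
    exact: V_mono.
  apply: ac_ext (ac_cst y y' 0) => x xx; first by rewrite zz.
  by rewrite sig_zero// zz.
have [Vb|Vb] := ltP 0 (V b t); first exact: pos.
have Vb0 : V b t = 0 by apply: le_anti; rewrite Vb V_ge0.
have [Va|Va] := ltP 0 (V a t); last first.
  by apply: flat => //; apply: le_anti; rewrite Va V_ge0.
pose S := [set x | a <= x /\ x <= b /\ 0 < V x t].
have Sa : S a by split => //; split.
have S0 : S !=set0 by exists a.
have Sb : ubound S b by move=> x [_ []].
have hS : has_sup S by split => //; exists b.
(* The edge of the support in [[a, b]]: [V > 0] before it and [V = 0] from it on. *)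
pose ze := sup S.
have aze : a <= ze by apply: ub_le_sup => //; exists b.
have zeb : ze <= b by exact: ge_sup.
have cV1 : continuous (V ^~ t) by exact: cont2_sec1 (en_cV E).
have below x : a <= x -> x < ze -> 0 < V x t.
  move=> ax xz; have e0 : 0 < ze - x by rewrite subr_gt0.
  have [w [_ [_ Vw]] ww] := sup_adherent e0 hS.
  by apply: (lt_le_trans Vw); apply: V_mono; move: ww; rewrite subKr => /ltW.
have Vze : V ze t = 0.
  apply: le_anti; rewrite V_ge0 andbT leNgt; apply/negP => Vz.
  have zb : ze < b.
    by rewrite lt_neqAle zeb andbT; apply/eqP => zeE; move: Vz; rewrite zeE Vb0 ltxx.
  have [d d0 Hd] := (contP _).1 cV1 ze _ Vz.
  pose y := Num.min b (ze + d / 2).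
  have zy : ze < y by rewrite lt_min zb ltrDl divr_gt0.
  have yb : y <= b by rewrite ge_min lexx.
  have yd : y <= ze + d / 2 by rewrite ge_min lexx orbT.
  have : S y.
    split; [exact: le_trans (ltW zy)|split => //].
    have : `|y - ze| < d by rewrite ger0_norm; lra.
    by move=> /Hd; rewrite ltr_norml => /andP[]; lra.
  by move=> /(ub_le_sup (ex_intro _ b Sb)); rewrite leNgt zy.
apply: (@ac_glue _ a ze b) => //; last exact: flat.
move: aze; rewrite le_eqVlt => /orP[/eqP aE|aze].
  by rewrite -aE in Vze; rewrite Vze ltxx in Va.
apply: ac_limit => //.
- exact: continuous_subspaceT (@cz1 t).
- apply: sig_meas1; apply: iv_sub Is; [exact: ltW|exact: ltW (le_lt_trans zeb bbe)].
- by move=> x _; exact: sig_ge0.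
- move=> x ax xz; apply: pos => //; [exact: le_trans (ltW xz) zeb|exact: below].
Qed.

(** For the last clause: [z = 0] holds on a right half-line, where [V^m] is constant, so the density
    [s] vanishes almost everywhere on it. *)
Lemma ac_z al be c0 d : \forall t \ae mu, c0 < t < d -> iv al be (s ^~ t) /\
  (forall a b, al < a -> a <= b -> b < be -> ac a b (z ^~ t) (sig ^~ t)) /\
  \forall x \ae mu, al < x < be -> z x t = 0 -> s x t = 0.
Proof.
have [_ _ _ HF _] := en_flux E.
have := HF al be c0 d; apply: aeS => t Ht tcd; have [Is H] := Ht tcd; split => //; split.
  by move=> a b; exact: ac_z_slice Is H.
pose S := [set x | al < x < be /\ z x t = 0].
have [[x1 Sx1]|nS] := pselect (exists x, S x); last first.
  by apply: aeW => x xx zx; exfalso; apply: nS; exists x.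
have hS : has_inf S by split; [exists x1|exists al => x [/andP[/ltW]]].
pose ze := inf S.
have I0 : \forall x \ae mu, ze <= x <= be -> s x t = 0.
  apply: ae_eq0_of_I.
    apply: iv_sub Is => //; rewrite /ze; apply: lb_le_inf; first by exists x1.
    by move=> x [/andP[/ltW]].
  move=> a b za ab bb.
  have e0 : 0 < a - ze by rewrite subr_gt0.
  have [w [/andP[w1 w2] w3] ww] := inf_adherent e0 hS.
  have wa : w <= a by move: ww; rewrite addrC subrK => /ltW.
  have V0 y : w <= y -> V y t = 0.
    move=> wy; rewrite -(en_Uz E) (pr_U0 W)//; have := en_zm E t wy; by rewrite w3.
  by rewrite -H ?(lt_le_trans w1 wa)// !V0 ?subrr// (le_trans wa ab).
apply: aeS I0 => x Hx /andP[x1' x2] zx; apply: Hx; rewrite (ltW x2) andbT.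
by apply: ge_inf; [case: hS|split => //; rewrite x1'].
Qed.

(** Tonelli's theorem. It serves [sig], which is controlled on time slices, through the increments
    of [z]. *)
Lemma int2_of_slices a b (c0 d : R) (f : R -> R -> R) M :
  measurable_fun (`[a, b] `*` `[c0, d]) (unc f) -> (forall x t, 0 <= f x t) ->
  (\forall t \ae mu, c0 < t < d -> iv a b (f ^~ t) /\ I a b (f ^~ t) <= M) -> int2 a b c0 d f.
Proof.
move=> mf f0 H.
have mD : measurable (`[a, b] `*` `[c0, d] : set (R * R)) by exact: measurable_rect.
pose g := (EFin \o unc f) \_ (`[a, b] `*` `[c0, d] : set (R * R)).
have mg : measurable_fun setT g by exact: measurable_to_rect.
have g_ge0 (w : R * R) : (0 <= g w)%E by rewrite /g patchE; case: ifP => _ //; rewrite lee_fin f0.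
apply/integrableP; split; first exact/measurable_EFinP.
have -> : (\int[@leb2 R]_(w in `[a, b] `*` `[c0, d]) `|(EFin \o unc f) w| = \int[@leb2 R]_w g w)%E.
  rewrite integral_mkcond; apply: eq_integral => w _; rewrite /g !patchE; case: ifP => // _.
  by apply: gee0_abs; rewrite lee_fin f0.
have -> : (\int[@leb2 R]_w g w = \int[mu]_t \int[mu]_x g (x, t))%E.
  exact: (@fubini_tonelli2 _ _ _ _ R mu mu g mg g_ge0).
pose k : R -> \bar R := (EFin \o (fun=> Num.max M 0)) \_ `[c0, d].
apply: (@le_lt_trans _ _ (\int[mu]_t k t)%E); last first.
  rewrite /k -integral_mkcond/= integral_cst//= lebesgue_measure_itv/=.
  by case: ifP => _; rewrite ?mule0 ?ltry// -EFinM ltry.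
apply: ae_ge0_le_integral => //.
- by move=> t _; apply: integral_ge0.
- exact: (@measurable_fun_fubini_tonelli_G _ _ _ _ R mu g mg g_ge0).
- by move=> t _; rewrite /k patchE; case: ifP => // _; rewrite lee_fin le_max lexx orbT.
- by apply: (measurable_restrictT _ (measurable_itv _)).1; exact: measurable_cst.
have := ae_le_lt H; apply: aeS => t Ht _.
have [tcd|ntcd] := boolP (c0 <= t <= d); last first.
  rewrite (_ : (\int[mu]_x g (x, t))%E = 0%E); first by apply: erestrict_ge0 => y _; rewrite lee_fin le_max lexx orbT.
  apply: integral0_eq => x _; rewrite /g patchE.
  have -> : ((x, t) \in (`[a, b] `*` `[c0, d] : set (R * R))) = false.
    by apply/negP; rewrite inE => -[_] /=; rewrite in_itv/= => h1; rewrite h1 in ntcd.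
  by [].
have [If IM] := Ht tcd.
have -> : (\int[mu]_x g (x, t) = \int[mu]_(x in `[a, b]) (f x t)%:E)%E.
  rewrite [RHS]integral_mkcond; apply: eq_integral => x _; rewrite /g !patchE.
  have -> // : ((x, t) \in (`[a, b] `*` `[c0, d] : set (R * R))) = (x \in (`[a, b]%classic : set R)).
  by apply/idP/idP; rewrite !inE/= !in_itv/= ?tcd; [case|].
have := fineK (@integrable_fin_num _ _ _ mu _ (measurable_itv _) _ If) => <-.
by rewrite /k patchE mem_setE in_itv/= tcd lee_fin le_max -[X in X <= M]/(I a b (f ^~ t)) IM.
Qed.

Lemma z_diff_le a b t : a <= b -> b <= C -> z b t - z a t <= b - a + 2 * C.
Proof.
move=> ab bC; have Cp := en_C E; have lo := en_lo E a t.
have hi : z b t <= b + C.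
  have [/(en_hi E)//|bC'] := leP b (- C); apply: (le_trans (z0 b t)); lra.
have : a - C <= z a t by apply: le_trans lo; rewrite le_min lexx; lra.
lra.
Qed.

Lemma int2_sig l r c0 d : l <= r -> r <= C -> int2 l r c0 d sig.
Proof.
move=> lr rC; apply: (@int2_of_slices _ _ _ _ _ (r - l + 2 * C)).
- exact: sig_measurable.
- exact: sig_ge0.
have := ac_z (l - 1) (r + 1) c0 d; apply: aeS => t Ht tcd; have [_ [Ha _]] := Ht tcd.
have := Ha l r; rewrite !(_ : forall u : R, u - 1 < u) ?(_ : forall u : R, u < u + 1); try by move=> u; lra.
move=> /(_ isT lr isT) H; split; first by case: H.
by rewrite (ac_I lr H) z_diff_le.
Qed.

End Slope.

(** * The general monotonicity inequality *)

Section GeneralInequality.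
Variable R : realType.
Implicit Types (x y t e a b l r : R).
Notation mu := (@lebesgue_measure R).

Lemma cont2_graph (g a : R -> R -> R) : continuous (unc g) -> continuous (unc a) ->
  continuous (unc (fun x t => g x (a x t))).
Proof.
move=> cg ca; apply/cont2P => x t e e0.
have [d d0 Hd] := (cont2P _).1 cg x (a x t) e e0.
have [r r0 Hr] := (cont2P _).1 ca x t d d0.
exists (Num.min d r); first by rewrite lt_min d0.
move=> x' t'; rewrite !lt_min => /andP[h1 h2] /andP[_ h3]; apply: Hd => //; exact: Hr.
Qed.

Lemma ae_cont_le (g : R -> R) l r k : l < r -> continuous g ->
  (\forall x \ae mu, l < x < r -> k <= g x) -> forall x, l <= x <= r -> k <= g x.
Proof.
move=> lr cg H x /andP[lx xr]; rewrite leNgt; apply/negP => gk.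
have e0 : 0 < k - g x by rewrite subr_gt0.
have [d d0 Hd] := (contP _).1 cg x _ e0.
have ab : Num.max l (x - d) < Num.min r (x + d).
  by rewrite lt_min !gt_max; apply/andP; split; apply/andP; split; lra.
have H2 : \forall y \ae mu, Num.max l (x - d) < y < Num.min r (x + d) -> k <= g y.
  apply: aeS H => y Hy; rewrite lt_min gt_max => /andP[/andP[h1 h2] /andP[h3 h4]].
  by apply: Hy; rewrite h1.
have [y] := ae_ex ab H2; rewrite lt_min gt_max => /andP[/andP[h1 h2] /andP[h3 h4]] ky.
have : `|y - x| < d by rewrite ltr_norml; apply/andP; split; lra.
by move=> /Hd; rewrite ltr_norml => /andP[]; lra.
Qed.

Variables (n m c L PM rM C : R) (h U kap : R -> R) (V s z : R -> R -> R).
Hypotheses (W : profile n m c L PM rM h U kap) (E : entire n m c C h U V s z).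
Notation P := (pres c h U).
Notation sig := (sig n c h U s z).

Let cz := en_cz E.
Let z0 := en_z0 E.
Let cV := en_cV E.

Lemma hV_cont : continuous (unc (fun x t => h (V x t))).
Proof.
have -> : (fun x t => h (V x t)) = (fun x t => (h \o U) (z x t)).
  by apply/funext => x; apply/funext => t /=; rewrite (en_Uz E).
exact: (cont2_comp (hU_cont W) cz).
Qed.

Lemma V_le1 x t : V x t <= 1.
Proof. by rewrite -(en_Uz E) ltW// (pr_U1 W). Qed.

Lemma h_bound u : 0 <= u <= 1 -> `|h u| <= L.
Proof.
move=> /andP[u0 u1]; have := pr_hL W (lexx 0) u0 u1; rewrite (pr_h0 W) !subr0 => /le_trans -> //.
by rewrite ler_piMr// ltW// (pr_L W).
Qed.

Lemma hV_bound x t : `|h (V x t)| <= L.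
Proof. by apply: h_bound; rewrite (V_ge0 W E) V_le1. Qed.

(** On [[l, C]] this is the integral of [v] from [x] to [C]; the cut at [l] makes it jointly
    continuous on the whole plane. *)
Definition tailI l (v : R -> R -> R) x t := I l C (v ^~ t) - I l (Num.max x l) (v ^~ t).

Lemma tailI_cont l v : continuous (unc v) -> continuous (unc (tailI l v)).
Proof.
move=> cv; apply: cont2B; first by apply: (cont2_2 (phi := fun t => I l C (v ^~ t))); exact: I_param_cont.
have := @cont_I_upper R (fun t x => v x t) l (cont2_swap cv); exact: (@cont2_swap R (fun t z0 => I l (Num.max z0 l) (v ^~ t))).
Qed.

Lemma tailIE l v x t : continuous (unc v) -> l <= x -> x <= C -> tailI l v x t = I x C (v ^~ t).
Proof.
move=> cv lx xC; rewrite /tailI max_l// (I_split lx xC); first by rewrite addrAC subrr add0r.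
by apply: iv_contT; exact: cont2_sec1.
Qed.

Lemma ac_tailI l r v t : continuous (unc v) -> ac l r (tailI l v ^~ t) (fun x => - v x t).
Proof.
move=> cv; have iv1 : iv l r (v ^~ t) by apply: iv_contT; exact: cont2_sec1.
apply: ac_ext (acB (ac_cst l r (I l C (v ^~ t))) (ac_indef iv1)) => x xx.
  by rewrite /tailI max_l//; case/andP: xx.
by rewrite sub0r.
Qed.

(** Formally the space density of the time derivative of the integral of [Psi(x, z)] after
    integration by parts: first the diffusion, then the reaction. For [lam = 1/n] the bracket of the
    reaction has a double zero at [sig = 1]. *)
Definition GIterm (th lam : R) (rho f f1 : R -> R) x t :=
  rho (z x t) * (f1 (x - th * z x t) * P (z x t) * (pw n (sig x t) - 1) * (1 - th * sig x t) +
   f (x - th * z x t) * h (V x t) * ((1 - sig x t) + lam * sig x t * (pw n (sig x t) - 1))).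

Lemma z_range x t : Num.min (x - C) 0 <= z x t <= Num.min 0 (x + C).
Proof.
rewrite (en_lo E) le_min z0/=; have [/(en_hi E)//|xC] := leP x (- C).
by apply: (le_trans (z0 x t)); rewrite -lerBlDr sub0r ltW.
Qed.

Lemma flux_arith (a1 l0 Q1 Q2 K X F m1 m2 : R) : a1 * (Q2 - Q1) + l0 * K = X + F ->
  F <= a1 * Q2 - m2 - (a1 * Q1 - m1) + l0 * K -> m2 - m1 <= X.
Proof. by move=> h1 h2; lra. Qed.

Definition weight (th : R) (rho f : R -> R) x t := rho (z x t) * f (x - th * z x t).

Definition weight_x (th : R) (k0 rho f f1 : R -> R) x t :=
  rho (z x t) * (f1 (x - th * z x t) * (1 - th * sig x t)) +
  f (x - th * z x t) * (k0 (z x t) * rho (z x t) * sig x t).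

(** For [x] in [[l, C]], formally the time derivative of the integral of [V] from [x] to [C]. *)
Definition flux_density l x t := pw n (s x t) - c * V x t + tailI l (fun x t => h (V x t)) x t.

Lemma shifted_cont th : continuous (unc (fun x t => x - th * z x t)).
Proof.
apply: cont2B; first by apply: (cont2_1 (phi := id)) => x; exact: cvg_id.
by apply: cont2M => //; apply: (cont2_1 (phi := fun=> th)); exact: cont1c.
Qed.

Lemma ac_weight (th : R) (k0 rho f f1 : R -> R) l r t : continuous k0 -> (forall y, is_derive y 1 rho (k0 y * rho y)) ->
  continuous f1 -> (forall y, is_derive y 1 f (f1 y)) -> ac l r (z ^~ t) (sig ^~ t) ->
  ac l r (weight th rho f ^~ t) (weight_x th k0 rho f f1 ^~ t).
Proof.
move=> ck0 drho cf1 df acz.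
have crho : continuous rho by move=> y; exact: is_derive_cont (drho y).
have cz' : continuous (z ^~ t) by exact: cont2_sec1.
have a1 : ac l r (fun x => rho (z x t)) (fun x => k0 (z x t) * rho (z x t) * sig x t).
  apply: (@ac_comp _ l r (z ^~ t) (sig ^~ t) rho (fun y => k0 y * rho y)) => //.
  by apply: continuous_subspaceT; apply: cont1M; exact: cont1_comp.
have a2 : ac l r (fun x => f (x - th * z x t)) (fun x => f1 (x - th * z x t) * (1 - th * sig x t)).
  apply: (@ac_comp _ l r (fun x => x - th * z x t) (fun x => 1 - th * sig x t) f f1) => //.
    by apply: acB; [exact: ac_id|exact: acZ].
  apply: continuous_subspaceT; apply: cont1_comp => //; exact: (@cont2_sec1 R (fun x t => x - th * z x t) t (@shifted_cont th)).
exact: (acM a1 a2).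
Qed.

(* Integration by parts against [J], the integral of [h(V)] from [x] to [C] minus that of [h(U)] from [z] to [0]: the flux differs from [J] by [P(z) (sig^n - 1)], and [J_x = - h(V) (1 - sig)]. *)
Lemma slice_identity (th lam : R) (k0 rho f f1 : R -> R) l r t : l < r -> r <= C ->
  continuous k0 -> (forall y, is_derive y 1 rho (k0 y * rho y)) ->
  continuous f1 -> (forall y, is_derive y 1 f (f1 y)) ->
  (forall y, y <= 0 -> k0 y * P y = lam * h (U y)) ->
  f (l - th * z l t) = 0 -> (r = C \/ f (r - th * z r t) = 0) ->
  ac l r (z ^~ t) (sig ^~ t) -> (\forall x \ae mu, l < x < r -> z x t = 0 -> s x t = 0) ->
  iv l r (fun x => flux_density l x t * weight_x th k0 rho f f1 x t) ->
  exists G, [/\ iv l r G, \forall x \ae mu, l < x < r -> G x = GIterm th lam rho f f1 x t &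
    I l r (fun x => flux_density l x t * weight_x th k0 rho f f1 x t) = I l r G].
Proof.
move=> lr rC ck0 drho cf1 df kP bl br acz Hs ITk.
have cz' : continuous (z ^~ t) by exact: cont2_sec1.
pose psi := weight th rho f ^~ t; pose k := weight_x th k0 rho f f1 ^~ t.
have acp : ac l r psi k by exact: ac_weight.
pose H x := tailI l (fun x t => h (V x t)) x t.
pose J x := H x + prim (h \o U) (z x t).
pose jd x := - h (V x t) + h (V x t) * sig x t.
have acJ : ac l r J jd.
  apply: acD; first by apply: ac_tailI; exact: hV_cont.
  have := @ac_comp _ l r (z ^~ t) (sig ^~ t) (prim (h \o U)) (h \o U) acz
    (fun x _ => is_derive_prim (z x t) (hU_cont W)) (continuous_subspaceT (cont1_comp (hU_cont W) cz')).
  by apply: ac_ext => // x _ /=; rewrite (en_Uz E).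
have [IJk FE] := acM acp acJ.
have Jr : psi r * J r = 0.
  case: br => [rE|fr]; last by rewrite /psi /weight fr mulr0 mul0r.
  rewrite /J /H tailIE// ?(ltW lr)//; last exact: hV_cont.
  by rewrite (z_right E) ?rE// prim0 Iaa addr0 mulr0.
have := FE l r (lexx _) (ltW lr) (lexx _); rewrite Jr sub0r /psi /weight bl mulr0 mul0r oppr0 => I0.
exists (fun x => flux_density l x t * k x - (psi x * jd x + J x * k x)); split.
- exact: ivB.
- apply: aeS Hs => x Hx xx.
  have eqn : flux_density l x t = P (z x t) * (pw n (sig x t) - 1) + J x.
    rewrite /flux_density /J /H.
    have cVz : c * V x t = P (z x t) - prim (h \o U) (z x t) by rewrite /pres (en_Uz E) addrK.
    rewrite cVz; have := z0 x t; rewrite le_eqVlt => /orP[/eqP zx|zx]; last by rewrite (sig_pow W E zx); ring.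
    rewrite Hx// zx (pres_zero W)// pw_npos//; first by ring.
    by rewrite gt_eqF// (lt_le_trans ltr01 (pr_n W)).
  rewrite eqn /GIterm /k /weight_x /psi /weight /jd.
  have kz := kP _ (z0 x t); rewrite (en_Uz E) in kz.
  transitivity (rho (z x t) * (f1 (x - th * z x t) * P (z x t) * (pw n (sig x t) - 1) * (1 - th * sig x t)) +
    f (x - th * z x t) * rho (z x t) * ((k0 (z x t) * P (z x t)) * sig x t * (pw n (sig x t) - 1) + h (V x t) * (1 - sig x t))); first by ring.
  by rewrite kz; ring.
- by rewrite IB// -I0 subr0.
Qed.

(** The hypothesis on [Psi] and integration by parts bound the increment of the functional over
    [[t - tau, t]] by the integral of [k] times the increment of [Q], where [Q] is the integral of
    [V] from [x] to [C] and [k] the [x]-derivative of the weight. As [k <= c1] and the flux is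
    bounded below, [fatou_flux] lets [tau] tend to [0], and [slice_identity] rewrites the limit. The
    sign of [rho (k0 f - th f1)] says that the weight decreases in [z]. *)
Lemma general_inequality (l r T0 T1 T2 T3 th lam c1 : R) (k0 rho f f1 : R -> R) (Psi B : R -> R -> R) :
  l < r -> r <= C -> T0 < T1 -> T1 <= T2 -> T2 < T3 ->
  continuous k0 -> (forall y, is_derive y 1 rho (k0 y * rho y)) ->
  continuous f1 -> (forall y, is_derive y 1 f (f1 y)) ->
  (forall y, y <= 0 -> k0 y * P y = lam * h (U y)) ->
  (forall x y, l <= x <= r -> Num.min (x - C) 0 <= y <= Num.min 0 (x + C) ->
     rho y * (k0 y * f (x - th * y) - th * f1 (x - th * y)) <= 0) ->
  (forall x y, l <= x <= r -> Num.min (x - C) 0 <= y <= Num.min 0 (x + C) -> rho y * f1 (x - th * y) <= c1) ->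
  (forall t, T0 < t < T3 -> f (l - th * z l t) = 0) ->
  (r = C \/ forall t, T0 < t < T3 -> f (r - th * z r t) = 0) ->
  continuous (unc Psi) ->
  (forall x y1 y2, l <= x <= r -> Num.min (x - C) 0 <= y1 <= Num.min 0 (x + C) -> Num.min (x - C) 0 <= y2 <= Num.min 0 (x + C) ->
     Psi x y2 - Psi x y1 <= rho y2 * f (x - th * y2) * (U y2 - U y1)) ->
  int2 l r T1 T2 B ->
  (\forall t \ae mu, T1 < t < T2 -> forall G, iv l r G -> ac l r (z ^~ t) (sig ^~ t) ->
     (\forall x \ae mu, l < x < r -> G x = GIterm th lam rho f f1 x t) -> I l r G <= I l r (B ^~ t)) ->
  I l r (fun x => Psi x (z x T2)) - I l r (fun x => Psi x (z x T1)) <= J2 l r T1 T2 B.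
Proof.
move=> lr rC T01 T12 T23 ck0 drho cf1 df kP Hneg Hc1 bl br cPsi HPsi IB2 HB.
have lC : l < C by exact: lt_le_trans rC.
have crho : continuous rho by move=> y; exact: is_derive_cont (drho y).
have cf : continuous f by move=> y; exact: is_derive_cont (df y).
pose mm t := I l r (fun x => Psi x (z x t)).
have cPz : continuous (unc (fun x t => Psi x (z x t))) by exact: cont2_graph.
have cmm : continuous mm by exact: I_param_cont.
pose Q := tailI l V.
have cQ : continuous (unc Q) by exact: tailI_cont.
pose H := tailI l (fun x t => h (V x t)).
have cH : continuous (unc H) by apply: tailI_cont; exact: hV_cont.
pose Th := flux_density l.
have ccV : continuous (unc (fun x t => c * V x t)).
  by apply: cont2M => //; apply: (cont2_1 (phi := fun=> c)); exact: cont1c.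
have [_ _ Isn _ F2] := en_flux E.
have ITh : int2 l r T1 T2 Th by apply: int2D; [apply: int2B; [exact: Isn|exact: int2_cont]|exact: int2_cont].
have HQ : \forall x \ae mu, l < x < r -> iv T0 T3 (Th x) /\
     forall t1 t2, T0 < t1 -> t1 <= t2 -> t2 < T3 -> Q x t2 - Q x t1 = I t1 t2 (Th x).
  have := F2 T0 T3 C (fun x t Cx _ => V_right W E t Cx) l lC; apply: aeS => x Hx /andP[lx xr].
  have xC : x < C by exact: lt_le_trans rC.
  have [Is E1] := Hx (introT andP (conj lx xC)); split.
    apply: ivD; last by apply: iv_contT; exact: cont2_sec2.
    by apply: ivB => //; apply: iv_contT; exact: cont2_sec2 ccV.
  move=> t1 t2 h1 h2 h3; rewrite /Q !tailIE// ?(ltW lx) ?(ltW xC)// E1//.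
  by apply: I_ext => t _; rewrite /Th /flux_density tailIE ?(ltW lx) ?(ltW xC)//; exact: hV_cont.
(* Lower bound for the flux density: [s^n >= 0], [c V <= c], and the integral of [h(V)] over a
   subinterval of [[l, C]] is at most [L (C - l)] in absolute value. *)
pose L0 := c + L * (C - l).
have Cl0 : 0 <= C - l by rewrite subr_ge0 ltW.
have HH x t : l <= x -> x <= C -> `|H x t| <= L * (C - l).
  move=> lx xC; rewrite /H tailIE//; last exact: hV_cont.
  apply: (@le_trans _ _ (L * (C - x))).
    apply: I_le_abs => //; first by apply: iv_contT; exact: cont2_sec1 hV_cont.
    by move=> y _; exact: hV_bound.
  by rewrite ler_wpM2l ?(ltW (pr_L W))// lerD2l lerN2.
have ThL x t : l <= x -> x <= C -> - L0 <= Th x t.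
  move=> lx xC; have := HH x t lx xC; rewrite ler_norml => /andP[h1 _].
  have : c * V x t <= c by rewrite ler_piMr ?V_le1// ltW// (pr_c W).
  by have := pw_ge0 n (s x t); rewrite /Th /flux_density /L0 -/(H x t); lra.
have HL x t1 t2 : l <= x <= r -> T0 < t1 -> t1 <= t2 -> t2 < T3 -> - L0 * (t2 - t1) <= Q x t2 - Q x t1.
  move=> xlr h1 h2 h3.
  apply: (@ae_cont_le (fun x => Q x t2 - Q x t1) l r (- L0 * (t2 - t1)) lr _ _ x xlr).
    by apply: cont1B; exact: cont2_sec1 cQ.
  apply: aeS HQ => y Hy yy; have [ITy Ey] := Hy yy; rewrite Ey// -I_cst//.
  apply: I_le; [exact: iv_cst|by apply: iv_sub ITy; exact: ltW|].
  by move=> t _; case/andP: yy => /ltW ly /ltW yr; apply: ThL => //; exact: le_trans rC.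
pose psi := weight th rho f.
pose k := weight_x th k0 rho f f1.
have cY := @shifted_cont th.
have crz : continuous (unc (fun x t => rho (z x t))) by exact: (cont2_comp crho cz).
have ckz : continuous (unc (fun x t => k0 (z x t))) by exact: (cont2_comp ck0 cz).
have cfY : continuous (unc (fun x t => f (x - th * z x t))) by exact: (cont2_comp cf cY).
have cf1Y : continuous (unc (fun x t => f1 (x - th * z x t))) by exact: (cont2_comp cf1 cY).
have cpsi : continuous (unc psi) by exact: cont2M.
have Ik : int2 l r T1 T2 k.
  have Is := int2_sig W E T1 T2 (ltW lr) rC.
  have c1' : continuous (unc (fun x t => rho (z x t) * f1 (x - th * z x t))) by exact: cont2M.
  have c2' : continuous (unc (fun x t => f (x - th * z x t) * (k0 (z x t) * rho (z x t)) - th * (rho (z x t) * f1 (x - th * z x t)))).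
    apply: cont2B; first by apply: cont2M => //; exact: cont2M.
    by apply: cont2M => //; apply: (cont2_1 (phi := fun=> th)); exact: cont1c.
  apply: int2_ext (int2D (int2_cont l r T1 T2 c1') (int2_mulc c2' Is)) => x t _ _.
  by rewrite /k /weight_x; ring.
(* No bound on [sig] is available; its coefficient in [k] is nonpositive by [Hneg], so [k] is still
   bounded above. *)
have kc1 x t : l <= x <= r -> T1 <= t <= T2 -> k x t <= c1.
  move=> xx _; have zz := z_range x t.
  have -> : k x t = rho (z x t) * f1 (x - th * z x t) +
     sig x t * (rho (z x t) * (k0 (z x t) * f (x - th * z x t) - th * f1 (x - th * z x t))).
    by rewrite /k /weight_x; ring.
  have := Hc1 x _ xx zz; have := mulr_ge0_le0 (sig_ge0 E x t) (Hneg x _ xx zz); lra.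
pose q t := c1 * I l r (Q ^~ t) - mm t.
have cq : continuous q.
  by apply: cont1B => //; apply: cont1M; [exact: cont1c|exact: I_param_cont].
have ac_psi t : ac l r (z ^~ t) (sig ^~ t) -> ac l r (psi ^~ t) (k ^~ t) by exact: ac_weight.
have brV t v : T0 < t < T3 -> (r = C -> v = 0) -> v * psi r t = 0.
  move=> tt vC; case: br => [rC'|H0]; first by rewrite vC ?mul0r.
  by rewrite /psi /weight H0// !mulr0.
have Q_C t : r = C -> Q r t = 0.
  by move=> rE; rewrite /Q tailIE ?(ltW lr)// rE Iaa.
have aczt := ac_z W E (l - 1) (r + 1) T0 T3.
have good : \forall t \ae mu, T0 < t < T3 -> ac l r (z ^~ t) (sig ^~ t) /\
    \forall x \ae mu, l < x < r -> z x t = 0 -> s x t = 0.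
  apply: aeS aczt => t Ht tt; have [_ [Ha Hs]] := Ht tt; split.
    by apply: Ha; [lra|exact: ltW|lra].
  apply: aeS Hs => x Hx /andP[h1 h2]; apply: Hx; apply/andP; split; lra.
have Hq : \forall t \ae mu, T1 < t < T2 -> forall tau, 0 < tau -> tau < T1 - T0 ->
     I l r (fun x => (Q x t - Q x (t - tau)) * (c1 - k x t)) <= q t - q (t - tau).
  have := aeI good (fub_ae2 Ik); apply: aeS => t [Hg Hk] /andP[t1 t2] tau tau0 tauT.
  have tt : T0 < t < T3 by apply/andP; split; lra.
  have [acz _] := Hg tt; have acp := ac_psi t acz.
  have ikt : iv l r (k ^~ t) by apply: Hk; rewrite !ltW.
  pose dQ x := Q x t - Q x (t - tau).
  have cdQ : continuous dQ by apply: cont1B; exact: cont2_sec1 cQ.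
  have acQ : ac l r dQ (fun x => - V x t - - V x (t - tau)) by apply: acB; exact: ac_tailI.
  have [Iab FE] := acM acp acQ.
  have := FE l r (lexx _) (ltW lr) (lexx _).
  have -> : psi l t * dQ l = 0 by rewrite /psi /weight bl// mulr0 mul0r.
  have -> : psi r t * dQ r = 0.
    by rewrite mulrC brV// => rE; rewrite /dQ !Q_C// subrr.
  rewrite subrr => FE0.
  have ipV : iv l r (fun x => psi x t * (V x t - V x (t - tau))).
    apply: iv_contT; apply: cont1M; first exact: cont2_sec1 cpsi.
    by apply: cont1B; exact: cont2_sec1 cV.
  have iQk : iv l r (fun x => dQ x * k x t) by apply: iv_mulc => //; exact: continuous_subspaceT.
  (* Integration by parts, [-V] being the [x]-derivative of [Q]; the boundary terms vanish with the
     weight or, at [C], with [Q]. *)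
  have E1 : I l r (fun x => psi x t * (V x t - V x (t - tau))) = I l r (fun x => dQ x * k x t).
    apply/eqP; rewrite eq_sym -subr_eq0 -IB//; apply/eqP; rewrite [RHS]FE0.
    by apply: I_ext => x _; ring.
  have iPs t' : iv l r (fun x => Psi x (z x t')) by apply: iv_contT; exact: cont2_sec1 cPz.
  have E2 : mm t - mm (t - tau) <= I l r (fun x => psi x t * (V x t - V x (t - tau))).
    rewrite /mm -IB//; apply: I_le => //; first exact: ivB.
    move=> x xx; rewrite -!(en_Uz E); apply: HPsi => //; exact: z_range.
  have idQ : iv l r dQ by exact: iv_contT.
  have -> : I l r (fun x => (Q x t - Q x (t - tau)) * (c1 - k x t)) = c1 * I l r dQ - I l r (fun x => dQ x * k x t).
    rewrite -IZ// -IB//; last exact: ivZ.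
    by apply: I_ext => x _; rewrite /dQ; ring.
  have -> : q t - q (t - tau) = c1 * I l r dQ - (mm t - mm (t - tau)).
    rewrite /q /dQ (IB (f := Q ^~ t)); [ring|by apply: iv_contT; exact: cont2_sec1 cQ|by apply: iv_contT; exact: cont2_sec1 cQ].
  by rewrite lerD2l lerN2 -E1.
have [IF JF] := fatou_flux T01 T12 T23 cQ cq HQ HL (int2_mes ITh)
   (fun x t xx _ => ThL x t (proj1 (andP xx)) (le_trans (proj2 (andP xx)) rC)) Ik kc1 Hq.
have IK : int2 l r T1 T2 (fun x t => c1 - k x t) by apply: int2B => //; exact: int2_cst.
pose Tk x t := Th x t * k x t.
have IA : int2 l r T1 T2 (fun x t => c1 * Th x t + L0 * (c1 - k x t)).
  by apply: int2D; exact: int2Z.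
have ITk : int2 l r T1 T2 Tk.
  by apply: int2_ext (int2B IA IF) => x t _ _; rewrite /Tk; ring.
have JTh : J2 l r T1 T2 Th = I l r (Q ^~ T2) - I l r (Q ^~ T1).
  rewrite J2_swap// -IB; [|by apply: iv_contT; exact: cont2_sec1 cQ|by apply: iv_contT; exact: cont2_sec1 cQ].
  apply: I_ae_eq; [exact: fub_iv1 ITh|by apply: iv_contT; apply: cont1B; exact: cont2_sec1 cQ|].
  have := ae_le_lt HQ; by apply: aeS => x Hx xx; have [_ Ex] := Hx xx; rewrite Ex.
have JTk : mm T2 - mm T1 <= J2 l r T1 T2 Tk.
  have E3 : J2 l r T1 T2 (fun x t => c1 * Th x t + L0 * (c1 - k x t)) =
     J2 l r T1 T2 Tk + J2 l r T1 T2 (fun x t => (Th x t + L0) * (c1 - k x t)).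
    by rewrite -(J2D ITk IF); apply: J2_ext => x t _ _; rewrite /Tk; ring.
  rewrite J2D in E3; [|exact: int2Z|exact: int2Z].
  rewrite (J2Z c1 ITh) (J2Z L0 IK) JTh in E3.
  exact: (flux_arith E3 JF).
apply: (le_trans JTk); rewrite /J2; apply: I_ae_le; [exact: fub_iv2 ITk|exact: fub_iv2 IB2|].
have := aeI (aeI (ae_neq T1) (ae_neq T2)) (aeI HB (aeI good (fub_ae2 ITk))).
apply: aeS => t [[tT1 tT2] [Hb [Hg HTk]]] tt.
have tt' : T1 < t < T2 by case/andP: tt => h1 h2; rewrite !lt_neqAle h1 h2 eq_sym tT1 tT2.
have tt3 : T0 < t < T3 by case/andP: tt' => h1 h2; rewrite (lt_trans T01 h1) (lt_trans h2 T23).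
have [acz Hs] := Hg tt3.
have br' : r = C \/ f (r - th * z r t) = 0 by case: br => [->|H0]; [left|right; exact: H0].
have [G [IG GE ->]] := slice_identity lr rC ck0 drho cf1 df kP (bl t tt3) br' acz Hs (HTk tt).
exact: Hb.
Qed.

End GeneralInequality.

(** * Elementary inequalities for powers *)

Section Algebra.
Variable R : realType.
Implicit Types (a x y n : R).

(** Young's inequality with exponents [1/a] and [1/(1 - a)]. *)
Lemma bernoulli_powR a y : 0 <= a -> a < 1 -> 0 <= y -> y `^ a <= 1 + a * (y - 1).
Proof.
move=> a0 a1 y0; move: a0; rewrite le_eqVlt => /orP[/eqP <-|a0]; first by rewrite powRr0 mul0r addr0.
have b0 : 0 < 1 - a by rewrite subr_gt0.
have := @conjugate_powR R (y `^ a) 1 a^-1 (1 - a)^-1 (powR_ge0 _ _) ler01.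
rewrite !invr_gt0 !invrK => /(_ a0 b0); rewrite mulr1 powR1 -powRrM mulfV ?gt_eqF// powRr1//.
by move=> H; apply: (le_trans (H _)); [ring|lra].
Qed.

Variable n : R.
Hypothesis n1 : 1 <= n.
Let n0 : 0 < n. Proof. exact: lt_le_trans n1. Qed.

Lemma pw_sub1_sign x : 0 <= x -> 0 <= (1 - x) * (1 - pw n x).
Proof.
move=> x0; rewrite !pwE//; have e1 : (1 : R) `^ n = 1 by rewrite powR1.
have n0' := ltW n0; have [x1|/ltW x1] := leP x 1.
  by rewrite mulr_ge0// subr_ge0// -[leRHS]e1 ge0_ler_powR// nnegrE.
by rewrite mulr_le0// subr_le0// -[leLHS]e1 ge0_ler_powR// nnegrE.
Qed.

Lemma dist1_le_pw x : 0 <= x -> `|1 - x| <= `|1 - pw n x|.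
Proof.
move=> x0; rewrite pwE//; have [x1|/ltW x1] := leP x 1.
  have H : x `^ n <= x.
    have [->|xn] := eqVneq x 0; first by rewrite powR0// gt_eqF.
    by apply: ge1r_powR => //; rewrite lt_neqAle eq_sym xn x0.
  by rewrite !ger0_norm ?subr_ge0// ?lerD2l ?lerN2//; exact: le_trans x1.
have H : x <= x `^ n by apply: le1r_powR.
rewrite ler0_norm ?subr_le0// ler0_norm ?subr_le0//; last exact: le_trans H.
by rewrite lerN2 lerD2l lerN2.
Qed.

(* [p >= 2] enters here, through the concavity of [y^(1/n)]. *)
Lemma reaction_defect x : 0 <= x ->
  0 <= (1 - x) + n^-1 * x * (pw n x - 1) /\
  (1 - x) + n^-1 * x * (pw n x - 1) <= (1 - x) * (1 - pw n x).
Proof.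
move=> x0; rewrite pwE//; have g0 : 0 < n^-1 by rewrite invr_gt0.
have g1 : n^-1 <= 1 by rewrite invf_le1.
have xx : x * x `^ n = x `^ (n + 1).
  by rewrite -[n in LHS](_ : (n + 1) - 1 = n) ?mulr_powRB1 ?addr_gt0//; ring.
split.
  have b1 : n^-1 / (1 + n^-1) < 1 by rewrite ltr_pdivrMr ?mul1r ?ltrDr//; lra.
  have b0 : 0 <= n^-1 / (1 + n^-1) by rewrite divr_ge0//; lra.
  (* The exponent is [1/(n + 1)], applied to [x^(n+1)]; this is the lower bound. The upper bound
     uses the exponent [1 - 1/n] on [x^n]. *)
  have := bernoulli_powR b0 b1 (powR_ge0 x (n + 1)).
  rewrite -powRrM (_ : (n + 1) * (n^-1 / (1 + n^-1)) = 1); last first.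
    by field; rewrite !gt_eqF// addr_gt0.
  rewrite powRr1// -xx => H.
  have p0 : 0 < 1 + n^-1 by lra.
  move: H; rewrite -(ler_pM2l p0).
  have -> : (1 + n^-1) * (1 + n^-1 / (1 + n^-1) * (x * x `^ n - 1)) = 1 + n^-1 * (x * x `^ n).
    by field; rewrite !gt_eqF// addr_gt0.
  by move=> H; rewrite -subr_ge0 in H; apply: le_trans H _; rewrite le_eqVlt; apply/orP; left; apply/eqP; ring.
have c0 : 0 <= 1 - n^-1 by lra.
have c1 : 1 - n^-1 < 1 by lra.
have := bernoulli_powR c0 c1 (powR_ge0 x n).
rewrite -powRrM (_ : n * (1 - n^-1) = n - 1); last by field; rewrite gt_eqF.
move=> H; have := ler_wpM2l x0 H; rewrite mulr_powRB1// => {}H.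
rewrite -subr_ge0; rewrite -subr_ge0 in H; apply: le_trans H _.
rewrite le_eqVlt; apply/orP; left; apply/eqP; ring.
Qed.

(** The truncation at [1] keeps the growth of order [x^n], so that [P(z) dissip(sig)] is integrable
    together with the flux; the full product [(1 - x)(1 - x^n)] grows like [x^(n+1)]. *)
Definition dissip x : R := `|pw n x - 1| * Num.min `|1 - x| 1.

Lemma dissip_ge0 x : 0 <= dissip x.
Proof. by rewrite mulr_ge0// le_min normr_ge0 ler01. Qed.

Lemma dissip_le x : 0 <= x -> dissip x <= (1 - x) * (1 - pw n x).
Proof.
move=> x0; rewrite -[leRHS]ger0_norm ?pw_sub1_sign// normrM mulrC [`|1 - pw n x|]distrC.
by rewrite /dissip ler_wpM2l// ge_min lexx.
Qed.

Lemma dissip_le_pw x : dissip x <= `|pw n x - 1|.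
Proof. by rewrite /dissip ler_piMr// ge_min lexx orbT. Qed.

Lemma pw_le_dissip x : 0 <= x -> `|pw n x - 1| <= pw n 2 + 1 + dissip x.
Proof.
move=> x0; have p2 := pw_ge0 n 2; have d0 := dissip_ge0 x.
have [x2|/ltW x2] := leP x 2.
  have : pw n x <= pw n 2 by rewrite pw_le// ltW.
  have := pw_ge0 n x; rewrite ler_norml => h1 h2; apply/andP; split; lra.
rewrite /dissip min_r; first by rewrite mulr1; lra.
by rewrite ler0_norm; lra.
Qed.

(** Split at the threshold [d]: beyond it the truncated factor of [dissip] is at least [d], and the
    other one is at least [|1 - x|] since [n >= 1]. *)
Lemma dist1_le_dissip d x : 0 < d -> d <= 1 -> 0 <= x -> `|1 - x| <= d + dissip x / d.
Proof.
move=> d0 d1 x0; have h0 := dissip_ge0 x.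
have [xd|/ltW xd] := leP `|1 - x| d; first by rewrite (le_trans xd)// lerDl divr_ge0// ltW.
suff : `|1 - x| <= dissip x / d by move=> ?; rewrite (le_trans (y := dissip x / d))// lerDr ltW.
rewrite ler_pdivlMr// /dissip; have H := dist1_le_pw x0; rewrite distrC in H; rewrite [`|pw n x - 1|]distrC.
have H2 : `|1 - x| <= `|1 - pw n x| by rewrite [`|1 - x|]distrC.
apply: ler_pM => //; first exact: ltW.
by rewrite le_min xd.
Qed.

End Algebra.

(** * Potentials whose derivative is [U'] times a weight *)

Section Potential.
Variable R : realType.
Implicit Types (x y t e a b l r A : R).
Notation mu := (@lebesgue_measure R).
Variables (n m c L PM rM : R) (h U kap : R -> R).
Hypotheses (W : profile n m c L PM rM h U kap).
Notation P := (pres c h U).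
Notation u := (slope n m c h U).

Let m0 := pr_m W.
Let n0 : 0 < n. Proof. exact: lt_le_trans (pr_n W). Qed.
Let cP : continuous P := presc W.
Let cU := pr_cU W.

Lemma slope_nonneg y : 0 <= u y.
Proof. by rewrite /slope !mulr_ge0 ?powR_ge0// ?pw_ge0// invr_ge0 ltW. Qed.

(** The slope may be unbounded at the edge, so the identity is proved on [[A, y]] with [y < 0] and
    extended to [0] by monotone convergence. *)
Lemma ac_profile A : A < 0 -> ac A 0 U (fun y => - u y).
Proof.
move=> A0.
have cW : continuous (fun y => pw m (U y)) by apply: cont1_comp => //; exact: pw_cont.
have cPg : continuous (fun y => pw n^-1 (P y)).
  by apply: cont1_comp => //; apply: pw_cont; rewrite invr_gt0.
have H y : A <= y -> y < 0 -> ac A y U (fun y => - u y).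
  move=> Ay y0.
  have acW : ac A y (fun y => pw m (U y)) (fun y => - pw n^-1 (P y)).
    by apply: ac_smooth; [exact: cont1N|exact: (pr_dW W)].
  have pos x : A <= x <= y -> 0 < pw m (U x).
    by move=> /andP[_ xy]; rewrite pw_gt0// (pr_Up W)// (le_lt_trans xy).
  have := @ac_comp _ A y _ _ (pw m^-1) (fun w => m^-1 * w `^ (m^-1 - 1)) acW.
  move=> /(_ (fun x xx => is_derive_pw m^-1 (pos x xx))) H.
  apply: ac_ext (H _) => [x _|x _|].
  - by rewrite /= pw_inv//; have [x0|/(pr_Up W)/ltW//] := leP 0 x; rewrite (pr_U0 W).
  - by rewrite /slope; ring.
  apply/within_ptP => x e xx e0.
  have cx : {for x, continuous (fun x => m^-1 * pw m (U x) `^ (m^-1 - 1))}.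
    have D := @dC _ (fun w => m^-1 * w `^ (m^-1 - 1)) (fun y => pw m (U y)) x _ _
      (dZ m^-1 (is_derive1_powR (m^-1 - 1) (pos x xx))) (pr_dW W x).
    exact: is_derive_cont D.
  have /cvgrPdist_lt /(_ e e0) [d /= d0 Hd] := cx.
  by exists d => // w _ wx; rewrite distrC; apply: Hd; rewrite /ball_/= distrC.
have acN : ac A 0 (fun y => - U y) u.
  apply: ac_limit => //.
  - by apply: continuous_subspaceT; exact: cont1N.
  - apply: measurable_funM; last by apply: measurable_funTS; exact: continuous_measurable_fun.
    apply: measurable_funM; first exact: measurable_cst.
    apply: (measurableT_comp (measurable_powR _)); apply: measurable_funTS.
    exact: continuous_measurable_fun.
  - by move=> x _; exact: slope_nonneg.
  - move=> x Ax x0; apply: ac_ext (acZ (-1) (H x Ax x0)) => y _; first by rewrite mulN1r.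
    by rewrite mulN1r opprK.
by apply: ac_ext (acZ (-1) acN) => y _; rewrite mulN1r// opprK.
Qed.

Lemma iv_slope A : A < 0 -> iv A 0 u.
Proof. by move=> /ac_profile[Iu _]; apply: iv_ext (ivN Iu) => x _; rewrite opprK. Qed.

Lemma I_slope a b : a <= b -> b <= 0 -> I a b u = U a - U b.
Proof.
move=> ab b0; move: ab; rewrite le_eqVlt => /orP[/eqP ->|ab]; first by rewrite Iaa subrr.
have a0 := lt_le_trans ab b0; have [Iu FE] := ac_profile a0.
have iu : iv a b u by apply: iv_sub (iv_slope a0).
rewrite -opprB FE ?(ltW ab)// -I_N; last by apply: iv_sub Iu.
by apply: I_ext => x _; rewrite opprK.
Qed.

(* A primitive in [y] of [U' psi], integrated by parts so that no derivative of [U] occurs. *)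
Definition PsiA A (psi psiy : R -> R -> R) x y :=
  U y * psi x y - I A (Num.max y A) (fun w => U w * psiy x w).

Lemma PsiA_cont A psi psiy : continuous (unc psi) -> continuous (unc psiy) ->
  continuous (unc (PsiA A psi psiy)).
Proof.
move=> c1 c2; apply: cont2B; first by apply: cont2M => //; exact: cont2_2.
apply: (@cont_I_upper R (fun x w => U w * psiy x w) A); apply: cont2M => //; exact: cont2_2.
Qed.

Lemma PsiA_incr A (psi psiy : R -> R -> R) x y1 y2 : continuous (psiy x) ->
  (forall y, is_derive y 1 (psi x) (psiy x y)) ->
  A <= y1 -> y1 <= y2 -> y2 <= 0 ->
  PsiA A psi psiy x y2 - PsiA A psi psiy x y1 = - I y1 y2 (fun w => u w * psi x w).
Proof.
move=> cpy dpsi Ay1; rewrite le_eqVlt => /orP[/eqP ->|y12] y20; first by rewrite Iaa oppr0 subrr.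
have y10 := lt_le_trans y12 y20.
have cpsi : continuous (psi x) by move=> y; exact: is_derive_cont (dpsi y).
have acU : ac y1 y2 U (fun y => - u y) by apply: ac_sub (ac_profile y10).
have acp : ac y1 y2 (psi x) (psiy x) by exact: ac_smooth.
have [IM FE] := acM acU acp.
have i1 a b : iv a b (fun w => U w * psiy x w) by apply: iv_contT; exact: cont1M.
have iu : iv y1 y2 (fun w => u w * psi x w).
  by apply: iv_ext (iv_mulc (continuous_subspaceT cpsi) (iv_sub (lexx _) y20 (iv_slope y10))) => w _; exact: mulrC.
have := FE y1 y2 (lexx _) (ltW y12) (lexx _).
have -> : I y1 y2 (fun w => U w * psiy x w + psi x w * - u w) = I y1 y2 (fun w => U w * psiy x w) - I y1 y2 (fun w => u w * psi x w).
  by rewrite -IB//; apply: I_ext => w _; ring.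
rewrite /PsiA max_l; last exact: le_trans (ltW y12).
rewrite max_l// (@I_split _ A y1 y2)// ?(ltW y12)//.
move=> H.
transitivity (U y2 * psi x y2 - U y1 * psi x y1 - I y1 y2 (fun w => U w * psiy x w)); first by ring.
by rewrite H; ring.
Qed.

Lemma nonincreasing_of_derive (g g' : R -> R) a b : a <= b -> (forall y, is_derive y 1 g (g' y)) ->
  (forall y, a <= y <= b -> g' y <= 0) -> g b <= g a.
Proof.
move=> ab dg g0; move: ab; rewrite le_eqVlt => /orP[/eqP ->//|ab].
rewrite -lerN2; apply: (@le_of_derive _ a b (fun y => - g y) (fun y => - g' y)) => //.
- by apply: continuous_subspaceT; apply: cont1N => y; exact: is_derive_cont (dg y).
- by move=> x /andP[h1 h2]; rewrite oppr_ge0 g0// !ltW.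
Qed.

(* The tangent-line inequality for [Psi], whose [y]-derivative is [U' psi] with [psi] nonincreasing in [y]. *)
Lemma PsiA_convex A (psi psiy : R -> R -> R) x y1 y2 : continuous (psiy x) ->
  (forall y, is_derive y 1 (psi x) (psiy x y)) ->
  A <= y1 -> A <= y2 -> y1 <= 0 -> y2 <= 0 ->
  (forall y, Num.min y1 y2 <= y <= Num.max y1 y2 -> psiy x y <= 0) ->
  PsiA A psi psiy x y2 - PsiA A psi psiy x y1 <= psi x y2 * (U y2 - U y1).
Proof.
move=> cpy dpsi A1 A2 y10 y20 neg.
have cpsi : continuous (psi x) by move=> y; exact: is_derive_cont (dpsi y).
have [->|yne] := eqVneq y1 y2; first by rewrite !subrr mulr0.
have iup a b : a < b -> b <= 0 -> iv a b (fun w => u w * psi x w) /\ iv a b u.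
  move=> ab b0; have iu : iv a b u by apply: iv_sub (iv_slope (lt_le_trans ab b0)).
  by split=> //; apply: iv_ext (iv_mulc (continuous_subspaceT cpsi) iu) => w _; exact: mulrC.
have [y12|y21|E] := ltgtP y1 y2; last by rewrite E eqxx in yne.
  have [i1 i2] := iup _ _ y12 y20; rewrite min_l ?(ltW y12)// max_r ?(ltW y12)// in neg.
  rewrite PsiA_incr ?(ltW y12)// -opprB -(I_slope (ltW y12) y20) mulrN lerN2 -IZ//.
  apply: I_le => //; first exact: ivZ.
  move=> w /andP[w1 w2]; rewrite mulrC ler_wpM2l ?slope_nonneg//.
  apply: (@nonincreasing_of_derive (psi x) (psiy x)) => // y /andP[g1 g2]; apply: neg.
  by rewrite (le_trans w1 g1).
have [i1 i2] := iup _ _ y21 y10; rewrite min_r ?(ltW y21)// max_l ?(ltW y21)// in neg.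
rewrite -opprB PsiA_incr ?(ltW y21)// opprK -(I_slope (ltW y21) y10) -IZ//.
apply: I_le => //; first exact: ivZ.
move=> w /andP[w1 w2]; rewrite mulrC ler_wpM2r ?slope_nonneg//.
apply: (@nonincreasing_of_derive (psi x) (psiy x)) => // y /andP[g1 g2]; apply: neg.
by rewrite g1 (le_trans g2 w2).
Qed.

End Potential.

(** * The Lyapunov functional *)

Section Weights.
Variable R : realType.
Implicit Types (x y t e a b l r : R).

Definition psi2 (th : R) (rho f : R -> R) x y := rho y * f (x - th * y).
Definition psi2y (th : R) (k0 rho f f1 : R -> R) x y := rho y * (k0 y * f (x - th * y) - th * f1 (x - th * y)).

Lemma is_derive_psi2 (th : R) (k0 rho f f1 : R -> R) x y : (forall y, is_derive y 1 rho (k0 y * rho y)) ->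
  (forall y, is_derive y 1 f (f1 y)) ->
  is_derive y 1 (psi2 th rho f x) (psi2y th k0 rho f f1 x y).
Proof.
move=> drho df.
have D1 : is_derive y 1 (fun y => f (x - th * y)) (- th * f1 (x - th * y)).
  have D := @daff _ f x (- th) y (f1 (x - th * y)).
  rewrite mulNr in D; have {}D := D (df _).
  by apply: is_derive_near D; exists 1 => // w _; rewrite mulNr.
by apply: (is_derive_eq (dM (drho y) D1)); rewrite /psi2y; ring.
Qed.

Lemma psi2_cont (th : R) (rho f : R -> R) : continuous rho -> continuous f -> continuous (unc (psi2 th rho f)).
Proof.
move=> cr cf; apply: cont2M; first exact: cont2_2.
apply: (cont2_comp (f := fun x y => x - th * y) cf); apply: cont2B.
  by apply: (cont2_1 (phi := id)) => x; exact: cvg_id.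
by apply: (cont2_2 (phi := fun y => th * y)); apply: cont1M; [exact: cont1c|move=> x; exact: cvg_id].
Qed.

Lemma psi2y_cont (th : R) (k0 rho f f1 : R -> R) : continuous k0 -> continuous rho -> continuous f -> continuous f1 ->
  continuous (unc (psi2y th k0 rho f f1)).
Proof.
move=> ck cr cf cf1.
have c1 := @psi2_cont th _ _ (cont1M cr ck) cf.
have c2 := @psi2_cont th _ _ (cont1M (@cont1c R th) cr) cf1.
have := cont2B c1 c2.
have -> // : unc (fun x t => psi2 th (fun y => rho y * k0 y) f x t - psi2 th (fun y => th * rho y) f1 x t) =
  unc (psi2y th k0 rho f f1).
by apply/funext => -[x' y']; rewrite /unc/= /psi2 /psi2y; ring.
Qed.

Lemma is_derive_rho (k : R -> R) y : continuous k -> is_derive y 1 (fun y => expR (prim k y)) (k y * expR (prim k y)).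
Proof.
move=> ck; have := @dC _ (@expR R) (prim k) y _ _ (is_derive_expR _) (is_derive_prim y ck).
by rewrite mulrC.
Qed.

(** On a window where [max(x, 0)] is at most [q] this gives [f <= (q/r) f'] for the power [f] of
    exponent [r]: the diffusion term, with [f'], beats the reaction term, with [f], once [r] is
    large. *)
Lemma pw_split r x : 0 < r -> pw r x = Num.max x 0 * pw (r - 1) x.
Proof. by move=> r0; rewrite /pw mulr_powRB1// le_max lexx orbT. Qed.

Lemma is_derive_pw_pos r b x : 1 < r -> is_derive x 1 (fun v => pw r (v - b)) (r * pw (r - 1) (x - b)).
Proof. by move=> r1; apply: dshift; exact: is_derive_pw1. Qed.

Lemma is_derive_pw_neg r b x : 1 < r -> is_derive x 1 (fun v => - pw r (b - v)) (r * pw (r - 1) (b - x)).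
Proof.
move=> r1; have D := @daff _ (pw r) b (- 1) x (r * pw (r - 1) (b - x)).
rewrite mulN1r in D; have := dN (D (is_derive_pw1 _ r1)); rewrite mulN1r opprK => {}D.
by apply: is_derive_near D; exists 1 => // w _; rewrite mulN1r.
Qed.

End Weights.

(** [F] and [F1] stand for [-f] and [f'], [X] for [sig^n]. The diffusion gives [- F1 p D] with
    [D = (1 - sig)(1 - X)]; the reaction is at most half of that, because [F <= q F1] and
    [lc q <= 1/2]; the tilt adds at most [e F1 p sig], which is bounded through [s]. *)
Lemma lyapunov_pointwise (R : realType) (r r1 F F1 p k X sg g ds hv sv e q lc B1 : R) :
  0 <= r -> r <= r1 -> 0 <= F -> F <= q * F1 -> 0 <= F1 -> F1 <= B1 -> 0 <= p -> 0 <= sg -> 0 <= X ->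
  0 <= (1 - sg) + g * sg * (X - 1) -> (1 - sg) + g * sg * (X - 1) <= (1 - sg) * (1 - X) ->
  ds <= (1 - sg) * (1 - X) -> - hv <= lc * p -> 0 <= lc -> lc * q <= 2^-1 ->
  p * sg <= k * sv -> 0 <= k -> 0 <= sv -> 0 <= e ->
  r * (F1 * p * (X - 1) * (1 - (1 + e) * sg) + - F * hv * ((1 - sg) + g * sg * (X - 1))) <=
  - 2^-1 * (r * F1 * (p * ds)) + e * (r1 * B1 * k) * sv.
Proof.
move=> r0 rr F0 FB f0 fb p0 sg0 X0 G0 GD Dd hn lc0 lq Ps k0 s0 e0.
move: G0 GD Dd; set D := (1 - sg) * _; set Gd := (1 - sg) + _ => G0 GD Dd.
have D0 : 0 <= D by exact: le_trans G0 GD.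
have t1 : - hv * (F * Gd) <= (lc * p) * (F * D).
  apply: (@le_trans _ _ (lc * p * (F * Gd))); first by rewrite ler_wpM2r// mulr_ge0.
  by rewrite ler_wpM2l ?mulr_ge0// ler_wpM2l.
have t2 : (lc * p) * (F * D) <= 2^-1 * (F1 * p * D).
  apply: (@le_trans _ _ (lc * p * ((q * F1) * D))).
    by rewrite ler_wpM2l ?mulr_ge0// ler_wpM2r.
  have -> : lc * p * (q * F1 * D) = (lc * q) * (F1 * p * D) by ring.
  have FpD : 0 <= F1 * p * D by apply: mulr_ge0 => //; exact: mulr_ge0.
  by rewrite ler_wpM2r.
have t3 : (X - 1) * (1 - (1 + e) * sg) <= - D + e * sg.
  have : 0 <= e * sg * X by rewrite !mulr_ge0.
  have -> : (X - 1) * (1 - (1 + e) * sg) = - D + e * sg - e * sg * X by rewrite /D; ring.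
  lra.
have t4 : F1 * p * ((X - 1) * (1 - (1 + e) * sg)) <= F1 * p * (- D + e * sg).
  by rewrite ler_wpM2l// mulr_ge0.
have t5 : r * (F1 * (p * sg)) <= r1 * B1 * k * sv.
  rewrite -[leRHS]mulrA -[leRHS]mulrA; apply: ler_pM => //; first by rewrite !mulr_ge0.
  by apply: ler_pM => //; rewrite mulr_ge0.
have t6 : F1 * p * ds <= F1 * p * D by rewrite ler_wpM2l// mulr_ge0.
apply: (@le_trans _ _ (r * (- (2^-1 * (F1 * p * ds)) + e * (F1 * (p * sg))))).
  rewrite ler_wpM2l//.
  have -> : F1 * p * (X - 1) * (1 - (1 + e) * sg) + - F * hv * Gd =
    F1 * p * ((X - 1) * (1 - (1 + e) * sg)) + - hv * (F * Gd) by ring.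
  apply: (le_trans (lerD t4 (le_trans t1 t2))).
  have -> : F1 * p * (- D + e * sg) + 2^-1 * (F1 * p * D) =
    - (2^-1 * (F1 * p * D)) + e * (F1 * (p * sg)) by field.
  by rewrite lerD2r lerN2 ler_wpM2l// invr_ge0.
have -> : r * (- (2^-1 * (F1 * p * ds)) + e * (F1 * (p * sg))) =
   - 2^-1 * (r * F1 * (p * ds)) + e * (r * (F1 * (p * sg))) by ring.
by rewrite lerD2l -[leRHS]mulrA ler_wpM2l.
Qed.

Section LyapunovStep.
Variable R : realType.
Implicit Types (x y t e a b l r : R).
Notation mu := (@lebesgue_measure R).
Variables (n m c L PM rM C : R) (h U kap : R -> R) (V s z : R -> R -> R).
Hypotheses (W : profile n m c L PM rM h U kap) (E : entire n m c C h U V s z).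
Notation P := (pres c h U).
Notation sig := (sig n c h U s z).

Let cz := en_cz E.
Let z0 := en_z0 E.
Let n1 := pr_n W.
Let n0 : 0 < n. Proof. exact: lt_le_trans n1. Qed.
Let g0 : 0 < n^-1. Proof. by rewrite invr_gt0. Qed.
Let C0 := en_C E.
Let c0 := pr_c W.
Let L0 := pr_L W.

(** One unit more than [C]: for [x <= C] one has [x - z <= C], so the base [bp - (x - z)] of the
    untilted weight is at least [1]. *)
Definition bp := C + 1.
(** Each summand has its task: the first makes the weight continuously differentiable, the second
    makes the reaction at most half of the diffusion, the third makes the weight nonincreasing in
    [z]. *)
Definition jM := 2 + 2 * (bp + C) * L / c + (bp + C) * n^-1 * L / c.
Definition rho y := expR (prim kap y).
(** The minus sign makes the potential, with derivative [U' rho fM], nondecreasing in [z]. *)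
Definition fM v := - pw jM (bp - v).
Definition fM1 v := jM * pw (jM - 1) (bp - v).
Definition dis x t := P (z x t) * dissip n (sig x t).
(** Cost of the tilt per unit of [e]: a bound for [rho fM1] times the constant of [Psig_le]. *)
Definition s_weight := rM * (jM * pw (jM - 1) (bp + C)) * (1 + PM).

Let bpC : 0 < bp + C. Proof. by rewrite /bp; have := C0; lra. Qed.

Lemma jM_ge : 2 <= jM /\ (2 * (bp + C) * L / c <= jM /\ (bp + C) * n^-1 * L / c <= jM).
Proof.
have h1 : 0 <= 2 * (bp + C) * L / c by rewrite divr_ge0 ?mulr_ge0// ?(ltW bpC)// ltW.
have h2 : 0 <= (bp + C) * n^-1 * L / c by rewrite divr_ge0 ?mulr_ge0// ltW.
by rewrite /jM; split; [|split]; lra.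
Qed.

Let jM1 : 1 < jM. Proof. by have [h1 _] := jM_ge; lra. Qed.
Let jM0 : 0 < jM. Proof. by have := jM1; lra. Qed.
Let jMm : 0 < jM - 1. Proof. by have := jM1; lra. Qed.

Lemma PM_ge0 : 0 <= PM.
Proof. exact: le_trans (pres_ge0 W 0) (pr_PM W 0). Qed.

Lemma rho_pos y : 0 < rho y. Proof. exact: expR_gt0. Qed.
Lemma rho_le y : y <= 0 -> rho y <= rM. Proof. exact: (pr_rM W). Qed.
Lemma drho y : is_derive y 1 rho (kap y * rho y). Proof. exact: is_derive_rho (pr_ck W). Qed.
Lemma rho_cont : continuous rho. Proof. by move=> y; exact: is_derive_cont (drho y). Qed.
Lemma dfM (v : R) : is_derive v 1 fM (fM1 v). Proof. exact: is_derive_pw_neg. Qed.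
Lemma fM_cont : continuous fM. Proof. by move=> y; exact: is_derive_cont (dfM y). Qed.
Lemma fM1_cont : continuous fM1.
Proof.
apply: cont1M; first exact: cont1c.
apply: cont1_comp; first exact: pw_cont.
by apply: cont1B; [exact: cont1c|move=> x; exact: cvg_id].
Qed.
Lemma fM1_ge0 v : 0 <= fM1 v. Proof. by rewrite mulr_ge0 ?pw_ge0// ltW. Qed.

Lemma rM_gt0 : 0 < rM. Proof. exact: lt_le_trans (rho_pos 0) (rho_le (lexx 0)). Qed.

Lemma fM_bound v : bp - v <= bp + C -> 0 <= - fM v /\ - fM v <= (bp + C) / jM * fM1 v.
Proof.
move=> vC; rewrite /fM /fM1 opprK; split; first exact: pw_ge0.
rewrite pw_split// mulrA divfK ?gt_eqF// ler_wpM2r ?pw_ge0// ge_max vC/=.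
exact: ltW bpC.
Qed.

Lemma fM1_bound v : bp - v <= bp + C -> fM1 v <= jM * pw (jM - 1) (bp + C).
Proof. by move=> vC; rewrite ler_wpM2l ?(ltW jM0)// pw_le// ltW. Qed.

Lemma window e x y : 0 <= e -> y <= Num.min 0 (x + C) -> bp - (x - (1 + e) * y) <= bp + C.
Proof.
move=> e0; rewrite le_min => /andP[y0 yx].
have : e * y <= 0 by rewrite mulr_ge0_le0.
rewrite mulrDl mul1r; lra.
Qed.

(** Dominated by [s^n + P(z)], because [dissip] is at most [|sig^n - 1|] and [P(z) sig^n = s^n]
    where [z < 0]. *)
Lemma dis_int2 l r T1 T2 : l <= r -> r <= C -> int2 l r T1 T2 dis.
Proof.
move=> lr rC; have [_ _ Isn _ _] := en_flux E.
have cPz := Pz_cont W E.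
have mX : measurable_fun (`[l, r] `*` `[T1, T2]) (unc (fun x t => pw n (sig x t))).
  have -> : unc (fun x t => pw n (sig x t)) = (@powR R ^~ n) \o unc sig.
    by apply/funext => -[x t]; rewrite /unc/= pwE// (sig_ge0 E).
  by apply: measurableT_comp; [exact: measurable_powR|exact: (sig_measurable W E)].
have mab (g : R * R -> R) D : measurable_fun D g -> measurable_fun D (fun w => `|g w|).
  by move=> mg; exact: (measurableT_comp (@normr_measurable R _)).
have I1 : int2 l r T1 T2 (fun x t => pw n (s x t) + P (z x t)) by apply: int2D; [exact: Isn|exact: int2_cont].
apply: (int2_le _ _ I1).
  apply: measurable_funM; first by apply: measurable_funTS; exact: (cont2_mes cPz).
  apply: measurable_funM.
    by apply: mab; apply: measurable_funB => //; exact: measurable_cst.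
  apply: measurable_minr; last exact: measurable_cst.
  by apply: mab; apply: measurable_funB; [exact: measurable_cst|exact: (sig_measurable W E)].
move=> x t _ _; have Pz := pres_ge0 W (z x t); have s0 := pw_ge0 n (s x t).
rewrite /dis ger0_norm; last by rewrite mulr_ge0 ?dissip_ge0.
have := z0 x t; rewrite le_eqVlt => /orP[/eqP zx|zx].
  by rewrite zx (pres_zero W)// mul0r addr0.
rewrite (sig_pow W E zx) -[X in _ + X]mulr1 -mulrDr ler_wpM2l//.
apply: (le_trans (dissip_le_pw _ _)); have := pw_ge0 n (sig x t).
rewrite ler_norml => h1; apply/andP; split; lra.
Qed.

(** [P sig = s P^(1 - 1/n)], with a nonnegative exponent since [n >= 1]. A bound by [s] is wanted
    because the integral of [s] over a time slice is at most [1]. *)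
Lemma Psig_le x t : P (z x t) * sig x t <= (1 + PM) * s x t.
Proof.
have s0 := flux_s_ge0 E x t; have := z0 x t; rewrite le_eqVlt => /orP[/eqP zx|zx].
  by rewrite zx (pres_zero W)// mul0r mulr_ge0// addr_ge0// PM_ge0.
have Pz := pr_P0 W zx; rewrite /sig mulrCA mulrC ler_wpM2r//.
rewrite -{1}[P _](powRr1 (ltW Pz)) -powRD; last by apply/implyP => _; rewrite gt_eqF.
have g1 : n^-1 <= 1 by rewrite invf_le1.
have [P1|/ltW P1] := leP (P (z x t)) 1.
  apply: (@le_trans _ _ 1); last by rewrite lerDl PM_ge0.
  by rewrite -[leRHS](powRr0 (P (z x t))) ger_powR ?Pz//; lra.
apply: (@le_trans _ _ (P (z x t))); last by rewrite (le_trans (pr_PM W _))// lerDr.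
by rewrite -[leRHS](powRr1 (ltW Pz)) ler_powR// gerBl ltW.
Qed.

Definition PsiM e A := PsiA U A (psi2 (1 + e) rho fM) (psi2y (1 + e) kap rho fM fM1).

(** Far to the left [z <= l + C], so [e z] alone outweighs the largest possible value [bp + C] of
    the untilted base. *)
Lemma fM_zero e l t : 0 < e -> l + C <= - ((bp + C) / e) -> fM (l - (1 + e) * z l t) = 0.
Proof.
move=> e0 le; have q0 : 0 < (bp + C) / e by rewrite divr_gt0.
have zl : z l t <= l + C by apply: (en_hi E); lra.
have : e * z l t <= - (bp + C).
  by rewrite -ler_pdivlMl// mulrC mulNr; exact: le_trans le.
move=> ez; have H : bp - (l - (1 + e) * z l t) <= 0 by rewrite mulrDl mul1r; lra.
by rewrite /fM pw_npos ?oppr0// gt_eqF.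
Qed.

(* The tilt [th = 1 + e] makes the weight compactly supported in [x] and costs only [e] times the total variation of [V^m]. *)
Lemma lyapunov_step e l A T1 T2 : 0 < e -> l + C <= - ((bp + C) / e) -> A <= l - C -> T1 <= T2 ->
  I l C (fun x => PsiM e A x (z x T2)) - I l C (fun x => PsiM e A x (z x T1)) <=
  J2 l C T1 T2 (fun x t => - 2^-1 * (rho (z x t) * fM1 (x - (1 + e) * z x t) * dis x t) +
                           e * s_weight * s x t).
Proof.
move=> e0 le AlC T12.
have q0 : 0 < (bp + C) / e by rewrite divr_gt0.
have lC0 : l + C < 0 by lra.
have lC : l < C by have := C0; lra.
have cr := rho_cont; have cf := fM_cont; have cf1 := fM1_cont; have ck := pr_ck W.
have cpsi := @psi2_cont R (1 + e) _ _ cr cf.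
have cpsiy := @psi2y_cont R (1 + e) _ _ _ _ ck cr cf cf1.
have dpsi x y : is_derive y 1 (psi2 (1 + e) rho fM x) (psi2y (1 + e) kap rho fM fM1 x y).
  exact: (@is_derive_psi2 R (1 + e) kap rho fM fM1 x y drho dfM).
have Hneg x y : y <= Num.min 0 (x + C) ->
    rho y * (kap y * fM (x - (1 + e) * y) - (1 + e) * fM1 (x - (1 + e) * y)) <= 0.
  move=> yr; apply: mulr_ge0_le0; first exact/ltW/rho_pos.
  have [h1 h2] := fM_bound (window (ltW e0) yr).
  have y0 : y <= 0 by move: yr; rewrite le_min => /andP[].
  have kg := pr_kge W y0; have f0 := fM1_ge0 (x - (1 + e) * y).
  have [_ [_ j2]] := jM_ge.
  move: h1 h2 f0; set F := - fM _; set F1 := fM1 _ => h1 h2 f0.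
  have -> : fM (x - (1 + e) * y) = - F by rewrite /F opprK.
  have k1 : - kap y * F <= (n^-1 * L / c) * F by rewrite ler_wpM2r// lerNl.
  have k2 : (n^-1 * L / c) * F <= F1.
    apply: (@le_trans _ _ ((n^-1 * L / c) * ((bp + C) / jM * F1))).
      by rewrite ler_wpM2l// divr_ge0 ?mulr_ge0 ?ltW.
    rewrite mulrA ler_piMl//.
    have -> : n^-1 * L / c * ((bp + C) / jM) = ((bp + C) * n^-1 * L / c) / jM by field; rewrite !gt_eqF.
    by rewrite ler_pdivrMr// mul1r.
  have : 0 <= e * F1 by rewrite mulr_ge0// ltW.
  rewrite mulrN mulrDl mul1r; lra.
apply: (general_inequality (T0 := T1 - 1) (T3 := T2 + 1) (lam := n^-1) (c1 := rM * (jM * pw (jM - 1) (bp + C)))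
  W E lC (lexx C) _ T12 _ ck drho cf1 dfM (pr_kP W)).
- by lra.
- by lra.
- by move=> x y _ /andP[_ yr]; exact: Hneg.
- move=> x y _ /andP[_ yr]; have y0 : y <= 0 by move: yr; rewrite le_min => /andP[].
  by apply: ler_pM; rewrite ?fM1_ge0 ?(ltW (rho_pos _)) ?rho_le// fM1_bound// window// ltW.
- by move=> t _; exact: fM_zero.
- by left.
- exact: (@PsiA_cont _ _ _ _ _ _ _ _ _ _ W A _ _ cpsi cpsiy).
- move=> x y1 y2 /andP[lx xC] /andP[y1l y1r] /andP[y2l y2r].
  have Ay y : Num.min (x - C) 0 <= y -> A <= y.
    by apply: le_trans; rewrite le_min; apply/andP; split; lra.
  have y0 y : y <= Num.min 0 (x + C) -> y <= 0 by rewrite le_min => /andP[].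
  apply: (PsiA_convex W) => //; [|exact: Ay|exact: Ay|exact: y0|exact: y0|].
    exact: (cont2_sec2 (x := x) cpsiy).
  move=> y /andP[_ yM]; apply: Hneg; apply: (le_trans yM).
  by rewrite ge_max y1r.
- have [_ Is _ _ _] := en_flux E; apply: int2D; last by apply: int2Z; exact: Is.
  apply: int2Z; apply: int2_mulc; last by apply: dis_int2 => //; exact: ltW.
  apply: cont2M; first exact: (cont2_comp cr cz).
  exact: (cont2_comp cf1 (@shifted_cont _ _ _ _ _ _ _ _ _ _ E (1 + e))).
have [_ Is _ _ _] := en_flux E.
have aeI2 := fub_ae2 (int2_cont l C T1 T2 cz).
have IB2 : int2 l C T1 T2 (fun x t => - 2^-1 * (rho (z x t) * fM1 (x - (1 + e) * z x t) * dis x t) +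
                           e * s_weight * s x t).
  apply: int2D; last by apply: int2Z; exact: Is.
  apply: int2Z; apply: int2_mulc; last by apply: dis_int2 => //; exact: ltW.
  apply: cont2M; first exact: (cont2_comp cr cz).
  exact: (cont2_comp cf1 (@shifted_cont _ _ _ _ _ _ _ _ _ _ E (1 + e))).
have := fub_ae2 IB2; apply: aeS => t Ht /andP[t1 t2] G IG acz HG.
have IB := Ht (introT andP (conj (ltW t1) (ltW t2))).
apply: I_ae_le => //; apply: ae_le_lt; apply: aeS HG => x Hx xx; rewrite Hx//.
have /andP[lx xC] := xx; have /andP[_ zr] := z_range E x t.
have [F0 FB] := fM_bound (window (ltW e0) zr).
have f0 := fM1_ge0 (x - (1 + e) * z x t).
have fb := fM1_bound (window (ltW e0) zr).
have sg := sig_ge0 E x t; have Pz := pres_ge0 W (z x t).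
have [G0 GD] := reaction_defect n1 sg.
have Dd := dissip_le n1 sg; have hn := pr_hn W (z0 x t); rewrite (en_Uz E) in hn.
have Ps := Psig_le x t; have r0 := rho_pos (z x t); have rr := rho_le (z0 x t).
have s0 := flux_s_ge0 E x t; have X0 := pw_ge0 n (sig x t).
have [_ [j1 _]] := jM_ge.
rewrite /GIterm /dis /s_weight -[fM _]opprK.
apply: (lyapunov_pointwise (q := (bp + C) / jM) (lc := L / c)) => //.
- exact: ltW.
- by rewrite divr_ge0// ltW.
- rewrite mulrA ler_pdivrMr//.
  have -> : L / c * (bp + C) = 2^-1 * (2 * (bp + C) * L / c) by field; rewrite gt_eqF.
  by rewrite ler_wpM2l// invr_ge0.
- by rewrite addr_ge0// PM_ge0.
- exact: ltW.
Qed.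

End LyapunovStep.

(** * Removing the tilt from the Lyapunov inequality *)

Section LyapunovLimit.
Variable R : realType.
Implicit Types (x y t e a b l r w A : R).
Notation mu := (@lebesgue_measure R).

Lemma small_eps (X Y K k : R) : 0 < k -> (forall e, 0 < e -> e <= k -> X <= Y + e * K) -> X <= Y.
Proof.
move=> k0 H; rewrite leNgt; apply/negP => YX.
pose K1 := `|K| + 1; have K10 : 0 < K1 by rewrite ltr_wpDl.
have d0 : 0 < (X - Y) / 2 by rewrite divr_gt0 ?subr_gt0.
pose e := Num.min k ((X - Y) / 2 / K1).
have e0 : 0 < e by rewrite lt_min k0 divr_gt0.
have ek : e <= k by rewrite ge_min lexx.
have eK : e * K <= (X - Y) / 2.
  apply: (@le_trans _ _ (e * K1)).
    by rewrite ler_wpM2l ?(ltW e0)// (le_trans (ler_norm _))// lerDl.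
  by rewrite -ler_pdivlMr// ge_min lexx orbT.
have := H e e0 ek; lra.
Qed.

Lemma dissipation_arith (A2 A1 M2 J Js d K t : R) :
  A2 - A1 <= - J + Js -> Js <= t -> d <= J -> M2 <= A2 + K -> forall M0 : R, A1 <= M0 ->
  M2 + d <= M0 + (K + t).
Proof. by move=> *; lra. Qed.

Lemma iv_rev a b (f : R -> R) : b <= a -> iv a b f.
Proof.
move=> ba; apply: (iv_ext _ (iv_cst a b (f a))) => x /andP[ax xb].
by congr f; apply: le_anti; rewrite ax (le_trans xb).
Qed.

Variables (n m c L PM rM C : R) (h U kap : R -> R).
Variables (V s z : R -> R -> R).
Hypotheses (W : profile n m c L PM rM h U kap) (E : entire n m c C h U V s z).
Let C0 := en_C E.
Notation P := (pres c h U).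
Notation u := (slope n m c h U).
Notation bp := (bp C).
Notation jM := (jM n c L C).
Notation rho := (rho kap).
Notation fM := (fM n c L C).
Notation fM1 := (fM1 n c L C).

Let bpC : 0 < bp + C. Proof. by rewrite /bp; have := C0; lra. Qed.
Let jM_ge' : 2 <= jM.
Proof.
have n0 : 0 < n by exact: lt_le_trans (pr_n W).
have h1 : 0 <= 2 * (bp + C) * L / c by rewrite divr_ge0 ?mulr_ge0 ?(ltW bpC) ?(ltW (pr_L W)) ?(ltW (pr_c W)).
have h2 : 0 <= (bp + C) * n^-1 * L / c.
  by rewrite divr_ge0 ?mulr_ge0 ?invr_ge0 ?(ltW n0) ?(ltW bpC) ?(ltW (pr_L W)) ?(ltW (pr_c W)).
by rewrite /jM; lra.
Qed.
Let jM1 : 1 < jM. Proof. by have := jM_ge'; lra. Qed.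
Let jM0 : 0 < jM. Proof. by have := jM1; lra. Qed.
Let jMm : 0 < jM - 1. Proof. by have := jM1; lra. Qed.
Let rho0 y : 0 < rho y. Proof. exact: expR_gt0. Qed.
Let rhoM y : y <= 0 -> rho y <= rM. Proof. exact: (pr_rM W). Qed.
Let rM0 : 0 < rM. Proof. exact: lt_le_trans (rho0 0) (rhoM (lexx 0)). Qed.
Let cr := rho_cont W.

Definition Fe e x w := pw jM (bp - x + (1 + e) * w).
Definition pot e x w := u w * (rho w * Fe e x w).
(** The potential of the Lyapunov functional, normalised to vanish at [x - bp], below which the
    weight is zero. Its integrand is nonnegative, so it increases with [y]. *)
Definition Pot e x y := I (x - bp) y (pot e x).
Definition K4 := rM * pw jM (bp + C).
Definition Lip := jM * pw (jM - 1) (bp + C).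

Lemma Fe_cont e x : continuous (Fe e x).
Proof.
apply: cont1_comp; first exact: pw_cont.
apply: cont1D; first exact: cont1c.
by apply: cont1M; [exact: cont1c|move=> ?; exact: cvg_id].
Qed.

Lemma iv_slope_mul (g : R -> R) a b : continuous g -> b <= 0 -> iv a b (fun w => u w * g w).
Proof.
move=> cg b0; have [ab|ba] := ltP a b; last exact: iv_rev.
have iu : iv a b u by apply: iv_sub (iv_slope W (lt_le_trans ab b0)).
by apply: iv_ext (iv_mulc (continuous_subspaceT cg) iu) => w _; exact: mulrC.
Qed.

Lemma iv_pot e x a b : b <= 0 -> iv a b (pot e x).
Proof. by move=> b0; apply: iv_slope_mul => //; apply: cont1M => //; exact: Fe_cont. Qed.

Lemma iv_slope' a b : b <= 0 -> iv a b u.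
Proof.
move=> b0; have [ab|ba] := ltP a b; last exact: iv_rev.
by apply: iv_sub (iv_slope W (lt_le_trans ab b0)).
Qed.

Lemma pot_ge0 e x w : 0 <= pot e x w.
Proof. by rewrite mulr_ge0 ?(slope_nonneg W)// mulr_ge0 ?pw_ge0// ltW. Qed.

Lemma Fe_zero e x w : 0 <= e -> w <= 0 -> w <= x - bp -> Fe e x w = 0.
Proof.
move=> e0 w0 wx; rewrite /Fe pw_npos ?gt_eqF// mulrDl mul1r.
have : e * w <= 0 by rewrite mulr_ge0_le0.
lra.
Qed.

Lemma Fe_le e x w : 0 <= e -> w <= Num.min 0 (x + C) -> Fe e x w <= pw jM (bp + C).
Proof.
move=> e0; rewrite le_min => /andP[w0 wx]; apply: pw_le; first exact: ltW.
have : e * w <= 0 by rewrite mulr_ge0_le0.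
rewrite mulrDl mul1r; lra.
Qed.

Lemma pot_le e x w : 0 <= e -> w <= Num.min 0 (x + C) -> pot e x w <= K4 * u w.
Proof.
move=> e0 wx; rewrite /pot mulrC ler_wpM2r ?(slope_nonneg W)//.
have w0 : w <= 0 by move: wx; rewrite le_min => /andP[].
by apply: ler_pM; rewrite ?pw_ge0 ?(ltW (rho0 _)) ?rhoM// Fe_le.
Qed.

Lemma Pot_ge0 e x y : 0 <= Pot e x y.
Proof. by apply: I_ge0 => w _; exact: pot_ge0. Qed.

Lemma Pot_incr e x y y' : x - bp <= y -> y <= y' -> y' <= 0 -> Pot e x y' - Pot e x y = I y y' (pot e x).
Proof.
move=> xy yy y0; rewrite /Pot (I_split xy yy (iv_pot _ _ _ y0)).
by rewrite addrAC subrr add0r.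
Qed.

Lemma Pot_mono e x y y' : x - bp <= y -> y <= y' -> y' <= 0 -> Pot e x y <= Pot e x y'.
Proof.
by move=> xy yy y0; rewrite -subr_ge0 Pot_incr//; apply: I_ge0 => w _; exact: pot_ge0.
Qed.

Lemma Pot_lip e x y y' : 0 <= e -> x - bp <= y -> y <= y' -> y' <= Num.min 0 (x + C) ->
  Pot e x y' - Pot e x y <= K4 * (U y - U y').
Proof.
move=> e0 xy yy yx; have y0 : y' <= 0 by move: yx; rewrite le_min => /andP[].
rewrite Pot_incr// -(I_slope W yy y0) -IZ; last exact: iv_slope'.
apply: I_le; [exact: iv_pot|by apply: ivZ; exact: iv_slope'|].
by move=> w /andP[_ wy]; apply: pot_le => //; exact: le_trans yx.
Qed.

Lemma Pot_zero e x : Pot e x (x - bp) = 0. Proof. exact: Iaa. Qed.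

Lemma K4_ge0 : 0 <= K4. Proof. by rewrite mulr_ge0 ?pw_ge0// ltW. Qed.

Lemma Pot_le e x y : 0 <= e -> x - bp <= y -> y <= Num.min 0 (x + C) ->
  Pot e x y <= K4 * (U (x - bp) - U y).
Proof. by move=> e0 xy yx; have := Pot_lip e0 (lexx (x - bp)) xy yx; rewrite Pot_zero subr0. Qed.

Lemma Pot_tilt_le e x y : 0 <= e -> y <= 0 -> Pot e x y <= Pot 0 x y.
Proof.
move=> e0 y0; apply: I_le; [exact: iv_pot|exact: iv_pot|].
move=> w /andP[_ wy]; rewrite ler_wpM2l ?(slope_nonneg W)// ler_wpM2l ?(ltW (rho0 _))//.
apply: pw_le; first exact: ltW.
have : e * w <= 0 by rewrite mulr_ge0_le0// (le_trans wy).
rewrite !mulrDl !mul1r mul0r; lra.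
Qed.

Lemma pw_lipschitz v v' : v <= v' -> v' <= bp + C -> pw jM v' - pw jM v <= Lip * (v' - v).
Proof.
move=> vv vB.
have D y : is_derive y 1 (fun y => pw jM y - Lip * y) (jM * pw (jM - 1) y - Lip).
  have := dB (is_derive_pw1 y jM1) (dZ Lip (is_derive_id y (1 : R))).
  by rewrite mulr1.
have := @nonincreasing_of_derive R _ _ v v' vv D.
rewrite mulrBr => H; suff : pw jM v' - Lip * v' <= pw jM v - Lip * v by lra.
apply: H => y /andP[_ yv]; rewrite subr_le0 /Lip ler_wpM2l ?(ltW jM0)//.
by apply: pw_le; [exact: ltW|exact: le_trans vB].
Qed.

Lemma Lip_ge0 : 0 <= Lip. Proof. by rewrite mulr_ge0 ?pw_ge0// ltW. Qed.

(** The two weights differ by at most [Lip e |w|] times [rho], with [|w| <= bp - l] on the range of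
    integration, and the slope has total mass at most [1]. *)
Lemma Pot_close e l x y : 0 <= e -> l <= x -> l <= bp -> x - bp <= y -> y <= Num.min 0 (x + C) ->
  Pot 0 x y <= Pot e x y + e * (rM * (Lip * (bp - l))).
Proof.
move=> e0 lx lb xy yx; have y0 : y <= 0 by move: yx; rewrite le_min => /andP[].
have KK : 0 <= rM * (Lip * (bp - l)) by rewrite mulr_ge0 ?(ltW rM0)// mulr_ge0 ?Lip_ge0// subr_ge0.
rewrite -lerBlDl /Pot -IB; [|exact: iv_pot|exact: iv_pot].
apply: (@le_trans _ _ (I (x - bp) y (fun w => (e * (rM * (Lip * (bp - l)))) * u w))); last first.
  rewrite IZ; last exact: iv_slope'.
  rewrite (I_slope W xy y0); have KK' := mulr_ge0 e0 KK; rewrite ler_piMr//.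
  have := pr_U1 W (x - bp); have : 0 <= U y.
    by have [yy|/(pr_Up W)/ltW//] := leP 0 y; rewrite (pr_U0 W).
  lra.
apply: I_le; [by apply: ivB; exact: iv_pot|by apply: ivZ; exact: iv_slope'|].
move=> w /andP[xw wy]; have w0 := le_trans wy y0.
rewrite /pot -mulrBr -mulrBr mulrC ler_wpM2r ?(slope_nonneg W)//.
have wm : w <= Num.min 0 (x + C) by exact: le_trans yx.
have ew : e * w <= 0 by rewrite mulr_ge0_le0.
have := @pw_lipschitz (bp - x + (1 + e) * w) (bp - x + (1 + 0) * w).
rewrite addr0 !mulrDl !mul1r => H.
have wC : w <= x + C by move: wm; rewrite le_min => /andP[].
have HF : Fe 0 x w - Fe e x w <= Lip * (- (e * w)).
  rewrite /Fe addr0 mulrDl !mul1r.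
  have -> : - (e * w) = bp - x + w - (bp - x + (w + e * w)) by ring.
  by apply: H; lra.
have F0 : 0 <= Fe 0 x w - Fe e x w.
  rewrite subr_ge0 /Fe; apply: pw_le; first exact: ltW.
  by rewrite addr0 mulrDl !mul1r; lra.
apply: (@le_trans _ _ (rM * (Lip * (- (e * w))))).
  by apply: ler_pM => //; [exact: ltW|exact: rhoM].
rewrite [leRHS]mulrCA ler_wpM2l ?(ltW rM0)// mulrCA ler_wpM2l ?Lip_ge0//.
rewrite -mulrN ler_wpM2l//; lra.
Qed.

(** Between [A] and [x - bp] the weight vanishes, so that part of the integral is zero. *)
Lemma PsiM_Pot e A x y : 0 <= e -> x <= bp -> A <= x - bp -> x - bp <= y -> y <= 0 ->
  PsiM n c L C U kap e A x y = Pot e x y.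
Proof.
move=> e0 xb Ax xy y0; have A0 : A <= 0 by lra.
have fF w : fM (x - (1 + e) * w) = - Fe e x w by rewrite /fM /Fe; congr (- pw _ _); ring.
have cpsiy := @psi2y_cont R (1 + e) _ _ _ _ (pr_ck W) cr (fM_cont W E) (fM1_cont W E).
have dpsi w := @is_derive_psi2 R (1 + e) kap rho fM fM1 x w (drho W) (dfM W E).
have H := PsiA_incr W (cont2_sec2 (x := x) cpsiy) dpsi (lexx A) (le_trans Ax xy) y0.
have zA : PsiM n c L C U kap e A x A = 0.
  by rewrite /PsiM /PsiA max_l// Iaa /psi2 fF Fe_zero// oppr0 !mulr0 addr0.
rewrite -[LHS]subr0 -[in LHS]zA [LHS]H /Pot.
have -> : - I A y (fun w => u w * psi2 (1 + e) rho fM x w) = I A y (pot e x).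
  rewrite -I_N; last first.
    by apply: iv_slope_mul => //; exact: (cont2_sec2 (x := x) (@psi2_cont R (1 + e) _ _ cr (fM_cont W E))).
  by apply: I_ext => w _; rewrite /psi2 fF /pot; ring.
rewrite (I_split Ax xy (iv_pot _ _ _ y0)) (I_ext (b := x - bp) (g := fun=> 0)) ?I_0 ?add0r//.
by move=> w /andP[_ wx]; rewrite /pot Fe_zero ?mulr0//; lra.
Qed.

Definition adm (ze : R -> R) := continuous ze /\
  forall x, Num.min (x - C) 0 <= ze x <= Num.min 0 (x + C).

Lemma adm_range ze x : adm ze -> x <= C -> x - bp <= ze x /\ ze x <= Num.min 0 (x + C).
Proof.
move=> [_ /(_ x)/andP[h1 h2]] xC; split => //; apply: le_trans h1.
by rewrite le_min /bp; apply/andP; split; lra.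
Qed.

Lemma iv_Pot e l ze : 0 <= e -> adm ze -> iv l C (fun x => Pot e x (ze x)).
Proof.
move=> e0 az; have [lC|Cl] := leP l C; last exact/iv_rev/ltW.
have cpsi := @psi2_cont R (1 + e) _ _ cr (fM_cont W E).
have cpsiy := @psi2y_cont R (1 + e) _ _ _ _ (pr_ck W) cr (fM_cont W E) (fM1_cont W E).
have cP : continuous (unc (PsiM n c L C U kap e (l - bp))).
  exact: (@PsiA_cont _ _ _ _ _ _ _ _ _ _ W (l - bp) _ _ cpsi cpsiy).
apply: (iv_ext (f := fun x => PsiM n c L C U kap e (l - bp) x (ze x))) => [x /andP[lx xC]|].
  have [h1 h2] := adm_range az xC; apply: PsiM_Pot => //.
  - by rewrite /bp; lra.
  - lra.
  - by move: h2; rewrite le_min => /andP[].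
apply: iv_contT.
have cze : continuous (unc (fun x t : R => ze x)) by apply: cont2_1; case: az.
exact: (@cont2_sec1 R _ 0 (cont2_graph cP cze)).
Qed.

Definition Mz l (ze : R -> R) := I l C (fun x => Pot 0 x (ze x)).
(** Bounds the contribution of the half-line to the left of [l], see [tail_bound]; it tends to [0]
    as [l] tends to [-oo] because [U] tends to [1]. *)
Definition tl l := K4 * ((bp + C) * (1 - U (l + C))).

Lemma U_nonneg y : 0 <= U y.
Proof. by have [yy|/(pr_Up W)/ltW//] := leP 0 y; rewrite (pr_U0 W). Qed.

(** The left side telescopes to two integrals of [U] over windows of length [p - q]: the one near
    [l] is at most [p - q] as [U < 1], the one near [l0] is bounded below by monotonicity. *)
Lemma I_shift_le p q l l0 : q <= p -> l <= l0 ->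
  I l l0 (fun x => U (x - p) - U (x - q)) <= (p - q) * (1 - U (l0 - q)).
Proof.
move=> qp ll; have cU := pr_cU W.
have cs k : continuous (fun x => U (x + k)).
  by apply: cont1_comp => //; apply: cont1D; [move=> ?; exact: cvg_id|exact: cont1c].
rewrite IB; [|exact: iv_contT|exact: iv_contT].
have sh k : I l l0 (fun x => U (x + k)) = prim U (l0 + k) - prim U (l + k).
  by have [_ ->//] := ac_smooth l l0 (cs k) (fun x => dshift (is_derive_prim (x + k) cU)).
rewrite !sh.
have -> : prim U (l0 - p) - prim U (l - p) - (prim U (l0 - q) - prim U (l - q)) =
   (prim U (l - q) - prim U (l - p)) - (prim U (l0 - q) - prim U (l0 - p)) by ring.
have g l' : l' - p <= l' - q by rewrite lerD2l lerN2.
rewrite -(I_prim cU (g l)) -(I_prim cU (g l0)).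
have i1 : I (l - p) (l - q) U <= p - q.
  apply: (@le_trans _ _ (I (l - p) (l - q) (fun=> 1))).
    by apply: I_le; [exact: iv_contT|exact: iv_cst|move=> x _; exact/ltW/(pr_U1 W)].
  by rewrite I_cst//; lra.
have i2 : (p - q) * U (l0 - q) <= I (l0 - p) (l0 - q) U.
  apply: (@le_trans _ _ (I (l0 - p) (l0 - q) (fun=> U (l0 - q)))).
    by rewrite I_cst// [leRHS]mulrC ler_wpM2r ?U_nonneg//; lra.
  by apply: I_le; [exact: iv_cst|exact: iv_contT|move=> x /andP[_ xx]; exact: (pr_Um W)].
rewrite mulrBr mulr1; lra.
Qed.

Lemma tail_bound e l l0 ze : 0 <= e -> adm ze -> l <= l0 -> l0 <= - C ->
  I l l0 (fun x => Pot e x (ze x)) <= tl l0.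
Proof.
move=> e0 az ll lC; have cU := pr_cU W.
have cs k : continuous (fun x => U (x - k)).
  by apply: cont1_comp => //; apply: cont1B; [move=> ?; exact: cvg_id|exact: cont1c].
have l0C : l0 <= C by have := C0; lra.
apply: (@le_trans _ _ (I l l0 (fun x => K4 * (U (x - bp) - U (x - - C))))).
  apply: I_le.
  - by apply: iv_sub (iv_Pot l e0 az).
  - by apply: ivZ; apply: ivB; apply: iv_contT; exact: cs.
  move=> x /andP[lx xl]; have [h1 h2] := adm_range az (le_trans xl l0C); rewrite opprK.
  have h3 : ze x <= x + C by move: h2; rewrite le_min => /andP[].
  have h4 : x + C <= Num.min 0 (x + C) by rewrite le_min lexx andbT; lra.
  have h5 : x + C <= 0 by lra.
  apply: (le_trans (Pot_mono _ h1 h3 h5)).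
  apply: Pot_le => //; exact: le_trans h3.
rewrite IZ; last by apply: ivB; apply: iv_contT; exact: cs.
rewrite /tl ler_wpM2l ?K4_ge0//; have bC : - C <= bp by have := bpC; lra.
by have := I_shift_le bC ll; rewrite !opprK.
Qed.

(** On a bounded range of [x] the values of [z] are bounded, so [rho] is bounded below; the base of
    [fM1] is at least [1] before tilting, and [e1] is chosen so that the tilt takes away at most
    [1/2]. *)
Lemma weight_lower l1 : l1 <= C -> exists2 k, 0 < k & exists2 e1, 0 < e1 &
  forall e x y, 0 < e -> e <= e1 -> l1 <= x -> x <= C -> x - C <= y -> y <= 0 ->
    k <= 2^-1 * (rho y * fM1 (x - (1 + e) * y)).
Proof.
move=> lC; have ck : continuous (prim kap) by apply: prim_cont; exact: (pr_ck W).
have [M M0 HM] := within_bounded (continuous_subspaceT (A := `[l1 - C, 0]%classic) ck).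
have hp : (0 : R) < 2^-1 by rewrite invr_gt0.
exists (2^-1 * (expR (- M) * (jM * pw (jM - 1) 2^-1))).
  by rewrite !mulr_gt0 ?expR_gt0 ?pw_gt0.
have D0 : 0 < 2 * (C - l1 + 1) by lra.
exists (2 * (C - l1 + 1))^-1; first by rewrite invr_gt0.
move=> e x y e0 e1 lx xC xy y0; rewrite ler_wpM2l ?(ltW hp)//.
have yl : l1 - C <= y <= 0 by rewrite y0 andbT; lra.
apply: ler_pM; rewrite ?expR_ge0 ?mulr_ge0 ?pw_ge0 ?(ltW jM0)//.
  by rewrite ler_expR lerNl; have := HM y yl; rewrite ler_norml => /andP[]; lra.
rewrite /fM1 ler_wpM2l ?(ltW jM0)//; apply: pw_le; first exact: ltW.
have : e * - y <= 2^-1.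
  apply: (@le_trans _ _ ((2 * (C - l1 + 1))^-1 * (C - l1 + 1))); last first.
    by rewrite le_eqVlt; apply/orP; left; apply/eqP; field; rewrite gt_eqF//; lra.
  by apply: ler_pM => //; [exact: ltW|lra|lra].
rewrite mulrN mulrDl mul1r /bp; lra.
Qed.

Lemma adm_z t : adm (z^~ t).
Proof. by split; [exact: (cont2_sec1 (en_cz E))|move=> x; exact: (z_range E)]. Qed.

Lemma J2_s_le l T1 T2 : l <= C -> T1 <= T2 -> J2 l C T1 T2 s <= T2 - T1.
Proof.
move=> lC T12; have [s0 Is _ F1 _] := en_flux E.
have -> : T2 - T1 = I T1 T2 (fun=> 1) by rewrite I_cst// mul1r.
apply: I_ae_le; [exact: fub_iv2 (Is l C T1 T2)|exact: iv_cst|].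
have F := F1 (l - 1) (C + 1) (T1 - 1) (T2 + 1).
apply: aeS F => t Ht /andP[t1 t2].
have [|_ {}Ht] := Ht; first by apply/andP; split; lra.
rewrite -Ht//; [|lra|lra].
have p1 : pw m 1 = 1 :> R by rewrite pwE ?ler01// powR1.
have : pw m (V l t) <= 1 by rewrite -p1; apply: pw_le; [exact/ltW/(pr_m W)|exact: (V_le1 W E)].
have := pw_ge0 m (V C t); lra.
Qed.

Lemma J2_sub_left l l1 T1 T2 (f : R -> R -> R) : l <= l1 -> l1 <= C -> int2 l C T1 T2 f -> (forall x t, 0 <= f x t) ->
  J2 l1 C T1 T2 f <= J2 l C T1 T2 f.
Proof.
move=> ll lC If f0; have If1 : int2 l1 C T1 T2 f by apply: int2_sub If.
apply: I_ae_le; [exact: fub_iv2 If1|exact: fub_iv2 If|].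
have := fub_ae2 If; apply: aeS => t Ht tt; apply: I_sub_le => //; exact: Ht.
Qed.

Lemma dis_ge0 x t : 0 <= dis n c h U s z x t.
Proof. by rewrite mulr_ge0 ?dissip_ge0// (pres_ge0 W). Qed.

Lemma J2_weighted_left l l1 T1 T2 k (w f : R -> R -> R) : l <= l1 -> l1 <= C -> int2 l C T1 T2 f ->
  int2 l C T1 T2 (fun x t => w x t * f x t) -> (forall x t, 0 <= w x t) -> (forall x t, 0 <= f x t) ->
  (forall x t, l1 <= x <= C -> k <= 2^-1 * w x t) ->
  k * J2 l1 C T1 T2 f <= 2^-1 * J2 l C T1 T2 (fun x t => w x t * f x t).
Proof.
move=> ll lC If Iw w0 f0 kw.
have If1 : int2 l1 C T1 T2 f by apply: int2_sub If.
have Iw1 : int2 l1 C T1 T2 (fun x t => w x t * f x t) by apply: int2_sub Iw.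
have sub := J2_sub_left ll lC Iw (fun x t => mulr_ge0 (w0 x t) (f0 x t)).
apply: (le_trans _ (ler_wpM2l _ sub)); last by rewrite invr_ge0.
rewrite -(J2Z _ If1) -(J2Z _ Iw1); apply: J2_le; [exact: int2Z|exact: int2Z|].
by move=> x t xx _; rewrite mulrA ler_wpM2r// kw.
Qed.

(** The tilted inequality needs a left end [l] that depends on [e]. The functional is read on the
    fixed half-line from [l0], the part between [l] and [l0] being a tail bounded uniformly in [e];
    then [e] tends to [0]. *)
Lemma dissipation l1 : l1 <= C -> exists2 k, 0 < k & forall l0 T1 T2, l0 <= l1 -> l0 <= - C -> T1 <= T2 ->
  Mz l0 (z^~ T2) + k * J2 l1 C T1 T2 (dis n c h U s z) <= Mz l0 (z^~ T1) + tl l0.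
Proof.
move=> l1C; have [k k0 [e1 e10 Hk]] := weight_lower l1C; exists k => // l0 T1 T2 l01 l0C T12.
have l0C' : l0 <= C by have := C0; lra.
have Cb : C <= bp by rewrite /bp; lra.
have l0b := le_trans l0C' Cb.
apply: (@small_eps _ _ ((rM * (Lip * (bp - l0))) * (C - l0) + (s_weight n c L PM rM C) * (T2 - T1)) e1) => // e e0 ee.
have e0' := ltW e0.
(* Far enough to the left for [fM_zero]: the tilted weight vanishes at [l]. *)
pose l := Num.min l0 (- C - (bp + C) / e).
have ll0 : l <= l0 by rewrite ge_min lexx.
have lle : l + C <= - ((bp + C) / e).
  have : l <= - C - (bp + C) / e by rewrite ge_min lexx orbT.
  lra.
have lC : l <= C by exact: le_trans l0C'.
have Al : l - bp <= l - C by rewrite /bp; lra.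
have step := lyapunov_step W E e0 lle Al T12.
have EP t : I l C (fun x => PsiM n c L C U kap e (l - bp) x (z x t)) = I l C (fun x => Pot e x (z x t)).
  apply: I_ext => x /andP[lx xC]; have [h1 h2] := adm_range (adm_z t) xC.
  by apply: PsiM_Pot => //; [exact: le_trans xC Cb|rewrite lerD2r|exact: (en_z0 E)].
rewrite !EP in step.
have [_ Is _ _ _] := en_flux E.
have Id := dis_int2 W E T1 T2 lC (lexx C).
have Iw : int2 l C T1 T2 (fun x t => rho (z x t) * fM1 (x - (1 + e) * z x t) * dis n c h U s z x t).
  apply: int2_mulc => //; apply: cont2M; first exact: (cont2_comp cr (en_cz E)).
  exact: (cont2_comp (fM1_cont W E) (@shifted_cont _ _ _ _ _ _ _ _ _ _ E (1 + e))).
rewrite J2D in step; [|exact: int2Z|by apply: int2Z; exact: Is].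
rewrite (J2Z (- 2^-1) Iw) (J2Z (e * _) (Is _ _ _ _)) in step.
have js := J2_s_le lC T12.
have sw0 : 0 <= e * s_weight n c L PM rM C.
  rewrite mulr_ge0// /s_weight mulr_ge0 ?addr_ge0 ?(PM_ge0 W)// mulr_ge0 ?(ltW rM0)//.
  by rewrite mulr_ge0 ?pw_ge0// ltW.
have js2 := ler_wpM2l sw0 js.
have d1 : k * J2 l1 C T1 T2 (dis n c h U s z) <= 2^-1 * J2 l C T1 T2
    (fun x t => rho (z x t) * fM1 (x - (1 + e) * z x t) * dis n c h U s z x t).
  apply: J2_weighted_left => //; first exact: le_trans ll0 l01.
  - by move=> x t; rewrite mulr_ge0 ?(ltW (rho0 _))//; exact: (fM1_ge0 W E).
  - by move=> x t; exact: dis_ge0.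
  move=> x t /andP[lx xC]; apply: Hk => //; last exact: (en_z0 E).
  have [h1 _] := andP (z_range E x t); apply: le_trans h1; rewrite le_min lexx subr_le0 xC.
  by [].
have iP e' t l' : 0 <= e' -> iv l' C (fun x => Pot e' x (z x t)) by move=> e'0; apply: iv_Pot => //; exact: adm_z.
have up : Mz l0 (z^~ T2) <= I l C (fun x => Pot e x (z x T2)) + e * (rM * (Lip * (bp - l0)) * (C - l0)).
  apply: (@le_trans _ _ (I l0 C (fun x => Pot e x (z x T2) + e * (rM * (Lip * (bp - l0)))))).
    apply: I_le; [exact: iP|by apply: ivD; [exact: iP|exact: iv_cst]|].
    move=> x /andP[lx xC]; have [h1 h2] := adm_range (adm_z T2) xC; exact: Pot_close.
  rewrite ID; [|exact: iP|exact: iv_cst]; rewrite I_cst// [X in _ <= _ + X]mulrA lerD2r.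
  by apply: (I_sub_le ll0 l0C' (lexx C)); [exact: iP|move=> x _; exact: Pot_ge0].
have dn : I l C (fun x => Pot e x (z x T1)) <= Mz l0 (z^~ T1) + tl l0.
  rewrite (I_split ll0 l0C')//; last exact: iP.
  have h1 := tail_bound e0' (adm_z T1) ll0 l0C.
  have h2 : I l0 C (fun x => Pot e x (z x T1)) <= Mz l0 (z^~ T1).
    by apply: I_le; [exact: iP|exact: iP|move=> x _; apply: Pot_tilt_le => //; exact: (en_z0 E)].
  by rewrite [leLHS]addrC lerD.
rewrite mulNr in step; rewrite mulrDr [e * (s_weight _ _ _ _ _ _ * _)]mulrA.
exact: (dissipation_arith step js2 d1 up dn).
Qed.

End LyapunovLimit.

(** * Comparison functionals *)

Section Excess.
Variable R : realType.
Implicit Types (x y t e a b l r w A : R).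
Notation mu := (@lebesgue_measure R).
Variables (n m c L PM rM C : R) (h U kap : R -> R) (V s z : R -> R -> R).
Hypotheses (W : profile n m c L PM rM h U kap) (E : entire n m c C h U V s z).
Notation P := (pres c h U).
Notation u := (slope n m c h U).
Notation sig := (sig n c h U s z).
Let C0 := en_C E.
Let cz := en_cz E.
Let z0 := en_z0 E.

(** With [th = 1], positive [rho] and [f] positive exactly on [v > b], this is positive exactly
    where [y < min(x - b, 0)], that is where [U(y)] exceeds [U(x - b)]. *)
Definition exc (th : R) (rho f : R -> R) x y := I y 0 (fun w => u w * psi2 th rho f x w).

Definition excA A (th : R) (k0 rho f f1 : R -> R) x y :=
  PsiA U A (psi2 th rho f) (psi2y th k0 rho f f1) x y - PsiA U A (psi2 th rho f) (psi2y th k0 rho f f1) x 0.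

Section Weight.
Variables (th : R) (k0 rho f f1 : R -> R).
Hypotheses (ck0 : continuous k0) (drho : forall y, is_derive y 1 rho (k0 y * rho y)).
Hypotheses (cf1 : continuous f1) (df : forall y, is_derive y 1 f (f1 y)).
Let crho : continuous rho. Proof. by move=> y; exact: is_derive_cont (drho y). Qed.
Let cf : continuous f. Proof. by move=> y; exact: is_derive_cont (df y). Qed.
Let cpsi := @psi2_cont R th _ _ crho cf.
Let cpsiy := @psi2y_cont R th _ _ _ _ ck0 crho cf cf1.

Lemma excA_cont A : continuous (unc (excA A th k0 rho f f1)).
Proof.
have cP : continuous (unc (PsiA U A (psi2 th rho f) (psi2y th k0 rho f f1))).
  exact: (@PsiA_cont _ _ _ _ _ _ _ _ _ _ W A _ _ cpsi cpsiy).
apply: cont2B => //; exact: (cont2_1 (cont2_sec1 (t := 0) cP)).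
Qed.

Lemma excAE A x y : A <= y -> y <= 0 -> excA A th k0 rho f f1 x y = exc th rho f x y.
Proof.
move=> Ay y0; rewrite /excA /exc -[LHS]opprB.
rewrite (PsiA_incr W (cont2_sec2 (x := x) cpsiy) (fun y => is_derive_psi2 th x y drho df) Ay y0 (lexx 0)).
exact: opprK.
Qed.

Lemma iv_exc x a b : b <= 0 -> iv a b (fun w => u w * psi2 th rho f x w).
Proof. by move=> b0; apply: (iv_slope_mul W) => //; exact: (cont2_sec2 (x := x) cpsi). Qed.

Lemma exc_ge0 x y : (forall w, 0 <= rho w) -> (forall w, 0 <= f w) -> 0 <= exc th rho f x y.
Proof. by move=> r0 f0; apply: I_ge0 => w _; rewrite mulr_ge0 ?(slope_nonneg W)// mulr_ge0. Qed.

Lemma slope_zero : u 0 = 0.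
Proof.
have n0 : 0 < n by exact: lt_le_trans (pr_n W).
have pz : pw n^-1 0 = 0 :> R by rewrite pw_npos// invr_eq0 gt_eqF.
by rewrite /slope (pres_zero W)// pz mulr0.
Qed.

Lemma exc_le x y y1 K : y <= y1 -> y1 <= 0 -> 0 <= K ->
  (forall w, y <= w <= y1 -> psi2 th rho f x w <= K) ->
  (forall w, y1 <= w -> w < 0 -> psi2 th rho f x w = 0) -> exc th rho f x y <= K * (U y - U y1).
Proof.
move=> yy y10 K0 H1 H2; rewrite /exc (I_split yy y10 (iv_exc _ _ (lexx 0))).
rewrite (I_ext (a := y1) (g := fun=> 0)); last first.
  move=> w /andP[yw]; rewrite le_eqVlt => /orP[/eqP ->|w0]; first by rewrite slope_zero mul0r.
  by rewrite H2 ?mulr0.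
rewrite I_0 addr0 -(I_slope W yy y10) -IZ; last exact: (iv_slope' W).
apply: I_le; [exact: iv_exc|by apply: ivZ; exact: (iv_slope' W)|].
by move=> w ww; rewrite mulrC ler_wpM2r ?(slope_nonneg W)// H1.
Qed.

Lemma exc_gt0 x y y1 : y < y1 -> y1 <= 0 -> (forall w, 0 <= rho w) -> (forall w, 0 <= f w) ->
  (forall w, y <= w <= y1 -> 0 < psi2 th rho f x w) -> 0 < exc th rho f x y.
Proof.
move=> yy y10 r0 f0 H.
have cp : {within `[y, y1], continuous (psi2 th rho f x)}.
  by apply: continuous_subspaceT; exact: (cont2_sec2 (x := x) cpsi).
have [w0 w0y Hmin] := EVT_min (ltW yy) cp.
have k0' : 0 < psi2 th rho f x w0 by apply: H; move: w0y; rewrite in_itv.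
apply: (@lt_le_trans _ _ (psi2 th rho f x w0 * (U y - U y1))).
  by rewrite mulr_gt0// subr_gt0 (pr_dec W).
rewrite -(I_slope W (ltW yy) y10) -IZ; last exact: (iv_slope' W).
apply: (@le_trans _ _ (I y y1 (fun w => u w * psi2 th rho f x w))).
  apply: I_le; [by apply: ivZ; exact: (iv_slope' W)|exact: iv_exc|].
  by move=> w ww; rewrite mulrC ler_wpM2l ?(slope_nonneg W)// Hmin// in_itv.
apply: (I_sub_le (lexx y) (ltW yy) y10); first exact: iv_exc.
by move=> w _; rewrite mulr_ge0 ?(slope_nonneg W)// mulr_ge0.
Qed.

Lemma range_base l x y : l <= x -> l < C -> Num.min (x - C) 0 <= y -> l - C <= y.
Proof.
move=> lx lC; apply: le_trans; rewrite le_min lerD2r lx/= subr_le0; exact: ltW.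
Qed.

Lemma I_excE l r t : l <= r -> l < C ->
  I l r (fun x => exc th rho f x (z x t)) = I l r (fun x => excA (l - C) th k0 rho f f1 x (z x t)).
Proof.
move=> lr lC; apply: I_ext => x /andP[lx _]; rewrite excAE//.
by apply: (range_base lx lC); have /andP[] := z_range E x t.
Qed.

Lemma excess_step l r T0 T1 T2 T3 lam c1 B :
  l < r -> r <= C -> T0 < T1 -> T1 <= T2 -> T2 < T3 ->
  (forall y, y <= 0 -> k0 y * P y = lam * h (U y)) ->
  (forall x y, l <= x <= r -> Num.min (x - C) 0 <= y <= Num.min 0 (x + C) ->
     rho y * (k0 y * f (x - th * y) - th * f1 (x - th * y)) <= 0) ->
  (forall x y, l <= x <= r -> Num.min (x - C) 0 <= y <= Num.min 0 (x + C) -> rho y * f1 (x - th * y) <= c1) ->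
  (forall t, T0 < t < T3 -> f (l - th * z l t) = 0) ->
  (r = C \/ forall t, T0 < t < T3 -> f (r - th * z r t) = 0) ->
  int2 l r T1 T2 B ->
  (\forall t \ae mu, T1 < t < T2 -> forall G, iv l r G -> ac l r (z ^~ t) (sig ^~ t) ->
     (\forall x \ae mu, l < x < r -> G x = GIterm n c h U V s z th lam rho f f1 x t) -> I l r G <= I l r (B ^~ t)) ->
  I l r (fun x => exc th rho f x (z x T2)) - I l r (fun x => exc th rho f x (z x T1)) <= J2 l r T1 T2 B.
Proof.
move=> lr rC T01 T12 T23 kP Hneg Hc1 bl br IB2 HB.
have lC : l < C by exact: lt_le_trans rC.
rewrite !(I_excE _ (ltW lr) lC).
apply: (general_inequality W E lr rC T01 T12 T23 ck0 drho cf1 df kP Hneg Hc1 bl br _ _ IB2 HB).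
  exact: excA_cont.
move=> x y1 y2 xx yy1 yy2; rewrite /excA.
have cancel (p q v : R) : p - v - (q - v) = p - q by ring.
rewrite cancel.
have /andP[lx _] := xx; have /andP[h1 h2] := yy1; have /andP[h3 h4] := yy2.
have y0 y : y <= Num.min 0 (x + C) -> y <= 0 by rewrite le_min => /andP[].
apply: (PsiA_convex W (cont2_sec2 (x := x) cpsiy) (fun y => is_derive_psi2 th x y drho df)).
- exact: range_base lx lC h1.
- exact: range_base lx lC h3.
- exact: y0.
- exact: y0.
move=> y /andP[ym yM]; apply: Hneg => //.
apply/andP; split; first by apply: le_trans ym; rewrite le_min h1.
by apply: (le_trans yM); rewrite ge_max h2.
Qed.

End Weight.

(** Unlike in the Lyapunov estimate the diffusion is spent entirely on the reaction, [k q <= 1], and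
    no dissipation is kept. *)
Lemma excess_pointwise (r F F1 p q k X sg Gd hv : R) :
  0 <= r -> 0 <= F -> F <= q * F1 -> 0 <= F1 -> 0 <= p -> hv <= k * p -> 0 <= k -> k * q <= 1 ->
  0 <= Gd -> Gd <= (1 - sg) * (1 - X) ->
  r * (F1 * p * (X - 1) * (1 - 1 * sg) + F * hv * Gd) <= 0.
Proof.
move=> r0 F0 Fq F10 p0 hk k0 kq G0 GD; apply: mulr_ge0_le0 => //.
set D := (1 - sg) * (1 - X) in GD.
have D0 : 0 <= D by exact: le_trans GD.
have t1 : F * hv * Gd <= (q * F1) * (k * p) * D.
  apply: (@le_trans _ _ (F * (k * p) * Gd)).
    by rewrite ler_wpM2r// ler_wpM2l.
  apply: ler_pM => //; first by rewrite !mulr_ge0.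
  by rewrite ler_wpM2r// mulr_ge0.
have t2 : (q * F1) * (k * p) * D <= F1 * p * D.
  have -> : (q * F1) * (k * p) * D = (k * q) * (F1 * p * D) by ring.
  by rewrite ler_piMl// mulr_ge0// mulr_ge0.
have -> : F1 * p * (X - 1) * (1 - 1 * sg) = - (F1 * p * D) by rewrite /D; ring.
lra.
Qed.

Lemma posf_cont b (j : R) : 0 < j -> continuous (fun v => pw j (v - b)).
Proof.
by move=> j0; apply: cont1_comp; [exact: pw_cont|apply: cont1B; [move=> ?; exact: cvg_id|exact: cont1c]].
Qed.

Lemma range_v x y : x <= C -> Num.min (x - C) 0 <= y -> x - y <= C.
Proof.
by move=> xC; rewrite /Num.min; case: ifP => _ h1; lra.
Qed.

(** To the right of [xi1] the range of [z] is bounded, so [|kap| <= K], and [v - b] is at most [q].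
    A power [j] above [K q] and [n K q] gives [f <= (q/j) f'] with enough room for the sign
    condition and for absorbing the reaction, as [h(V) = n kap P]. The boundary condition makes the
    weight vanish at [xi1]. *)
Lemma excess_right b xi1 : xi1 < C -> exists2 j, 2 <= j & forall T0 T1 T2 T3, T0 < T1 -> T1 <= T2 -> T2 < T3 ->
  (forall t, T0 < t < T3 -> xi1 - b <= z xi1 t) ->
  I xi1 C (fun x => exc 1 (rho kap) (fun v => pw j (v - b)) x (z x T2)) <=
  I xi1 C (fun x => exc 1 (rho kap) (fun v => pw j (v - b)) x (z x T1)).
Proof.
move=> xiC; have ck := pr_ck W.
have n0 : 0 < n := lt_le_trans ltr01 (pr_n W).
have [K K0 HK] := within_bounded (continuous_subspaceT (A := `[xi1 - C, 0]%classic) ck).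
pose q := Num.max (C - b) 0.
have q0 : 0 <= q by rewrite le_max lexx orbT.
have [j [j2 jK jnK]] : exists j : R, [/\ 2 <= j, K * q <= j & n * K * q <= j].
  have Kq : 0 <= K * q by rewrite mulr_ge0.
  have nKq : 0 <= n * K * q by rewrite !mulr_ge0// ltW.
  by exists (2 + K * q + n * K * q); split; lra.
have j0 : 0 < j by lra.
have j1 : 1 < j by lra.
have jm : 0 < j - 1 by lra.
exists j; first exact: j2.
move=> T0 T1 T2 T3 T01 T12 T23 Hb.
pose f v := pw j (v - b); pose f1 v := j * pw (j - 1) (v - b).
have df (v : R) : is_derive v 1 f (f1 v) by exact: is_derive_pw_pos.
have cf1 : continuous f1 by apply: cont1M; [exact: cont1c|exact: posf_cont].
have f0 v : 0 <= f v by exact: pw_ge0.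
have f10 v : 0 <= f1 v by rewrite mulr_ge0 ?pw_ge0// ltW.
have ff v : v <= C -> f v <= q / j * f1 v.
  move=> vC; rewrite /f /f1 pw_split// mulrA divfK ?gt_eqF// ler_wpM2r ?pw_ge0//.
  by rewrite ge_max le_max /q lerD2r vC/= le_max lexx orbT.
have ylow x y : xi1 <= x -> Num.min (x - C) 0 <= y -> xi1 - C <= y by move=> h1; exact: range_base.
have kb x y : xi1 <= x -> Num.min (x - C) 0 <= y -> y <= 0 -> `|kap y| <= K.
  by move=> h1 h2 y0; apply: HK; rewrite y0 (ylow x).
have y0' x y : y <= Num.min 0 (x + C) -> y <= 0 by rewrite le_min => /andP[].
rewrite -subr_le0.
have J0 : J2 xi1 C T1 T2 (fun _ _ : R => 0) = 0.
  by rewrite /J2 (I_ext (g := fun=> 0)) ?I_0// => t _; rewrite I_0.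
rewrite -[X in _ <= X]J0.
apply: (excess_step (th := 1) (k0 := kap) (rho := rho kap) (f := f) (f1 := f1) ck (drho W) cf1 df
  (T0 := T0) (T3 := T3) (lam := n^-1) (c1 := rM * (j * pw (j - 1) (C - b)))) => //.
- exact: (pr_kP W).
- move=> x y /andP[lx xC] /andP[h1 h2]; apply: mulr_ge0_le0; first exact/ltW/rho_pos.
  have yy := y0' _ _ h2; have k1 := kb _ _ lx h1 yy.
  have v1 := range_v xC h1; rewrite !mul1r subr_le0.
  apply: (@le_trans _ _ (K * (q / j * f1 (x - y)))).
    apply: (@le_trans _ _ (K * f (x - y))); last by rewrite ler_wpM2l// ff.
    by rewrite ler_wpM2r// (le_trans (ler_norm _)).
  by rewrite mulrA ler_piMl// mulrA ler_pdivrMr// mul1r.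
- move=> x y /andP[lx xC] /andP[h1 h2]; rewrite mul1r; apply: ler_pM => //; first exact/ltW/rho_pos.
    by apply: (rho_le W); exact: y0' h2.
  rewrite ler_wpM2l ?(ltW j0)//; apply: pw_le; [exact: ltW|by rewrite lerD2r; exact: range_v].
- move=> t tt; rewrite mul1r /f pw_npos ?gt_eqF//; have := Hb t tt; lra.
- by left.
- exact: int2_cst.
apply: aeW => t tt G IG acz HG; apply: I_ae_le => //; first exact: iv_cst.
apply: ae_le_lt; apply: aeS HG => x Hx xx; rewrite Hx//.
have /andP[/ltW lx /ltW xC] := xx; have /andP[h1 h2] := z_range E x t.
have sg := sig_ge0 E x t; have Pz := pres_ge0 W (z x t).
have [G0 GD] := reaction_defect (pr_n W) sg.
rewrite /GIterm; apply: (@excess_pointwise _ _ _ _ (q / j) (n * K)) => //.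
- exact/ltW/rho_pos.
- by rewrite mul1r; apply: ff; exact: range_v.
- have := pr_kP W (z0 x t); rewrite (en_Uz E) => kP.
  have -> : h (V x t) = n * (kap (z x t) * P (z x t)) by rewrite kP mulrA mulfV ?mul1r// gt_eqF.
  rewrite -mulrA ler_wpM2l ?(ltW n0)// ler_wpM2r// (le_trans (ler_norm _))//.
  exact: kb lx h1 (z0 x t).
- by rewrite mulr_ge0// ltW.
- by rewrite mulrA ler_pdivrMr// mul1r.
Qed.

End Excess.

(** * Chain rule along a graph *)

Section ChainRule.
Variable R : realType.
Implicit Types (x y t e a b l r w A : R).
Notation mu := (@lebesgue_measure R).

Lemma I_near a b (q : R -> R) k e : a <= b -> iv a b q -> (forall x, a <= x <= b -> `|q x - k| <= e) ->
  `|I a b q - k * (b - a)| <= e * (b - a).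
Proof.
move=> ab iq H; rewrite -(I_cst k ab) -IB//; last exact: iv_cst.
by apply: I_le_abs => //; apply: ivB => //; exact: iv_cst.
Qed.

Lemma abs4_half (e a b c d p q : R) : `|a - p| <= e / 2 -> `|b - p| <= e / 2 ->
  forall e', `|c - q| <= e' / 2 -> `|d - q| <= e' / 2 -> `|(a + c) - (b + d)| <= e + e'.
Proof. by rewrite !ler_norml => h1 h2 e'; rewrite !ler_norml; lra. Qed.

(** Over [[u, v]] move first in [y] at the position [u], then in [x] at the level [z v]; continuity
    of [gx] and [gy] at the point [(x, z x)] controls both parts. The sign of [sg] makes [z]
    monotone, so the levels passed lie between [z u] and [z v]. *)
Lemma ac_chain2 (A l r : R) (g gx gy : R -> R -> R) (z sg : R -> R) :
  continuous (unc gx) -> continuous (unc gy) -> continuous z ->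
  (forall x, l <= x <= r -> A <= z x) -> (forall x, l <= x <= r -> 0 <= sg x) ->
  (forall y u v, A <= y -> u <= v -> g v y - g u y = I u v (gx ^~ y)) ->
  (forall x y1 y2, A <= y1 -> y1 <= y2 -> g x y2 - g x y1 = I y1 y2 (gy x)) ->
  ac l r z sg -> ac l r (fun x => g x (z x)) (fun x => gx x (z x) + gy x (z x) * sg x).
Proof.
move=> cgx cgy cz zA sg0 Hx Hy [Is Ez].
have cgr k : continuous (unc k) -> continuous (fun x => k x (z x)).
  move=> ck; have c2 : continuous (unc (fun x t : R => z x)) by exact: cont2_1.
  exact: (@cont2_sec1 R _ 0 (cont2_graph ck c2)).
have ix : iv l r (fun x => gx x (z x)) by apply: iv_contT; exact: cgr.
have iy : iv l r (fun x => gy x (z x) * sg x).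
  by apply: iv_mulc => //; apply: continuous_subspaceT; exact: cgr.
apply: (@ac_of_increments _ _ _ _ _ (fun x => 1 + sg x)).
- exact: ivD.
- by apply: ivD => //; exact: iv_cst.
- by move=> x xx; rewrite addr_ge0// sg0.
move=> e x e0 /andP[lx xr]; have e2 : 0 < e / 2 by rewrite divr_gt0.
have [d1 d10 H1] := (cont2P _).1 cgx x (z x) _ e2.
have [d2 d20 H2] := (cont2P _).1 cgy x (z x) _ e2.
have d12 : 0 < Num.min d1 d2 by rewrite lt_min d10.
have [d3 d30 H3] := (contP _).1 cz x _ d12.
exists (Num.min (Num.min d1 d2) d3); first by rewrite lt_min d12.
move=> u v lu uv vr xuv; rewrite lt_min => /andP[]; rewrite lt_min => /andP[uv1 uv2] uv3.
have dist p : u <= p -> p <= v -> `|p - x| <= v - u.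
  by move=> h1 h2; case: xuv => ->; rewrite ler_norml; apply/andP; split; lra.
have zd p : u <= p -> p <= v -> `|z p - z x| < Num.min d1 d2.
  by move=> h1 h2; apply: H3; exact: le_lt_trans (dist p h1 h2) uv3.
have zu := zd u (lexx u) uv; have zv := zd v uv (lexx v).
have Euv := Ez u v lu uv vr.
have isg : iv u v sg by apply: iv_sub Is.
have sguv p : u <= p <= v -> 0 <= sg p.
  by move=> /andP[h1 h2]; apply: sg0; rewrite (le_trans lu)// (le_trans h2).
have zuv : z u <= z v by rewrite -subr_ge0 Euv; apply: I_ge0.
have zw w : z u <= w -> w <= z v -> `|w - z x| < d1 /\ `|w - z x| < d2.
  move: zu zv; rewrite !lt_min !ltr_norml => /andP[/andP[a1 a2] /andP[a3 a4]] /andP[/andP[b1 b2] /andP[b3 b4]] h1 h2.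
  by split; apply/andP; split; lra.
have Fuv : g v (z v) - g u (z u) = I u v (gx ^~ (z v)) + I (z u) (z v) (gy u).
  rewrite -Hx//; last by apply: zA; rewrite vr (le_trans lu).
  rewrite -Hy//; last by apply: zA; rewrite lu (le_trans uv).
  ring.
have ixuv : iv u v (fun x => gx x (z x)) by apply: iv_sub ix.
have iyuv : iv u v (fun x => gy x (z x) * sg x) by apply: iv_sub iy.
rewrite Fuv !ID//; last exact: iv_cst.
rewrite I_cst// mul1r -Euv mulrDr.
apply: (@abs4_half _ _ _ _ _ (gx x (z x) * (v - u)) (gy x (z x) * (z v - z u))); rewrite mulrAC.
- apply: I_near => //; first by apply: iv_contT; exact: cont2_sec1 cgx.
  move=> p /andP[h1 h2]; apply/ltW/H1; first exact: le_lt_trans (dist p h1 h2) uv1.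
  by have [] := zw _ zuv (lexx _).
- apply: I_near => // p /andP[h1 h2]; apply/ltW/H1; first exact: le_lt_trans (dist p h1 h2) uv1.
  by have := zd p h1 h2; rewrite lt_min => /andP[].
- apply: I_near => //; first by apply: iv_contT; exact: cont2_sec2 cgy.
  move=> w /andP[h1 h2]; apply/ltW/H2; first exact: le_lt_trans (dist u (lexx u) uv) uv2.
  by have [] := zw _ h1 h2.
rewrite Euv -IZ// -IB//; last exact: ivZ.
have iB : iv u v (fun p => gy p (z p) * sg p - gy x (z x) * sg p) by apply: ivB => //; exact: ivZ.
apply: (le_trans (I_norm iB)); rewrite -IZ//; apply: I_le; [exact: iv_norm|exact: ivZ|].
move=> p pp; rewrite -mulrBl normrM (ger0_norm (sguv p pp)) ler_wpM2r ?sguv//.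
have /andP[h1 h2] := pp; apply/ltW/H2; first exact: le_lt_trans (dist p h1 h2) uv2.
by have := zd p h1 h2; rewrite lt_min => /andP[].
Qed.

(** Minus the integral of [k x] from [y] to [0] when [A <= y <= 0]; the cuts at [A] make it jointly
    continuous on the plane. *)
Definition kint A (k : R -> R -> R) x y := I A (Num.max y A) (k x) - I A (Num.max 0 A) (k x).

Lemma kint_cont A k : continuous (unc k) -> continuous (unc (kint A k)).
Proof.
move=> ck; have c1 := @cont_I_upper R k A ck; apply: cont2B => //.
exact: (cont2_1 (cont2_sec1 (u := fun x z => I A (Num.max z A) (k x)) (t := 0) c1)).
Qed.

Lemma kintE A k x y : continuous (unc k) -> A <= y -> y <= 0 -> kint A k x y = - I y 0 (k x).
Proof.
move=> ck Ay y0; rewrite /kint max_l// max_l ?(le_trans Ay)//.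
rewrite (I_split Ay y0); last by apply: iv_contT; exact: cont2_sec2 ck.
by rewrite opprD addrA subrr sub0r.
Qed.

Lemma kint_y A k x y1 y2 : continuous (unc k) -> A <= y1 -> y1 <= y2 -> kint A k x y2 - kint A k x y1 = I y1 y2 (k x).
Proof.
move=> ck Ay yy; have cancel (p q v : R) : p - v - (q - v) = p - q by ring.
rewrite /kint cancel !max_l ?(le_trans Ay)//.
rewrite (I_split Ay yy) ?addrK//; last by apply: iv_contT; exact: cont2_sec2 ck.
by rewrite addrAC subrr add0r.
Qed.

(** Differentiation under the integral sign, in integrated form, by exchanging the order of
    integration. *)
Lemma kint_x A (q f f1 : R -> R) (th : R) y u v : continuous q -> continuous f1 -> (forall v : R, is_derive v 1 f (f1 v)) ->
  u <= v ->
  kint A (fun x w => q w * f (x - th * w)) v y - kint A (fun x w => q w * f (x - th * w)) u y =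
  I u v ((kint A (fun x w => q w * f1 (x - th * w))) ^~ y).
Proof.
move=> cq cf1 df uv; have cf : continuous f by move=> y0; exact: is_derive_cont (df y0).
have caff : continuous (unc (fun x w => x - th * w)).
  apply: cont2B; first by apply: (cont2_1 (phi := id)) => x; exact: cvg_id.
  by apply: (cont2_2 (phi := fun w => th * w)); apply: cont1M; [exact: cont1c|move=> x; exact: cvg_id].
have ck (k : R -> R) : continuous k -> continuous (unc (fun x w => q w * k (x - th * w))).
  by move=> ck; apply: cont2M; [exact: cont2_2|exact: (cont2_comp ck caff)].
have part B : I A B (fun w => q w * f (v - th * w)) - I A B (fun w => q w * f (u - th * w)) =
    I u v (fun x => I A B (fun w => q w * f1 (x - th * w))).
  rewrite -IB; [|by apply: iv_contT; exact: (cont2_sec2 (ck _ cf))|by apply: iv_contT; exact: (cont2_sec2 (ck _ cf))].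
  rewrite fub; last by apply: int2_cont; exact: ck.
  apply: I_ext => w _; rewrite -mulrBr.
  have ca : continuous (fun x => f1 (x - th * w)) by exact: (cont2_sec1 (cont2_comp cf1 caff)).
  rewrite IZ; last exact: iv_contT.
  have [_ ->//] := ac_smooth u v ca (fun x => dshift (df (x - th * w))).
have ci B : continuous (fun x => I A B (fun w => q w * f1 (x - th * w))).
  exact: (@I_param_cont R (fun w x => q w * f1 (x - th * w)) A B (cont2_swap (ck _ cf1))).
rewrite /kint (IB (f := fun x => I A (Num.max y A) (fun w => q w * f1 (x - th * w))));
  [|by apply: iv_contT; exact: ci|by apply: iv_contT; exact: ci].
by rewrite -!part; ring.
Qed.

End ChainRule.

(** * The comparison functional with quadratic weight *)

Section Contact.
Variable R : realType.
Implicit Types (x y t e a b l r w A : R).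
Notation mu := (@lebesgue_measure R).
Variables (n m c L PM rM C : R) (h U kap : R -> R) (V s z : R -> R -> R).
Hypotheses (W : profile n m c L PM rM h U kap) (E : entire n m c C h U V s z).
Notation P := (pres c h U).
Notation u := (slope n m c h U).
Notation sig := (sig n c h U s z).
Let C0 := en_C E.
Let cz := en_cz E.
Let z0 := en_z0 E.

Definition sq b v : R := pw 2 (v - b).
Definition sq1 b v : R := 2 * pw (2 - 1) (v - b).
Definition exq (th b : R) := exc n m c h U th (fun=> 1) (sq b).

Lemma dsq b (v : R) : is_derive v 1 (sq b) (sq1 b v).
Proof. by apply: is_derive_pw_pos; lra. Qed.
Lemma csq1 b : continuous (sq1 b).
Proof. by apply: cont1M; [exact: cont1c|apply: posf_cont; lra]. Qed.
Lemma csq b : continuous (sq b).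
Proof. by move=> v; exact: is_derive_cont (dsq b v). Qed.
Lemma sq_ge0 b v : 0 <= sq b v. Proof. exact: pw_ge0. Qed.
Lemma sq1_ge0 b v : 0 <= sq1 b v. Proof. by rewrite mulr_ge0 ?pw_ge0//; lra. Qed.
Lemma sq_zero b v : v <= b -> sq b v = 0.
Proof. by move=> vb; rewrite /sq pw_npos ?subr_le0// gt_eqF//; lra. Qed.
Lemma sq1_zero b v : v <= b -> sq1 b v = 0.
Proof. by move=> vb; rewrite /sq1 pw_npos ?mulr0 ?subr_le0// gt_eqF//; lra. Qed.
Lemma sq1_le b v v' : v <= v' -> sq1 b v <= sq1 b v'.
Proof. by move=> vv; rewrite /sq1 ler_wpM2l; [|lra|apply: pw_le; lra]. Qed.

Let d1 (y : R) : is_derive y 1 (fun=> 1 : R) ((fun=> 0 : R) y * (fun=> 1 : R) y).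
Proof. by rewrite mul0r; exact: is_derive_cst. Qed.

(** The left side is positive only for [1 < sg < 1/(1 - e)]; there [sg <= 2] because [e <= 1/2], and
    the second factor is at most [e]. *)
Lemma tilt_pointwise e sg : 1 <= n -> 0 <= sg -> 0 < e -> e <= 2^-1 ->
  (pw n sg - 1) * (1 - (1 - e) * sg) <= e * pw n 2 * sg.
Proof.
move=> n1 sg0 e0 e2; have n0 : 0 < n by lra.
have RH : 0 <= e * pw n 2 * sg by rewrite !mulr_ge0 ?pw_ge0// ltW.
have p1 : pw n 1 = 1 :> R by rewrite pwE ?ler01// powR1.
have [s1|s1] := leP sg 1.
  apply: le_trans RH; apply: mulr_le0_ge0; first by rewrite subr_le0 -p1 pw_le// ltW.
  have : (1 - e) * sg <= 1 * 1 by apply: ler_pM => //; lra.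
  lra.
have X1 : 1 <= pw n sg by rewrite -p1; apply: pw_le; exact: ltW.
have [t0|t0] := leP (1 - (1 - e) * sg) 0.
  by apply: le_trans RH; apply: mulr_ge0_le0 => //; lra.
have s2 : sg <= 2.
  rewrite leNgt; apply/negP => s2.
  have : (1 - 2^-1) * 2 <= (1 - e) * sg by apply: ler_pM; lra.
  lra.
have X2 : pw n sg <= pw n 2 by apply: pw_le; [exact: ltW|].
have te : 1 - (1 - e) * sg <= e.
  have : (1 - e) * 1 <= (1 - e) * sg by rewrite ler_wpM2l; lra.
  lra.
apply: (@le_trans _ _ (pw n 2 * e)).
  by apply: ler_pM; lra.
by rewrite mulrC ler_peMr ?mulr_ge0 ?pw_ge0// ltW.
Qed.

Lemma caff th : continuous (unc (fun x w : R => x - th * w)).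
Proof.
apply: cont2B; first by apply: (cont2_1 (phi := id)) => x; exact: cvg_id.
by apply: (cont2_2 (phi := fun w => th * w)); apply: cont1M; [exact: cont1c|move=> x; exact: cvg_id].
Qed.

(* What remains of the reaction term of the comparison functional once [h(V) f sig] is integrated along [x |-> (x, z)]. *)
Definition react th b x y := h (U y) * sq b (x - th * y) - I y 0 (fun w => h (U w) * sq1 b (x - th * w)).

Definition KS b := sq1 b C * pw n 2 * (1 + PM).

Lemma exq_int2 th b l r T1 T2 : l <= r -> l < C -> int2 l r T1 T2 (fun x t => exq th b x (z x t)).
Proof.
move=> lr lC; have ck0 := @cont1c R 0.
have H : int2 l r T1 T2 (fun x t => excA U (l - C) th (fun=> 0) (fun=> 1) (sq b) (sq1 b) x (z x t)).
  apply: int2_cont; apply: cont2_graph => //; exact: (@excA_cont _ _ _ _ _ _ _ _ _ _ W th _ _ _ _ ck0 d1 (@csq1 b) (dsq b) (l - C)).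
apply: int2_ext H => x t /andP[lx _] _; rewrite (excAE W th ck0 d1 (@csq1 b) (dsq b))//.
by apply: (range_base lx lC); have /andP[] := z_range E x t.
Qed.

(** With [rho = 1] and [lam = 0] the reaction contributes [h(V) f (1 - sig)], whose [sig] part is
    integrated exactly along the graph of [z]. The tilt is opposite to that of the Lyapunov weight,
    since [f] now vanishes for small arguments: [l - (1 - e) z <= C + e (l + C) <= b] makes the
    weight vanish at [l]. *)
Lemma contact_step b e l r T0 T1 T2 T3 (La : R) (kappa : R -> R) :
  0 < e -> e <= 2^-1 -> l < r -> r <= C -> l <= - C -> C + e * (l + C) <= b ->
  T0 < T1 -> T1 <= T2 -> T2 < T3 ->
  (r = C \/ forall t, T0 < t < T3 -> r - b <= z r t) ->
  continuous kappa ->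
  (forall x y, l <= x <= r -> Num.min (x - C) 0 <= y -> y <= 0 ->
     react (1 - e) b x y <= La * exq (1 - e) b x y + e * kappa x) ->
  I l r (fun x => exq (1 - e) b x (z x T2)) - I l r (fun x => exq (1 - e) b x (z x T1)) <=
  J2 l r T1 T2 (fun x t => La * exq (1 - e) b x (z x t) + e * (kappa x + KS b * s x t)).
Proof.
move=> e0 e2 lr rC lC le T01 T12 T23 br ck HT.
pose th := 1 - e; have th0 : 0 <= th by rewrite /th; lra.
have th1 : th <= 1 by rewrite /th; lra.
have lC' : l < C by lra.
have [_ Is _ _ _] := en_flux E.
have IB2 : int2 l r T1 T2 (fun x t => La * exq (1 - e) b x (z x t) + e * (kappa x + KS b * s x t)).
  apply: int2D; first by apply: int2Z; apply: exq_int2 => //; exact: ltW.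
  apply: int2Z; apply: int2D; first by apply: int2_cont; exact: (cont2_1 ck).
  by apply: int2Z; exact: Is.
have vle x y : x <= C -> Num.min (x - C) 0 <= y -> y <= 0 -> x - th * y <= C.
  move=> xC yl y0; have := range_v xC yl.
  have : e * y <= 0 by rewrite mulr_ge0_le0// ltW.
  rewrite /th mulrBl mul1r; lra.
have bl t : sq b (l - th * z l t) = 0.
  apply: sq_zero; have := en_lo E l t; rewrite min_l; last lra.
  move=> zl; have := en_hi E t lC => zh.
  have : e * z l t <= e * (l + C) by rewrite ler_wpM2l// ltW.
  rewrite /th mulrBl mul1r; lra.
have brz t : T0 < t < T3 -> r = C \/ forall w, z r t <= w -> w <= 0 -> sq b (r - th * w) = 0.
  move=> tt; case: br => [->|H]; [by left|right => w zw w0]; apply: sq_zero.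
  have := H t tt; have : e * w <= 0 by rewrite mulr_ge0_le0// ltW.
  rewrite /th mulrBl mul1r; lra.
have br' : r = C \/ forall t, T0 < t < T3 -> sq b (r - th * z r t) = 0.
  case: (br) => [->|_]; [by left|].
  have [rE|/eqP rE] := eqVneq r C; [by left|right => t tt].
  by case: (brz t tt) => [//|->].
apply: (excess_step W E (th := th) (k0 := fun=> 0) (rho := fun=> 1) (f := sq b) (f1 := sq1 b) (lam := 0)
  (@cont1c R 0) d1 (@csq1 b) (dsq b) lr rC T01 T12 T23 (c1 := sq1 b C)) => //.
- by move=> y _; rewrite !mul0r.
- move=> x y _ _; rewrite mul1r mul0r sub0r oppr_le0 mulr_ge0// sq1_ge0//.
- move=> x y /andP[_ xr] /andP[h1 h2]; rewrite mul1r; apply: sq1_le; apply: vle => //.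
    exact: le_trans rC.
  by move: h2; rewrite le_min => /andP[].
have := fub_ae2 IB2; apply: aeS => t Ht /andP[t1 t2] G IG acz HG.
have tt : T0 < t < T3 by rewrite (lt_trans T01)// (lt_trans t2).
have {}Ht := Ht (introT andP (conj (ltW t1) (ltW t2))).
have chU := hU_cont W.
pose A := l - C.
have zA x : l <= x <= r -> A <= z x t.
  by move=> /andP[lx _]; apply: (range_base lx lC'); have /andP[] := z_range E x t.
pose k := fun x w => (h \o U) w * sq b (x - th * w).
pose k1 := fun x w => (h \o U) w * sq1 b (x - th * w).
have cc (f : R -> R) : continuous f -> continuous (unc (fun x w => (h \o U) w * f (x - th * w))).
  by move=> cf; apply: cont2M; [exact: cont2_2|exact: (cont2_comp cf (@caff th))].
have ck_ : continuous (unc k) := cc _ (@csq b).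
have ck1 : continuous (unc k1) := cc _ (@csq1 b).
have ach : ac l r (fun x => kint A k x (z x t)) (fun x => kint A k1 x (z x t) + k x (z x t) * sig x t).
  apply: (@ac_chain2 _ A l r (kint A k) (kint A k1) k (z ^~ t) (sig ^~ t)) => //.
  - exact: kint_cont.
  - exact: cont2_sec1.
  - by move=> x _; exact: (sig_ge0 E).
  - by move=> y u0 v0 _ uv; exact: (kint_x A th y chU (@csq1 b) (dsq b) uv).
  - by move=> x y1 y2; exact: kint_y.
have [Ia Fa] := ach.
(* [kint A k x (z x t)] vanishes at both ends, so its total derivative integrates to zero; adding it
   to [G] cancels the term [- h(V) f sig] and leaves [react]. *)
have I0 : I l r (fun x => kint A k1 x (z x t) + k x (z x t) * sig x t) = 0.
  have lrle := ltW lr; have ll : l <= l <= r by rewrite lexx.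
  have rr : l <= r <= r by rewrite lrle lexx.
  have zero x : (forall w, z x t <= w <= 0 -> k x w = 0) -> l <= x <= r -> kint A k x (z x t) = 0.
    by move=> kz xx; rewrite kintE ?zA// (I_ext (g := fun=> 0)) ?I_0 ?oppr0.
  rewrite -Fa// !zero// ?subrr//.
    move=> w /andP[zw w0]; rewrite /k; have := bl t; suff : sq b (l - th * w) <= sq b (l - th * z l t).
      move=> hh b0; have := sq_ge0 b (l - th * w); rewrite b0 in hh => hh2.
      by rewrite (@le_anti _ _ (sq b _) 0) ?mulr0// hh.
    by apply: pw_le; [lra|rewrite lerD2r lerD2l lerN2 ler_wpM2l].
  move=> w /andP[zw w0]; rewrite /k; case: (brz t tt) => [rE|->//]; last by rewrite mulr0.
  have w1 : w = 0 by apply: le_anti; rewrite w0 -(z_right E t (x := r)) ?rE// -rE.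
  rewrite w1 mulr0 subr0 /=; have := pr_U0 W (lexx 0) => ->; rewrite (pr_h0 W) mul0r//.
have -> : I l r G = I l r (fun x => G x + (kint A k1 x (z x t) + k x (z x t) * sig x t)).
  by rewrite ID// I0 addr0.
apply: I_ae_le => //; first exact: ivD.
apply: ae_le_lt; apply: aeS HG => x Hx xx; rewrite Hx//.
have /andP[/ltW lx /ltW xr] := xx; have xC := le_trans xr rC.
have xx' : l <= x <= r by rewrite lx.
have /andP[h1 _] := z_range E x t.
have sg := sig_ge0 E x t; have Pz := pres_ge0 W (z x t).
rewrite kintE ?zA//.
have HTx := HT x _ xx' h1 (z0 x t).
have T1' : sq1 b (x - th * z x t) * P (z x t) * (pw n (sig x t) - 1) * (1 - th * sig x t) <= e * (KS b * s x t).
  have f1b : sq1 b (x - th * z x t) <= sq1 b C by apply: sq1_le; exact: vle.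
  have tp := tilt_pointwise (pr_n W) sg e0 e2.
  rewrite -[leLHS]mulrA; apply: (@le_trans _ _ (sq1 b (x - th * z x t) * P (z x t) * (e * pw n 2 * sig x t))).
    by rewrite ler_wpM2l// mulr_ge0// sq1_ge0.
  have -> : sq1 b (x - th * z x t) * P (z x t) * (e * pw n 2 * sig x t) =
    e * (sq1 b (x - th * z x t) * pw n 2 * (P (z x t) * sig x t)) by ring.
  rewrite ler_wpM2l ?(ltW e0)// /KS -[leRHS]mulrA; apply: ler_pM.
  - by rewrite mulr_ge0 ?sq1_ge0 ?pw_ge0.
  - by rewrite mulr_ge0.
  - by rewrite ler_wpM2r ?pw_ge0.
  - exact: (Psig_le W E).
move: HTx T1'; rewrite /GIterm /react /k /k1 /= (en_Uz E) -/th.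
set a1 := sq1 b _ * _ * _ * _; set a2 := sq b _; set a3 := I _ _ _ => HTx T1'.
rewrite !mulrDr; lra.
Qed.

End Contact.

Lemma absorb_half (R : realType) (y w1 w2 w3 w4 : R) : y <= w1 + w2 -> w1 <= w3 -> w3 <= 2^-1 * y -> w2 <= w4 ->
  y <= 2 * w4.
Proof. by move=> *; lra. Qed.

(** * Comparison on half-lines and on the whole line *)

Section ContactConsequences.
Variable R : realType.
Implicit Types (x y t e a b l r w A : R).
Notation mu := (@lebesgue_measure R).
Variables (n m c L PM rM C : R) (h U kap : R -> R) (V s z : R -> R -> R).
Hypotheses (W : profile n m c L PM rM h U kap) (E : entire n m c C h U V s z).
Notation P := (pres c h U).
Notation u := (slope n m c h U).
Notation exq := (exq n m c h U).
Notation react := (react h U).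
Let C0 := en_C E.
Let cz := en_cz E.
Let z0 := en_z0 E.
Let L0 := pr_L W.

Let d1 (y : R) : is_derive y 1 (fun=> 1 : R) ((fun=> 0 : R) y * (fun=> 1 : R) y).
Proof. by rewrite mul0r; exact: is_derive_cst. Qed.

Lemma sq_aff_cont (th b : R) x (k : R -> R) : continuous k -> continuous (fun w => k w * sq1 b (x - th * w)).
Proof.
move=> ck; apply: cont1M => //; apply: (cont1_comp (@csq1 R b)).
by apply: cont1B; [exact: cont1c|apply: cont1M; [exact: cont1c|move=> ?; exact: cvg_id]].
Qed.

Lemma sq_taylor (th b : R) x y : y <= 0 ->
  sq b (x - th * y) = sq b x + th * I y 0 (fun w => sq1 b (x - th * w)).
Proof.
move=> y0; have cs : continuous (fun w => sq1 b (x - th * w)).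
  by have := @sq_aff_cont th b x _ (@cont1c R 1); under eq_fun do rewrite mul1r.
have D (w : R) : is_derive w 1 (fun w => sq b (x - th * w)) (- th * sq1 b (x - th * w)).
  have D := @daff _ (sq b) x (- th) w (sq1 b (x - th * w)).
  rewrite mulNr in D; have {}D := D (dsq b _).
  by apply: is_derive_near D; exists 1 => // w' _; rewrite mulNr.
have cd : continuous (fun w => - th * sq1 b (x - th * w)) by apply: cont1M => //; exact: cont1c.
have [_ H] := ac_smooth y 0 cd D.
have := H y 0 (lexx y) y0 (lexx 0); rewrite IZ; last exact: iv_contT.
by rewrite mulr0 subr0 => /eqP; rewrite subr_eq => /eqP ->; ring.
Qed.

(** Integration by parts gives [exq] and [react] similar forms, with [U] in the one and [h(U)] in
    the other, so that bounds on increments of [h] compare them. *)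
Lemma exq_parts (th b : R) x y : y <= 0 ->
  exq th b x y = U y * sq b x + I y 0 (fun w => th * (U y - U w) * sq1 b (x - th * w)).
Proof.
move=> y0; have cU := pr_cU W; have ck0 := @cont1c R 0.
have cs : continuous (fun w => sq1 b (x - th * w)).
  by have := @sq_aff_cont th b x _ (@cont1c R 1); under eq_fun do rewrite mul1r.
have cUs := @sq_aff_cont th b x _ cU.
rewrite /exq -(excAE W th ck0 d1 (@csq1 R b) (dsq b) x (lexx y) y0) /excA /PsiA maxxx Iaa max_l//.
rewrite (pr_U0 W (lexx 0)) mul0r sub0r opprK subr0 /psi2 mul1r sq_taylor//.
have -> : I y 0 (fun w => U w * psi2y th (fun=> 0) (fun=> 1) (sq b) (sq1 b) x w) =
  - th * I y 0 (fun w => U w * sq1 b (x - th * w)).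
  by rewrite -IZ; [apply: I_ext => w _; rewrite /psi2y; ring|exact: iv_contT].
have -> : I y 0 (fun w => th * (U y - U w) * sq1 b (x - th * w)) =
  th * U y * I y 0 (fun w => sq1 b (x - th * w)) - th * I y 0 (fun w => U w * sq1 b (x - th * w)).
  rewrite -IZ; last exact: iv_contT.
  rewrite -IZ; last exact: iv_contT.
  rewrite -IB; [|by apply: ivZ; exact: iv_contT|by apply: ivZ; exact: iv_contT].
  by apply: I_ext => w _; ring.
ring.
Qed.

Lemma react_parts (th b : R) x y : y <= 0 ->
  react th b x y = h (U y) * sq b x + I y 0 (fun w => (th * h (U y) - h (U w)) * sq1 b (x - th * w)).
Proof.
move=> y0; have chU := hU_cont W.
have cs : continuous (fun w => sq1 b (x - th * w)).
  by have := @sq_aff_cont th b x _ (@cont1c R 1); under eq_fun do rewrite mul1r.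
have chs := @sq_aff_cont th b x _ chU.
rewrite /react sq_taylor//.
have -> : I y 0 (fun w => (th * h (U y) - h (U w)) * sq1 b (x - th * w)) =
  th * h (U y) * I y 0 (fun w => sq1 b (x - th * w)) - I y 0 (fun w => h (U w) * sq1 b (x - th * w)).
  rewrite -IZ; last exact: iv_contT.
  rewrite -IB; [|by apply: ivZ; exact: iv_contT|exact: iv_contT].
  by apply: I_ext => w _; ring.
ring.
Qed.

Lemma sq1_window b e x w : 0 <= e -> w <= 0 -> x - b <= w -> sq1 b (x - (1 - e) * w) = 0.
Proof.
move=> e0 w0 xw; apply: sq1_zero; have : e * w <= 0 by rewrite mulr_ge0_le0.
rewrite mulrBl mul1r; lra.
Qed.

Lemma sq_window b e x w : 0 <= e -> w <= 0 -> x - b <= w -> sq b (x - (1 - e) * w) = 0.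
Proof.
move=> e0 w0 xw; apply: sq_zero; have : e * w <= 0 by rewrite mulr_ge0_le0.
rewrite mulrBl mul1r; lra.
Qed.

(** The integrand lives on [w <= x - b <= A], where [h(U)] is nonnegative and nondecreasing in the
    coordinate; hence [h(U y) <= h(U w)] for [y <= w], and no growth term appears. *)
Lemma react_left A b e x y : (forall x y, x <= y -> y <= A -> 0 <= h (U x) /\ h (U x) <= h (U y)) ->
  0 <= e -> e <= 1 -> x <= b -> x - b <= A -> y <= 0 -> react (1 - e) b x y <= 0.
Proof.
move=> hA e0 e1 xb xA y0; rewrite react_parts// sq_zero// mulr0 add0r.
have chU := hU_cont W; apply: (@le_trans _ _ (I y 0 (fun=> 0))); last by rewrite I_0.
apply: I_le; [|exact: iv_cst|].
  apply: iv_contT; apply: (@sq_aff_cont (1 - e) b x); apply: cont1B; [exact: cont1c|exact: chU].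
move=> w /andP[yw w0].
have [xw|wx] := leP (x - b) w; first by rewrite sq1_window ?mulr0.
have [h0 hh] := hA y w yw (le_trans (ltW wx) xA).
apply: mulr_le0_ge0; last exact: sq1_ge0.
have : 0 <= e * h (U y) by rewrite mulr_ge0.
rewrite mulrBl mul1r; lra.
Qed.

(** The Lipschitz bound of [h] gives the growth rate [L]. The tilt leaves [- e] times an integral of
    [h(U)], which has the good sign for [x <= a] and is bounded otherwise. *)
Lemma react_global b : b <= C -> exists k a, 0 <= k /\ forall e x y, 0 <= e -> e <= 1 -> x <= C ->
  Num.min (x - C) 0 <= y -> y <= 0 ->
  react (1 - e) b x y <= L * exq (1 - e) b x y + e * (k * Num.max (x - a + 1) 0).
Proof.
move=> bC; have [A hA] := pr_hdec W; have chU := hU_cont W; have cU := pr_cU W.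
(* For [x <= a] the window [w <= x - b] lies where [h(U) >= 0]. For [x > a] the integral runs over a
   length at most [C - a], and [max(x - a + 1, 0)] is a continuous majorant of the indicator of
   [x > a]. *)
pose a := Num.min b (b + A); pose k := L * sq1 b C * (C - a).
have ab : a <= b by rewrite ge_min lexx.
have aA : a <= b + A by rewrite ge_min lexx orbT.
have k0 : 0 <= k.
  by apply: mulr_ge0; [apply: mulr_ge0; [exact: ltW|exact: sq1_ge0]|rewrite subr_ge0; exact: le_trans bC].
exists k, a; split => // e x y e0 e1 xC yl y0.
have U01 w : 0 <= U w <= 1 by rewrite (U_nonneg W) ltW// (pr_U1 W).
have RH : 0 <= k * Num.max (x - a + 1) 0 by rewrite mulr_ge0// le_max lexx orbT.
rewrite react_parts// exq_parts//.
set th := 1 - e; have th0 : 0 <= th by rewrite /th; lra.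
have hU w : `|h (U w)| <= L * U w.
  by have /andP[u0 u1] := U01 w; have := pr_hL W (lexx 0) u0 u1; rewrite (pr_h0 W) !subr0.
have s0 : h (U y) * sq b x <= L * (U y * sq b x).
  rewrite mulrA ler_wpM2r ?sq_ge0//; exact: le_trans (ler_norm _) (hU y).
have ci1 : continuous (fun w => (th * h (U y) - h (U w)) * sq1 b (x - th * w)).
  by apply: (@sq_aff_cont th b x); apply: cont1B; [exact: cont1c|exact: chU].
have ci2 : continuous (fun w => th * (U y - U w) * sq1 b (x - th * w)).
  apply: (@sq_aff_cont th b x); apply: cont1M; first exact: cont1c.
  by apply: cont1B; [exact: cont1c|].
have ci3 : continuous (fun w => h (U w) * sq1 b (x - th * w)) by exact: (@sq_aff_cont th b x).
have core : I y 0 (fun w => (th * h (U y) - h (U w)) * sq1 b (x - th * w)) <=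
   L * I y 0 (fun w => th * (U y - U w) * sq1 b (x - th * w)) - e * I y 0 (fun w => h (U w) * sq1 b (x - th * w)).
  rewrite -IZ; last exact: iv_contT.
  rewrite -IZ; last exact: iv_contT.
  rewrite -IB; [|by apply: ivZ; exact: iv_contT|by apply: ivZ; exact: iv_contT].
  apply: I_le; [exact: iv_contT|by apply: ivB; apply: ivZ; exact: iv_contT|].
  move=> w /andP[yw w0]; have /andP[u0 _] := U01 w; have /andP[_ u1] := U01 y.
  have := pr_hL W u0 (pr_Um W yw) u1; rewrite ler_norml => /andP[_ hl].
  have hl2 : th * (h (U y) - h (U w)) <= th * (L * (U y - U w)) by rewrite ler_wpM2l.
  apply: (@le_trans _ _ ((L * (th * (U y - U w)) - e * h (U w)) * sq1 b (x - th * w))).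
    by rewrite ler_wpM2r ?sq1_ge0//; move: hl2; rewrite /th; lra.
  by move: (sq1 _ _) => F; rewrite le_eqVlt; apply/orP; left; apply/eqP; ring.
have tail : - I y 0 (fun w => h (U w) * sq1 b (x - th * w)) <= k * Num.max (x - a + 1) 0.
  have [xa|ax] := leP x a.
    apply: le_trans RH; rewrite oppr_le0; apply: I_ge0 => w /andP[yw w0].
    have [xw|wx] := leP (x - b) w; first by rewrite sq1_window ?mulr0.
    rewrite mulr_ge0 ?sq1_ge0//; have [] // := hA w w (lexx w).
    by apply: (le_trans (ltW wx)); rewrite lerBlDl; exact: le_trans aA.
  apply: (@le_trans _ _ k); last first.
    by rewrite ler_peMr// le_max; apply/orP; left; rewrite lerDr subr_ge0 ltW.
  apply: (le_trans (ler_norm _)); rewrite normrN.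
  have yx : x - C <= y by apply: le_trans yl; rewrite le_min lexx subr_le0.
  apply: (@le_trans _ _ (L * sq1 b C * (0 - y))); last first.
    by apply: ler_wpM2l; [apply: mulr_ge0; [exact: ltW|exact: sq1_ge0]|lra].
  apply: I_le_abs => //; first exact: iv_contT.
  move=> w /andP[yw w0]; rewrite normrM [X in _ * X]ger0_norm ?sq1_ge0//; apply: ler_pM => //.
  - exact: sq1_ge0.
  - apply: (le_trans (hU w)); rewrite ler_piMr ?(ltW L0)//; by have /andP[] := U01 w.
  apply: sq1_le; have : e * w <= 0 by rewrite mulr_ge0_le0.
  rewrite /th mulrBl mul1r; lra.
have := ler_wpM2l e0 tail; rewrite mulrDr; lra.
Qed.

(** For [x >= l1] the coordinate is at least [l1 - C], so the tilt moves the argument by at most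
    [e (C - l1)], which the shift from [b] to [b'] compensates. *)
Lemma exq_tilt b b' e l1 x y : 0 <= e -> l1 <= x -> x - C <= y -> y <= 0 -> b + e * (C - l1) <= b' ->
  exq 1 b' x y <= exq (1 - e) b x y.
Proof.
move=> e0 lx yx y0 bb; have ck0 := @cont1c R 0.
apply: I_le.
- by apply: (iv_exc W 1 d1 (dsq b')).
- by apply: (iv_exc W (1 - e) d1 (dsq b)).
move=> w /andP[yw w0]; rewrite ler_wpM2l ?(slope_nonneg W)// /psi2 !mul1r.
apply: pw_le; first by lra.
have : e * - w <= e * (C - l1) by rewrite ler_wpM2l//; lra.
rewrite mulrN mulrBl mul1r; lra.
Qed.

Lemma exq_ge0 th b x y : 0 <= exq th b x y.
Proof. by apply: exc_ge0 => [|w|w]; [exact: W|exact: ler01|exact: sq_ge0]. Qed.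

Lemma exq_zero b e x y : 0 <= e -> y <= 0 -> Num.min (x - b) 0 <= y -> exq (1 - e) b x y = 0.
Proof.
move=> e0 y0 xy; rewrite /exq /exc (I_ext (g := fun=> 0)) ?I_0// => w /andP[yw w0].
have [xb|xb] := leP (x - b) w; first by rewrite /psi2 sq_window// !mulr0.
have w1 : w = 0.
  apply: le_anti; rewrite w0/=; have := le_trans xy yw.
  by rewrite ge_min => /orP[|//]; rewrite leNgt xb.
by rewrite w1 (slope_zero W) mul0r.
Qed.

Lemma exq_le b e x y : 0 <= e -> x <= C -> x - b <= 0 -> x - C <= y -> y <= 0 ->
  exq (1 - e) b x y <= sq b C * (U (x - C) - U (x - b)).
Proof.
move=> e0 xC xb yx y0.
have [xy|yx'] := leP (x - b) y.
  rewrite exq_zero//; last by rewrite ge_min xy.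
  have [bC|Cb] := leP b C.
    by rewrite mulr_ge0 ?sq_ge0// subr_ge0; apply: (pr_Um W); rewrite lerD2l lerN2.
  by rewrite sq_zero ?mul0r// ltW.
apply: (@le_trans _ _ (sq b C * (U y - U (x - b)))); last first.
  by rewrite ler_wpM2l ?sq_ge0// lerD2r; exact: (pr_Um W).
rewrite /exq; apply: (exc_le W (th := 1 - e) d1 (dsq b)) => //; first exact: ltW.
- exact: sq_ge0.
- move=> w /andP[yw wx]; rewrite /psi2 mul1r; apply: pw_le; first by lra.
  have w0 : w <= 0 by exact: le_trans xb.
  have : e * w <= 0 by rewrite mulr_ge0_le0.
  rewrite mulrBl mul1r; lra.
- by move=> w xw /ltW w0; rewrite /psi2 mul1r sq_window.
Qed.

(** A point with [z] below [min(x - b, 0)] would give a continuous nonnegative integrand a positive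
    value. *)
Lemma exc_vanish (k0 rho f f1 : R -> R) b l1 r t : continuous k0 ->
  (forall y, is_derive y 1 rho (k0 y * rho y)) -> continuous f1 -> (forall v : R, is_derive v 1 f (f1 v)) ->
  (forall y, 0 < rho y) -> (forall v, 0 <= f v) -> (forall v, b < v -> 0 < f v) -> r <= C ->
  I l1 r (fun x => exc n m c h U 1 rho f x (z x t)) <= 0 ->
  forall x, l1 < x -> x < r -> Num.min (x - b) 0 <= z x t.
Proof.
move=> ck0 drho cf1 df r0 f0 fb rC IL x lx xr; rewrite leNgt; apply/negP => zx.
have lr := lt_trans lx xr; have lC := lt_le_trans lr rC.
move: IL; rewrite (I_excE W E 1 ck0 drho cf1 df t (ltW lr) lC); apply/negP; rewrite -ltNge.
pose g x := excA U (l1 - C) 1 k0 rho f f1 x (z x t).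
have gE x' : l1 <= x' -> g x' = exc n m c h U 1 rho f x' (z x' t).
  move=> lx'; rewrite /g (excAE W 1 ck0 drho cf1 df)//.
  by apply: (range_base lx' lC); have /andP[] := z_range E x' t.
apply: (@I_gt0 _ l1 r g x) => //; first by rewrite lx.
- have cg := cont2_graph (@excA_cont _ _ _ _ _ _ _ _ _ _ W 1 _ _ _ _ ck0 drho cf1 df (l1 - C)) cz.
  exact: (cont2_sec1 (t := t) cg).
- move=> x' /andP[lx' _]; rewrite gE//; apply: exc_ge0 => [|w|//]; [exact: W|exact: ltW].
rewrite gE ?(ltW lx)//.
move: zx; rewrite lt_min => /andP[zx1 zx2].
pose y1 := Num.min (z x t + (x - b - z x t) / 2) 0.
have y1z : z x t < y1 by rewrite lt_min zx2 andbT; lra.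
apply: (exc_gt0 W (th := 1) drho df y1z) => //.
- by rewrite ge_min lexx orbT.
- by move=> w; exact: ltW.
move=> w /andP[_ wy]; rewrite /psi2 mulr_gt0//; apply: fb.
have : w <= z x t + (x - b - z x t) / 2 by apply: le_trans wy _; rewrite ge_min lexx.
lra.
Qed.

Lemma exq_vanish b l1 r t : r <= C -> I l1 r (fun x => exq 1 b x (z x t)) <= 0 ->
  forall x, l1 < x -> x < r -> Num.min (x - b) 0 <= z x t.
Proof.
move=> rC; apply: (exc_vanish (@cont1c R 0) d1 (@csq1 R b) (dsq b)) => //.
- exact: sq_ge0.
- by move=> v bv; apply: pw_gt0; rewrite subr_gt0.
Qed.

Lemma iv_exq th b l r t : l < C -> l <= r -> iv l r (fun x => exq th b x (z x t)).
Proof.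
move=> lC lr; have ck0 := @cont1c R 0.
apply: (iv_ext (f := fun x => excA U (l - C) th (fun=> 0) (fun=> 1) (sq b) (sq1 b) x (z x t))).
  move=> x /andP[lx _]; rewrite (excAE W th ck0 d1 (@csq1 R b) (dsq b))//.
  by apply: (range_base lx lC); have /andP[] := z_range E x t.
have cg := cont2_graph (@excA_cont _ _ _ _ _ _ _ _ _ _ W th _ _ _ _ ck0 d1 (@csq1 R b) (dsq b) (l - C)) cz.
by apply: iv_contT; exact: (cont2_sec1 (t := t) cg).
Qed.

Lemma range_low x t : x <= C -> x - C <= z x t.
Proof. by move=> xC; have := en_lo E x t; rewrite min_l// subr_le0. Qed.

(** The tilted inequality is used in the region where the reaction has the good sign, from a left
    end that depends on [e]. At time [T1] the excess is confined to [x < l0] and bounded by a tail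
    of [1 - U]; at time [T2] the shift from [b] to [b'] absorbs the tilt. Then [e] tends to [0]. *)
Lemma contact_left A b b' l0 l1 r T1 T2 T3 :
  (forall x y, x <= y -> y <= A -> 0 <= h (U x) /\ h (U x) <= h (U y)) ->
  b < b' -> b <= C -> r <= C -> r <= b -> r - b <= A -> l1 < r -> l0 <= r -> T1 <= T2 -> T2 < T3 ->
  (forall t, t < T3 -> r - b <= z r t) -> (forall x, l0 <= x <= r -> x - b <= z x T1) ->
  I l1 r (fun x => exq 1 b' x (z x T2)) <= sq b C * ((C - b) * (1 - U (l0 - b))).
Proof.
move=> hA bb bC rC rb rA l1r l0r T12 T23 Hr H1.
have l1C := lt_le_trans l1r rC; have Cl : 0 < C - l1 by rewrite subr_gt0.
pose e1 := Num.min 2^-1 ((b' - b) / (C - l1)).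
have e10 : 0 < e1 by rewrite lt_min invr_gt0 ltr0n/= divr_gt0// subr_gt0.
apply: (@small_eps _ _ _ (KS n PM C b * (T2 - T1)) e1) => // e e0 ee.
have e2 : e <= 2^-1 by apply: (le_trans ee); rewrite ge_min lexx.
have eb : e * (C - l1) <= b' - b by rewrite -ler_pdivlMr//; apply: (le_trans ee); rewrite ge_min lexx orbT.
(* The last entry is the left end that the tilt requires, [C + e (l + C) <= b]. *)
pose l := Num.min (Num.min l1 l0) (Num.min (- C) (- C - (C - b) / e)).
have ll1 : l <= l1 by rewrite /l !ge_min lexx.
have ll0 : l <= l0 by rewrite /l !ge_min lexx orbT.
have lC : l <= - C by rewrite /l !ge_min lexx !orbT.
have le : C + e * (l + C) <= b.
  have le1 : l <= - C - (C - b) / e by rewrite /l !ge_min lexx !orbT.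
  have : e * (l + C) <= e * (- ((C - b) / e)) by rewrite ler_wpM2l ?(ltW e0)//; lra.
  rewrite mulrN mulrCA mulfV ?gt_eqF// mulr1; lra.
have lr : l < r by exact: le_lt_trans l1r.
have lC' := lt_le_trans lr rC.
have [_ Is _ _ _] := en_flux E.
have br : r = C \/ forall t, T1 - 1 < t < T3 -> r - b <= z r t by right => t /andP[_]; exact: Hr.
have T11 : T1 - 1 < T1 by rewrite gtrBl.
have HT x y : l <= x <= r -> Num.min (x - C) 0 <= y -> y <= 0 ->
    react (1 - e) b x y <= 0 * exq (1 - e) b x y + e * (fun=> 0 : R) x.
  move=> /andP[_ xr] _ y0; rewrite mul0r mulr0 addr0; apply: (react_left hA) => //.
  - exact: ltW.
  - by apply: (le_trans e2); rewrite invf_le1// ler1n.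
  - exact: le_trans rb.
  - by apply: le_trans rA; rewrite lerD2r.
have := contact_step W E e0 e2 lr rC lC le T11 T12 T23 br (@cont1c R 0) HT.
have -> : J2 l r T1 T2 (fun x t => 0 * exq (1 - e) b x (z x t) + e * (0 + KS n PM C b * s x t)) =
   e * KS n PM C b * J2 l r T1 T2 s.
  by rewrite -(J2Z _ (Is _ _ _ _)); apply: J2_ext => x t _ _; ring.
have js : J2 l r T1 T2 s <= T2 - T1.
  apply: le_trans (J2_s_le W E (ltW lC') T12).
  apply: I_ae_le; [exact: fub_iv2 (Is _ _ _ _)|exact: fub_iv2 (Is _ _ _ _)|].
  have := fub_ae2 (Is l C T1 T2); apply: aeS => t Ht tt.
  apply: (I_sub_le (lexx l) (ltW lr) rC); first exact: Ht.
  by move=> x _; exact: (flux_s_ge0 E).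
have KS0 : 0 <= e * KS n PM C b.
  by rewrite mulr_ge0 ?(ltW e0)// /KS !mulr_ge0 ?sq1_ge0 ?pw_ge0// addr_ge0 ?(PM_ge0 W).
have js' := ler_wpM2l KS0 js.
have e0' := ltW e0.
have up : I l1 r (fun x => exq 1 b' x (z x T2)) <= I l r (fun x => exq (1 - e) b x (z x T2)).
  apply: (@le_trans _ _ (I l1 r (fun x => exq (1 - e) b x (z x T2)))).
    apply: I_le; [by apply: iv_exq => //; exact: ltW|by apply: iv_exq => //; exact: ltW|].
    move=> x /andP[lx xr]; apply: (exq_tilt e0' lx) => //; first by apply: range_low; exact: le_trans rC.
    by rewrite addrC -lerBrDr.
  apply: (I_sub_le ll1 (ltW l1r) (lexx r)); first by apply: iv_exq => //; exact: ltW.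
  by move=> x _; exact: exq_ge0.
have dn : I l r (fun x => exq (1 - e) b x (z x T1)) <= sq b C * ((C - b) * (1 - U (l0 - b))).
  rewrite (I_split ll0 l0r); last by apply: iv_exq => //; exact: ltW.
  rewrite (I_ext (a := l0) (g := fun=> 0)) ?I_0 ?addr0; last first.
    move=> x xx; apply: exq_zero => //; rewrite ge_min H1//.
  have cs k : continuous (fun x => U (x - k)).
    by apply: (cont1_comp (pr_cU W)); apply: cont1B; [move=> ?; exact: cvg_id|exact: cont1c].
  apply: (@le_trans _ _ (I l l0 (fun x => sq b C * (U (x - C) - U (x - b))))).
    apply: I_le; first by apply: iv_exq.
      by apply: ivZ; apply: ivB; apply: iv_contT; exact: cs.
    move=> x /andP[lx xl0]; have xr := le_trans xl0 l0r; have xC := le_trans xr rC.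
    by apply: exq_le => //; [rewrite subr_le0 (le_trans xr)|exact: range_low].
  rewrite IZ; last by apply: ivB; apply: iv_contT; exact: cs.
  by rewrite ler_wpM2l ?sq_ge0//; apply: (I_shift_le W).
rewrite [e * (_ * (T2 - T1))]mulrA => st.
move: st js' up dn; set a1 := I _ _ _; set a2 := I _ _ _; set a3 := e * _ * J2 _ _ _ _ _.
move: (e * _ * _) (sq _ _ * _) => q1 q2 h1 h2 h3 h4.
by apply: (le_trans h3); rewrite addrC; lra.
Qed.

(** Gronwall's argument over a time step of length at most [1/(2L)]: the excess starts at zero and
    grows at rate at most [L] up to an error [O(e)]. The pointwise conclusion uses levels [b']
    slightly above [b]. *)
Lemma contact_global b T1 T2 : b <= C -> T1 <= T2 -> T2 <= T1 + (2 * L)^-1 ->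
  (forall x, Num.min (x - b) 0 <= z x T1) -> forall x, Num.min (x - b) 0 <= z x T2.
Proof.
move=> bC T12 TL H1.
suff H b' l1 : b < b' -> l1 < C -> I l1 C (fun x => exq 1 b' x (z x T2)) <= 0.
  move=> x; rewrite leNgt; apply/negP => zx.
  have [xC|Cx] := ltP x C; last first.
    by move: zx; rewrite (z_right E)// lt_min ltxx andbF.
  move: zx; rewrite lt_min => /andP[zx1 zx2].
  have b1 : b < b + (x - b - z x T2) / 2 by lra.
  have l1 : x - 1 < C by lra.
  have xx : x - 1 < x by lra.
  have := exq_vanish (lexx C) (H _ _ b1 l1) xx xC; rewrite ge_min => /orP[]; lra.
move=> bb l1C.
have Cl : 0 < C - l1 by rewrite subr_gt0.
have [k [a [k0 HT]]] := react_global bC.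
pose kappa x := k * Num.max (x - a + 1) 0.
have ckap : continuous kappa.
  apply: cont1M; first exact: cont1c.
  have := @posf_cont R (a - 1) 1 ltr01.
  have -> // : (fun v => pw 1 (v - (a - 1))) = (fun x => Num.max (x - a + 1) 0).
  by apply/funext => v; rewrite /pw powRr1 ?le_max ?lexx ?orbT//; congr (Num.max _ _); ring.
pose B0 := Num.min (a - 1) (- C); pose kM := k * Num.max (C - a + 1) 0.
have B0C : B0 <= C by have := C0; rewrite ge_min => ?; apply/orP; right; lra.
have kM0 : 0 <= kM by rewrite mulr_ge0// le_max lexx orbT.
pose tau := (2 * L)^-1; pose kk := kM * (C - B0).
have tau0 : 0 <= tau by rewrite invr_ge0 mulr_ge0// ltW.
have ikap l : l <= B0 -> I l C kappa <= kk.
  move=> lB; rewrite (I_split lB B0C); last exact: iv_contT.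
  rewrite (I_ext (b := B0) (g := fun=> 0)) ?I_0 ?add0r.
    apply: (@le_trans _ _ (I B0 C (fun=> kM))); last by rewrite I_cst.
    apply: I_le; [exact: iv_contT|exact: iv_cst|move=> x /andP[_ xC]].
    rewrite ler_wpM2l// ge_max !le_max lexx !orbT andbT; apply/orP; left; lra.
  move=> x /andP[_ xB]; have : B0 <= a - 1 by rewrite ge_min lexx.
  by move=> Ba; rewrite /kappa max_r ?mulr0//; lra.
pose KSb := KS n PM C b.
have KS0 : 0 <= KSb by rewrite /KSb /KS !mulr_ge0 ?sq1_ge0 ?pw_ge0// addr_ge0 ?(PM_ge0 W).
pose e1 := Num.min 2^-1 ((b' - b) / (C - l1)).
have e10 : 0 < e1 by rewrite lt_min invr_gt0 ltr0n/= divr_gt0// subr_gt0.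
apply: (@small_eps _ _ _ (2 * tau * (kk + KSb)) e1) => // e e0 ee; rewrite add0r.
have e0' := ltW e0.
have e2 : e <= 2^-1 by apply: (le_trans ee); rewrite ge_min lexx.
have eb : e * (C - l1) <= b' - b by rewrite -ler_pdivlMr//; apply: (le_trans ee); rewrite ge_min lexx orbT.
pose l := Num.min (Num.min l1 B0) (Num.min (- C) (- C - (C - b) / e)).
have ll1 : l <= l1 by rewrite /l !ge_min lexx.
have lB : l <= B0 by apply: (@le_trans _ _ (Num.min l1 B0)); rewrite ge_min lexx ?orbT.
have lC : l <= - C by rewrite /l !ge_min lexx !orbT.
have le : C + e * (l + C) <= b.
  have le1 : l <= - C - (C - b) / e by rewrite /l !ge_min lexx !orbT.
  have : e * (l + C) <= e * (- ((C - b) / e)) by rewrite ler_wpM2l//; lra.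
  rewrite mulrN mulrCA mulfV ?gt_eqF// mulr1; lra.
have lC' : l < C by exact: le_lt_trans l1C.
pose y t := I l C (fun x => exq (1 - e) b x (z x t)).
have cy : continuous y.
  have ck0 := @cont1c R 0.
  have -> : y = (fun t => I l C (fun x => excA U (l - C) (1 - e) (fun=> 0) (fun=> 1) (sq b) (sq1 b) x (z x t))).
    by apply/funext => t; exact: (I_excE W E (1 - e) ck0 d1 (@csq1 R b) (dsq b) t (ltW lC') lC').
  apply: I_param_cont.
  exact: (cont2_graph (@excA_cont _ _ _ _ _ _ _ _ _ _ W (1 - e) _ _ _ _ ck0 d1 (@csq1 R b) (dsq b) (l - C)) cz).
(* At the maximising time the inequality reads [y <= L (tm - T1) y + O(e)], and [tm - T1 <= 1/(2L)]
   absorbs half of [y]. *)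
have [tm tmT Hmax] := EVT_max T12 (continuous_subspaceT (A := `[T1, T2]%classic) cy).
have /andP[Tm mT] : T1 <= tm <= T2 by move: tmT; rewrite in_itv.
have [_ Is _ _ _] := en_flux E.
have T11 : T1 - 1 < T1 by rewrite gtrBl.
have Tmm : tm < tm + 1 by rewrite ltrDl.
have e1' : e <= 1 by apply: (le_trans e2); rewrite invf_le1// ler1n.
have := contact_step W E e0 e2 lC' (lexx C) lC le T11 Tm Tmm (or_introl erefl) ckap (La := L)
  (fun x y xx h1 h2 => HT e x y e0' e1' (proj2 (andP xx)) h1 h2).
have Iq := exq_int2 W E (1 - e) b T1 tm (ltW lC') lC'.
have Ik : int2 l C T1 tm (fun x t => kappa x) by apply: int2_cont; exact: (cont2_1 ckap).
rewrite J2D; [|exact: int2Z|by apply: int2Z; apply: int2D => //; apply: int2Z; exact: Is].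
rewrite (J2Z L Iq) (J2Z e) ?J2D//; [|by apply: int2Z; exact: Is|by apply: int2D => //; apply: int2Z; exact: Is].
rewrite (J2Z _ (Is _ _ _ _)) -/KSb.
have y1 : I l C (fun x => exq (1 - e) b x (z x T1)) = 0.
  by rewrite (I_ext (g := fun=> 0)) ?I_0// => x _; apply: exq_zero.
rewrite y1 subr0 -/(y tm).
have d0 : 0 <= tm - T1 by rewrite subr_ge0.
have dt : tm - T1 <= tau by rewrite /tau; lra.
have ym0 : 0 <= y tm by apply: I_ge0 => x _; exact: exq_ge0.
have j1 : J2 l C T1 tm (fun x t => exq (1 - e) b x (z x t)) <= y tm * (tm - T1).
  rewrite -(I_cst _ Tm); apply: I_le; [by apply: iv_contT|exact: iv_cst|].
  by move=> t /andP[t1 t2]; apply: Hmax; rewrite in_itv/= t1 (le_trans t2).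
have j2 : J2 l C T1 tm (fun x t => kappa x) <= kk * (tm - T1).
  rewrite -(I_cst _ Tm); apply: I_le; [exact: iv_cst|exact: iv_cst|move=> t _; exact: ikap].
have j3 := J2_s_le W E (ltW lC') Tm.
have q1 : L * (y tm * (tm - T1)) <= 2^-1 * y tm.
  rewrite mulrCA mulrC ler_wpM2r//; apply: (@le_trans _ _ (L * tau)).
    by rewrite ler_wpM2l// ltW.
  by rewrite /tau invfM mulrCA mulfV ?mulr1// gt_eqF.
have q2 := ler_wpM2l (ltW L0) j1.
have q3 : J2 l C T1 tm (fun x t => kappa x) + KSb * J2 l C T1 tm s <= tau * (kk + KSb).
  rewrite mulrDr; apply: lerD; last by rewrite mulrC ler_wpM2r// (le_trans j3).
  apply: (le_trans j2); rewrite mulrC ler_wpM2r//.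
  by rewrite mulr_ge0// subr_ge0.
have q4 := ler_wpM2l e0' q3.
have fin : I l1 C (fun x => exq 1 b' x (z x T2)) <= y tm.
  apply: (@le_trans _ _ (y T2)); last by apply: Hmax; rewrite in_itv/= T12 lexx.
  apply: (@le_trans _ _ (I l1 C (fun x => exq (1 - e) b x (z x T2)))).
    apply: I_le; [by apply: iv_exq => //; exact: ltW|by apply: iv_exq => //; exact: ltW|].
    move=> x /andP[lx xr]; apply: (exq_tilt e0' lx) => //; first exact: range_low.
    by rewrite addrC -lerBrDr.
  apply: (I_sub_le ll1 (ltW l1C) (lexx C)); first by apply: iv_exq => //; exact: ltW.
  by move=> x _; exact: exq_ge0.
move=> st; apply: (le_trans fin).
have -> : e * (2 * tau * (kk + KSb)) = 2 * (e * (tau * (kk + KSb))) by ring.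
exact: (absorb_half st q2 q1 q4).
Qed.

Lemma contact_forward b T1 : b <= C -> (forall x, Num.min (x - b) 0 <= z x T1) ->
  forall t x, T1 <= t -> Num.min (x - b) 0 <= z x t.
Proof.
move=> bC H1; pose tau := (2 * L)^-1.
have tau0 : 0 < tau by rewrite invr_gt0 mulr_gt0.
have H k : forall t x, T1 <= t -> t <= T1 + tau * k%:R -> Num.min (x - b) 0 <= z x t.
  elim: k => [|k IHk] t x Tt.
    by rewrite mulr0 addr0 => tT; have -> : t = T1 by apply: le_anti; rewrite tT.
  rewrite -natr1 mulrDr mulr1 => tk; have [tk'|kt] := leP t (T1 + tau * k%:R); first exact: IHk.
  have k0 : 0 <= tau * k%:R by rewrite mulr_ge0// ltW.
  apply: (@contact_global b (T1 + tau * k%:R)) => //; [exact: ltW|by rewrite -addrA|].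
  by move=> x'; apply: IHk => //; rewrite lerDl.
move=> t x Tt; apply: (H (Num.bound ((t - T1) / tau))) => //.
rewrite -lerBlDl mulrC -ler_pdivrMr// ltW//; apply: archi_boundP.
by rewrite divr_ge0 ?(ltW tau0)// subr_ge0.
Qed.

End ContactConsequences.

(** * Rigidity *)

Lemma dissipation_small (R : realType) (M1 M2 Mi J e : R) : M2 + J <= M1 -> Mi - e < M2 -> M1 <= Mi -> J < e.
Proof. by move=> *; lra. Qed.

Lemma dissipation_tail (R : realType) (M1 M2 Z1 Z2 J t e : R) : Z2 + J <= Z1 + t -> Z1 <= M1 -> M2 <= Z2 + t ->
  t <= e -> M2 + J <= M1 + e * 2.
Proof. by move=> *; lra. Qed.

Lemma sup_gap (R : realType) (J Zf Z Mf M t : R) : 0 < J -> Zf + J <= Z -> t <= J / 2 -> M <= Mf ->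
  Mf <= Zf + t -> Z <= M -> False.
Proof. by move=> *; lra. Qed.

(** * The Lyapunov functional on the whole line *)

Section LyapunovFunctional.
Variable R : realType.
Implicit Types (x y t e a b l r w A : R).
Notation mu := (@lebesgue_measure R).
Variables (n m c L PM rM C : R) (h U kap : R -> R) (V s z : R -> R -> R).
Hypotheses (W : profile n m c L PM rM h U kap) (E : entire n m c C h U V s z).
Notation P := (pres c h U).
Notation u := (slope n m c h U).
Notation sig := (sig n c h U s z).
Notation bp := (bp C).
Notation Pot := (Pot n m c L C h U kap).
Notation Mz := (Mz n m c L C h U kap).
Notation tl := (tl n c L rM C U).
Notation K4 := (K4 n c L rM C).
Notation adm := (adm C).
Notation dis := (dis n c h U s z).
Let C0 := en_C E.
Let cz := en_cz E.
Let z0 := en_z0 E.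

(** The coordinate of the translate [U(x - b)]. *)
Definition front b x : R := Num.min (x - b) 0.

Lemma adm_front b : - C <= b -> b <= C -> adm (front b).
Proof.
move=> bC Cb; split.
  have := (@pw_cont R 1 ltr01) => cp.
  have -> : front b = (fun x => - pw 1 (b - x)).
    apply/funext => x; rewrite /front /pw powRr1 ?le_max ?lexx ?orbT//.
    by rewrite /Num.max /Num.min; case: ifP => h1; case: ifP => h2; lra.
  apply: cont1N; apply: (cont1_comp cp); apply: cont1B; [exact: cont1c|move=> ?; exact: cvg_id].
move=> x; rewrite /front; apply/andP; split.
  by rewrite le_min ge_min lerD2l lerN2 Cb/= ge_min lexx orbT.
rewrite le_min ge_min lexx orbT/= ge_min lerD2l; apply/orP; left; lra.
Qed.

Lemma tl_small l' k K e : 0 <= K -> 0 < e -> exists2 l, l <= l' & K * (1 - U (l + k)) <= e.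
Proof.
move=> K0 e0; have K10 : 0 < K + 1 by lra.
have [A HA] := pr_lim W (divr_gt0 e0 K10).
exists (Num.min l' (A - k)); first by rewrite ge_min lexx.
have := HA (Num.min l' (A - k) + k); rewrite -lerBrDr ge_min lexx orbT => /(_ isT).
rewrite ltr_norml => /andP[h1 _].
apply: (@le_trans _ _ (K * (e / (K + 1)))); first by rewrite ler_wpM2l//; lra.
by rewrite mulrCA ler_piMr ?(ltW e0)// ler_pdivrMr// mul1r lerDl.
Qed.

Let bpC : 0 <= bp + C. Proof. by rewrite /bp; have := C0; lra. Qed.

Lemma tl_ge0 l : 0 <= tl l.
Proof.
apply: mulr_ge0; first exact: (K4_ge0 C W).
by apply: mulr_ge0; [exact: bpC|rewrite subr_ge0 ltW// (pr_U1 W)].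
Qed.

Lemma tl_small' l' e : 0 < e -> exists2 l, l <= l' & tl l <= e.
Proof.
move=> e0; have K0 : 0 <= K4 * (bp + C).
  by apply: mulr_ge0; [exact: (K4_ge0 C W)|exact: bpC].
by have [l ll H] := tl_small l' C K0 e0; exists l; rewrite // /tl mulrA.
Qed.

Lemma Mz_split l l' ze : adm ze -> l <= l' -> l' <= - C ->
  Mz l' ze <= Mz l ze /\ Mz l ze <= Mz l' ze + tl l'.
Proof.
move=> az ll lC; have lC' : l' <= C by have := C0; lra.
have iP := iv_Pot W E l (lexx 0) az.
rewrite /Mz (I_split ll lC' iP); split.
  by rewrite lerDr; apply: I_ge0 => x _; exact: (Pot_ge0 C W).
by rewrite addrC lerD2l; apply: (tail_bound W E).
Qed.

(** The integral over the whole left half-line: the truncated functionals increase as [l] decreases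
    and are bounded by [tail_bound]. *)
Definition MM (ze : R -> R) := sup [set v | exists2 l, l <= - C & v = Mz l ze].

Lemma MM_has_sup ze : adm ze -> has_sup [set v | exists2 l, l <= - C & v = Mz l ze].
Proof.
move=> az; split; first by exists (Mz (- C) ze); exists (- C).
exists (Mz (- C) ze + tl (- C)) => v [l lC ->].
by have [] := Mz_split az lC (lexx _).
Qed.

Lemma Mz_le_MM l ze : adm ze -> l <= - C -> Mz l ze <= MM ze.
Proof. by move=> az lC; apply: sup_upper_bound; [exact: MM_has_sup|exists l]. Qed.

Lemma MM_le l ze : adm ze -> l <= - C -> MM ze <= Mz l ze + tl l.
Proof.
move=> az lC; apply: sup_le_ub; first by exists (Mz (- C) ze); exists (- C).
move=> v [l' lC' ->]; have [ll|/ltW ll] := leP l l'.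
  have [h1 _] := Mz_split az ll lC'; apply: (le_trans h1); rewrite lerDl; exact: tl_ge0.
by have [] := Mz_split az ll lC.
Qed.

Lemma U_front b x : U (front b x) = U (x - b).
Proof.
rewrite /front; have [xb|xb] := leP (x - b) 0; first by [].
by rewrite (pr_U0 W (lexx 0)) (pr_U0 W)// ltW.
Qed.

(** Increments of the potential are bounded by [K4] times those of [U], and the integral of the
    difference of two translates of [U] is at most the distance between them. *)
Lemma MM_front_close b b' : - C <= b -> b <= b' -> b' <= C -> MM (front b) <= MM (front b') + K4 * (b' - b).
Proof.
move=> b1 bb b2; have a1 := adm_front b1 (le_trans bb b2); have a2 := adm_front (le_trans b1 bb) b2.
apply: sup_le_ub; first by exists (Mz (- C) (front b)); exists (- C).
move=> v [l lC ->]; have lC' : l <= C by have := C0; lra.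
rewrite -lerBlDl; apply: (@le_trans _ _ (Mz l (front b) - Mz l (front b'))).
  by rewrite lerD2l lerN2 Mz_le_MM.
have cs k : continuous (fun x => U (x - k)).
  by apply: (cont1_comp (pr_cU W)); apply: cont1B; [move=> ?; exact: cvg_id|exact: cont1c].
rewrite /Mz -IB; [|exact: (iv_Pot W E)|exact: (iv_Pot W E)].
apply: (@le_trans _ _ (I l C (fun x => K4 * (U (x - b') - U (x - b))))).
  apply: I_le; first by apply: ivB; exact: (iv_Pot W E).
    by apply: ivZ; apply: ivB; apply: iv_contT; exact: cs.
  move=> x /andP[_ xC]; have [h1 h2] := adm_range a1 xC; have [h3 h4] := adm_range a2 xC.
  rewrite -!U_front; apply: (Pot_lip W E) => //.
  by rewrite /front le_min !ge_min lexx orbT andbT lerD2l lerN2 bb.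
rewrite IZ; last by apply: ivB; apply: iv_contT; exact: cs.
rewrite ler_wpM2l ?(K4_ge0 C W)//; apply: (le_trans (I_shift_le W bb lC')).
rewrite ler_piMr ?subr_ge0//; have := U_nonneg W (C - b); lra.
Qed.

Lemma Pot_lt x y y' : x <= C -> x - C <= y -> y < y' -> y' <= 0 -> Pot 0 x y < Pot 0 x y'.
Proof.
move=> xC xy yy y0; have xb : x - bp <= y by rewrite /bp; lra.
rewrite -subr_gt0 (Pot_incr W E)//; last exact: ltW.
have cF := @Fe_cont R n c L C; have cr := rho_cont W.
pose q w := rho kap w * Fe n c L C 0 x w.
have cq : continuous q by apply: cont1M => //; exact: (Fe_cont W E).
have [w0 w0y Hmin] := EVT_min (ltW yy) (continuous_subspaceT (A := `[y, y']%classic) cq).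
have q0 w : y <= w -> 0 < q w.
  move=> yw; apply: mulr_gt0; first exact: rho_pos.
  by apply: pw_gt0; rewrite addr0 mul1r /bp; lra.
have k0' : 0 < q w0 by apply: q0; move: w0y; rewrite in_itv => /andP[].
apply: (@lt_le_trans _ _ (q w0 * (U y - U y'))).
  by rewrite mulr_gt0// subr_gt0 (pr_dec W).
rewrite -(I_slope W (ltW yy) y0) -IZ; last exact: (iv_slope' W).
apply: I_le; [by apply: ivZ; exact: (iv_slope' W)|exact: (iv_pot W E)|].
by move=> w ww; rewrite mulrC ler_wpM2l ?(slope_nonneg W)// Hmin// in_itv.
Qed.

(** A strict inequality at one point gives a positive gain on [[l1, C]]; truncating so far to the
    left that the tail is at most half of this gain contradicts the inequality between the
    functionals. *)
Lemma MM_strict b ze : - C <= b -> b <= C -> adm ze -> (forall x, front b x <= ze x) -> MM ze <= MM (front b) ->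
  forall x, ze x = front b x.
Proof.
move=> b1 b2 az zz MMle x; apply: le_anti; rewrite zz andbT leNgt; apply/negP => fz.
have ab := adm_front b1 b2.
have zneg y : ze y <= 0 by have /andP[_] := (proj2 az) y; rewrite le_min => /andP[].
have xC : x < C.
  rewrite ltNge; apply/negP => Cx; move: fz; rewrite ltNge => /negP; apply.
  by apply: (le_trans (zneg x)); rewrite /front le_min lexx andbT subr_ge0 (le_trans b2).
pose l1 := Num.min (x - 1) (- C).
have l1x : l1 < x by apply: (@le_lt_trans _ _ (x - 1)); [rewrite ge_min lexx|rewrite gtrBl].
have l1C : l1 <= - C by rewrite ge_min lexx orbT.
pose g y := PsiM n c L C U kap 0 (l1 - bp) y (ze y) - PsiM n c L C U kap 0 (l1 - bp) y (front b y).
have gE y : l1 <= y -> y <= C -> g y = Pot 0 y (ze y) - Pot 0 y (front b y).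
  move=> ly yC; have [h1 h2] := adm_range az yC; have [h3 h4] := adm_range ab yC.
  have yb : y <= bp by rewrite /bp; apply: (le_trans yC); rewrite lerDl.
  rewrite /g !(PsiM_Pot W E) ?lerD2r//; by rewrite /front ge_min lexx orbT.
have cg : continuous g.
  have cpsi := @psi2_cont R (1 + 0) _ _ (rho_cont W) (fM_cont W E).
  have cpsiy := @psi2y_cont R (1 + 0) _ _ _ _ (pr_ck W) (rho_cont W) (fM_cont W E) (fM1_cont W E).
  have cP : continuous (unc (PsiM n c L C U kap 0 (l1 - bp))).
    exact: (@PsiA_cont _ _ _ _ _ _ _ _ _ _ W (l1 - bp) _ _ cpsi cpsiy).
  have cc ze' : continuous ze' -> continuous (fun y => PsiM n c L C U kap 0 (l1 - bp) y (ze' y)).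
    move=> cz'; have c2 : continuous (unc (fun x t : R => ze' x)) by exact: cont2_1.
    exact: (@cont2_sec1 R _ 0 (cont2_graph cP c2)).
  by apply: cont1B; apply: cc; [case: az|case: ab].
have g0 y : l1 <= y <= C -> 0 <= g y.
  move=> /andP[ly yC]; rewrite gE// subr_ge0; have [h3 h4] := adm_range ab yC.
  exact: (Pot_mono W E).
have gx : 0 < g x.
  rewrite gE ?(ltW l1x) ?(ltW xC)// subr_gt0; apply: Pot_lt => //; first exact: ltW.
  by have /andP[h4 _] := (proj2 ab) x; apply: le_trans h4; rewrite le_min lexx subr_le0 ltW.
have xx : l1 < x < C by rewrite l1x.
have Ig := I_gt0 xx cg g0 gx.
have Ig2 : 0 < I l1 C g / 2 by rewrite divr_gt0.
have [l ll tll] := tl_small' l1 Ig2.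
have lC := le_trans ll l1C.
have := Mz_le_MM az lC; have := MM_le ab lC.
have h1 : Mz l (front b) + I l1 C g <= Mz l ze.
  rewrite addrC -lerBrDr /Mz -IB; [|exact: (iv_Pot W E)|exact: (iv_Pot W E)].
  rewrite (I_ext (a := l1) (g := fun x => Pot 0 x (ze x) - Pot 0 x (front b x))); last first.
    by move=> y /andP[ly yC]; rewrite gE.
  apply: I_sub_le => //; [exact/ltW/(lt_trans l1x)|by apply: ivB; exact: (iv_Pot W E)|].
  move=> y /andP[_ yC]; rewrite subr_ge0; have [h3 h4] := adm_range ab yC; exact: (Pot_mono W E).
move=> h2 h3; exact: (sup_gap Ig h1 tll MMle h2 h3).
Qed.

Let az t : adm (z ^~ t) := adm_z E t.

Lemma MM_dissip l1 : l1 <= C -> exists2 k, 0 < k & forall T1 T2, T1 <= T2 ->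
  MM (z ^~ T2) + k * J2 l1 C T1 T2 dis <= MM (z ^~ T1).
Proof.
move=> lC; have [k k0 Hk] := dissipation W E lC; exists k => // T1 T2 T12.
apply: (@small_eps _ _ _ 2 1) => // e e0 _.
have [l ll tle] := tl_small' (Num.min l1 (- C)) e0.
have l1l : l <= l1 by apply: (le_trans ll); rewrite ge_min lexx.
have lC' : l <= - C by apply: (le_trans ll); rewrite ge_min lexx orbT.
have h1 := Hk l T1 T2 l1l lC' T12.
have h2 := Mz_le_MM (az T1) lC'; have h3 := MM_le (az T2) lC'.
exact: (dissipation_tail h1 h2 h3 tle).
Qed.

Lemma J2_dis_ge0 l T1 T2 : 0 <= J2 l C T1 T2 dis.
Proof. by apply: I_ge0 => t _; apply: I_ge0 => x _; exact: (dis_ge0 _ _ W). Qed.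

Lemma MM_decr T1 T2 : T1 <= T2 -> MM (z ^~ T2) <= MM (z ^~ T1).
Proof.
move=> T12; have [k k0 Hk] := MM_dissip (lexx C); apply: le_trans (Hk _ _ T12).
by rewrite lerDl mulr_ge0 ?(ltW k0)// J2_dis_ge0.
Qed.

(** As the functional is nonincreasing in time, this supremum is its limit at [-oo]. *)
Definition Minf := sup [set v | exists t, v = MM (z ^~ t)].

Lemma Minf_has_sup : has_sup [set v | exists t, v = MM (z ^~ t)].
Proof.
split; first by exists (MM (z ^~ 0)), 0.
exists (I (- C) C (fun=> K4) + tl (- C)) => v [t ->].
apply: (le_trans (MM_le (az t) (lexx _))); rewrite lerD2r.
apply: I_le; [exact: (iv_Pot W E)|exact: iv_cst|move=> x /andP[_ xC]].
have [h1 h2] := adm_range (az t) xC; apply: (le_trans (Pot_le W E (lexx 0) h1 h2)).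
rewrite ler_piMr ?(K4_ge0 C W)//; have := U_nonneg W (z x t); have := pr_U1 W (x - bp); lra.
Qed.

Lemma MM_le_Minf t : MM (z ^~ t) <= Minf.
Proof. by apply: sup_upper_bound; [exact: Minf_has_sup|exists t]. Qed.

Lemma Minf_close e : 0 < e -> exists T, forall t, t <= T -> Minf - e < MM (z ^~ t).
Proof.
move=> e0; have [v [T ->] H] := sup_adherent e0 Minf_has_sup.
by exists T => t tT; apply: (lt_le_trans H); exact: MM_decr.
Qed.

Lemma dis_small l e : l <= C -> 0 < e -> exists T, forall t1 t2, t1 <= t2 -> t2 <= T -> J2 l C t1 t2 dis < e.
Proof.
move=> lC e0; have [k k0 Hk] := MM_dissip lC.
have [T HT] := Minf_close (mulr_gt0 k0 e0); exists T => t1 t2 t12 t2T.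
have h1 := Hk _ _ t12; have h2 := HT _ t2T; have h3 := MM_le_Minf t1.
by rewrite -(ltr_pM2l k0); exact: (dissipation_small h1 h2 h3).
Qed.

Definition regular l t := ac l C (z ^~ t) (sig ^~ t) /\ iv l C (dis ^~ t).

(** Otherwise the slice dissipation would exceed [e] at almost every time of an interval of length
    [tau], against the smallness of its integral over early times. *)
Lemma good_time l e tau : l <= C -> 0 < e -> 0 < tau -> exists T, forall t, t <= T -> exists t',
  [/\ t - tau < t', t' < t, regular l t' & I l C (dis ^~ t') <= e].
Proof.
move=> lC e0 tau0; have [T HT] := dis_small lC (mulr_gt0 e0 tau0); exists T => t tT.
have tt : t - tau <= t by rewrite gerBl ltW.
have J := HT _ _ tt tT.
apply: contrapT => Hno.
have Id := dis_int2 W E (t - tau) t lC (lexx C).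
have reg : \forall t' \ae mu, t - tau < t' < t -> regular l t'.
  have := aeI (ac_z W E (l - 1) (C + 1) (t - tau) t) (fub_ae2 Id).
  apply: aeS => t' [H1 H2] t't; have [_ [Ha _]] := H1 t't; split.
    by apply: Ha; [lra|exact: lC|lra].
  by apply: H2; case/andP: t't => /ltW -> /ltW ->.
move: J; apply/negP; rewrite -leNgt.
have -> : e * tau = I (t - tau) t (fun=> e) by rewrite I_cst//; ring.
apply: I_ae_le; [exact: iv_cst|exact: fub_iv2 Id|].
apply: ae_le_lt; apply: aeS reg => t' H t't; have {}H := H t't.
rewrite leNgt; apply/negP => He; apply: Hno; exists t'.
by case/andP: t't => h1 h2; split => //; exact: ltW.
Qed.

End LyapunovFunctional.

Lemma gap_absurd (R : realType) (Mb Mb' Mz M Z t K e g : R) : Mb + g <= M -> M <= Z + t -> Z <= Mb' ->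
  Mb' <= Mb + K * e -> K * e <= g / 2 -> t <= g / 4 -> 0 < g -> False.
Proof. by move=> *; lra. Qed.

(** * Locating the solution among the translates *)

Section Rigidity.
Variable R : realType.
Implicit Types (x y t e a b l r w A : R).
Notation mu := (@lebesgue_measure R).
Variables (n m c L PM rM C : R) (h U kap : R -> R) (V s z : R -> R -> R).
Hypotheses (W : profile n m c L PM rM h U kap) (E : entire n m c C h U V s z).
Notation P := (pres c h U).
Notation sig := (sig n c h U s z).
Notation MM := (MM n m c L C h U kap).
Notation Minf := (Minf n m c L C h U kap z).
Notation K4 := (K4 n c L rM C).
Notation dis := (dis n c h U s z).
Notation regular := (regular n c C h U s z).
Let C0 := en_C E.
Let cz := en_cz E.
Let z0 := en_z0 E.

(** Where [P(z) >= p0], the bound of [dist1_le_dissip] controls the integral of [|1 - sig|] by a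
    small multiple of the length plus the dissipation, so [z] moves with slope close to [1]. *)
Lemma level_drift l d p0 e t : l <= C -> 0 < d -> d <= 1 -> 0 < p0 -> regular l t -> I l C (dis ^~ t) <= e ->
  forall u v, l <= u -> u <= v -> v <= C -> (forall x, u <= x <= v -> p0 <= P (z x t)) ->
  `|(v - u) - (z v t - z u t)| <= d * (C - l) + (d * p0)^-1 * e.
Proof.
move=> lC d0 d1 p00 [acz idis] He u v lu uv vC Hp.
have [isg Ez] := ac_sub lu vC acz.
have idp : 0 < d * p0 by exact: mulr_gt0.
have idis' : iv u v (dis ^~ t) by apply: iv_sub idis.
have i1 : iv u v (fun x => 1 - sig x t) by apply: ivB => //; exact: iv_cst.
have -> : (v - u) - (z v t - z u t) = I u v (fun x => 1 - sig x t).
  by rewrite IB//; [rewrite I_cst// mul1r (Ez u v)|exact: iv_cst].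
apply: (le_trans (I_norm i1)).
apply: (@le_trans _ _ (I u v (fun x => d + (d * p0)^-1 * dis x t))).
  apply: I_le; [exact: iv_norm|by apply: ivD; [exact: iv_cst|exact: ivZ]|].
  move=> x xx; apply: (le_trans (dist1_le_dissip (pr_n W) d0 d1 (sig_ge0 E x t))).
  rewrite lerD2l /dis; apply: (@le_trans _ _ ((d * p0)^-1 * (p0 * dissip n (sig x t)))).
    by rewrite le_eqVlt; apply/orP; left; apply/eqP; field; rewrite !gt_eqF.
  by rewrite ler_wpM2l ?invr_ge0 ?(ltW idp)// ler_wpM2r ?dissip_ge0// Hp.
rewrite ID; [|exact: iv_cst|exact: ivZ]; rewrite I_cst// IZ//; apply: lerD.
  by rewrite ler_wpM2l ?(ltW d0)//; lra.
rewrite ler_wpM2l ?invr_ge0 ?(ltW idp)//; apply: le_trans He.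
by apply: I_sub_le => // x _; exact: (dis_ge0 _ _ W).
Qed.

(** By contradiction: suppose [z] is below both bounds at [x1]. Below the level [-eta1] small
    dissipation keeps [z] close to a line of slope [1], so on [[l, C]] it lies below the translate
    by some [b'] close to [b]. Monotonicity and continuity of the functional then put its value at
    [z] below its value at [front b] plus [g]. *)
Lemma level_at b g eta l0 : - C <= b -> b <= C -> 0 < g -> 0 < eta -> exists l e,
  [/\ l <= l0, l <= - C & 0 < e] /\ forall t, regular l t -> I l C (dis ^~ t) <= e ->
    MM (front b) + g <= MM (z ^~ t) -> forall x, l <= x <= C -> Num.min (x - b) (- eta) <= z x t.
Proof.
move=> b1 b2 g0 eta0.
have K0 := K4_ge0 C W; pose K := K4 + 1; have K10 : 0 < K by rewrite /K; lra.
(* Passing from [b] to [b'] with [b - b' <= eta1 + de <= 2 de] changes the functional by at most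
   [2 K de = g/2], and the tail takes [g/4]. *)
pose de := g / (4 * K); have de0 : 0 < de by rewrite divr_gt0// mulr_gt0.
have [eta1 [e10 e1e e1C e1d]] : exists eta1, [/\ 0 < eta1, eta1 <= eta, eta1 <= C & eta1 <= de].
  exists (Num.min eta (Num.min C de)); rewrite !lt_min eta0 C0 de0; split => //.
  - by rewrite ge_min lexx.
  - by rewrite ge_min [X in _ || X]ge_min lexx orbT.
  - by rewrite ge_min [X in _ || X]ge_min lexx !orbT.
have g4 : 0 < g / 4 by rewrite divr_gt0.
have [l ll tle] := tl_small' W E (Num.min l0 (- C)) g4.
have [ll0 lC] : l <= l0 /\ l <= - C by move: ll; rewrite le_min => /andP[].
have lC' : l <= C by have := C0; lra.
have le1 : l - C <= - eta1 by have := C0; lra.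
have [y0 y0y Hmin] := EVT_min le1 (continuous_subspaceT (A := `[l - C, - eta1]%classic) (presc W)).
pose p0 := P y0; have p00 : 0 < p0.
  by apply: (pr_P0 W); move: y0y; rewrite in_itv => /andP[_]/=; lra.
pose D := C - l + 1; have D0 : 0 < D by rewrite /D; lra.
have [d [d0 d1 dD]] : exists d, [/\ 0 < d, d <= 1 & d * (C - l) <= de / 2].
  have q0 : 0 < de / 2 / D by apply: divr_gt0 => //; exact: divr_gt0.
  exists (Num.min 1 (de / 2 / D)); split.
  - by rewrite lt_min ltr01.
  - by rewrite ge_min lexx.
  apply: (@le_trans _ _ (de / 2 / D * D)); last by rewrite divfK ?gt_eqF.
  apply: ler_pM; [|lra|by rewrite ge_min lexx orbT|rewrite /D; lra].
  by rewrite le_min ler01 ltW.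
have de2 : 0 < de / 2 by exact: divr_gt0.
exists l, (d * p0 * (de / 2)); split; first by split => //; apply: mulr_gt0 => //; exact: mulr_gt0.
move=> t reg He Hg x1 /andP[lx1 x1C]; rewrite leNgt lt_min; apply/negP => /andP[zx1 zx2].
have drift u v : l <= u -> u <= v -> v <= C -> z v t <= - eta1 ->
    `|(v - u) - (z v t - z u t)| <= de.
  move=> lu uv vC zv; apply: (le_trans (level_drift lC' d0 d1 p00 reg He lu uv vC _)).
    move=> x /andP[ux xv]; apply: Hmin; rewrite in_itv/=; apply/andP; split.
      by apply: (@le_trans _ _ (x - C)); [rewrite lerD2r (le_trans lu)|apply: (range_low E); exact: le_trans vC].
    exact: le_trans (en_zm E t xv) zv.
  rewrite mulKf; last by rewrite gt_eqF// mulr_gt0.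
  by rewrite [leRHS](splitr de) lerD2r.
have z1 : z x1 t <= - eta1 by apply: ltW; apply: (lt_le_trans zx2); rewrite lerN2.
move: Hg tle; clear He reg Hmin dD.
(* Above the level [-eta1] the slope is not controlled; there [z <= 0] is compared with the crossing
   point [x'], where [z = -eta1]. *)
have up x : l <= x -> x <= C -> z x t <= x - b + (eta1 + de).
  move=> lx xC; have [xx1|/ltW x1x] := leP x x1.
    have := drift x x1 lx xx1 x1C z1; rewrite ler_norml => /andP[_]; lra.
  have [zx|zx] := leP (z x t) (- eta1).
    have := drift x1 x lx1 x1x xC zx; rewrite ler_norml => /andP[]; lra.
  have czt : {within `[x1, x], continuous (z ^~ t)} by apply: continuous_subspaceT; exact: cont2_sec1.
  have vv : Num.min (z x1 t) (z x t) <= - eta1 <= Num.max (z x1 t) (z x t).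
    by rewrite ge_min z1 le_max (ltW zx) orbT.
  have [x' ] := IVT x1x czt vv; rewrite in_itv/= => /andP[h1 h2] zx'.
  have zx'' : z x' t <= - eta1 by rewrite zx'.
  have := drift x1 x' lx1 h1 (le_trans h2 xC) zx''; rewrite ler_norml zx' => /andP[]; have := z0 x t; lra.
(* The bound [up] puts [z] below the translate by [b - (eta1 + de)]; the cut at [-C], covered by
   [z <= x + C], keeps [front b'] admissible. *)
pose b' := Num.max (b - (eta1 + de)) (- C).
have bb' : b' <= b by rewrite ge_max b1 andbT; lra.
have bC' : - C <= b' by rewrite le_max lexx orbT.
have bd : b - b' <= eta1 + de.
  have : b - (eta1 + de) <= b' by rewrite le_max lexx.
  lra.
have zb x : l <= x -> x <= C -> z x t <= front b' x.
  move=> lx xC; rewrite /front le_min z0 andbT /b' /Num.max; case: ifP => _; last first.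
    by have := up x lx xC; lra.
  by have /andP[_] := z_range E x t; rewrite le_min opprK => /andP[].
move=> Hg tle; have azt := adm_z E t; have ab' := adm_front bC' (le_trans bb' b2).
have h1 := MM_le W E azt lC.
have h2 : Mz n m c L C h U kap l (z ^~ t) <= MM (front b').
  apply: le_trans (Mz_le_MM W E ab' lC).
  apply: I_le; [exact: (iv_Pot W E)|exact: (iv_Pot W E)|].
  move=> x /andP[lx xC]; have [h3 h4] := adm_range azt xC; have [h5 h6] := adm_range ab' xC.
  apply: (Pot_mono W E) => //; first exact: zb.
  by move: h6; rewrite le_min => /andP[].
have h3 := MM_front_close W E bC' bb' b2.
have h4 : K4 * (b - b') <= g / 2.
  apply: (@le_trans _ _ (K * (2 * de))).
    apply: ler_pM; [exact: K0|by rewrite subr_ge0|by rewrite /K lerDl|].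
    have -> : 2 * de = de + de by ring.
    by apply: (le_trans bd); rewrite lerD2r.
  by rewrite /de le_eqVlt; apply/orP; left; apply/eqP; field; rewrite gt_eqF.
exact: (gap_absurd 0 Hg h1 h2 h3 h4 tle g0).
Qed.

(** At early times the functional is close to [Minf], so at the times supplied by [good_time] the
    hypothesis of [level_at] holds with half of the gap. *)
Lemma good_level b eta l0 tau : - C <= b -> b <= C -> MM (front b) < Minf -> 0 < eta -> 0 < tau ->
  exists T, forall t, t <= T -> exists2 t', t - tau < t' < t &
    forall x, l0 <= x <= C -> Num.min (x - b) (- eta) <= z x t'.
Proof.
move=> b1 b2 Mb eta0 tau0; pose g := (Minf - MM (front b)) / 2.
have g0 : 0 < g by rewrite divr_gt0// subr_gt0.
have gE : MM (front b) + g = Minf - g by rewrite /g; field.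
have [l [e [[ll lC e0] Hl]]] := level_at l0 b1 b2 g0 eta0.
have lC' : l <= C by have := C0; lra.
have [T1 H1] := Minf_close W E g0.
have [T2 H2] := good_time W E lC' e0 tau0.
exists (Num.min T1 T2) => t; rewrite le_min => /andP[t1 t2].
have [t' [h1 h2 reg He]] := H2 t t2; exists t'; first by rewrite h1.
move=> x /andP[lx xC]; apply: (Hl t' reg He); last by rewrite xC (le_trans ll).
by rewrite gE; apply/ltW/H1; exact: le_trans (ltW h2) t1.
Qed.

Lemma I_translate (q : R -> R) a b d : continuous q -> a <= b -> I a b (fun y => q (y + d)) = I (a + d) (b + d) q.
Proof.
move=> cq ab; have cs : continuous (fun x => q (x + d)).
  by apply: cont1_comp => //; apply: cont1D; [move=> ?; exact: cvg_id|exact: cont1c].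
have [_ H] := ac_smooth a b cs (fun x => dshift (is_derive_prim (x + d) cq)).
by rewrite -H// (I_prim cq) ?lerD2r.
Qed.

Lemma tail_flux l t1 t2 : l < C -> t1 <= t2 -> \forall x \ae mu, l < x < C ->
  tailI C l V x t2 - tailI C l V x t1 = I t1 t2 (flux_density n c C h V s l x).
Proof.
move=> lC t12; have [_ _ _ _ F2] := en_flux E.
have := F2 (t1 - 1) (t2 + 1) C (fun x t Cx _ => V_right W E t Cx) l lC; apply: aeS => x Hx /andP[lx xC].
have [_ E1] := Hx (introT andP (conj lx xC)).
have cV := en_cV E; have lx' := ltW lx; have xC' := ltW xC.
rewrite !tailIE// E1//; [|lra|lra].
by apply: I_ext => t _; rewrite /flux_density tailIE//; exact: (hV_cont W E).
Qed.

(** [s^n = P(z) sig^n], where [sig^n] is at most a constant plus [dissip] and [P(z) <= PM]. *)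
Lemma J2_flux_le l t1 t2 : l <= C -> t1 <= t2 ->
  J2 l C t1 t2 (fun x t => pw n (s x t)) <= J2 l C t1 t2 dis + PM * (pw n 2 + 2) * (C - l) * (t2 - t1).
Proof.
move=> lC t12; have [_ _ Isn _ _] := en_flux E.
have Id := dis_int2 W E t1 t2 lC (lexx C).
pose K := PM * (pw n 2 + 2).
have IK : int2 l C t1 t2 (fun x t => dis x t + K) by apply: int2D => //; exact: int2_cst.
have -> : J2 l C t1 t2 dis + K * (C - l) * (t2 - t1) = J2 l C t1 t2 (fun x t => dis x t + K).
  rewrite J2D//; last exact: int2_cst.
  by congr (_ + _); rewrite /J2 (I_ext (g := fun=> K * (C - l))) ?I_cst// => t _; rewrite I_cst.
have Is := Isn l C t1 t2.
apply: I_ae_le; [exact: fub_iv2 Is|exact: fub_iv2 IK|].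
have := aeI (ac_z W E (l - 1) (C + 1) (t1 - 1) (t2 + 1)) (aeI (fub_ae2 Is) (fub_ae2 IK)).
apply: aeS => t [H1 [H2 H3]] tt; have {}H2 := H2 tt; have {}H3 := H3 tt.
have [|_ [_ Hz]] := H1; first by case/andP: tt => ? ?; apply/andP; split; lra.
apply: I_ae_le => //; apply: aeS Hz => x Hx /andP[lx xC].
have P0 := pres_ge0 W (z x t); have PMz := pr_PM W (z x t); have p2 := pw_ge0 n 2.
have sg := sig_ge0 E x t.
have n0 : 0 < n by exact: lt_le_trans (pr_n W).
have K0 : 0 <= K by rewrite /K mulr_ge0 ?(PM_ge0 W)// addr_ge0.
have := z0 x t; rewrite le_eqVlt => /orP[/eqP zx|zx].
  rewrite Hx//; last by apply/andP; split; lra.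
  by rewrite pw_npos ?gt_eqF// addr_ge0// (dis_ge0 _ _ W).
rewrite (sig_pow W E zx) /dis /K.
have := pw_le_dissip (pr_n W) sg; rewrite ler_norml => /andP[_ h1].
apply: (@le_trans _ _ (P (z x t) * (pw n 2 + 2 + dissip n (sig x t)))); first by rewrite ler_wpM2l//; lra.
rewrite mulrDr addrC lerD2l ler_wpM2r//; lra.
Qed.

Lemma tail_diff l d y t : l <= y -> 0 <= d -> y + d <= C ->
  d * V (y + d) t <= tailI C l V y t - tailI C l V (y + d) t <= d * V y t.
Proof.
move=> ly d0 yC; have cV := en_cV E; have yd : y <= y + d by rewrite lerDl.
have cVt : continuous (V ^~ t) by exact: cont2_sec1.
rewrite !tailIE ?(le_trans ly yd) ?(le_trans yd yC)//.
rewrite (I_split yd yC) ?addrK; last exact: iv_contT.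
have dE : d = y + d - y by rewrite addrAC subrr add0r.
have cI k : k * d = I y (y + d) (fun=> k) by rewrite I_cst// -dE.
rewrite ![d * _]mulrC !cI; apply/andP; split; (apply: I_le; [by [exact: iv_cst|exact: iv_contT]|by [exact: iv_cst|exact: iv_contT]|]).
  by move=> x /andP[_ xd]; exact: (V_mono W E).
by move=> x /andP[yx _]; exact: (V_mono W E).
Qed.

(* Averages of [V] over windows have bounded speed because the flux is controlled by the dissipation. *)
Lemma propagate l : l < C -> exists2 K, 0 <= K & forall x1 d t1 t2, l <= x1 -> 0 < d -> x1 + d + d <= C -> t1 <= t2 ->
  d * d * V (x1 + d + d) t2 <= d * d * V x1 t1 + 2 * (J2 l C t1 t2 dis + K * (t2 - t1)).
Proof.
move=> lC; have lC' := ltW lC; have Cl : 0 <= C - l by rewrite subr_ge0.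
have c0 := ltW (pr_c W); have L0 := ltW (pr_L W).
pose K0 := c + L * (C - l); pose K1 := PM * (pw n 2 + 2).
have K00 : 0 <= K0 by rewrite addr_ge0// mulr_ge0.
have K10 : 0 <= K1 by rewrite mulr_ge0 ?(PM_ge0 W)// addr_ge0 ?pw_ge0.
exists ((K1 + K0) * (C - l)); first by rewrite mulr_ge0// addr_ge0.
move=> x1 d t1 t2 lx d0 xC t12.
have cV := en_cV E; have chV := hV_cont W E.
pose Q := tailI C l V; have cQ : continuous (unc Q) by exact: tailI_cont.
have cQt t : continuous (Q ^~ t) by exact: cont2_sec1.
pose Th := flux_density n c C h V s l.
have [_ _ Isn _ _] := en_flux E.
have IsnC := Isn l C t1 t2.
have ITh : int2 l C t1 t2 Th.
  apply: int2D; last by apply: int2_cont; exact: tailI_cont.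
  apply: int2B => //; apply: int2_cont; apply: cont2M => //; apply: (cont2_1 (phi := fun=> c)); exact: cont1c.
have ThB x t : l <= x <= C -> `|Th x t| <= pw n (s x t) + K0.
  move=> /andP[lx' xC'].
  have hH : `|tailI C l (fun x t => h (V x t)) x t| <= L * (C - l).
    rewrite tailIE//; apply: (@le_trans _ _ (L * (C - x))); last by rewrite ler_wpM2l//; lra.
    apply: I_le_abs => //; first by apply: iv_contT; exact: cont2_sec1 chV.
    by move=> y _; exact: (hV_bound W E).
  have V0 := V_ge0 W E x t; have V1 := V_le1 W E x t.
  have h1 : c * V x t <= c by rewrite ler_piMr.
  have h0 : 0 <= c * V x t by rewrite mulr_ge0.
  have p0 := pw_ge0 n (s x t).
  move: hH; rewrite /Th /flux_density /K0 !ler_norml => /andP[h2 h3]; apply/andP; split; lra.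
pose B := J2 l C t1 t2 dis + (K1 + K0) * (C - l) * (t2 - t1).
have win a b : l <= a -> a <= b -> b <= C -> `|I a b (Q ^~ t2) - I a b (Q ^~ t1)| <= B.
  move=> la ab bC.
  have ITab : int2 a b t1 t2 Th by apply: int2_sub ITh.
  have -> : I a b (Q ^~ t2) - I a b (Q ^~ t1) = I a b (fun x => I t1 t2 (Th x)).
    rewrite -IB; [|exact: iv_contT|exact: iv_contT].
    apply: I_ae_eq; [by apply: iv_contT; apply: cont1B|exact: fub_iv1 ITab|].
    apply: ae_le_lt; have := tail_flux lC t12; apply: aeS => x Hx /andP[ax xb]; apply: Hx.
    by rewrite (le_lt_trans la) ?(lt_le_trans xb).
  have i1 := fub_iv1 ITab.
  apply: (le_trans (I_norm i1)).
  have IsK : int2 l C t1 t2 (fun x t => pw n (s x t) + K0) by apply: int2D => //; exact: int2_cst.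
  apply: (@le_trans _ _ (I l C (fun x => I t1 t2 (fun t => pw n (s x t) + K0)))).
    have IsKab : int2 a b t1 t2 (fun x t => pw n (s x t) + K0) by apply: int2_sub IsK.
    apply: (@le_trans _ _ (I a b (fun x => I t1 t2 (fun t => pw n (s x t) + K0)))).
      apply: I_ae_le; [exact: iv_norm|exact: fub_iv1 IsKab|].
      have := aeI (fub_ae1 ITab) (fub_ae1 IsKab); apply: aeS => x [H1 H2] /[dup] xx /andP[ax xb].
      have {}H1 := H1 xx; have {}H2 := H2 xx; apply: (le_trans (I_norm H1)).
      apply: I_le; [exact: iv_norm|exact: H2|move=> t _; apply: ThB].
      by rewrite (le_trans la) ?(le_trans xb).
    apply: I_sub_le => //; first exact: fub_iv1 IsK.
    by move=> x _; apply: I_ge0 => t _; rewrite addr_ge0 ?pw_ge0.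
  rewrite -(J2_swap IsK) J2D//; last exact: int2_cst.
  have -> : J2 l C t1 t2 (fun _ _ : R => K0) = K0 * (C - l) * (t2 - t1).
    by rewrite /J2 (I_ext (g := fun=> K0 * (C - l))) ?I_cst// => t _; rewrite I_cst.
  have := J2_flux_le lC' t12; rewrite -/K1 /B.
  have -> : (K1 + K0) * (C - l) * (t2 - t1) = K1 * (C - l) * (t2 - t1) + K0 * (C - l) * (t2 - t1) by ring.
  by rewrite addrA lerD2r.
have x12 : x1 <= x1 + d by rewrite lerDl ltW.
have x23 : x1 + d <= x1 + d + d by rewrite lerDl ltW.
(* The integrals of [Q] over two adjacent windows of length [d] differ by an integral of averages of
   [V], squeezed between [d^2 V] at the far ends of the two windows. *)
have Adiff t : I x1 (x1 + d) (Q ^~ t) - I (x1 + d) (x1 + d + d) (Q ^~ t) =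
    I x1 (x1 + d) (fun y => Q y t - Q (y + d) t).
  rewrite -(I_translate d (cQt t) x12) IB//; first exact: iv_contT.
  apply: iv_contT; apply: (cont1_comp (cQt t)); apply: cont1D; [move=> ?; exact: cvg_id|exact: cont1c].
have cdiff t : continuous (fun y => Q y t - Q (y + d) t).
  apply: cont1B => //; apply: (cont1_comp (cQt t)); apply: cont1D; [move=> ?; exact: cvg_id|exact: cont1c].
have dE : x1 + d - x1 = d by rewrite addrAC subrr add0r.
have cE k : k * d = I x1 (x1 + d) (fun=> k) by rewrite I_cst// dE.
have lo : d * d * V (x1 + d + d) t2 <= I x1 (x1 + d) (Q ^~ t2) - I (x1 + d) (x1 + d + d) (Q ^~ t2).
  rewrite Adiff mulrAC cE; apply: I_le; [exact: iv_cst|exact: iv_contT|].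
  move=> y /andP[xy yx]; have yd : y + d <= x1 + d + d by rewrite lerD2r.
  have /andP[h1 _] := tail_diff t2 (le_trans lx xy) (ltW d0) (le_trans yd xC).
  by apply: le_trans h1; rewrite ler_wpM2l ?(ltW d0)//; exact: (V_mono W E).
have hi : I x1 (x1 + d) (Q ^~ t1) - I (x1 + d) (x1 + d + d) (Q ^~ t1) <= d * d * V x1 t1.
  rewrite Adiff mulrAC cE; apply: I_le; [exact: iv_contT|exact: iv_cst|].
  move=> y /andP[xy yx]; have yd : y + d <= x1 + d + d by rewrite lerD2r.
  have /andP[_ h1] := tail_diff t1 (le_trans lx xy) (ltW d0) (le_trans yd xC).
  by apply: (le_trans h1); rewrite ler_wpM2l ?(ltW d0)//; exact: (V_mono W E).
have w1 := win x1 (x1 + d) lx x12 (le_trans x23 xC).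
have w2 := win (x1 + d) (x1 + d + d) (le_trans lx x12) x23 xC.
move: lo hi w1 w2; rewrite -/B !ler_norml; clear.
move: (I _ _ _) (I _ _ _) (I _ _ _) (I _ _ _) (d * d * _) (d * d * _) B => i1 i2 i3 i4 v1 v2 B.
by move=> h1 h2 /andP[h3 h4] /andP[h5 h6]; lra.
Qed.

Lemma front_of_le b x t : x - b <= 0 -> V x t <= U (x - b) -> x - b <= z x t.
Proof.
move=> xb; rewrite -(en_Uz E) leNgt => H; rewrite leNgt; apply/negP => zx.
by move: H; rewrite (pr_dec W zx xb).
Qed.

(** At a good time [t'] shortly before [t] the coordinate at [x1 < xi] is at least [x1 - b1].
    [propagate] carries this to time [t] and to the point [xi] with a loss, covered by the gap
    between [U(xi - b)] and [U(x1 - b1)]; the gap is positive because [b - b1 = 4 d > 2 d]. *)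
Lemma boundary b1 b X0 : - C <= b1 -> b1 < b -> b <= C -> MM (front b1) < Minf ->
  exists xi, [/\ xi <= X0, xi < - C & exists T, forall t, t <= T -> xi - b <= z xi t].
Proof.
move=> bC bb Cb Mb; pose d := (b - b1) / 4; have d0 : 0 < d by rewrite divr_gt0// subr_gt0.
have bC1 : b1 <= C by exact: le_trans (ltW bb) Cb.
pose xi := Num.min X0 (- C - 1); exists xi.
have xiC : xi < - C by apply: (@le_lt_trans _ _ (- C - 1)); [rewrite ge_min lexx orbT|rewrite gtrBl].
split => //; first by rewrite ge_min lexx.
pose x1 := xi - d - d; have xE : x1 + d + d = xi by rewrite /x1; ring.
have y1 : x1 - b1 <= 0 by rewrite /x1; lra.
have yy : xi - b < x1 - b1 by rewrite /x1 /d; lra.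
have xiC' : xi <= C by have := C0; lra.
have x1C : x1 < C by rewrite /x1; lra.
pose ga := U (xi - b) - U (x1 - b1); have ga0 : 0 < ga by rewrite subr_gt0 (pr_dec W).
(* The dissipation and the drift are each at most [e] and enter with the factor [2], which makes up
   exactly the gap [d^2 ga = 4 e]. *)
pose e := d * d * ga / 4; have e0 : 0 < e by rewrite divr_gt0// mulr_gt0// mulr_gt0.
have [K K0 HK] := propagate x1C.
pose tau := e / (K + 1); have tau0 : 0 < tau by rewrite divr_gt0//; lra.
have eta0 : 0 < b1 - x1 by rewrite /x1; lra.
have [T1 H1] := dis_small W E (ltW x1C) e0.
have [T2 H2] := good_level x1 bC bC1 Mb eta0 tau0.
exists (Num.min T1 T2) => t; rewrite le_min => /andP[tT1 tT2].
have [t' /andP[h1 h2] Hz] := H2 t tT2.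
apply: front_of_le; first by lra.
have := HK x1 d t' t (lexx x1) d0; rewrite xE => /(_ xiC' (ltW h2)) P1.
have P2 := H1 t' t (ltW h2) tT1.
have P3 : V x1 t' <= U (x1 - b1).
  have := Hz x1; rewrite lexx (ltW x1C) => /(_ isT) hz.
  rewrite -(en_Uz E); apply: (pr_Um W); apply: le_trans hz.
  by rewrite le_min lexx; lra.
have P4 : K * (t - t') <= e.
  apply: (@le_trans _ _ (K * tau)); first by rewrite ler_wpM2l//; lra.
  by rewrite /tau mulrCA ler_piMr ?(ltW e0)// ler_pdivrMr ?mul1r ?lerDl//; lra.
have dd0 : 0 < d * d by rewrite mulr_gt0.
rewrite -(ler_pM2l dd0); apply: (le_trans P1).
have P5 : d * d * V x1 t' <= d * d * U (x1 - b1) by rewrite ler_pM2l.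
have E4 : d * d * U (xi - b) = d * d * U (x1 - b1) + 4 * e by rewrite /e /ga; field.
rewrite E4; move: P2 P4 P5; clear; move: (J2 _ _ _ _ _) (K * _) (d * d * _) (d * d * _) => j k v1 v2; lra.
Qed.

(** The comparison at [xi], valid at all early times, serves as a boundary condition for both
    half-lines. On each side the excess at a given time is bounded by data at good times that can be
    taken arbitrarily early, where they are as small as desired. *)
Lemma below_level b1 b : - C <= b1 -> b1 < b -> b <= C -> MM (front b1) < Minf ->
  forall t x, front b x <= z x t.
Proof.
move=> bC bb Cb Mb; have bC1 : b1 <= C by exact: le_trans (ltW bb) Cb.
have [A hA] := pr_hdec W.
have [xi [xiA xiC [T HT]]] := boundary (A + b) bC bb Cb Mb.
have xib : xi < b by lra.
have xiC' : xi < C by have := C0; lra.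
have eta0 : 0 < b - xi by rewrite subr_gt0.
have right t x : t < T -> xi < x -> x < C -> front b x <= z x t.
  move=> tT; have [j j2 HN] := excess_right W E b xiC'.
  have j0 : 0 < j by lra.
  have j1 : 1 < j by lra.
  have jm : 0 < j - 1 by lra.
  pose f v := pw j (v - b); pose f1 v := j * pw (j - 1) (v - b).
  have df (v : R) : is_derive v 1 f (f1 v) by exact: is_derive_pw_pos.
  have cf1 : continuous f1 by apply: cont1M; [exact: cont1c|exact: posf_cont].
  have f0 v : 0 <= f v by exact: pw_ge0.
  have fb v : b < v -> 0 < f v by move=> bv; apply: pw_gt0; rewrite subr_gt0.
  have ck := pr_ck W; have dr := drho W.
  apply: (exc_vanish W E ck dr cf1 df (@rho_pos R kap) f0 fb (lexx C)).
  pose K := rM * pw j (C - b); have K0 : 0 <= K by rewrite mulr_ge0 ?pw_ge0// ltW// (rM_gt0 W).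
  apply: (@small_eps _ _ _ (K * (C - xi)) 1) => // e e0 _; rewrite add0r.
  (* At the early good time an excess over [front b] occurs only where [z >= -r/2], that is where
     [V <= e]; the functional there is at most a multiple of [e]. *)
  have [r r0 Hr] := (contP _).1 (pr_cU W) 0 e e0.
  have r2 : 0 < r / 2 by rewrite divr_gt0.
  have [T2 H2] := good_level xi bC bC1 Mb r2 ltr01.
  pose t0 := Num.min t T2.
  have t0T2 : t0 <= T2 by rewrite ge_min lexx orbT.
  have [t' /andP[_ t't0] Hz] := H2 t0 t0T2.
  have t't : t' <= t by apply: (le_trans (ltW t't0)); rewrite ge_min lexx.
  have t1 : t' - 1 < t' by rewrite gtrBl.
  apply: (le_trans (HN (t' - 1) t' t T t1 t't tT (fun t0 tt => HT t0 (ltW (proj2 (andP tt)))))).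
  clear HN.
  apply: (@le_trans _ _ (I xi C (fun=> e * K))); last by rewrite I_cst ?(ltW xiC')// mulrA.
  have Ue : U (- (r / 2)) <= e.
    have := Hr (- (r / 2)); rewrite subr0 normrN gtr0_norm// (pr_U0 W (lexx 0)) subr0.
    have rr : r / 2 < r by lra.
    by move=> /(_ rr) /(le_lt_trans (ler_norm _)) /ltW.
  have iE : iv xi C (fun x => exc n m c h U 1 (rho kap) f x (z x t')).
    apply: (iv_ext (f := fun x => excA U (xi - C) 1 kap (rho kap) f f1 x (z x t'))).
      move=> y /andP[xy yC]; rewrite (excAE W 1 ck dr cf1 df)//.
      by apply: (range_base xy xiC'); have /andP[] := z_range E y t'.
    have cg := cont2_graph (@excA_cont _ _ _ _ _ _ _ _ _ _ W 1 _ _ _ _ ck dr cf1 df (xi - C)) cz.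
    by apply: iv_contT; exact: (cont2_sec1 (t := t') cg).
  apply: I_le => //; first exact: iv_cst.
  move=> y /[dup] yy /andP[xy yC].
  have [yz|zy] := leP (front b y) (z y t').
    rewrite /exc (I_ext (g := fun=> 0)) ?I_0; first by rewrite mulr_ge0// ltW.
    move=> w /andP[zw w0]; rewrite /psi2 mul1r.
    have [yw|wy] := leP (y - b) w; first by rewrite /f pw_npos ?gt_eqF ?mulr0//; lra.
    have w1 : w = 0.
      apply: le_anti; rewrite w0/=; have := le_trans yz zw.
      by rewrite /front ge_min => /orP[|//]; rewrite leNgt wy.
    by rewrite w1 (slope_zero W) mul0r.
  have zy1 := zy; rewrite /front lt_min in zy1; case/andP: zy1 => zy1 zy2.
  have zl : - (r / 2) <= z y t'.
    have := Hz y yy; rewrite ge_min => /orP[h1|//].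
    by have := le_lt_trans h1 zy1; rewrite ltrD2l ltrN2 ltNge (ltW bb).
  apply: (@le_trans _ _ (K * (U (z y t') - U (front b y)))).
    apply: (exc_le W (th := 1) dr df (ltW zy)) => //.
    - by rewrite /front ge_min lexx orbT.
    - move=> w /andP[zw wf]; rewrite /psi2 mul1r; have w0 : w <= 0.
        by apply: (le_trans wf); rewrite /front ge_min lexx orbT.
      apply: ler_pM; rewrite ?pw_ge0 ?(ltW (rho_pos _ _)) ?(rho_le W)//.
      by apply: pw_le; [exact: ltW|have := range_low E t' yC; lra].
    - move=> w fw w0; rewrite /psi2 mul1r.
      have [yw|wy] := leP (y - b) w; first by rewrite /f pw_npos ?gt_eqF ?mulr0//; lra.
      by move: fw; rewrite /front ge_min leNgt wy leNgt w0.
  rewrite mulrC ler_wpM2r//; have := pr_Um W zl; have := U_nonneg W (front b y); lra.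
(* With [eta = b - xi] the level [-eta] is at least [x - b] for [x <= xi], so the good time gives
   the full comparison on [[l0, xi]]; what lies beyond [l0] is a tail. *)
have left t x : t < T -> x < xi -> front b x <= z x t.
  move=> tT xxi; rewrite leNgt; apply/negP; rewrite /front lt_min => /andP[zx1 zx2].
  pose b' := b + (x - b - z x t) / 2.
  have bb' : b < b' by rewrite /b'; lra.
  suff H : I (x - 1) xi (fun x => exq n m c h U 1 b' x (z x t)) <= 0.
    have x1 : x - 1 < x by rewrite gtrBl.
    have := exq_vanish W E (ltW xiC') H x1 xxi; rewrite ge_min /b' => /orP[]; lra.
  apply: (@small_eps _ _ _ 1 1) => // e e0 _; rewrite add0r mulr1.
  have K0 : 0 <= sq b C * (C - b) by rewrite mulr_ge0 ?subr_ge0// sq_ge0.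
  have [l0 l0xi Hl] := tl_small W xi (- b) K0 e0.
  have [T2 H2] := good_level l0 bC bC1 Mb eta0 ltr01.
  pose t0 := Num.min t T2; have t0T2 : t0 <= T2 by rewrite ge_min lexx orbT.
  have [t' /andP[_ t't0] Hz] := H2 t0 t0T2.
  have t't : t' <= t by apply: (le_trans (ltW t't0)); rewrite ge_min lexx.
  apply: le_trans Hl; rewrite -mulrA.
  have xiA' : xi - b <= A by rewrite lerBlDr.
  have x1xi : x - 1 < xi by apply: lt_trans xxi; rewrite gtrBl.
  apply: (contact_left W E hA bb' Cb (ltW xiC') (ltW xib) xiA' x1xi l0xi t't tT).
    by move=> t1 t1T; apply/HT/ltW.
  move=> y /andP[ly yxi]; have := Hz y; rewrite ly (le_trans yxi (ltW xiC')) => /(_ isT).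
  by rewrite ge_min => /orP[]; lra.
have early t x : t < T -> front b x <= z x t.
  move=> tT; have [xC|Cx] := ltP x C; last by rewrite (z_right E)// ge_min lexx orbT.
  have [x1|x1|->] := ltgtP x xi; [exact: left|exact: right|].
  by rewrite ge_min HT// ltW.
move=> t x; pose t1 := Num.min t (T - 1).
have t1T : t1 < T by apply: (@le_lt_trans _ _ (T - 1)); [rewrite ge_min lexx orbT|rewrite gtrBl].
apply: (contact_forward W E Cb (T1 := t1)); last by rewrite ge_min lexx.
by move=> y; exact: early.
Qed.

Theorem rigidity : exists a, - C <= a <= C /\ forall x t, z x t = front a x.
Proof.
pose S := [set b | (- C <= b <= C) /\ forall x t, front b x <= z x t].
have CC : - C <= C by have := C0; lra.
have SC : S C.
  split; first by rewrite CC lexx.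
  by move=> x t; exact: (en_lo E).
have hS : has_inf S.
  by split; [exists C|exists (- C) => b [/andP[]]].
pose a := inf S.
have aC : a <= C by apply: ge_inf => //; exact: (proj2 hS).
have Ca : - C <= a by apply: lb_le_inf; [exists C|move=> b [/andP[]]].
have za x t : front a x <= z x t.
  rewrite leNgt; apply/negP; rewrite lt_min => /andP[zx1 zx2].
  have e0 : 0 < x - a - z x t by lra.
  have [b [_ Hb] ba] := inf_adherent e0 hS.
  by have := Hb x t; rewrite /front ge_min => /orP[]; rewrite -/a in ba; lra.
exists a; split; first by rewrite Ca.
(* At [a = -C] there is no smaller level to test, but [front a] then coincides with the upper
   barrier for [z]. *)
have [aE|aC'] := eqVneq a (- C).
  move=> x t; apply: le_anti; rewrite za andbT aE /front opprK le_min z0 andbT.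
  by have /andP[_] := z_range E x t; rewrite le_min => /andP[].
have {}Ca : - C < a by rewrite lt_neqAle eq_sym aC'.
have level b : - C <= b -> b < a -> Minf <= MM (front b).
  move=> bC ba; rewrite leNgt; apply/negP => Mb.
  pose b2 := (b + a) / 2; have bb2 : b < b2 by rewrite /b2; lra.
  have b2C : b2 <= C by rewrite /b2; lra.
  have Hb := below_level bC bb2 b2C Mb.
  have : a <= b2.
    apply: ge_inf; first exact: (proj2 hS).
    by split; [rewrite b2C andbT /b2; lra|move=> x t; exact: Hb].
  by rewrite /b2; lra.
have Ma : Minf <= MM (front a).
  apply: (@small_eps _ _ _ K4 (a + C)); first by lra.
  move=> e e0 eaC; have b1 : - C <= a - e by lra.
  have ba : a - e < a by rewrite gtrBl.
  apply: (le_trans (level _ b1 ba)); apply: (le_trans (MM_front_close W E b1 (ltW ba) aC)).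
  by rewrite opprB addrCA subrr addr0 mulrC.
move=> x t; have Mt := le_trans (MM_le_Minf W E t) Ma.
exact: (MM_strict W E (ltW Ca) aC (adm_z E t) (fun x => za x t) Mt x).
Qed.

End Rigidity.

(** * The standing assumptions provide the required data *)

Section Hypotheses.
Variable R : realType.
Implicit Types (x y t e u v : R).
Notation mu := (@lebesgue_measure R).

Lemma reaction_one (h : R -> R) (a : R) : a < 1 -> continuous (fun x => h (Num.max x 0)) ->
  (forall u, a < u < 1 -> 0 < h u) -> (forall u, 1 < u -> h u < 0) -> h 1 = 0.
Proof.
move=> a1 ch hpos hneg.
have m1 : Num.max 1 0 = 1 :> R by rewrite max_l.
apply/eqP; rewrite -[_ == _]negbK; apply/negP => h1.
have n0 : 0 < `|h 1| by rewrite normr_gt0.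
have [d d0 Hd] := (contP _).1 ch 1 _ n0; rewrite m1 in Hd.
have {h1} [h1|h1] : h 1 < 0 \/ 0 < h 1 by move: h1; rewrite neq_lt => /orP[]; [left|right].
  pose y := Num.max ((a + 1) / 2) (Num.max (1 - d / 2) 2^-1).
  have y1 : y < 1 by rewrite !gt_max; apply/and3P; split; lra.
  have y2 : (a + 1) / 2 <= y by rewrite le_max lexx.
  have y3 : 1 - d / 2 <= y by rewrite !le_max lexx orbT.
  have y4 : 2^-1 <= y by rewrite !le_max lexx !orbT.
  have ay : a < y < 1 by rewrite y1 andbT; lra.
  have yd : `|y - 1| < d by rewrite ltr_norml; apply/andP; split; lra.
  have hy := hpos y ay; have := Hd y yd; rewrite max_l; last lra.
  by rewrite (ltr0_norm h1) ltr_norml => /andP[]; lra.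
have y1 : 1 < 1 + d / 2 by lra.
have yd : `|1 + d / 2 - 1| < d by rewrite ltr_norml; apply/andP; split; lra.
have hy := hneg _ y1; have := Hd _ yd; rewrite max_l; last lra.
by rewrite (gtr0_norm h1) ltr_norml => /andP[]; lra.
Qed.

(** For [a > 0] this is the assumption itself, rewritten with cut bases; finiteness comes from
    [|h(v)| <= L v]. For [a = 0] the continuous minorant [h(v) v^m] is nonnegative on [[0, 1]] and
    positive at [1/2]. *)
Lemma potential_gt0 (m L a : R) (h : R -> R) : 0 < m -> 0 <= a -> a < 1 -> h 0 = 0 -> h 1 = 0 ->
  continuous (fun x => h (Num.max x 0)) ->
  (forall u v, 0 <= u -> u <= v -> v <= 1 -> `|h v - h u| <= L * (v - u)) ->
  (forall u, a < u < 1 -> 0 < h u) ->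
  (0 < a -> (0 < \int[mu]_(u in `[0%R, 1%R]) (h u * u `^ (m - 1))%R%:E)%E) ->
  0 < I 0 1 (fun v => h (Num.max v 0) * (Num.max v 0) `^ (m - 1)).
Proof.
move=> m0 a0 a1 h0 h1 ch hL hpos hint.
have mx v : 0 <= v -> Num.max v 0 = v by move=> v0; rewrite max_l.
have hb v : 0 <= v <= 1 -> `|h v| <= L * v.
  by move=> /andP[v0 v1]; have := hL 0 v (lexx 0) v0 v1; rewrite h0 !subr0.
have iphi : iv 0 1 (fun v => h (Num.max v 0) * (Num.max v 0) `^ (m - 1)).
  apply: (iv_le (g := fun v => L * pw m v)); last first.
  - by apply: iv_contT; apply: cont1M; [exact: cont1c|exact: pw_cont].
  - move=> v /andP[v0 v1]; rewrite mx// normrM (ger0_norm (powR_ge0 _ _)).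
    move: v0; rewrite le_eqVlt => /orP[/eqP <-|v0].
      by rewrite h0 normr0 mul0r pw_npos ?mulr0// gt_eqF.
    rewrite pwE ?(ltW v0)// -(mulr_powRB1 _ m0) ?(ltW v0)// mulrA ler_wpM2r ?powR_ge0//.
    by apply: hb; rewrite (ltW v0).
  - apply: measurable_funM; first by apply: measurable_funTS; exact: continuous_measurable_fun.
    apply: (measurableT_comp (measurable_powR (m - 1))).
    by apply: measurable_maxr; [exact: measurable_id|exact: measurable_cst].
move: a0; rewrite le_eqVlt => /orP[/eqP aE|a0]; last first.
  have := hint a0; rewrite /I /Rintegral.
  have -> : (\int[mu]_(u in `[0%R, 1%R]) (h u * u `^ (m - 1))%R%:E)%E =
     (\int[mu]_(x in `[0%R, 1%R]) (h (Num.max x 0) * Num.max x 0 `^ (m - 1))%R%:E)%E.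
    by apply: eq_integral => v; rewrite inE/= in_itv/= => /andP[v0 _]; rewrite mx.
  move=> H; apply: fine_gt0; rewrite H/=.
  have mI : measurable (`[0, 1] : set R) by exact: measurable_itv.
  have : (\int[mu]_(x in `[0%R, 1%R]) (h (Num.max x 0) * Num.max x 0 `^ (m - 1))%R%:E)%E \is a fin_num.
    exact: (@integrable_fin_num _ _ _ mu).
  by rewrite fin_numElt => /andP[].
have h_ge0 v : 0 <= v <= 1 -> 0 <= h v.
  move=> /andP[v0 v1]; have [->|v0'] := eqVneq v 0; first by rewrite h0.
  have [->|v1'] := eqVneq v 1; first by rewrite h1.
  by rewrite ltW// hpos// -aE !lt_neqAle eq_sym v0' v0 v1' v1.
have hh : 0 < (2^-1 : R) < 1 by apply/andP; split; lra.
apply: (@lt_le_trans _ _ (I 0 1 (fun v => h (Num.max v 0) * pw m v))).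
  have h01 : 0 < 2^-1 :> R by case/andP: hh.
  apply: (I_gt0 hh).
  - by apply: cont1M => //; exact: pw_cont.
  - by move=> v /[dup] vv /andP[v0 _]; rewrite mulr_ge0 ?pw_ge0// mx// h_ge0.
  by rewrite mulr_gt0 ?pw_gt0// mx ?(ltW h01)// hpos// -aE.
apply: I_le => //.
  by apply: iv_contT; apply: cont1M => //; exact: pw_cont.
move=> v /[dup] vv /andP[v0 v1]; rewrite mx// ler_wpM2l ?h_ge0//.
by rewrite pwE// -(mulr_powRB1 _ m0)// ler_piMl// powR_ge0.
Qed.

Lemma limit_ninfty (U : R -> R) : (U x @[x --> -oo] --> (1:R)) ->
  forall e, 0 < e -> exists A : R, forall y, y <= A -> `|U y - 1| < e.
Proof.
move=> /cvgrPdist_lt H e e0; have [A [_ HA]] := H e e0.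
exists (A - 1) => y yA; rewrite distrC; apply: HA; lra.
Qed.

Lemma wave_profile (m p cs : R) (h U : R -> R) : standing m p h -> 2 <= p -> finite_wavefront m p h cs U 0 ->
  exists L PM rM kap, profile (p - 1) m cs L PM rM h U kap.
Proof.
move=> [[m0 _] _ [h' [hC1 hd1]] h0 [a [[a0 a1] hneg hpos hneg1 hint]]] p2 [[cU Um] Ul U0 Up Wk].
have n1 : 1 <= p - 1 by lra.
have n0 : 0 < p - 1 by lra.
have [L L0 hL] := halfline_lipschitz hC1; have ch := halfline_cont hC1.
have Ulim := limit_ninfty Ul; have h0d := halfline_derive0 hC1 h0.
have h1 := reaction_one a1 ch hpos hneg1.
have phi0 := potential_gt0 m0 a0 a1 h0 h1 ch hL hpos hint.
have U_ge0 x : 0 <= U x by have [x0|x0] := leP 0 x; [rewrite U0|exact: ltW (Up x x0)].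
have wm t : {homo (fun x => U (x - cs * t)) : x y / x <= y >-> y <= x}.
  by move=> x y xy; apply: Um; rewrite lerD2r.
have [_ [s Fs]] := weak_flux m0 p2 ch h0 (fun x t => U_ge0 (x - cs * t)) wm Wk.
have [P0 dW] := wave_pressure n0 m0 cU U0 Up ch h0 Fs.
have c0 := wave_speed_gt0 n1 m0 L0 cU U0 Up Ulim ch h0 hL phi0 dW.
have [PM HPM] := pres_bounded n1 m0 L0 cU Um U0 Up Ulim ch h0 hL a1 hpos h1 phi0 P0 dW.
have [rM HrM] := rho_bounded n1 m0 L0 cU Um U0 Up Ulim ch h0 hL a1 hneg hpos h1 h0d phi0 P0 dW.
have U1 := profile_lt1 n1 m0 L0 cU Um U0 Up Ulim ch h0 hL h1 phi0 P0 dW.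
exists L, PM, rM, (kap (p - 1) cs (h' 0) h U); split => //.
- exact: (profile_decr n1 m0 L0 cU Um U0 Up Ulim ch h0 hL hneg hpos h1 phi0 P0 dW).
- exact: (pres_gt0 n1 m0 L0 cU Um U0 Up Ulim ch h0 hL hneg hpos h1 phi0 P0 dW).
- exact: (kap_cont n1 m0 L0 cU Um U0 Up Ulim ch h0 hL hneg hpos h1 h0d phi0 P0 dW).
- exact: (kap_pres (h' 0) n1 m0 L0 cU Um U0 Up Ulim ch h0 hL hneg hpos h1 phi0 P0 dW).
- exact: (kap_ge n1 m0 L0 cU Um U0 Up Ulim ch h0 hL hneg hpos h1 h0d phi0 P0 dW).
- exact: (hneg_le_pres n1 m0 L0 cU Um U0 Up Ulim ch h0 hL hneg hpos h1 phi0 P0 dW).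
have [d /andP[d0 d1] Hd] := halfline_decreasing hC1 hd1.
have [A HA] := Ulim d d0; exists A => x y xy yA.
have lowU w : w <= A -> 1 - d <= U w.
  by move=> /HA; rewrite ltr_norml => /andP[h3 _]; lra.
split; last by apply: Hd; [exact: lowU|exact: Um|exact/ltW/U1].
by rewrite -h1; apply: Hd => //; [exact/lowU/(le_trans xy)|exact/ltW/U1].
Qed.

(** The intermediate value theorem between the two barriers gives a coordinate; strict monotonicity
    of [U] on the negative half-line makes it monotone and continuous. *)
Lemma inverse_profile (n m c L PM rM C : R) (h U kap : R -> R) (V : R -> R -> R) :
  profile n m c L PM rM h U kap -> 0 < C -> continuous (unc V) ->
  (forall t, {homo (fun x => V x t) : x y / x <= y >-> y <= x}) ->
  (forall x t, U (x + C) <= V x t /\ V x t <= U (x - C)) ->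
  exists z : R -> R -> R, [/\ continuous (unc z), forall x t, U (z x t) = V x t,
    forall x y t, x <= y -> z x t <= z y t &
    forall x t, Num.min (x - C) 0 <= z x t <= Num.min 0 (x + C)].
Proof.
move=> W C0 cV Vm VU.
have Uneg y y' : y <= 0 -> y' <= 0 -> U y <= U y' -> y' <= y.
  by move=> y0 y0' UU; rewrite leNgt; apply/negP => yy; move: UU; rewrite leNgt (pr_dec W yy y0').
have ex (w : R * R) : exists y, Num.min (w.1 - C) 0 <= y <= Num.min 0 (w.1 + C) /\ U y = V w.1 w.2.
  case: w => x t /=; have [V1 V2] := VU x t.
  have lohi : Num.min (x - C) 0 <= Num.min 0 (x + C).
    by rewrite le_min !ge_min lexx orbT/=; apply/orP; left; lra.
  have Umin y : U (Num.min y 0) = U y.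
    rewrite /Num.min; case: ifP => // /negbT; rewrite -leNgt => y0.
    by rewrite (pr_U0 W (lexx 0)) (pr_U0 W).
  have vv : Num.min (U (Num.min (x - C) 0)) (U (Num.min 0 (x + C))) <= V x t <=
            Num.max (U (Num.min (x - C) 0)) (U (Num.min 0 (x + C))).
    by rewrite [Num.min 0 _]minC !Umin ge_min le_max V1 V2 orbT.
  have [y] := IVT lohi (continuous_subspaceT (pr_cU W)) vv.
  by rewrite in_itv => yy Uy; exists y.
have [zz Hz] := choice ex.
pose z x t := zz (x, t).
have zr x t : Num.min (x - C) 0 <= z x t <= Num.min 0 (x + C) by have [] := Hz (x, t).
have Uz x t : U (z x t) = V x t by have [] := Hz (x, t).
have z0 x t : z x t <= 0 by have /andP[_] := zr x t; rewrite le_min => /andP[].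
exists z; split => //; last first.
  by move=> x y t xy; apply: Uneg => //; rewrite !Uz; exact: Vm.
apply/cont2P => x t e e0.
have r1 : U (z x t) < U (z x t - e) by apply: (pr_dec W) => //; rewrite gtrBl.
(* Beyond [0] the profile is flat, so a gap above [z] is available only if [z + e <= 0]; otherwise
   [z <= 0] is already the upper bound. *)
have [r r0 [Hr1 Hr2]] : exists2 r, 0 < r & r <= U (z x t - e) - U (z x t) /\
    (z x t + e <= 0 -> r <= U (z x t) - U (z x t + e)).
  have q1 : 0 < U (z x t - e) - U (z x t) by rewrite subr_gt0.
  have [ze|ze] := leP (z x t + e) 0; last by exists (U (z x t - e) - U (z x t)).
  have q2 : 0 < U (z x t) - U (z x t + e) by rewrite subr_gt0 (pr_dec W)// ltrDl.
  exists (Num.min (U (z x t - e) - U (z x t)) (U (z x t) - U (z x t + e))).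
    by rewrite lt_min q1.
  by split => [|_]; rewrite ge_min lexx ?orbT.
have [d d0 Hd] := (cont2P _).1 cV x t r r0.
exists d => // x' t' xx tt; have := Hd x' t' xx tt; rewrite -!Uz ltr_norml => /andP[h1 h2].
rewrite ltr_norml; apply/andP; split.
  rewrite ltrBrDl ltNge; apply/negP => zz1; have := pr_Um W zz1; lra.
rewrite ltrBlDl ltNge; apply/negP => zz1; have := pr_Um W zz1; have := Hr2 (le_trans zz1 (z0 x' t')); lra.
Qed.

End Hypotheses.

Theorem mainTheorem17 (R : realType) (m p : R) (h : R -> R)
  (cs : R) (Ucs : R -> R) (V : R -> R -> R) (C : R) :
  standing m p h ->
  2 <= p ->
  finite_wavefront m p h cs Ucs 0 ->
  weak_sol m p cs h V ->
  (forall t : R, {homo (fun x => V x t) : x y / x <= y >-> y <= x}) ->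
  0 < C ->
  (forall x t : R, Ucs (x + C) <= V x t /\ V x t <= Ucs (x - C)) ->
  exists xs : R, -C <= xs <= C /\ forall x t : R, V x t = Ucs (x - xs).
Proof.
move=> st p2 fw ws Vm C0 VU.
have [L [PM [rM [kap W]]]] := wave_profile st p2 fw.
have [[m0 _] _ [h' [hC1 _]] h0 _] := st.
have ch := halfline_cont hC1.
have V0 x t : 0 <= V x t by apply: le_trans (proj1 (VU x t)); exact: (U_nonneg W).
have [cV [s Fs]] := weak_flux m0 p2 ch h0 V0 Vm ws.
have [z [cz Uz zm zr]] := inverse_profile W C0 cV Vm VU.
have z0 x t : z x t <= 0 by have /andP[_] := zr x t; rewrite le_min => /andP[].
have E : entire (p - 1) m cs C h Ucs V s z.
  split => //; first by move=> x t; have /andP[] := zr x t.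
  by move=> x t _; have /andP[_] := zr x t; rewrite le_min => /andP[].
have [a [aC za]] := rigidity W E.
by exists a; split => // x t; rewrite -Uz za (U_front W).
Qed.
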